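(* For each constant $\epsilon>0$ there is a value $\epsilon_{\mathrm{skew}}>0$ such that there is a polynomial-time $(1+\epsilon)$-approximation algorithm for (weighted) 2DKR restricted to instances in which every input item $i\in I$ satisfies $h(i)\le \epsilon_{\mathrm{skew}}N$ or $w(i)\le\epsilon_{\mathrm{skew}}N$.
   Context: Two-dimensional geometric knapsack (2DK): an instance consists of an integer $N\ge 1$ and a set $I$ of $n$ items; each item $i\in I$ has a width $w(i)\in\mathbb N$, a height $h(i)\in\mathbb N$ and a profit $p(i)\in\mathbb N$. Let $K=[0,N]\times[0,N]$. A feasible solution is a subset $S\subseteq I$ together with a placement of each $i\in S$ as an open axis-parallel rectangle $(x_i,x_i+w(i))\times(y_i,y_i+h(i))\subseteq K$ such that the rectangles of distinct items are pairwise disjoint; its profit is $p(S)=\sum_{i\in S}p(i)$, to be maximized. In the variant with rotations (2DKR) each selected item may alternatively be placed rotated by $90^\circ$, i.e., as a rectangle of width $h(i)$ and height $w(i)$. $\mathrm{OPT}$ denotes an optimal solution. For $\alpha\ge 1$, an $\alpha$-approximation algorithm outputs a feasible solution of profit at least $p(\mathrm{OPT})/\alpha$. *)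

(* Defs.v *)
From HB Require Import structures.
From mathcomp Require Import all_boot all_order all_algebra.
From mathcomp Require Import reals.
Set Implicit Arguments. Unset Strict Implicit. Unset Printing Implicit Defensive.
Import Order.TTheory GRing.Theory Num.Theory.

Inductive sym := S0 | S1 | SB.
Inductive move := ML | MR | MS.

(* States are 'I_(tm_Q.+1); the start state is ord0; the machine halts
   when the transition function returns None. *)
Record TM := MkTM {
  tm_Q : nat;
  tm_delta : 'I_tm_Q.+1 -> sym -> option ('I_tm_Q.+1 * sym * move) }.

(* configuration: state, left part of the tape (nearest cell first),
   scanned symbol, right part of the tape (nearest cell first) *)
Record config (M : TM) := MkConfig {
  c_state : 'I_(tm_Q M).+1;
  c_left : seq sym;
  c_head : sym;
  c_right : seq sym }.

Definition step (M : TM) (c : config M) : option (config M) :=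
  match tm_delta (c_state c) (c_head c) with
  | None => None
  | Some (q, b, m) =>
    match m with
    | MS => Some (MkConfig q (c_left c) b (c_right c))
    | ML => match c_left c with
            | [::] => Some (MkConfig q [::] SB (b :: c_right c))
            | x :: l => Some (MkConfig q l x (b :: c_right c))
            end
    | MR => match c_right c with
            | [::] => Some (MkConfig q (b :: c_left c) SB [::])
            | x :: r => Some (MkConfig q (b :: c_left c) x r)
            end
    end
  end.

Fixpoint run (M : TM) (t : nat) (c : config M) : option (config M) :=
  match step c with
  | None => Some c
  | Some c' => match t with 0 => None | t'.+1 => run t' c' end
  end.

Definition init (M : TM) (w : seq sym) : config M :=
  match w with
  | [::] => MkConfig ord0 [::] SB [::]
  | x :: r => MkConfig ord0 [::] x r
  end.

Fixpoint nonblank_prefix (s : seq sym) : seq sym :=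
  match s with
  | [::] => [::]
  | SB :: _ => [::]
  | x :: r => x :: nonblank_prefix r
  end.

Definition tm_output (M : TM) (c : config M) : seq sym :=
  nonblank_prefix (c_head c :: c_right c).

Definition sym_of_bool (b : bool) : sym := if b then S1 else S0.

Fixpoint bin_aux (k n : nat) : seq bool :=
  match k with
  | 0 => [::]
  | k'.+1 => if n is 0 then [::] else odd n :: bin_aux k' n./2
  end.
Definition bin (n : nat) : seq bool := bin_aux n n.

(* self-delimiting code: bit b |-> 1b, end marker 00 *)
Definition enc_nat (n : nat) : seq bool :=
  flatten [seq [:: true; b] | b <- bin n] ++ [:: false; false].
Definition enc_nats (s : seq nat) : seq bool := flatten (map enc_nat s).

Record item := Item { iw : nat; ih : nat; ip : nat }.
Definition item0 := Item 0 0 0.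

Definition enc_instance (N : nat) (I : seq item) : seq sym :=
  map sym_of_bool
    (enc_nats (N :: size I :: flatten [seq [:: iw it; ih it; ip it] | it <- I])).

Section Packing.
Variable R : realFieldType.
Local Open Scope ring_scope.

(* a selected item (index into I), the lower-left corner of its placement,
   and whether it is rotated by 90 degrees *)
Record placement := Place { pidx : nat; px : R; py : R; prot : bool }.
Definition place0 := Place 0 0 0 false.

Definition pwidth (I : seq item) (pl : placement) : nat :=
  let it := nth item0 I (pidx pl) in if prot pl then ih it else iw it.
Definition pheight (I : seq item) (pl : placement) : nat :=
  let it := nth item0 I (pidx pl) in if prot pl then iw it else ih it.

Definition fits (N : nat) (I : seq item) (pl : placement) : bool :=
  [&& 0 <= px pl, 0 <= py pl,
      px pl + (pwidth I pl)%:R <= N%:R & py pl + (pheight I pl)%:R <= N%:R].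

Definition in_open (I : seq item) (pl : placement) (a b : R) : bool :=
  [&& px pl < a, a < px pl + (pwidth I pl)%:R,
      py pl < b & b < py pl + (pheight I pl)%:R].

Definition feasible (N : nat) (I : seq item) (S : seq placement) : Prop :=
  [/\ uniq (map pidx S),
      all (fun pl => ((pidx pl < size I)%N) && fits N I pl) S &
      forall j k, (j < size S)%N -> (k < size S)%N -> j != k ->
        forall a b : R,
          ~~ (in_open I (nth place0 S j) a b && in_open I (nth place0 S k) a b)].

Definition profit (I : seq item) (S : seq placement) : nat :=
  (\sum_(pl <- S) ip (nth item0 I (pidx pl)))%N.

(* machine output: (index, (xnum, xden), (ynum, yden), rotated) with
   rational coordinates x = xnum/xden, y = ynum/yden *)
Definition out_entry := (nat * (nat * nat) * (nat * nat) * bool)%type.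

Definition entry_ok (e : out_entry) : bool :=
  let: (_, (_, xd), (_, yd), _) := e in (0 < xd)%N && (0 < yd)%N.

Definition entry_place (e : out_entry) : placement :=
  let: (i, (xn, xd), (yn, yd), r) := e in
  Place i (xn%:R / xd%:R) (yn%:R / yd%:R) r.

End Packing.

Definition enc_solution (sol : seq out_entry) : seq sym :=
  map sym_of_bool
    (enc_nats (flatten [seq let: (i, (xn, xd), (yn, yd), r) := e in
                            [:: i; xn; xd; yn; yd; nat_of_bool r] | e <- sol])).

Definition skewed (R : realFieldType) (eps_skew : R) (N : nat) (I : seq item) : bool :=
  all (fun it => ((ih it)%:R <= eps_skew * N%:R)%R || ((iw it)%:R <= eps_skew * N%:R)%R) I.

(* Main.v *)
(* Scale the knapsack to the unit square.  Items have one side at most delta; call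
   them horizontal (H) or vertical (V) by their long side.  Items of medium length
   are lost by a pigeonhole over length scales, so each item is long or small.

   Compaction pushes the packing down; it frees a slab unless some pile of items
   reaches the top, and a pile that cannot be shortened by dropping a cheap residue
   class of slabs consists almost only of V items.  A nearly pure V pile and a
   nearly pure H pile must cross, so for one of the two directions a thin set of
   items meets all of them; deleting the profitable but thin sets at a suitable
   scale frees a strip of constant width.  Stretching into it, cutting the square
   into cells and merging cells into maximal runs separates H from V items in
   boundedly many boxes.  In a box only containers of boundedly many item lengths
   are needed: a set of items fits up to a small waste as soon as, for each length
   threshold, its total thickness is at most that of the containers above the
   threshold.  The containers form a bounded list of shapes, whose coordinates can
   be made subset sums of their own widths and heights.

   The algorithm guesses shapes and item lengths, selects items greedily by density
   under the nested capacity constraints (for which greedy loses only O(1) items of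
   thickness delta per constraint), packs small items on shelves of grid length and
   fills the containers by first fit.

   A Turing machine runs a language of stack commands; binary trees stored in
   preorder on one stack encode all data, and the polynomial-time maps between
   trees are closed under composition, pairing, branching and folds whose
   accumulator grows by an amount independent of the accumulator. *)
Require Import Defs.
From HB Require Import structures.
From mathcomp Require Import all_boot all_order all_algebra.
From mathcomp Require Import reals lra ring zify.
From Stdlib Require Import Classical FunctionalExtensionality.
Import Order.TTheory GRing.Theory Num.Theory.
Local Open Scope ring_scope.

(** * Structured packings *)

(** What makes the crossing argument usable is that it can be repeated. Nearly pure H chains lying
    more than [beta] apart in height each cut a V chain that avoids the deleted items at a height
    where it has no V item. Such a V chain has at most [q] V items, hence at most [q + 1] well
    separated heights of this kind, so [q + 2] H chains suffice to hit all V chains; failing that, a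
    bounded maximal family of H chains lies close to every other one.

    Rotation enters when containers of both orientations are counted together: an item can be turned
    to suit either, so for each length threshold one total thickness decides.

    Greedy, shelves and first fit waste an additive amount proportional to the item thickness. It is
    paid by a unit of thickness held back in each container, and that unit by the slack of one
    full-length strip at the top of the square.

    Long, small and medium are relative to a level [(q, r)]; the [r] of one level bounds the [q] of
    the next, and the thickness bound is the minimum over [E + 1] levels. Of [E + 1] parts of the
    profit, two are lost in the contraction, one among small and one among medium items. *)

Module Geometry.
Set Implicit Arguments. Unset Strict Implicit. Unset Printing Implicit Defensive.
Local Open Scope ring_scope.

(** * Disjoint intervals and counting along lines *)

Section Intervals.
Variables (R : realType) (T : finType).
Implicit Types (B : {set T}) (u l : T -> R).

(** A sweep: the element with the largest [f] is split off, so that everything remaining starts no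
    later than it. *)
Lemma set_argmax_ind (P : {set T} -> Prop) (f : T -> R) :
  P set0 ->
  (forall B i, i \in B -> (forall j, j \in B -> f j <= f i) -> P (B :\ i) -> P B) ->
  forall B, P B.
Proof.
move=> P0 PS B; move: {2}#|B|.+1 (ltnSn #|B|) => n.
elim: n B => // n IH B; have [->//|[i0 Bi0]] := set_0Vmem B => leBn.
case: (@arg_maxP _ _ _ i0 (mem B) f Bi0) => i Bi maxi; have {}Bi : i \in B by [].
apply: (PS B i) => //; apply: IH; rewrite -ltnS; apply: leq_trans leBn.
by rewrite ltnS [X in (_ < X)%N](cardsD1 i) Bi.
Qed.

Lemma sum_disjoint_intervals B u l a b :
  a <= b ->
  (forall i, i \in B -> [/\ a <= u i, u i + l i <= b & 0 < l i]) ->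
  (forall i j, i \in B -> j \in B -> i != j ->
     u i + l i <= u j \/ u j + l j <= u i) ->
  \sum_(i in B) l i <= b - a.
Proof.
move: B b; apply: (set_argmax_ind (f := u)) => [b leab _ _|B i Bi maxi IH b leab bnd dis].
  by rewrite big_set0 subr_ge0.
rewrite (big_setD1 i) //=; have [aui uib li] := bnd i Bi.
suff : \sum_(j in B :\ i) l j <= u i - a by lra.
apply: IH => //.
  move=> j; rewrite !inE => /andP[ji Bj]; have [? ? lj] := bnd j Bj; split=> //.
  have [||//] := dis i j Bi Bj; first by rewrite eq_sym.
  by have := maxi j Bj; lra.
by move=> j k; rewrite !inE => /andP[_ Bj] /andP[_ Bk]; apply: dis.
Qed.

(* Every interval of length at least [mu > 1/q] in [0,1] contains one of the
   points [k/q], so a family meeting a window can be counted line by line. *)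
Lemma grid_line (x w : R) (q : nat) : (0 < q)%N -> 0 <= x -> x + w <= 1 -> 1 < w * q%:R ->
  exists k : 'I_q, x < (k : nat)%:R / q%:R < x + w.
Proof.
move=> q0 x0 x1 wq; have q0R : 0 < q%:R :> R by rewrite ltr0n.
have xq0 : 0 <= x * q%:R by apply: mulr_ge0 => //; apply: ltW.
set k := (Num.truncn (x * q%:R)).+1.
have [k1 k2] : x * q%:R < k%:R /\ k%:R <= x * q%:R + 1.
  by split; [exact: truncnS_gt | rewrite -natr1 lerD2r truncn_le].
have kq : (k < q)%N.
  rewrite -(ltr_nat R); apply: le_lt_trans k2 _.
  have : (x + w) * q%:R <= 1 * q%:R by rewrite ler_pM2r.
  by rewrite mulrDl mul1r; lra.
exists (Ordinal kq) => /=; rewrite ltr_pdivlMr // k1 /= ltr_pdivrMr // mulrDl.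
by apply: le_lt_trans k2 _; rewrite ltrD2l.
Qed.

Lemma window_thickness B (x w y h : T -> R) (q : nat) (u v : R) : (0 < q)%N ->
  u <= v ->
  (forall i, i \in B -> [/\ 0 <= x i, x i + w i <= 1, 1 < w i * q%:R, 0 < h i
                         & u <= y i /\ y i + h i <= v]) ->
  (forall i j, i \in B -> j \in B -> i != j ->
     x i < x j + w j -> x j < x i + w i -> y i + h i <= y j \/ y j + h j <= y i) ->
  \sum_(i in B) h i <= q%:R * (v - u).
Proof.
move=> q0 uv bnd dis.
pose on (k : 'I_q) i := x i < (k : nat)%:R / q%:R < x i + w i.
apply: (@le_trans _ _ (\sum_(k < q) \sum_(i in B | on k i) h i)).
  rewrite (exchange_big_dep (mem B)) /=; last by move=> k i _ /andP[].
  apply: ler_sum => i Bi; have [x0 x1 wq hi _] := bnd i Bi.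
  have [k onk] := grid_line q0 x0 x1 wq.
  rewrite (bigD1 k) /=; last by rewrite Bi.
  by rewrite lerDl; apply: sumr_ge0 => *; apply: ltW.
rewrite -[q in X in _ <= X](card_ord q) -sumr_const mulr_suml.
apply: ler_sum => k _; rewrite mul1r.
rewrite (eq_bigl (fun i => i \in [set i in B | on k i])); last by move=> i; rewrite inE.
apply: (@sum_disjoint_intervals _ y) => // [i|i j].
  by rewrite inE => /andP[Bi _]; have [_ _ _ ? []] := bnd i Bi.
rewrite !inE => /andP[Bi oi] /andP[Bj oj] ij; apply: dis => //.
  by case/andP: oi => oi _; case/andP: oj => _; apply: lt_trans.
by case/andP: oj => oj _; case/andP: oi => _; apply: lt_trans.
Qed.

End Intervals.

(** * Pushing a packing down *)

Section Compaction.
Variables (R : realType) (T : finType).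
Variables (x w y h : T -> R).

Definition xover i j := (x i < x j + w j) && (x j < x i + w i).
Definition below i j := xover i j && (y i + h i <= y j).

Lemma xoverC i j : xover i j = xover j i.
Proof. by rewrite /xover andbC. Qed.

(** Items are lowered in the order of their old bottoms, each onto the highest new top among the
    items that were below it, or to the ground. [below] always refers to the old positions, so the
    relation stays fixed while the items move. *)
Lemma compaction (A : {set T}) : (forall i, i \in A -> 0 < h i /\ 0 <= y i) ->
  exists y' : T -> R,
  [/\ forall i, i \in A -> 0 <= y' i <= y i,
      forall i j, i \in A -> j \in A -> below i j -> y' i + h i <= y' j &
      forall i, i \in A ->
        y' i = 0 \/ exists2 j, j \in A & below j i /\ y' i = y' j + h j].
Proof.
move: A; apply: (set_argmax_ind (f := y)) => [_|A i Ai maxi IH bnd].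
  by exists (fun=> 0); split=> i; rewrite inE.
have [|y' [y'1 y'2 y'3]] := IH.
  by move=> j; rewrite !inE => /andP[_ Aj]; apply: bnd.
have ni j : j \in A -> ~~ below i j.
  by move=> Aj; apply/negP => /andP[_]; have := maxi j Aj; have [] := bnd i Ai; lra.
pose B := [set j in A :\ i | below j i].
have [y'' [y''0 y''1 y''2]] : exists y'' : R, [/\ 0 <= y'' <= y i,
    forall j, j \in B -> y' j + h j <= y'' &
    y'' = 0 \/ exists2 j, j \in B & y'' = y' j + h j].
  have [B0|[j0 Bj0]] := set_0Vmem B.
    by exists 0; split; [have [_ ->] := bnd i Ai; rewrite lexx | move=> j; rewrite B0 inE | left].
  case: (@arg_maxP _ _ _ j0 (mem B) (fun j => y' j + h j) Bj0) => j Bj maxj; have {}Bj : j \in B by [].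
  exists (y' j + h j); split=> //; last by right; exists j.
  move: Bj; rewrite 3!inE => /andP[/andP[ji Aj] /andP[_ b2]].
  have /andP[? ?] : 0 <= y' j <= y j by apply: y'1; rewrite !inE ji.
  by have [? ?] := bnd j Aj; apply/andP; split; lra.
exists (fun j => if j == i then y'' else y' j); split=> [j Aj|j k Aj Ak bjk|j Aj].
- by have [->|ji] := eqVneq j i => //; apply: y'1; rewrite !inE ji.
- have [ji|ji] := eqVneq j i; first by rewrite -ji in ni; rewrite (negPf (ni k Ak)) in bjk.
  have [ki|ki] := eqVneq k i; last by apply: y'2; rewrite // !inE ?ji ?ki.
  by apply: y''1; rewrite !inE ji Aj -ki.
- have [->|ji] := eqVneq j i.
    case: y''2 => [->|[k]]; [by left | rewrite !inE => /andP[/andP[ki Ak] bki] ->].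
    by right; exists k => //; rewrite (negPf ki).
  have [|->|[k]] := y'3 j; first by rewrite !inE ji.
    by left.
  by rewrite !inE => /andP[ki Ak] [bkj ->]; right; exists k => //; rewrite (negPf ki).
Qed.

(* Unfolding the recursion gives each compacted coordinate as the total height
   of a chain of items stacked on top of each other. *)
Lemma compaction_chain (A : {set T}) (y' : T -> R) :
  (forall i, i \in A -> 0 < h i) ->
  (forall i, i \in A ->
        y' i = 0 \/ exists2 j, j \in A & below j i /\ y' i = y' j + h j) ->
  forall i, i \in A -> exists s : seq T,
    [/\ {subset s <= A}, path (fun i j => below j i) i s & y' i = \sum_(j <- s) h j].
Proof.
move=> hpos rec.
(* Generalized to subsets that contain every item below one of their members. Removing the item with
   the largest [y] keeps this closure, since no member of the subset lies above it. *)
suff : forall B : {set T}, B \subset A -> (forall i j, i \in B -> below j i -> j \in A -> j \in B) ->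
   forall i, i \in B -> exists s : seq T,
    [/\ {subset s <= A}, path (fun i j => below j i) i s & y' i = \sum_(j <- s) h j].
  by move=> /(_ A (subxx _)); apply.
apply: (set_argmax_ind (f := y)) => [_ _ i|B m Bm maxm IH BA Bcl i Bi]; first by rewrite inE.
have IH' j : j \in B :\ m -> exists s : seq T,
    [/\ {subset s <= A}, path (fun i j => below j i) j s & y' j = \sum_(k <- s) h k].
  apply: IH => [|k l]; first by apply: subset_trans BA; rewrite subD1set.
  rewrite !inE => /andP[km Bk] blk Al; rewrite (Bcl k l) // andbT.
  apply/eqP => lm; move: blk => /andP[_]; have := maxm k Bk; rewrite lm.
  by have := hpos m (subsetP BA _ Bm); lra.
have [im|im] := eqVneq i m; last by apply: IH'; rewrite !inE im.
have [->|[j Aj [bji ->]]] := rec i (subsetP BA _ Bi).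
  by exists [::]; split=> //; rewrite big_nil.
have [|s [s1 s2 s3]] := IH' j.
  rewrite !inE (Bcl i j) // andbT; apply/eqP => jm; move: bji => /andP[_].
  by rewrite jm im; have := hpos m (subsetP BA _ Bm); lra.
exists (j :: s); split=> /=; [|by rewrite bji|by rewrite big_cons addrC s3].
by move=> k; rewrite inE => /orP[/eqP->|/s1].
Qed.

End Compaction.

(** * A discrete crossing theorem for chains of rectangles *)

Section Crossing.
Variable R : realType.

(* A closed, possibly degenerate, rectangle [p1,p2] x [q1,q2]. *)
Record piece := Pc { p1 : R; p2 : R; q1 : R; q2 : R }.
Implicit Types A B : piece.

(** Also meant for degenerate intervals: a point meets an interval when it lies in its interior, and
    two points never meet. *)
Definition meet (a1 a2 b1 b2 : R) := (a1 < b2) && (b1 < a2).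
Definition meetx A B := meet (p1 A) (p2 A) (p1 B) (p2 B).
Definition meety A B := meet (q1 A) (q2 A) (q1 B) (q2 B).
Definition wfp A := p1 A <= p2 A /\ q1 A <= q2 A.
Definition swapp A := Pc (q1 A) (q2 A) (p1 A) (p2 A).

(** [Prop]-valued versions of [path] and [all]: the link relation [vlink] contains an existential
    over the reals, and pieces carry no decidable equality here. *)
Fixpoint ppath (X : Type) (r : X -> X -> Prop) (a : X) (s : seq X) : Prop :=
  if s is b :: s' then r a b /\ ppath r b s' else True.
Fixpoint pall (X : Type) (P : X -> Prop) (s : seq X) : Prop :=
  if s is b :: s' then P b /\ pall P s' else True.

Lemma pall_sub (X : Type) (P Q : X -> Prop) s : (forall a, P a -> Q a) -> pall P s -> pall Q s.
Proof. by move=> PQ; elim: s => //= a s IH [/PQ ? /IH]. Qed.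

Lemma pall_or (X : Type) (P P' : X -> Prop) (D : Prop) l :
  (forall a, P a -> P' a \/ D) -> pall P l -> pall P' l \/ D.
Proof.
move=> PD; elim: l => [|a l IH] /=; first by left.
by move=> [/PD[|] ? /IH[|] ?]; [left|right|right|right].
Qed.

Lemma pall_map (X Y : Type) (f : X -> Y) (P : Y -> Prop) s : pall P (map f s) <-> pall (P \o f) s.
Proof. by elim: s => //= a s ->. Qed.

(** The common coordinate [z] avoids the finite set [F] of breakpoints, so that a chain of the other
    direction never has a joint exactly at [z]. *)
Definition vlink (F : seq R) A B := [/\ q2 A = q1 B, meetx A B &
  exists2 z, z \notin F & p1 A <= z <= p2 A /\ p1 B <= z <= p2 B].

Definition strict A (z : R) := (q1 A < z) && (z < q2 A).

(** The pieces cover their height range without gaps, so a height that is no breakpoint lies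
    strictly inside one of them. Quantifying over [P] transports any property of all pieces to the
    one found. *)
Lemma pall_strict F A0 s z : ppath (vlink F) A0 s -> q1 A0 < z -> z < q2 (last A0 s) ->
  pall (fun A => z <> q1 A /\ z <> q2 A) (A0 :: s) ->
  forall P : piece -> Prop, pall P (A0 :: s) -> exists2 A, P A & strict A z.
Proof.
elim: s A0 => [|A1 s IH] A0 /= => [_ h1 h2 _ P [PA _]|[[e _ _] pth] h1 h2 [[n1 n2] al] P [PA0 PA]].
  by exists A0 => //; rewrite /strict h1.
have [h|h] := ltP z (q2 A0); first by exists A0 => //; rewrite /strict h1.
apply: (IH A1) => //=; rewrite -e lt_neqAle h andbT.
by apply/eqP => zz; apply: n2.
Qed.

(** The pieces that share a height with [B] are consecutive in the chain, and consecutive pieces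
    overlap horizontally, so the chain cannot change sides while it passes [B]. *)
Lemma side_dich F A0 s B : wfp B -> ppath (vlink F) A0 s -> pall wfp (A0 :: s) ->
  pall (fun A => ~~ (meetx A B && meety A B)) (A0 :: s) ->
  pall (fun A => meety A B -> p2 B <= p1 A) (A0 :: s) \/
  pall (fun A => meety A B -> p2 A <= p1 B) (A0 :: s).
Proof.
move=> [wB1 wB2].
have side A : ~~ (meetx A B && meety A B) -> meety A B -> p2 B <= p1 A \/ p2 A <= p1 B.
  move=> + m; rewrite m andbT negb_and -!leNgt => /orP[h|h]; [by left|by right].
elim: s A0 => [|A1 s IH] A0 /=.
  move=> _ _ [nA _]; have [m|m] := boolP (meety A0 B); last by left.
  by case: (side _ nA m) => h; [left|right].
move=> [[e mx _] pth] [wA0 [wA1 wA]] [nA0 nA].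
have /orP[m|m] := orbN (meety A0 B); last first.
  by case: (IH A1 pth _ nA) => // h; [left|right]; split=> //; rewrite (negPf m).
have /orP[m1|m1] := orbN (meety A1 B).
  move: mx => /andP[mx1 mx2].
  case: (IH A1 pth _ nA) => // h; case: (side _ nA0 m) => h0.
  - by left; split.
  - by exfalso; case: h wA0 => /(_ m1) h _ [? ?]; lra.
  - by exfalso; case: h wA0 => /(_ m1) h _ [? ?]; lra.
  - by right; split.
(* [A0] shares heights with [B] and the next piece does not: the chain has left the height range of
   [B] upwards, for good. *)
suff vac : pall (fun A => ~~ meety A B) (A1 :: s).
  have v1 : pall (fun A => meety A B -> p2 B <= p1 A) (A1 :: s).
    by apply: pall_sub vac => A /negPf ->.
  have v2 : pall (fun A => meety A B -> p2 A <= p1 B) (A1 :: s).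
    by apply: pall_sub vac => A /negPf ->.
  by case: (side _ nA0 m) => h0; [left|right]; split.
have q2B : q2 B <= q1 A1.
  move: m m1 wA1 => /andP[_ mm]; rewrite negb_and -!leNgt => /orP[//|h] [_ ?].
  by move: mm; rewrite e; lra.
split=> // {IH m m1 nA0 nA mx e wA0}.
elim: s A1 pth wA1 wA q2B => //= A2 s IH A1 [[e _ _] pth] [_ w1] [wA2 wA] q2B.
have q2B' : q2 B <= q1 A2 by rewrite -e; apply: le_trans w1.
split; first by rewrite negb_and -!leNgt q2B'.
exact: IH pth wA2 wA q2B'.
Qed.

(** A rectangle version of the fact that a bottom-to-top path crosses a left-to-right path. If no
    two pieces meet, every [B] has the vertical chain on one side. The first [B] starts at the left
    border and has the chain on its right, the last one ends at the right border and cannot, so some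
    consecutive pair changes sides. *)
Lemma crossing F G A0 s B0 r :
  pall wfp (A0 :: s) -> pall wfp (B0 :: r) ->
  ppath (vlink F) A0 s -> q1 A0 = 0 -> q2 (last A0 s) = 1 ->
  ppath (vlink G) (swapp B0) (map swapp r) -> p1 B0 = 0 -> p2 (last B0 r) = 1 ->
  (exists2 z, z \notin G & q1 B0 <= z <= q2 B0) ->
  (forall z, z \notin G -> pall (fun A => z <> q1 A /\ z <> q2 A) (A0 :: s)) ->
  pall (fun B => forall z, z \notin G -> q1 B <= z <= q2 B -> 0 < z < 1) (B0 :: r) ->
  pall (fun A => 0 < p2 A /\ p1 A < 1) (A0 :: s) ->
  pall (fun B => pall (fun A => p1 A = p2 A -> p1 A <> p2 B) (A0 :: s)) (B0 :: r) ->
  ~ pall (fun B => pall (fun A => ~~ (meetx A B && meety A B)) (A0 :: s)) (B0 :: r).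
Proof.
move=> wA + pth qA0 qA1 + pB0 + zB0 Ggen + pA + + .
have cut z (P : piece -> Prop) : 0 < z < 1 -> z \notin G -> pall P (A0 :: s) ->
    exists2 A, P A & strict A z.
  move=> /andP[z0 z1] zG; apply: (pall_strict pth); rewrite ?qA0 ?qA1 //.
  exact: Ggen.
have st_meet A z B : strict A z -> q1 B <= z <= q2 B -> meety A B.
  by move=> /andP[? ?] /andP[? ?]; apply/andP; split; lra.
pose left B := pall (fun A => meety A B -> p2 B <= p1 A) (A0 :: s).
have conj (P Q : piece -> Prop) l : pall P l -> pall Q l -> pall (fun A => P A /\ Q A) l.
  by elim: l => //= a l IH [? ?] [? ?]; split=> //; apply: IH.
have start : (exists2 z, z \notin G & q1 B0 <= z <= q2 B0) -> wfp B0 ->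
   (forall z, z \notin G -> q1 B0 <= z <= q2 B0 -> 0 < z < 1) ->
   pall (fun A => ~~ (meetx A B0 && meety A B0)) (A0 :: s) -> left B0.
  move=> [z zG zB] wB zin nB; case: (side_dich wB pth wA nB) => // rB.
  have [A [rA [pA1 _]] Az] := cut z _ (zin z zG zB) zG (conj _ _ _ rB pA).
  by have := rA (st_meet _ _ _ Az zB); rewrite pB0; lra.
have {start} lB0 := start zB0.
have main r' B1 : (exists2 z, z \notin G & q1 B1 <= z <= q2 B1) -> left B1 ->
    pall wfp (B1 :: r') -> ppath (vlink G) (swapp B1) (map swapp r') -> p2 (last B1 r') = 1 ->
    pall (fun B => forall z, z \notin G -> q1 B <= z <= q2 B -> 0 < z < 1) (B1 :: r') ->
    pall (fun B => pall (fun A => p1 A = p2 A -> p1 A <> p2 B) (A0 :: s)) (B1 :: r') ->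
    ~ pall (fun B => pall (fun A => ~~ (meetx A B && meety A B)) (A0 :: s)) (B1 :: r').
  elim: r' B1 => [|B2 r' IH] B1 [z zG zB] lB1.
    move=> wB _ lastB [zin _] _ _.
    have [A [lA [_ pA1]] Az] := cut z _ (zin z zG zB) zG (conj _ _ _ lB1 pA).
    by have := lA (st_meet _ _ _ Az zB); rewrite lastB; lra.
  move=> [_ wB] [[/= e1 _ [z' z'G [zB1 zB2]]] pthB] lastB [zin0 zin] [deg0 degB] [nB1 nB].
  apply: (IH B2) => //; first by exists z'.
  have [wB2 _] := wB; have [nB2 _] := nB.
  case: (side_dich wB2 pth wA nB2) => // rB.
  (* At the shared height [z'] the piece [A] lies right of [B1] and left of [B2], which abut. Hence
     [A] is degenerate and lies on their common edge, which the hypothesis on degenerate pieces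
     excludes. *)
  have [A [[lA [rA dA]] wAA] Az] := cut z' _ (zin0 z' z'G zB1) z'G
     (conj _ _ _ (conj _ _ _ lB1 (conj _ _ _ rB deg0)) wA).
  have l1 := lA (st_meet _ _ _ Az zB1); have l2 := rA (st_meet _ _ _ Az zB2).
  by have [wA1 _] := wAA; exfalso; apply: dA; move: e1; lra.
move=> wB pthB lastB zin degB nB; apply: (main r B0) => //.
by apply: lB0 => //; [case: wB | case: zin | case: nB].
Qed.

End Crossing.

Lemma avoid_finite (R : realType) (F : seq R) a b : a < b ->
  exists2 z, z \notin F & a < z < b.
Proof.
elim: F b => [|c F IH] b ab; first by exists ((a + b) / 2) => //; lra.
have [|h] := boolP (a < c < b); last first.
  have [z zF zab] := IH b ab; exists z => //; rewrite inE negb_or zF andbT.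
  by apply: contraNneq h => <-.
move=> /andP[ac cb]; have [z zF /andP[az zc]] := IH c ac.
by exists z; rewrite ?inE ?negb_or ?zF ?(lt_eqF zc) // az (lt_trans zc).
Qed.

(** * From chains of items to gapless chains of pieces *)

Section ChainPieces.
Variables (R : realType) (T : finType).
Variables (x w y h : T -> R) (A : {set T}).

Definition in_unit i : Prop := [/\ 0 <= x i, x i + w i <= 1, 0 <= y i, y i + h i <= 1 & 0 < w i /\ 0 < h i].
Definition packed : Prop :=
  (forall i, i \in A -> in_unit i) /\
  (forall i j, i \in A -> j \in A -> xover x w i j -> xover y h i j -> i = j).

Definition bds (u l : T -> R) : seq R :=
  0 :: 1 :: [seq u i | i <- enum T] ++ [seq u i + l i | i <- enum T].

Lemma bdsP u l i : u i \in bds u l /\ u i + l i \in bds u l.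
Proof.
rewrite !inE !mem_cat; split; apply/orP; right; apply/orP; right; apply/orP.
  by left; apply: map_f; rewrite mem_enum.
by right; apply: (map_f (fun i => u i + l i)); rewrite mem_enum.
Qed.

(** A vertical segment bridging a gap of the chain [S], between consecutive items or towards the
    border of the square. Its heights are free of the whole chain, so purity bounds its length, and
    at least one end rests on an item that contains its abscissa. *)
Definition vseg (S : seq T) z a b :=
  [/\ a <= b, forall v, v \in S -> y v + h v <= a \/ b <= y v,
      exists2 c, c \in S & x c < z < x c + w c /\ (y c + h c = a \/ y c = b),
      a = 0 \/ (exists2 c, c \in S & x c < z < x c + w c /\ y c + h c = a) &
      b = 1 \/ (exists2 c, c \in S & x c < z < x c + w c /\ y c = b)].

Definition item_piece i := Pc (x i) (x i + w i) (y i) (y i + h i).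

Definition goodp S (Z : seq R) P :=
  (exists2 i, i \in S & P = item_piece i) \/
  (exists z a b, [/\ z \notin bds x w, vseg S z a b, z \in Z & P = Pc z z a b]).

Lemma goodp_sub S Z1 Z2 P : {subset Z1 <= Z2} -> goodp S Z1 P -> goodp S Z2 P.
Proof.
move=> sub [?|[z [a [b [? ? zZ ?]]]]]; [by left | right].
by exists z, a, b; split=> //; apply: sub.
Qed.

Lemma path_below_le c s : (forall i, i \in c :: s -> 0 < h i) ->
  path (below x w y h) c s -> forall v, v \in s -> y c + h c <= y v.
Proof.
elim: s c => //= d s IH c hp /andP[/andP[_ cd] pth] v; rewrite inE => /orP[/eqP->//|vs].
have hd : 0 < h d by apply: hp; rewrite !inE eqxx orbT.
suff : y d + h d <= y v by lra.
by apply: IH pth _ vs => i i1; apply: hp; rewrite inE i1 orbT.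
Qed.

(** [S] is the whole chain and [c :: s] the part still to be translated; the last hypothesis says
    that the part already passed lies below [c], which keeps the new segments free of all of [S].
    One segment, possibly of length zero, follows each item of the tail, hence the size of [Z]. *)
Lemma chain_tail S c s :
  (forall i, i \in S -> in_unit i) ->
  {subset c :: s <= S} -> path (below x w y h) c s ->
  (forall v, v \in S -> v \in c :: s \/ y v + h v <= y c) ->
  exists Ps Z, [/\ ppath (vlink (bds x w)) (item_piece c) Ps, q2 (last (item_piece c) Ps) = 1,
     pall (goodp S Z) (item_piece c :: Ps) & size Z = (size s).+1].
Proof.
move=> uS; elim: s c => [|d s IH] c sub.
  move=> _ old; have Sc : c \in S by apply: sub; rewrite inE.
  have [? ? ? ? [w0 h0]] := uS c Sc.
  have [z zF zc] := @avoid_finite R (bds x w) (x c) (x c + w c) ltac:(lra).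
  exists [:: Pc z z (y c + h c) 1], [:: z]; split=> //=.
    split=> //; split=> //.
    by exists z => //=; rewrite lexx; move: zc => /andP[? ?]; split; apply/andP; split; lra.
  split; first by left; exists c.
  split=> //; right; exists z, (y c + h c), 1; split; rewrite ?inE //; split=> //.
  - by move=> v /old[|]; [rewrite inE => /eqP-> | move=> ?]; left; lra.
  - by exists c => //; split=> //; left.
  - by right; exists c.
  - by left.
move=> /= /andP[/andP[/andP[o1 o2] cd] pth] old.
have Sc : c \in S by apply: sub; rewrite inE eqxx.
have sub' : {subset d :: s <= S} by move=> i i1; apply: sub; rewrite inE i1 orbT.
have Sd : d \in S by apply: sub'; rewrite inE eqxx.
have [? ? ? ? [w0 h0]] := uS c Sc; have [? ? ? ? [w0' h0']] := uS d Sd.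
have [|z zF zc] := @avoid_finite R (bds x w) (Num.max (x c) (x d)) (Num.min (x c + w c) (x d + w d)).
  by rewrite lt_min !gt_max; apply/andP; split; apply/andP; split; lra.
move: zc; rewrite gt_max lt_min => /andP[/andP[z1 z2] /andP[z3 z4]].
have dle v : v \in s -> y d + h d <= y v.
  by apply: path_below_le pth v => i i1; have [_ _ _ _ []] := uS i (sub' _ i1).
have [|Ps [Z [Ps1 Ps2 Ps3 sZ]]] := IH d sub' pth.
- move=> v /old[|vc]; last by right; lra.
  by rewrite inE => /orP[/eqP->|]; [right|left].
have zZ : {subset Z <= z :: Z} by move=> t tZ; rewrite inE tZ orbT.
exists (Pc z z (y c + h c) (y d) :: item_piece d :: Ps), (z :: Z); split=> //=; last by rewrite sZ.
  split; last split=> //; split=> //.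
  - by rewrite /meetx /meet /=; apply/andP; split; lra.
  - by exists z => //=; split; apply/andP; split; lra.
  - by rewrite /meetx /meet /=; apply/andP; split; lra.
  - by exists z => //=; split; apply/andP; split; lra.
split; first by left; exists c.
split; last by apply: pall_sub Ps3 => P; apply: goodp_sub.
right; exists z, (y c + h c), (y d); split; rewrite ?inE ?eqxx //; split=> //.
- move=> v /old[|]; last by left; lra.
  rewrite !inE => /or3P[/eqP->|/eqP->|/dle]; [by left|by right|right; lra].
- by exists c => //; split; [apply/andP | left].
- by right; exists c => //; split=> //; apply/andP.
- by right; exists d => //; split=> //; apply/andP.
Qed.

Lemma chain_pieces c s :
  (forall i, i \in c :: s -> in_unit i) -> path (below x w y h) c s ->
  exists A0 Ps Z, [/\ ppath (vlink (bds x w)) A0 Ps, q1 A0 = 0, q2 (last A0 Ps) = 1,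
     pall (goodp (c :: s) Z) (A0 :: Ps) &
     (exists2 z, z \notin bds x w & p1 A0 <= z <= p2 A0) /\ size Z = (size s).+2].
Proof.
move=> uS pth.
have [v|Ps [Z [Ps1 Ps2 Ps3 sZ]]] := chain_tail uS (fun i i1 => i1) pth; first by left.
have Sc : c \in c :: s by rewrite inE eqxx.
have [? ? ? ? [w0 h0]] := uS c Sc.
have [z zF zc] := @avoid_finite R (bds x w) (x c) (x c + w c) ltac:(lra).
have zZ : {subset Z <= z :: Z} by move=> t tZ; rewrite inE tZ orbT.
exists (Pc z z 0 (y c)), (item_piece c :: Ps), (z :: Z); split=> //=.
- split=> //; split=> //=.
    by rewrite /meetx /meet /= andbC.
  by exists z => //=; move: zc => /andP[? ?]; split; apply/andP; split; lra.
- split; last by apply: pall_sub Ps3 => P; apply: goodp_sub.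
  right; exists z, 0, (y c); split; rewrite ?inE ?eqxx //; split=> //.
  + move=> v; rewrite inE => /orP[/eqP->|]; first by right.
    move=> vs; right; apply: le_trans (path_below_le _ pth vs); first by lra.
    by move=> i /uS[_ _ _ _ []].
  + by exists c => //; split=> //; right.
  + by left.
  + by right; exists c.
- by rewrite sZ; split=> //; exists z => //=; rewrite lexx.
Qed.

End ChainPieces.

Section ChainCross.
Variables (R : realType) (T : finType).
Variables (x w y h : T -> R) (A : {set T}).
Hypothesis pkd : packed x w y h A.

(* The finite set [Z] of heights of the gap segments of the horizontal chain is
   chosen before the vertical chain. *)
Lemma chain_cross d r :
  {subset d :: r <= A} -> path (below y h x w) d r -> let Q := d :: r in
  exists2 Z : seq R, size Z = (size r).+2 &
  forall c s, {subset c :: s <= A} -> path (below x w y h) c s -> let S := c :: s in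
  [\/ exists2 i, i \in S & i \in Q,
      exists z a b j, [/\ vseg x w y h S z a b, j \in Q, x j < z < x j + w j
                        & a < y j + h j /\ y j < b],
      exists i z a b, [/\ i \in S, z \in Z, vseg y h x w Q z a b, y i < z < y i + h i
                        & a < x i + w i /\ x i < b] |
      exists z a b z' a' b', [/\ vseg x w y h S z a b, z' \in Z, vseg y h x w Q z' a' b',
                        a' < z < b' & a < z' < b]].
Proof.
move=> rA pd Q; have [uA dis] := pkd.
have swu i : in_unit x w y h i -> in_unit y h x w i by case=> ? ? ? ? [? ?]; split.
have [B0 [Qs [Z [Qs1 Qs2 Qs3 Qs4 [[z1 z1F Qs5] sZ]]]]] :=
  chain_pieces (fun i i1 => swu _ (uA i (rA i i1))) pd.
exists Z => // c s sA pc S.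
have [A0 [Ps [ZZ [Ps1 Ps2 Ps3 Ps4 _]]]] := chain_pieces (fun i i1 => uA i (sA i i1)) pc.
have inFx i : i \in A -> 0 < x i + w i /\ x i < 1.
  by move=> /uA[? ? ? ? [? ?]]; split; lra.
have sw (B : piece R) : swapp (swapp B) = B by case: B.
have swm l : map (@swapp R) (map (@swapp R) l) = l.
  by rewrite -map_comp; elim: l => //= B l ->; rewrite sw.
(* The horizontal chain was obtained by running the vertical construction with the coordinates
   exchanged; here it is reflected back. *)
pose B0' := swapp B0; pose Qs' := map (@swapp R) Qs.
have lastsw : last B0' Qs' = swapp (last B0 Qs) by rewrite /B0' /Qs' last_map.
have Qg : pall (fun B => goodp y h x w Q Z (swapp B)) (B0' :: Qs').
  have e : pall (goodp y h x w Q Z) (map (@swapp R) (B0' :: Qs')) by rewrite /= sw swm.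
  exact/pall_map.
have inx i : x i \in bds x w /\ x i + w i \in bds x w by apply: bdsP.
have iny i : y i \in bds y h /\ y i + h i \in bds y h by apply: bdsP.
have zero (u l : T -> R) : (0 : R) \in bds u l by rewrite inE eqxx.
have one (u l : T -> R) : (1 : R) \in bds u l by rewrite !inE eqxx orbT.
pose ncr := pall (fun B => pall (fun A => ~~ (meetx A B && meety A B)) (A0 :: Ps)) (B0' :: Qs').
have : ~ ncr.
  apply: (@crossing R (bds x w) (bds y h) A0 Ps B0' Qs').
  - apply: pall_sub Ps4 => P [[i /sA /uA[? ? ? ? [? ?]] ->]|[z [a [b [_ [? _ _ _ _] _ ->]]]]].
      by split=> /=; lra.
    by split=> /=.
  - apply: pall_sub Qg => -[a1 a2 b1 b2] /=.
    move=> [[i /rA /uA[? ? ? ? [? ?]] [-> -> -> ->]]|[z [a [b [_ [? _ _ _ _] _ [-> -> -> ->]]]]]];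
    by split=> /=; lra.
  - exact: Ps1.
  - exact: Ps2.
  - exact: Ps3.
  - by rewrite /B0' sw /Qs' swm.
  - exact: Qs2.
  - by rewrite lastsw.
  - by exists z1.
  - move=> z zF; apply: pall_sub Ps4 => P; have nz t : t \in bds y h -> z <> t.
      by move=> tF e; move: zF; rewrite e tF.
    move=> [[i _ ->]|[t [a [b [_ [_ _ _ aa bb] _ ->]]]]] /=.
      by split; apply: nz; case: (iny i).
    split; apply: nz; [case: aa => [->//|[i _ [_ <-]]] | case: bb => [->//|[i _ [_ <-]]]];
    by case: (iny i).
  - apply: pall_sub Qg => -[a1 a2 b1 b2] /= + z zF.
    have nz t : t \in bds y h -> z != t by move=> tF; apply: contraNneq zF => ->.
    move=> + /andP[zl zr]; move=> [[i /rA Ai [e1 e2 e3 e4]]|[t [a [b [_ [_ _ [i /rA Ai [tt _]] _ _] _ [e1 e2 e3 e4]]]]]];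
    have [? ? ? ? [? ?]] := uA i Ai; apply/andP; split; move: zl zr; rewrite ?e1 ?e2;
    try lra; move=> ? ?; rewrite lt_neqAle.
    + by rewrite eq_sym (nz _ (zero _ _)) /=; lra.
    + by rewrite (nz _ (one _ _)) /=; lra.
  - apply: pall_sub Ps4 => P [[i /sA /uA[? ? ? ? [? ?]] ->]|[z [a [b [_ [_ _ [i /sA/uA[? ? ? ? [? ?]] [/andP[? ?] _]] _ _] _ ->]]]]] /=;
    by split; lra.
  - apply: pall_sub Qg => B gB; apply: pall_sub Ps4 => P.
    have p2B : p2 B \in bds x w.
      case: B gB => a1 a2 b1 b2 /= [[i _ [_ _ _ ->]]|[t [a [b [_ [_ _ _ _ bb] _ [_ _ _ ->]]]]]].
        by case: (inx i).
      by case: bb => [->//|[i _ [_ <-]]]; case: (inx i).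
    move=> [[i /sA /uA[? ? ? ? [? ?]] ->]|[z [a [b [zF _ _ ->]]]]] /=; first by lra.
    by move=> _ e; move: zF; rewrite e p2B.
set D := (X in _ -> X) => nn.
suff [//|//] : ncr \/ D.
apply: pall_or Qg => B gB; apply: pall_or Ps4 => P gP.
have [mm|] := boolP (meetx P B && meety P B); last by left.
right; move: mm => /andP[/andP[m1 m2] /andP[m3 m4]]; rewrite /D.
case: gP => [[i Si e]|[z [a [b [zF vs _ e]]]]]; subst P;
case: B gB m1 m2 m3 m4 => B1 B2 B3 B4 /=;
case=> [[j Qj [-> -> -> ->]]|[z' [a' [b' [zF' vs' z'Z [-> -> -> ->]]]]]] m1 m2 m3 m4.
- have ij : i = j by apply: dis; [exact: sA|exact: rA|apply/andP; split|apply/andP; split].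
  by apply: Or41; exists i => //; rewrite ij.
- by apply: Or43; exists i, z', a', b'; split=> //; apply/andP.
- by apply: Or42; exists z, a, b, j; split=> //; apply/andP.
- by apply: Or44; exists z, a, b, z', a', b'; split=> //; apply/andP.
Qed.

End ChainCross.

Section Generic.
Variables (R : realType) (T : finType).
Implicit Types (x w y h u l : T -> R) (B : {set T}).

Definition apart u l i j := u i + l i <= u j \/ u j + l j <= u i.

Lemma chain_apart x w y h s : (forall i, i \in s -> 0 < h i) -> sorted (below x w y h) s ->
  forall i j, i \in s -> j \in s -> i != j -> apart y h i j.
Proof.
case: s => // c s; elim: s c => [|d s IH] c hp pth i j.
  by rewrite !inE => /eqP-> /eqP->; rewrite eqxx.
have le v : v \in d :: s -> y c + h c <= y v by apply: path_below_le pth v.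
have pth' : sorted (below x w y h) (d :: s) by move: pth => /= /andP[].
have hp' k : k \in d :: s -> 0 < h k by move=> k1; apply: hp; rewrite inE k1 orbT.
rewrite inE => /orP[/eqP->|i1]; rewrite inE => /orP[/eqP->|j1].
- by rewrite eqxx.
- by left; apply: le.
- by right; apply: le.
- exact: IH hp' pth' i j i1 j1.
Qed.

Lemma sum_gap B u l a b :
  (forall i, i \in B -> [/\ 0 <= u i, u i + l i <= 1 & 0 < l i]) ->
  (forall i j, i \in B -> j \in B -> i != j -> apart u l i j) ->
  0 <= a -> a <= b -> b <= 1 -> (forall i, i \in B -> u i + l i <= a \/ b <= u i) ->
  \sum_(i in B) l i <= 1 - (b - a).
Proof.
move=> bnd dis a0 ab b1 gap.
pose P i := u i + l i <= a.
rewrite (bigID P) /=.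
have s1 : \sum_(i in B | P i) l i <= a - 0.
  rewrite (eq_bigl (fun i => i \in [set i in B | P i])); last by move=> i; rewrite inE.
  apply: (@sum_disjoint_intervals _ _ _ u) => // [i|i j].
    by rewrite inE => /andP[Bi Pi]; have [] := bnd i Bi.
  by rewrite !inE => /andP[? _] /andP[? _]; apply: dis.
have s2 : \sum_(i in B | ~~ P i) l i <= 1 - b.
  rewrite (eq_bigl (fun i => i \in [set i in B | ~~ P i])); last by move=> i; rewrite inE.
  apply: (@sum_disjoint_intervals _ _ _ u) => // [i|i j].
    rewrite inE => /andP[Bi Pi]; have [? ? ?] := bnd i Bi.
    by case: (gap i Bi) => // Pi'; rewrite /P Pi' in Pi.
  by rewrite !inE => /andP[? _] /andP[? _]; apply: dis.
by lra.
Qed.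

Lemma card_long B l (q : nat) : (forall i, i \in B -> 1 < l i * q%:R) ->
  \sum_(i in B) l i <= 1 -> (#|B| <= q)%N.
Proof.
move=> lq s1; rewrite -(ler_nat R) -sum1_card natr_sum.
apply: (@le_trans _ _ (\sum_(i in B) l i * q%:R)); first by apply: ler_sum => i /lq/ltW.
by rewrite -mulr_suml ler_piMl.
Qed.

Lemma sum_has_le (I : eqType) (P : I -> pred T) (f : T -> R) (s : seq I) :
  (forall i, 0 <= f i) ->
  \sum_(i | has (fun k => P k i) s) f i <= \sum_(k <- s) \sum_(i | P k i) f i.
Proof.
move=> f0; elim: s => [|k s IH]; first by rewrite big_pred0 // big_nil.
rewrite big_cons [X in X <= _](bigID (P k)) /=; apply: lerD.
  rewrite [X in _ <= X](bigID (fun i => P k i || has (fun k => P k i) s)) /=.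
  rewrite [X in X <= _](eq_bigl (fun i => P k i && (P k i || has (P^~ i) s))); last first.
    by move=> i; rewrite andbC.
  by rewrite lerDl; apply: sumr_ge0.
apply: le_trans IH; rewrite [X in _ <= X](bigID (P k)) /=.
rewrite [X in X <= _](eq_bigl (fun i => has (P^~ i) s && ~~ P k i)).
  by rewrite lerDr; apply: sumr_ge0.
by move=> i; case: (P k i); rewrite ?andbF.
Qed.

Lemma sum_setU_le B C (f : T -> R) : (forall i, 0 <= f i) ->
  \sum_(i in B :|: C) f i <= \sum_(i in B) f i + \sum_(i in C) f i.
Proof.
move=> f0; rewrite (eq_bigl (fun i => (i \in B) || (i \in C))); last by move=> i; rewrite inE.
have := @sum_has_le bool (fun b i => i \in (if b then B else C)) f [:: true; false] f0.
rewrite !big_cons big_nil addr0; apply: le_trans.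
by rewrite le_eqVlt; apply/orP; left; apply/eqP/eq_bigl => i /=; rewrite orbF.
Qed.

Lemma line_bound B x w h (q : nat) c : (0 < q)%N ->
  (forall i, i \in B -> [/\ 0 <= x i, x i + w i <= 1, 1 < w i * q%:R & 0 <= h i]) ->
  (forall t, \sum_(i in B | (x i < t) && (t < x i + w i)) h i <= c) ->
  \sum_(i in B) h i <= q%:R * c.
Proof.
move=> q0 bnd line.
pose on (k : 'I_q) i := x i < (k : nat)%:R / q%:R < x i + w i.
apply: (@le_trans _ _ (\sum_(k < q) \sum_(i in B | on k i) h i)).
  rewrite (exchange_big_dep (mem B)) /=; last by move=> k i _ /andP[].
  apply: ler_sum => i Bi; have [x0 x1 wq hi] := bnd i Bi.
  have [k onk] := grid_line q0 x0 x1 wq.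
  rewrite (bigD1 k) /=; last by rewrite Bi.
  by rewrite lerDl; apply: sumr_ge0 => *; have [] := bnd i Bi.
rewrite -[q in X in _ <= X](card_ord q) -sumr_const mulr_suml.
by apply: ler_sum => k _; rewrite mul1r; apply: line.
Qed.

End Generic.

(** * Hitting all nearly pure chains of one direction by a thin set *)

Section Dichotomy.
Variables (R : realType) (T : finType).
Variables (x w y h : T -> R) (A : {set T}) (isH : pred T) (q : nat) (beta delta : R).
Hypothesis pkd : packed x w y h A.
Hypothesis Hlong : forall i, i \in A -> isH i -> 1 < w i * q%:R /\ h i <= delta.
Hypothesis Vlong : forall i, i \in A -> ~~ isH i -> 1 < h i * q%:R /\ w i <= delta.
Hypothesis q0 : (0 < q)%N.
Hypothesis delta0 : 0 < delta.
Hypothesis delta_beta : delta <= beta.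
Hypothesis beta_q : 2 * beta * q%:R <= 1.

Definition HS (S : seq T) := [set i | (i \in S) && isH i].
Definition VS (S : seq T) := [set i | (i \in S) && ~~ isH i].
(** Near purity is measured by the V items alone: they leave less than [beta] of the unit height
    uncovered, so no V-free gap of the chain reaches length [beta]. *)
Definition vchain S := [/\ {subset S <= A}, sorted (below x w y h) S & 1 - beta < \sum_(i in VS S) h i].
Definition hchain S := [/\ {subset S <= A}, sorted (below y h x w) S & 1 - beta < \sum_(i in HS S) w i].

Let qR : 1 <= q%:R :> R. Proof. by rewrite ler1n. Qed.

Let beta1 : beta <= 1 / 2.
Proof. by have := beta_q; have := delta0; have := delta_beta; have := qR; nra. Qed.

Lemma uA i : i \in A -> in_unit x w y h i. Proof. by case: pkd => + _; apply. Qed.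

Lemma vchain_apart S : vchain S -> forall i j, i \in S -> j \in S -> i != j -> apart y h i j.
Proof.
by move=> [sub srt _]; apply: chain_apart srt => i /sub/uA[_ _ _ _ []].
Qed.

Lemma hchain_apart S : hchain S -> forall i j, i \in S -> j \in S -> i != j -> apart x w i j.
Proof.
by move=> [sub srt _]; apply: chain_apart srt => i /sub/uA[_ _ _ _ []].
Qed.

Lemma vgap S a b : vchain S -> 0 <= a -> a <= b -> b <= 1 ->
  (forall v, v \in S -> ~~ isH v -> y v + h v <= a \/ b <= y v) -> b - a < beta.
Proof.
move=> vS a0 ab b1 gap; have [sub srt pur] := vS.
suff : \sum_(i in VS S) h i <= 1 - (b - a) by lra.
apply: (@sum_gap _ _ _ y) => // [i|i j|i]; rewrite !inE => /andP[iS Vi].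
- by have [] := uA (sub i iS) => _ _ ? ? [].
- by move=> /andP[jS _]; apply: vchain_apart vS _ _ iS jS.
- exact: gap.
Qed.

Lemma card_VS S : vchain S -> (#|VS S| <= q)%N.
Proof.
move=> vS; have [sub srt pur] := vS.
apply: (@card_long _ _ _ h) => [i|]; first by rewrite inE => /andP[iS Vi]; case: (Vlong (sub i iS) Vi).
have -> : 1 = 1 - (0 - 0) :> R by lra.
apply: (@sum_gap _ _ _ y) => // [i|i j|i]; rewrite ?inE ?ler01 // => /andP[iS Vi].
- by have [] := uA (sub i iS) => _ _ ? ? [].
- by move=> /andP[jS _]; apply: vchain_apart vS _ _ iS jS.
- by right; have [] := uA (sub i iS).
Qed.

Lemma card_HS S : hchain S -> (#|HS S| <= q)%N.
Proof.
move=> vS; have [sub srt pur] := vS.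
apply: (@card_long _ _ _ w) => [i|]; first by rewrite inE => /andP[iS Vi]; case: (Hlong (sub i iS) Vi).
have -> : 1 = 1 - (0 - 0) :> R by lra.
apply: (@sum_gap _ _ _ x) => // [i|i j|i]; rewrite ?inE ?ler01 // => /andP[iS Vi].
- by have [] := uA (sub i iS) => ? ? _ _ [].
- by move=> /andP[jS _]; apply: hchain_apart vS _ _ iS jS.
- by right; have [] := uA (sub i iS).
Qed.

(** The items through which a vertical chain can pass the chain [Q] without meeting its H items: V
    items that slip through a gap of [Q], overlapping each H item of [Q] by at most [delta] in
    projection, and H items close to the height of one of the gap segments in [Z]. *)
Definition DV (Q : seq T) (Z : seq R) : {set T} :=
  [set i in A | ~~ isH i && [forall v in HS Q, (x i + w i <= x v + delta) || (x v + w v - delta <= x i)]]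
  :|: [set i in A | isH i && has (fun z => (z - beta <= y i + h i) && (y i <= z + beta)) Z].

Lemma DV_V Q Z i t : i \in A -> ~~ isH i -> x i <= t <= x i + w i ->
  (forall v, v \in Q -> isH v -> x v + w v <= t \/ t <= x v) -> i \in DV Q Z.
Proof.
move=> Ai Vi /andP[t1 t2] av; rewrite 2!inE Ai Vi /=; apply/orP; left.
apply/forall_inP => v; rewrite inE => /andP[vQ Hv].
have [_ wd] := Vlong Ai Vi.
by case: (av v vQ Hv) => ?; apply/orP; [right|left]; lra.
Qed.

Lemma DV_H Q Z i z : i \in A -> isH i -> z \in Z -> z - beta <= y i + h i -> y i <= z + beta ->
  i \in DV Q Z.
Proof.
move=> Ai Hi zZ z1 z2; rewrite inE; apply/orP; right; rewrite inE Ai Hi /=.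
by apply/hasP; exists z => //; rewrite z1.
Qed.

(** Each of the four ways in which [S] can cross [Q] either exhibits an item of [S] in [DV], or
    shows that at the height of some H item of [Q] the chain [S] has no V item in its way. *)
Lemma cross_outcome d r : hchain (d :: r) ->
  exists2 Z : seq R, size Z = (size r).+2 &
  forall S, vchain S ->
   (exists2 i, i \in S & i \in DV (d :: r) Z) \/
   (exists t j, [/\ j \in d :: r, isH j, y j <= t <= y j + h j &
      forall v, v \in S -> ~~ isH v -> y v + h v <= t \/ t <= y v]).
Proof.
move=> hQ; have [Qsub Qsrt Qp] := hQ.
have [Z sZ cross] := chain_cross pkd Qsub Qsrt; exists Z => // -[|c s] vS.
  exfalso; case: vS => _ _; rewrite big1; last by move=> i; rewrite inE.
  by have := beta1; lra.
have [Ssub Ssrt Sp] := vS.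
have Vgap j t : j \in d :: r -> ~~ isH j -> x j <= t <= x j + w j ->
    forall v, v \in d :: r -> isH v -> x v + w v <= t \/ t <= x v.
  move=> jQ Vj /andP[t1 t2] v vQ Hv; have [vj|vj] := eqVneq v j; first by rewrite vj (negPf Vj) in Hv.
  by case: (hchain_apart hQ vQ jQ vj) => ?; [left|right]; lra.
have {cross} := cross c s Ssub Ssrt; set S := c :: s => -[].
- move=> [i iS iQ]; have [? ? ? ? [? ?]] := uA (Ssub i iS).
  have [Hi|Vi] := boolP (isH i).
    right; exists (y i), i; split=> //; first by apply/andP; split; lra.
    move=> v vS' Vv; have [vi|vi] := eqVneq v i; first by rewrite vi Hi in Vv.
    by case: (vchain_apart vS vS' iS vi) => ?; [left|right; lra].
  left; exists i => //; apply: (@DV_V _ _ _ (x i)) => //; first exact: Ssub.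
    by apply/andP; split; lra.
  by apply: Vgap Vi _ => //; apply/andP; split; lra.
(* A gap of [S] crosses an item [j] of [Q]. If [j] is H, the gap contains a height of [j]. If [j] is
   V, an item bounding the gap is V and in [DV], or it is H and disjoint from [j]; in the latter
   case the gap contains [j], which is longer than [1/q], contradicting [vgap]. *)
- move=> [z [a [b [j [[ab av [c0 Sc0 _] lo up] jQ /andP[zj1 zj2] [zj3 zj4]]]]]].
  have [? ? ? ? [? ?]] := uA (Qsub j jQ).
  have [Hj|Vj] := boolP (isH j).
    right; exists (Num.max a (y j)), j; split=> //.
      by rewrite le_max lexx orbT ge_max; apply/andP; split; lra.
    move=> v vS' _; have := av v vS'; rewrite le_max ge_max => -[->|bv]; first by left.
    by right; apply/andP; split; lra.
  have near0 i : i \in S -> x i < z < x i + w i -> i \in DV (d :: r) Z \/ isH i.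
    move=> iS /andP[zi1 zi2]; have [|Vi] := boolP (isH i); [by right|left].
    apply: (@DV_V _ _ _ z) => //; [exact: Ssub|by apply/andP; split; lra|].
    by apply: Vgap Vj _ => //; apply/andP; split; lra.
  have ov i : i \in S -> x i < z < x i + w i -> isH i -> y i + h i <= y j \/ y j + h j <= y i.
    move=> iS /andP[zi1 zi2] Hi; have [? ? ? ? [? ?]] := uA (Ssub i iS).
    have [//|n1] := leP (y i + h i) (y j); first by left.
    have [//|n2] := leP (y j + h j) (y i); first by right.
    have ij : i = j.
      case: pkd => _; apply; [exact: Ssub|exact: Qsub| |]; apply/andP; split; lra.
    by rewrite ij (negPf Vj) in Hi.
  have {}lo : (exists2 i, i \in S & i \in DV (d :: r) Z) \/ (0 <= a /\ a <= y j).
    case: lo => [->|[i iS [zi ya]]]; first by right; split; lra.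
    have [iD|Hi] := near0 i iS zi; first by left; exists i.
    have [? ? ? ? [? ?]] := uA (Ssub i iS).
    by right; case: (ov i iS zi Hi) => ?; split; lra.
  case: lo => [|[a0 aj]]; [by left | ].
  have {}up : (exists2 i, i \in S & i \in DV (d :: r) Z) \/ (b <= 1 /\ y j + h j <= b).
    case: up => [->|[i iS [zi ya]]]; first by right; split; lra.
    have [iD|Hi] := near0 i iS zi; first by left; exists i.
    have [? ? ? ? [? ?]] := uA (Ssub i iS).
    by right; case: (ov i iS zi Hi) => ?; split; lra.
  case: up => [|[b0 bj]]; [by left | ].
  have : b - a < beta by apply: (vgap vS) => // v vS' _; apply: av.
  have [hj _] := Vlong (Qsub j jQ) Vj; have := beta_q; have := qR; have := delta0; have := delta_beta.
  by nra.
- move=> [i [z [a [b [iS zZ [ab av _ _ _] /andP[zi1 zi2] [ai bi]]]]]].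
  left; exists i => //; have Ai := Ssub i iS; have [? ? ? ? [? ?]] := uA Ai.
  have [Hi|Vi] := boolP (isH i).
    by apply: DV_H zZ _ _ => //; have := delta0; have := delta_beta; lra.
  apply: (@DV_V _ _ _ (Num.max a (x i))) => //.
    by rewrite le_max lexx orbT ge_max; apply/andP; split; lra.
  move=> v vQ Hv; case: (av v vQ) => ?; [left|right]; rewrite ?le_max ?ge_max; first by apply/orP; left.
  by apply/andP; split; lra.
(* Two gaps cross. The item of [S] at an end of its gap contains the abscissa [z], which lies in the
   gap of [Q]; if it is H it is within [beta] of [z'], as the gap of [S] is shorter than [beta]. *)
- move=> [z [a [b [z' [a' [b' [[ab av [i iS [/andP[zi1 zi2] ei]] lo up] zZ [ab' av' _ _ _] /andP[za1 za2] /andP[zb1 zb2]]]]]]]].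
  left; exists i => //; have Ai := Ssub i iS; have [? ? ? ? [? ?]] := uA Ai.
  have [Hi|Vi] := boolP (isH i); last first.
    apply: (@DV_V _ _ _ z) => //; first by apply/andP; split; lra.
    by move=> v vQ _; case: (av' v vQ) => ?; [left|right]; lra.
  have a0 : 0 <= a by case: lo => [->//|[k kS [_ <-]]]; have [? ? ? ? [? ?]] := uA (Ssub k kS); lra.
  have b1 : b <= 1 by case: up => [->//|[k kS [_ <-]]]; have [? ? ? ? [? ?]] := uA (Ssub k kS); lra.
  have : b - a < beta by apply: (vgap vS) => // v vS' _; apply: av.
  by move=> gab; apply: DV_H zZ _ _ => //; case: ei => ei; lra.
Qed.

End Dichotomy.

Section Dichotomy.
Variables (R : realType) (T : finType).
Variables (x w y h : T -> R) (A : {set T}) (isH : pred T) (q : nat) (beta delta : R).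
Hypothesis pkd : packed x w y h A.
Hypothesis Hlong : forall i, i \in A -> isH i -> 1 < w i * q%:R /\ h i <= delta.
Hypothesis Vlong : forall i, i \in A -> ~~ isH i -> 1 < h i * q%:R /\ w i <= delta.
Hypothesis q0 : (0 < q)%N.
Hypothesis delta0 : 0 < delta.
Hypothesis delta_beta : delta <= beta.
Hypothesis beta_q : 2 * beta * q%:R <= 1.

Let qR : 1 <= q%:R :> R. Proof. by rewrite ler1n. Qed.
Let uA i : i \in A -> in_unit x w y h i. Proof. by case: pkd => + _; apply. Qed.
Local Notation hchain := (hchain x w y h A isH beta).
Local Notation vchain := (vchain x w y h A isH beta).

Lemma hchain_nth d S i j : hchain S -> (i < j < size S)%N ->
  x (nth d S i) + w (nth d S i) <= x (nth d S j).
Proof.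
move=> [sub srt _] /andP[ij jn].
have srt' : sorted (fun k l => x k + w k <= x l) S.
  by apply: sub_sorted srt => k l /andP[].
have tr : {in mem A & &, transitive (fun k l => x k + w k <= x l)}.
  move=> k l m Ak Al Am h1 h2; have [_ _ _ _ [? _]] := uA Ak.
  by apply: le_trans h1 _; apply: le_trans h2; lra.
apply: (sorted_ltn_nth_in tr _ _ srt') => //; first by apply/allP => k /sub.
by rewrite inE; apply: ltn_trans jn.
Qed.

Lemma hchain_uniq S : hchain S -> uniq S.
Proof.
case: S => // d S hS; have [sub _ _] := hS.
have lt i j : (i < j < size (d :: S))%N -> nth d (d :: S) i <> nth d (d :: S) j.
  move=> ij e; have := hchain_nth d hS ij; rewrite e.
  have /sub/uA[_ _ _ _ []] : nth d (d :: S) j \in d :: S by apply: mem_nth; case/andP: ij.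
  by lra.
apply/(uniqP d) => i j; rewrite !inE => iS jS e.
have [ij|ji|//] := ltngtP i j.
  by exfalso; apply: (lt i j) e; apply/andP.
by exfalso; apply: (lt j i) (esym e); apply/andP.
Qed.

Lemma splice_size (i j n : nat) : (i.+1 < j)%N -> (j < n)%N -> (i + (n - j.+1).+2 < n)%N.
Proof. by lia. Qed.

(** At most [q] V items in each of the [2 * q.+1] classes used in [shorten_step], and at most [q] H
    items. *)
Definition Lsize := (q.+1 * (2 * q) + q)%N.

Lemma count_HS S : uniq S -> count isH S = #|HS isH S|.
Proof.
move=> uS; rewrite -size_filter cardE; apply: perm_size; apply: uniq_perm.
- exact: filter_uniq.
- exact: enum_uniq.
- by move=> i; rewrite mem_filter mem_enum inE andbC.
Qed.

(** V items are classified by the number of H items before them and by the parity of their position.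
    A class with more than [q] members contains two that overlap in height, because their lengths
    exceed [1/q]; they can be linked directly, and only V items between them are cut out. *)
Lemma shorten_step S : hchain S -> (Lsize < size S)%N ->
  exists S', [/\ hchain S', {subset S' <= S} & (size S' < size S)%N].
Proof.
move=> hS big; have [sub srt pur] := hS.
have uS := hchain_uniq hS; have [d dS] : exists d, d \in S.
  by case: S big {hS sub srt pur uS} => // d S _; exists d; rewrite inE eqxx.
pose n := size S; pose e (i : 'I_n) := nth d S i.
pose key i := count isH (take i S).
have eS i : e i \in S by apply: mem_nth.
have keyq i : (key i <= q)%N.
  apply: leq_trans (card_HS pkd Hlong hS); rewrite -count_HS // /key.
  by rewrite -[X in (_ <= count _ X)%N](cat_take_drop i) count_cat leq_addr.
pose V := [set i : 'I_n | ~~ isH (e i)].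
pose C (kb : 'I_q.+1 * bool) := [set i in V | (inord (key i) == kb.1) && (odd i == kb.2)].
have cardV : (#|V| <= \sum_kb #|C kb|)%N.
  rewrite -sum1_card (partition_big (fun i : 'I_n => ((inord (key i) : 'I_q.+1), odd i)) xpredT) //=.
  apply: leq_sum => kb _; rewrite -sum1_card; apply: eq_leq; apply: eq_bigl => i.
  by rewrite [in RHS]inE; case: kb => k b /=; rewrite xpair_eqE.
have cardn : (n <= #|V| + q)%N.
  have nE : (#|V| + #|~: V| = n)%N by rewrite cardsC card_ord.
  apply: (leq_trans (eq_leq (esym nE))); rewrite leq_add2l; apply: leq_trans (card_HS pkd Hlong hS).
  have inje : {in ~: V &, injective e}.
    by move=> i j _ _ /eqP; rewrite nth_uniq // => /eqP/val_inj.
  rewrite -(card_in_imset inje); apply: subset_leq_card.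
  by apply/subsetP => v /imsetP[i]; rewrite !inE negbK => Hi ->; rewrite eS.
have [kb bigC] : exists kb, (q < #|C kb|)%N.
  case: (pickP (fun kb => q < #|C kb|)%N) => [kb ?|small]; first by exists kb.
  exfalso.
  have : (\sum_kb #|C kb| <= \sum_(kb : 'I_q.+1 * bool) q)%N.
    by apply: leq_sum => kb _; rewrite leqNgt small.
  rewrite sum_nat_const card_prod card_ord card_bool => sm.
  have : (n <= Lsize)%N by rewrite /Lsize; apply: leq_trans cardn _; rewrite leq_add2r (leq_trans cardV) // (leq_trans sm) // mulnA.
  by rewrite leqNgt big.
have [i [j [iC jC ij yo]]] : exists i j, [/\ i \in C kb, j \in C kb, (i < j)%N & xover y h (e i) (e j)].
  apply: NNPP => nex; suff : (#|C kb| <= q)%N by rewrite leqNgt bigC.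
  apply: (@card_long _ _ _ (fun i => h (e i))) => [i|].
    by rewrite !inE => /andP[Vi _]; case: (Vlong (sub _ (eS i)) Vi).
  have -> : 1 = 1 - (0 - 0) :> R by lra.
  apply: (@sum_gap _ _ _ (fun i => y (e i))) => //.
  - by move=> i _; have [? ? ? ? []] := uA (sub _ (eS i)).
  - move=> i j iC jC nij; rewrite /apart.
    have [?|h1] := leP (y (e i) + h (e i)) (y (e j)); first by left.
    have [?|h2] := leP (y (e j) + h (e j)) (y (e i)); first by right.
    exfalso; apply: nex; have [ij|ji|/val_inj e0] := ltngtP i j; last by rewrite e0 eqxx in nij.
      by exists i, j; split=> //; apply/andP.
    by exists j, i; split=> //; apply/andP.
  - by move=> i _; right; have [? ? ? ? []] := uA (sub _ (eS i)).
move: iC jC; rewrite !inE => /andP[Vi /andP[/eqP ki /eqP oi]] /andP[Vj /andP[/eqP kj /eqP oj]].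
have kij : key i = key j.
  have : (inord (key i) : 'I_q.+1) = inord (key j) by rewrite ki kj.
  by move/(congr1 (@nat_of_ord _)); rewrite !inordK ?ltnS.
(* Equal parity rules out neighbours, so the splice removes at least one item. *)
have ij2 : (i.+1 < j)%N.
  rewrite ltn_neqAle ij andbT; apply/eqP => ee; move: oj; rewrite -ee /= -oi.
  by case: (odd i).
have btw k : (i <= k < j)%N -> ~~ isH (nth d S k).
  move=> /andP[ik kj']; have kn : (k < n)%N by apply: ltn_trans (ltn_ord j).
  apply/negP => Hk.
  have m1 a b : (a <= b)%N -> (key a <= key b)%N.
    move=> ab; rewrite /key -[X in (_ <= count _ X)%N](cat_take_drop a) count_cat.
    by rewrite take_takel // leq_addr.
  have m2 : key k.+1 = (key k).+1.
    by rewrite /key (take_nth d) // -cats1 count_cat /= Hk addn0 addn1.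
  have l1 := m1 _ _ ik; have := m1 _ _ kj'; rewrite m2 -kij => l2.
  by have := leq_trans l2 l1; rewrite ltnn.
exists (take i S ++ e i :: e j :: drop j.+1 S).
have ej : e j :: drop j.+1 S = drop j S by rewrite (drop_nth d (ltn_ord j)).
have ei : rcons (take i S) (e i) = take i.+1 S by rewrite (take_nth d (ltn_ord i)).
have sub' : {subset take i S ++ e i :: e j :: drop j.+1 S <= S}.
  move=> k; rewrite mem_cat inE ej => /or3P[/mem_take//|/eqP->//|/mem_drop//].
split=> //; last first.
  by rewrite size_cat /= size_drop size_take (ltn_ord i); apply: splice_size (ltn_ord j).
split.
- by move=> k /sub' /sub.
- rewrite sorted_cat_cons ei take_sorted //= ; apply/andP; split.
    by rewrite /below yo hchain_nth // ij ltn_ord.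
  by have := drop_sorted j srt; rewrite -ej.
- apply: lt_le_trans pur _; rewrite le_eqVlt; apply/orP; left; apply/eqP; apply: eq_bigl => k.
  rewrite !inE; apply/andP/andP => -[kS Hk]; split=> //; last exact: sub'.
  have kn : (index k S < n)%N by rewrite index_mem.
  have kk : nth d S (index k S) = k by apply: nth_index.
  rewrite mem_cat inE ej.
  have [h1|h1] := ltnP (index k S) i.
    by rewrite -{1}kk -(nth_take d h1) mem_nth // size_take (ltn_ord i).
  have [h2|h2] := ltnP (index k S) j.
    by have := btw (index k S); rewrite h1 h2 kk Hk => /(_ isT).
  have : nth d (drop j S) (index k S - j) \in drop j S.
    by apply: mem_nth; rewrite size_drop; apply: ltn_sub2r kn; apply: ltn_ord.
  by rewrite nth_drop subnKC // kk => ->; rewrite !orbT.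
Qed.

Lemma shorten S : hchain S ->
  exists S', [/\ hchain S', {subset S' <= S} & (size S' <= Lsize)%N].
Proof.
have [n] := ubnP (size S); elim: n S => // n IH S; rewrite ltnS => Sn hS.
have [?|big] := leqP (size S) Lsize; first by exists S; split.
have [S1 [hS1 sub1 lt1]] := shorten_step hS big.
have [S' [? sub ?]] := IH S1 (leq_trans lt1 Sn) hS1.
by exists S'; split=> // i /sub/sub1.
Qed.

Definition thick i := if isH i then h i else w i.

(** V part: on any horizontal line the V items of [DV] and the H items of [Q] have almost disjoint
    projections, and the latter already fill all but [beta]; [q] lines meet all V items. H part:
    each height in [Z] has a window of height [4 * beta]. *)
Lemma DV_thick Q Z : hchain Q ->
  \sum_(i in DV x w y h A isH beta delta Q Z) thick i <=
    (q * (1 + 2 * q) + 4 * q * size Z)%:R * beta.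
Proof.
move=> hQ; have [Qsub Qsrt pur] := hQ.
pose f i := if i \in A then thick i else 0.
have f0 i : 0 <= f i.
  rewrite /f /thick; case: ifP => // /uA[_ _ _ _ [? ?]]; case: ifP => _; exact: ltW.
rewrite /DV; set D1 := (X in X :|: _); set D2 := (X in _ :|: X).
have -> : \sum_(i in D1 :|: D2) thick i = \sum_(i in D1 :|: D2) f i.
  by apply: eq_bigr => i; rewrite /f !inE; case: (i \in A).
apply: le_trans (sum_setU_le _ _ f0) _.
rewrite natrD mulrDl; apply: lerD.
  have -> : \sum_(i in D1) f i = \sum_(i in D1) w i.
    by apply: eq_bigr => i; rewrite !inE /f /thick => /andP[-> /andP[/negPf-> _]].
  rewrite natrM -mulrA; apply: (@line_bound _ _ _ y h w) => // [i|t].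
    rewrite inE => /andP[Ai /andP[Vi _]]; have [? ? ? ? [? ?]] := uA Ai.
    by have [? _] := Vlong Ai Vi; split=> //; apply: ltW.
  pose B1 := [set i in D1 | (y i < t) && (t < y i + h i)].
  pose B := B1 :|: HS isH Q.
  have dl : delta + delta <= 1 / q%:R.
    rewrite ler_pdivlMr ?ltr0n //; apply: le_trans beta_q.
    by rewrite ler_pM2r ?ltr0n //; move: delta_beta; lra.
  have wd i : i \in HS isH Q -> 2 * delta < w i.
    rewrite inE => /andP[iQ Hi]; have [wq _] := Hlong (Qsub i iQ) Hi.
    have : 1 / q%:R < w i by rewrite ltr_pdivrMr ?ltr0n.
    by lra.
  have disB : [disjoint B1 & HS isH Q].
    rewrite -setI_eq0; apply/eqP/setP => i; rewrite !inE.
    by case: (isH i); rewrite ?andbF.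
  (* H items of [Q] are shortened by [delta] at both ends, which makes their projections disjoint
     from those of the V items in [DV]. The at most [q] H items lose [2 * delta] each. *)
  pose u i := if isH i then x i + delta else x i.
  pose l i := if isH i then w i - 2 * delta else w i.
  have sB : \sum_(i in B) l i <= 1 - (0 - 0).
    apply: (@sum_gap _ _ _ u) => //; rewrite /u /l.
    - move=> i; rewrite in_setU => /orP[]; rewrite inE.
        rewrite inE => /andP[/andP[Ai /andP[/negPf-> _]] _].
        by have [? ? ? ? [? ?]] := uA Ai.
      move=> /andP[iQ Hi]; rewrite Hi; have [? ? ? ? [? ?]] := uA (Qsub i iQ).
      have := wd i; rewrite inE iQ Hi => /(_ isT) ?.
      by split; move: delta0; lra.
    - have aux i j : i \in B1 -> j \in HS isH Q ->
         apart (fun i => if isH i then x i + delta else x i) (fun i => if isH i then w i - 2 * delta else w i) i j.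
        rewrite inE => /andP[+ _]; rewrite inE => /andP[Ai /andP[/negPf Vi /forall_inP al]] jQ.
        have := al j jQ; move: jQ; rewrite inE /apart Vi => /andP[jQ ->].
        by move=> /orP[?|?]; [left|right]; lra.
      move=> i j; rewrite !in_setU => /orP[iB|iB] /orP[jB|jB] ij.
      + move: iB jB; rewrite !inE => /andP[/andP[Ai /andP[/negPf Vi _]] /andP[i1 i2]].
        move=> /andP[/andP[Aj /andP[/negPf Vj _]] /andP[j1 j2]].
        rewrite /apart Vi Vj.
        have [?|h1] := leP (x i + w i) (x j); first by left.
        have [?|h2] := leP (x j + w j) (x i); first by right.
        exfalso; move/eqP: ij; apply; case: pkd => _; apply=> //; apply/andP; split=> //.
          by lra.
        by lra.
      + exact: aux.
      + by have [?|?] := aux j i jB iB; [right|left].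
      + move: iB jB; rewrite !inE => /andP[iQ Hi] /andP[jQ Hj].
        rewrite /apart Hi Hj; have := hchain_apart pkd hQ iQ jQ ij.
        by move: delta0 => d0 [?|?]; [left|right]; lra.
    - move=> i; rewrite in_setU => /orP[]; rewrite inE.
        rewrite inE => /andP[/andP[Ai /andP[/negPf-> _]] _].
        by right; have [? ? ? ? [? ?]] := uA Ai.
      move=> /andP[iQ Hi]; rewrite Hi; have [? ? ? ? [? ?]] := uA (Qsub i iQ).
      by right; move: delta0; lra.
  rewrite (eq_bigl [predU B1 & HS isH Q]) in sB; last by move=> i; rewrite !inE.
  rewrite bigU // /l /= in sB.
  have e1 : \sum_(i in B1) (if isH i then w i - 2 * delta else w i) = \sum_(i in B1) w i.
    by apply: eq_bigr => i; rewrite !inE; case: (isH i); rewrite ?andbF.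
  have e2 : \sum_(i in HS isH Q) (if isH i then w i - 2 * delta else w i) =
     \sum_(i in HS isH Q) w i - 2 * delta * #|HS isH Q|%:R.
    rewrite (eq_bigr (fun i => w i - 2 * delta)); last by move=> i; rewrite inE => /andP[_ ->].
    by rewrite sumrB sumr_const mulr_natr.
  have e3 : \sum_(i in D1 | (y i < t) && (t < y i + h i)) w i = \sum_(i in B1) w i.
    by apply: eq_bigl => i; rewrite [in RHS]inE.
  have cH : 2 * delta * #|HS isH Q|%:R <= 2 * beta * q%:R.
    apply: ler_pM; rewrite ?ler0n //; first by move: delta0; lra.
      by move: delta_beta; lra.
    by rewrite ler_nat; apply: (card_HS pkd Hlong hQ).
  move: sB; rewrite {}e1 {}e2 {}e3 subr0 subr0 => sB.
  by rewrite natrD natrM; lra.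
have -> : \sum_(i in D2) f i = \sum_(i in D2) h i.
  by apply: eq_bigr => i; rewrite !inE /f /thick => /andP[-> /andP[-> _]].
pose P z i := [&& i \in A, isH i, z - beta <= y i + h i & y i <= z + beta].
apply: (@le_trans _ _ (\sum_(i | has (fun z => P z i) Z) f i)).
  rewrite le_eqVlt; apply/orP; left; apply/eqP.
  rewrite [RHS](eq_bigl (fun i => i \in D2)); last first.
    move=> i; rewrite [in RHS]inE; apply/hasP/andP => [[z zZ /and4P[Ai Hi z1 z2]]|[Ai /andP[Hi /hasP[z zZ /andP[z1 z2]]]]].
      by rewrite Ai Hi; split=> //; apply/hasP; exists z => //; rewrite z1.
    by exists z; rewrite // /P Ai Hi z1.
  by apply: eq_bigr => i; rewrite !inE /f /thick => /andP[-> /andP[-> _]].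
apply: le_trans (sum_has_le _ _ f0) _.
apply: (@le_trans _ _ (\sum_(z <- Z) q%:R * (4 * beta))); last first.
  by rewrite big_const_seq count_predT iter_addr_0 -mulr_natr !natrM; lra.
apply: ler_sum => z _.
have -> : 4 * beta = (z + 2 * beta) - (z - 2 * beta) by lra.
have -> : \sum_(i | P z i) f i = \sum_(i in [set i | P z i]) h i.
  rewrite [RHS](eq_bigl (P z)); last by move=> i; rewrite inE.
  by apply: eq_bigr => i /and4P[Ai Hi _ _]; rewrite /f /thick Ai Hi.
apply: (@window_thickness _ _ _ x w y h) => //; first by move: delta0 delta_beta; lra.
  move=> i; rewrite inE => /and4P[Ai Hi z1 z2]; have [? ? ? ? [? ?]] := uA Ai.
  have [wq hd] := Hlong Ai Hi; split=> //; split; move: delta_beta; lra.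
move=> i j; rewrite !inE => /and4P[Ai _ _ _] /and4P[Aj _ _ _] ij h1 h2.
have [?|h3] := leP (y i + h i) (y j); first by left.
have [?|h4] := leP (y j + h j) (y i); first by right.
by exfalso; move/eqP: ij; apply; case: pkd => _; apply=> //; apply/andP.
Qed.

Definition hfar (Q Q' : seq T) := forall i j, i \in Q -> j \in Q' -> isH i -> isH j ->
  y i + h i + beta < y j \/ y j + h j + beta < y i.

Fixpoint farfam (F : seq (seq T)) : Prop :=
  if F is Q :: F' then [/\ hchain Q, (size Q <= Lsize)%N, (forall Q', Q' \in F' -> hfar Q Q') & farfam F']
  else True.

(** A chain far from the family stays far when it is shortened, so the family grows by chains of
    bounded length until it has [m] members or no far chain is left. *)
Lemma far_family m : (exists2 F, size F = m & farfam F) \/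
  (exists F, [/\ (size F < m)%N, farfam F &
     forall Q, hchain Q -> exists2 Q', Q' \in F & ~ hfar Q Q']).
Proof.
elim: m => [|m [[F sF fF]|[F [sF fF mx]]]]; first by left; exists [::].
  have [mx|nmx] := classic (forall Q, hchain Q -> exists2 Q', Q' \in F & ~ hfar Q Q').
    by right; exists F; split=> //; rewrite sF.
  have [Q nQ] := not_all_ex_not _ _ nmx.
  have [hQ nfar] := imply_to_and _ _ nQ.
  have [Q' [hQ' sub sQ']] := shorten hQ.
  left; exists (Q' :: F); first by rewrite /= sF.
  split=> // Q1 Q1F i j iQ jQ; apply: (_ : hfar Q Q1) => //; last exact: sub.
  by apply: NNPP => nf; apply: nfar; exists Q1.
by right; exists F; split=> //; apply: ltnW.
Qed.

Lemma farfam_mem F Q : farfam F -> Q \in F -> hchain Q /\ (size Q <= Lsize)%N.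
Proof.
elim: F => //= Q0 F IH [? ? _ fF]; rewrite inE => /orP[/eqP->//|]; exact: IH.
Qed.

Definition near (Q : seq T) i := [exists j in HS isH Q, (y i <= y j + h j + beta) && (y j <= y i + h i + beta)].
Definition DN (F : seq (seq T)) := [set i in A | isH i && has (near^~ i) F].

Lemma DN_thick F : farfam F -> \sum_(i in DN F) thick i <= (size F * (5 * q * q))%:R * beta.
Proof.
move=> fF.
pose f i := if i \in A then thick i else 0.
have f0 i : 0 <= f i.
  rewrite /f /thick; case: ifP => // /uA[_ _ _ _ [? ?]]; case: ifP => _; exact: ltW.
pose P Q i := [&& i \in A, isH i & near Q i].
have -> : \sum_(i in DN F) thick i = \sum_(i | has (fun Q => P Q i) F) f i.
  rewrite [RHS](eq_bigl (fun i => i \in DN F)); last first.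
    move=> i; rewrite inE; case Ai: (i \in A) => /=; last by apply/hasPn => Q _; rewrite /P Ai.
    case Hi: (isH i) => /=; last by apply/hasPn => Q _; rewrite /P Hi andbF.
    by apply: eq_has => Q; rewrite /P Ai Hi.
  by apply: eq_bigr => i; rewrite inE /f => /andP[-> _].
apply: le_trans (sum_has_le _ _ f0) _.
have step Q : Q \in F -> \sum_(i | P Q i) f i <= (5 * q * q)%:R * beta.
  move=> QF; have [hQ _] := farfam_mem fF QF; have [sub _ _] := hQ.
  pose P' j i := [&& i \in A, isH i & (y i <= y j + h j + beta) && (y j <= y i + h i + beta)].
  have -> : \sum_(i | P Q i) f i = \sum_(i | has (P'^~ i) (enum (HS isH Q))) f i.
    apply: eq_bigl => i; rewrite /P; apply/and3P/hasP => [[Ai Hi /exists_inP[j jQ jj]]|[j]].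
      by exists j; rewrite ?mem_enum // /P' Ai Hi.
    by rewrite mem_enum => jQ /and3P[Ai Hi jj]; split=> //; apply/exists_inP; exists j.
  apply: le_trans (sum_has_le _ _ f0) _.
  rewrite big_enum /=.
  apply: (@le_trans _ _ (\sum_(j in HS isH Q) q%:R * (5 * beta))); last first.
    have cq : #|HS isH Q|%:R <= q%:R :> R by rewrite ler_nat; apply: (card_HS pkd Hlong hQ).
    have b0 : 0 <= q%:R * (5 * beta) by apply: mulr_ge0; rewrite ?ler0n //; move: delta0 delta_beta; lra.
    rewrite sumr_const -mulr_natr !natrM; have := ler_wpM2l b0 cq; lra.
  apply: ler_sum => j; rewrite inE => /andP[jQ Hj]; have Aj := sub _ jQ.
  have [wj hj] := Hlong Aj Hj.
  apply: (@le_trans _ _ (q%:R * ((y j + h j + beta + delta) - (y j - beta - delta)))); last first.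
    by apply: ler_wpM2l; rewrite ?ler0n //; move: delta_beta; lra.
  have -> : \sum_(i | P' j i) f i = \sum_(i in [set i | P' j i]) h i.
    rewrite [RHS](eq_bigl (P' j)); last by move=> i; rewrite inE.
    by apply: eq_bigr => i /and3P[Ai Hi _]; rewrite /f /thick Ai Hi.
  have [? ? ? ? [? ?]] := uA Aj.
  apply: (@window_thickness _ _ _ x w y h) => //; first by move: delta0 delta_beta; lra.
    move=> i; rewrite inE => /and3P[Ai Hi /andP[z1 z2]]; have [? ? ? ? [? ?]] := uA Ai.
    by have [wq hd] := Hlong Ai Hi; split=> //; split; move: delta_beta; lra.
  move=> i k; rewrite !inE => /and3P[Ai _ _] /and3P[Ak _ _] ik h1 h2.
  have [?|h3] := leP (y i + h i) (y k); first by left.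
  have [?|h4] := leP (y k + h k) (y i); first by right.
  by exfalso; move/eqP: ik; apply; case: pkd => _; apply=> //; apply/andP.
apply: (@le_trans _ _ (\sum_(Q <- F) (5 * q * q)%:R * beta)).
  by rewrite big_seq [X in _ <= X]big_seq; apply: ler_sum => Q; apply: step.
by rewrite big_const_seq count_predT iter_addr_0 -mulr_natr [(size F * _)%:R]natrM; lra.
Qed.

End Dichotomy.

Section Dichotomy.
Variables (R : realType) (T : finType).
Variables (x w y h : T -> R) (A : {set T}) (isH : pred T) (q : nat) (beta delta : R).
Hypothesis pkd : packed x w y h A.
Hypothesis Hlong : forall i, i \in A -> isH i -> 1 < w i * q%:R /\ h i <= delta.
Hypothesis Vlong : forall i, i \in A -> ~~ isH i -> 1 < h i * q%:R /\ w i <= delta.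
Hypothesis q0 : (0 < q)%N.
Hypothesis delta0 : 0 < delta.
Hypothesis delta_beta : delta <= beta.
Hypothesis beta_q : 2 * beta * q%:R <= 1.

Local Notation hchain := (hchain x w y h A isH beta).
Local Notation vchain := (vchain x w y h A isH beta).
Local Notation thick := (thick w h isH).

Let uA i : i \in A -> in_unit x w y h i. Proof. by case: pkd => + _; apply. Qed.

Definition Kv := (q * (1 + 2 * q) + 4 * q * (Lsize q).+1)%N.

Definition vfree (S : seq T) t := forall v, v \in S -> ~~ isH v -> y v + h v <= t \/ t <= y v.

Lemma thick_ge0 i : i \in A -> 0 <= thick i.
Proof. by move=> /uA[_ _ _ _ [? ?]]; rewrite /thick; case: ifP => _; apply: ltW. Qed.

(** Each chain of the family supplies a V-free height inside one of its own H items, and farness of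
    the chains keeps these heights more than [beta] apart. *)
Lemma fam_DV F : farfam x w y h A isH q beta F ->
  exists D : {set T}, [/\ D \subset A, \sum_(i in D) thick i <= (size F * Kv)%:R * beta &
   forall S, vchain S -> (exists2 i, i \in S & i \in D) \/
     exists ts : seq R, [/\ size ts = size F, pairwise (fun t t' => beta < `|t - t'|) ts &
       forall t, t \in ts -> [/\ vfree S t, 0 <= t <= 1 &
         exists Q j, [/\ Q \in F, j \in Q, isH j & y j <= t <= y j + h j]]]].
Proof.
have b0 : 0 <= beta by move: delta0 delta_beta; lra.
elim: F => [_|Q F IH [hQ sQ farQ /IH[D [DA Dth Dch]]]].
  exists set0; split; [exact: sub0set|by rewrite big_set0 mul0n mul0r|].
  by move=> S vS; right; exists [::].
have [Qsub _ Qp] := hQ.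
case: Q hQ sQ farQ Qsub Qp => [|d r] hQ sQ farQ Qsub Qp.
  exfalso; move: Qp; rewrite big1; last by move=> i; rewrite inE.
  by have qR : 1 <= q%:R :> R; [rewrite ler1n | move: beta_q b0; nra].
have [Z sZ out] := cross_outcome pkd Vlong q0 delta0 delta_beta beta_q hQ.
have thZ := DV_thick pkd Hlong Vlong q0 delta0 delta_beta beta_q Z hQ.
set DQ := DV _ _ _ _ _ _ _ _ _ _ in out thZ.
have DQA : DQ \subset A.
  by apply/subsetP => i; rewrite !inE => /orP[/andP[]|/andP[]].
exists (DQ :|: D); split; first by rewrite subUset DQA DA.
  pose f i := if i \in A then thick i else 0.
  have f0 i : 0 <= f i by rewrite /f; case: ifP => // /thick_ge0.
  have fE (B : {set T}) : B \subset A -> \sum_(i in B) thick i = \sum_(i in B) f i.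
    by move=> BA; apply: eq_bigr => i /(subsetP BA); rewrite /f => ->.
  rewrite fE; last by rewrite subUset DQA DA.
  apply: le_trans (sum_setU_le _ _ f0) _; rewrite -!fE //= mulSn natrD mulrDl.
  apply: lerD Dth; apply: le_trans thZ _; apply: ler_wpM2r => //.
  by rewrite ler_nat /Kv leq_add2l leq_mul2l sZ ltnS sQ orbT.
move=> S vS; case: (Dch S vS) => [[i iS iD]|[ts [sts pts tsP]]].
  by left; exists i; rewrite // inE iD orbT.
case: (out S vS) => [[i iS iD]|[t [j [jQ Hj tj tf]]]].
  by left; exists i; rewrite // inE iD.
right; exists (t :: ts); split; first by rewrite /= sts.
  rewrite /= pts andbT; apply/allP => t' /tsP[_ _ [Q' [k [Q'F kQ' Hk tk]]]].
  move: tj tk => /andP[? ?] /andP[? ?].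
  by rewrite lter_normr; apply/orP; case: (farQ Q' Q'F j k jQ kQ' Hj Hk) => ?; [right|left]; lra.
move=> t'; rewrite inE => /orP[/eqP->|/tsP[? ? [Q' [k [Q'F kQ' Hk tk]]]]]; last first.
  by split=> //; exists Q', k; split=> //; rewrite inE Q'F orbT.
split=> //; last by exists (d :: r), j; rewrite inE eqxx.
by have [? ? ? ? _] := uA (Qsub j jQ); move: tj => /andP[? ?]; apply/andP; split; lra.
Qed.

(** Counting the V items below a V-free height takes at most [q.+1] values. Two heights with equal
    counts enclose no V item, so they lie in a common gap and are less than [beta] apart. *)
Lemma vfree_few S ts : vchain S -> pairwise (fun t t' => beta < `|t - t'|) ts ->
  (forall t, t \in ts -> vfree S t /\ 0 <= t <= 1) -> (size ts <= q.+1)%N.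
Proof.
move=> vS pts tsP; rewrite leqNgt; apply/negP => big.
pose B t := [set v in VS isH S | y v + h v <= t].
have : ~~ uniq [seq #|B t| | t <- ts].
  apply/negP => u; have : {subset [seq #|B t| | t <- ts] <= iota 0 q.+1}.
    move=> n /mapP[t _ ->]; rewrite mem_iota /= ltnS.
    apply: leq_trans (card_VS pkd Vlong vS); apply: subset_leq_card.
    by apply/subsetP => v; rewrite inE => /andP[].
  by move/(uniq_leq_size u); rewrite size_map size_iota leqNgt big.
case/(uniqPn 0%N) => i [j [ij]]; rewrite size_map => jn.
rewrite !(nth_map 0) //; last by apply: ltn_trans jn.
set t := nth 0 ts i; set t' := nth 0 ts j => e.
have Ht : t \in ts by apply: mem_nth; apply: ltn_trans jn.
have Ht' : t' \in ts by apply: mem_nth.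
have far : beta < `|t - t'|.
  by move/(pairwiseP 0): pts => /(_ i j); rewrite !inE => /(_ (ltn_trans ij jn) jn ij).
have gap s s' : s \in ts -> s' \in ts -> #|B s| = #|B s'| -> s <= s' -> s' - s < beta.
  move=> /tsP[fs /andP[s0 s1]] /tsP[fs' /andP[s0' s1']] ee ss'.
  apply: (vgap pkd vS) => // v vS' Vv; case: (fs' v vS' Vv) => h1; last by right.
  left; have BB : B s = B s'.
    apply/eqP; rewrite eqEcard ee leqnn andbT; apply/subsetP => u.
    by rewrite !inE => /andP[-> h2]; apply: le_trans ss'.
  have : v \in B s' by rewrite !inE vS' Vv.
  by rewrite -BB inE => /andP[].
have [tt|tt] := leP t t'.
  have := gap t t' Ht Ht' e tt; move: far; rewrite ler0_norm; last by lra.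
  by lra.
have := gap t' t Ht' Ht (esym e) (ltW tt); move: far; rewrite ger0_norm; last by lra.
by lra.
Qed.

Definition Kd := (q.+2 * Kv + q.+2 * (5 * q * q))%N.

(** With [q.+2] far chains, a V chain missing [D] would have one separated V-free height too many.
    With fewer in a maximal family, every H chain has an H item within [beta] of one of the family,
    and such an item lies in [DN]. [Kd] adds the constants of both cases. *)
Theorem dichotomy : exists D : {set T}, [/\ D \subset A, \sum_(i in D) thick i <= Kd%:R * beta &
   (forall S, vchain S -> exists2 i, i \in S & i \in D) \/
   (forall S, hchain S -> exists2 i, i \in S & i \in D)].
Proof.
have b0 : 0 <= beta by move: delta0 delta_beta; lra.
case: (far_family (beta := beta) pkd Hlong Vlong q0 delta0 delta_beta beta_q q.+2).
  move=> [F sF fF]; have [D [DA Dth Dch]] := fam_DV fF.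
  exists D; split=> //.
    by apply: le_trans Dth _; rewrite sF /Kd ler_wpM2r // ler_nat leq_addr.
  left=> S vS; case: (Dch S vS) => // -[ts [sts pts tsP]]; exfalso.
  have : (size ts <= q.+1)%N by apply: (vfree_few vS pts) => t /tsP[].
  by rewrite sts sF ltnn.
move=> [F [sF fF mx]]; exists (DN y h A isH beta F); split.
- by apply/subsetP => i; rewrite inE => /andP[].
- apply: le_trans (DN_thick pkd Hlong q0 delta0 delta_beta fF) _.
  by rewrite ler_wpM2r // ler_nat /Kd; apply: leq_trans (leq_addl _ _); rewrite leq_mul2r ltnW ?orbT.
right=> Q hQ; have [Q' Q'F nf] := mx Q hQ; apply: NNPP => nD; apply: nf => i j iQ jQ Hi Hj.
have [//|h1] := ltP (y i + h i + beta) (y j); first by left.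
have [//|h2] := ltP (y j + h j + beta) (y i); first by right.
exfalso; apply: nD; exists i => //; have [sub _ _] := hQ; rewrite inE sub // Hi /=.
apply/hasP; exists Q' => //; apply/exists_inP; exists j; first by rewrite inE jQ.
by rewrite h1 h2.
Qed.

End Dichotomy.

Lemma pigeon_sum E (f : 'I_E -> nat) P : (0 < E)%N -> (\sum_r f r <= P)%N ->
  exists r, (E * f r <= P)%N.
Proof.
move=> E0 sP; case: (pickP (fun r => E * f r <= P)%N) => [r ?|nr]; first by exists r.
exfalso; have : (\sum_(r < E) P.+1 <= \sum_(r < E) E * f r)%N.
  by apply: leq_sum => r _; rewrite ltnNge nr.
rewrite sum_nat_const card_ord -big_distrr /= leq_pmul2l // => h.
by have := leq_trans h sP; rewrite ltnn.
Qed.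

Lemma pigeon_chain E (a : nat -> nat) P : (0 < E)%N -> (forall j, a j.+1 <= a j)%N ->
  (a 0 <= P)%N -> exists2 j, (j < E)%N & (E * (a j - a j.+1) <= P)%N.
Proof.
move=> E0 dec aP; have [|r Hr] := @pigeon_sum E (fun j => a j - a j.+1)%N P E0; last by exists r.
suff : (\sum_(j < E) (a j - a j.+1) + a E <= a 0)%N.
  by move=> h; apply: leq_trans aP; apply: leq_trans h; apply: leq_addr.
elim: E {E0} => [|E IH]; first by rewrite big_ord0.
by rewrite big_ord_recr /= -addnA subnK.
Qed.

Section Generic.
Variables (R : realType) (T : finType).

Lemma cover_sum (B : {set T}) (u l : T -> R) a b : a <= b ->
  (forall i, i \in B -> 0 <= l i) ->
  (forall t, a <= t <= b -> exists2 i, i \in B & u i < t < u i + l i) ->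
  b - a <= \sum_(i in B) l i.
Proof.
have [n] := ubnP #|B|; elim: n B b => // n IH B b Bn ab l0 cov.
have [i Bi /andP[u1 u2]] := cov b ltac:(lra).
rewrite (big_setD1 i Bi) /=.
have l0' k : k \in B :\ i -> 0 <= l k by rewrite !inE => /andP[_ /l0].
have [h1|h1] := ltP (u i) a.
  by have h2 : 0 <= \sum_(k in B :\ i) l k by [apply: sumr_ge0]; lra.
suff : u i - a <= \sum_(k in B :\ i) l k by lra.
apply: IH => //; first by move: Bn; rewrite (cardsD1 i B) Bi ltnS.
move=> t /andP[t1 t2]; have [k Bk /andP[k1 k2]] := cov t ltac:(lra).
exists k; last by apply/andP.
by rewrite !inE Bk andbT; apply/eqP => ki; move: k1; rewrite ki; lra.
Qed.

Lemma chain_uniq (x w y h : T -> R) s : (forall i, i \in s -> 0 < h i) -> sorted (below x w y h) s ->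
  uniq s.
Proof.
elim: s => //= c s IH hp pth; apply/andP; split; last first.
  by apply: IH; [move=> i i1; apply: hp; rewrite inE i1 orbT | apply: path_sorted pth].
apply/negP => cs; have := path_below_le hp pth cs.
by have := hp c; rewrite inE eqxx => /(_ isT); lra.
Qed.

End Generic.

(** * Freeing a strip in the absence of nearly pure chains *)

Section Compress.
Variables (R : realType) (T : finType).
Variables (x w y h : T -> R) (A : {set T}) (isH : pred T) (p : T -> nat).
Variables (q E P : nat) (beta delta : R).
Hypothesis pkd : packed x w y h A.
Hypothesis Hlong : forall i, i \in A -> isH i -> 1 < w i * q%:R /\ h i <= delta.
Hypothesis Vlong : forall i, i \in A -> ~~ isH i -> 1 < h i * q%:R /\ w i <= delta.
Hypothesis q0 : (0 < q)%N.
Hypothesis E0 : (0 < E)%N.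
Hypothesis P0 : (0 < P)%N.
Hypothesis Pbig : 4 * q%:R < beta * P%:R.
Hypothesis delta0 : 0 < delta.
Let s : R := (E * P)%:R^-1.
Hypothesis delta_s : delta <= s / 2.
Hypothesis nopure : forall S, ~ vchain x w y h A isH beta S.

Let uA i : i \in A -> in_unit x w y h i. Proof. by case: pkd => + _; apply. Qed.

Let s0 : 0 < s. Proof. by rewrite invr_gt0 ltr0n muln_gt0 E0. Qed.

(* Dropping the H items whose bottom lies in one residue class of slabs of
   height [s] empties a slab in every period [E * s]. *)
Lemma slab_drop : exists (A2 : {set T}) (r : 'I_E), [/\ A2 \subset A,
   (E * \sum_(i in A :\: A2) p i <= \sum_(i in A) p i)%N &
   forall i k, i \in A2 -> isH i -> y i + h i <= (k * E + r)%:R * s + delta \/ (k * E + r).+1%:R * s <= y i].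
Proof.
pose c i : 'I_E := Ordinal (ltn_pmod (Num.truncn (y i / s)) E0).
have [|r Hr] := @pigeon_sum E (fun r => \sum_(i in A | isH i && (c i == r)) p i)%N (\sum_(i in A) p i)%N E0.
  rewrite (exchange_big_dep (mem A)) /=; last by move=> i j _ /andP[].
  apply: leq_sum => i Ai; rewrite (bigID (fun j => j == c i)) /= [X in (_ + X)%N]big1 ?addn0.
    apply: (@leq_trans (\sum_(j < E | j == c i) p i)%N); last by rewrite big_pred1_eq.
    rewrite [X in (X <= _)%N](eq_bigl (fun j => (j == c i) && isH i)).
      by case: (isH i); [under eq_bigl do rewrite andbT | rewrite big_pred0 // => j; rewrite andbF].
    by move=> j; rewrite Ai /= [c i == j]eq_sym; case: (j == c i); case: (isH i).
  by move=> j /andP[/and3P[_ _ /eqP->]]; rewrite eqxx.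
exists [set i in A | ~~ (isH i && (c i == r))], r; split.
- by apply/subsetP => i; rewrite inE => /andP[].
- rewrite (eq_bigl (fun i => (i \in A) && (isH i && (c i == r)))) // => i.
  by rewrite !inE; case: (i \in A); rewrite /= ?andbF ?negbK ?andbT.
- move=> i k; rewrite inE => /andP[Ai nc] Hi; move: nc; rewrite Hi /= => /eqP nc.
  have [_ hd] := Hlong Ai Hi; have [? ? y0 ? [? ?]] := uA Ai.
  have ys : 0 <= y i / s by apply: divr_ge0 => //; apply: ltW.
  have /andP[t1 t2] := truncn_itv ys; move: t1 t2; rewrite ler_pdivlMr // ltr_pdivrMr // => t1 t2.
  have [lt|ge] := ltnP (Num.truncn (y i / s)) (k * E + r).
    left; apply: lerD => //; apply: le_trans (ltW t2) _.
    by rewrite ler_pM2r // ler_nat.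
  right; apply: le_trans t1; rewrite ler_pM2r // ler_nat ltn_neqAle ge andbT.
  apply/eqP => e; apply: nc; apply: val_inj => /=.
  by rewrite -e modnMDl modn_small.
Qed.

(** If the chain leaves the emptied slab of some period free, it misses at least [s / 2]. Otherwise
    a V item meets the slab of every period; then few and long V items come close to every height,
    and the chain would be nearly pure. *)
Lemma chain_height (A2 : {set T}) (r : 'I_E) (S : seq T) : A2 \subset A ->
   (forall i k, i \in A2 -> isH i -> y i + h i <= (k * E + r)%:R * s + delta \/ (k * E + r).+1%:R * s <= y i) ->
   {subset S <= A2} -> sorted (below x w y h) S -> \sum_(i <- S) h i <= 1 - s / 2.
Proof.
move=> A2A slab sub srt.
have subA i : i \in S -> i \in A by move=> /sub/(subsetP A2A).
have hp i : i \in S -> 0 < h i by move=> /subA/uA[_ _ _ _ []].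
have ap := chain_apart hp srt.
have -> : \sum_(i <- S) h i = \sum_(i in [set i in S]) h i.
  rewrite [RHS](eq_bigl (fun i => i \in S)) ?big_uniq ?(chain_uniq hp srt) //.
  by move=> i; rewrite inE.
have PEs : P%:R * (E%:R * s) = 1.
  by rewrite mulrA -natrM mulnC divff // pnatr_eq0 -lt0n muln_gt0 E0.
have Es0 : 0 < E%:R * s by apply: mulr_gt0; rewrite ?ltr0n.
(* The emptied slab of period [k] without its lowest [delta], into which H items starting below may
   protrude. *)
pose lo k := (k * E + r)%:R * s + delta; pose hi k := (k * E + r).+1%:R * s.
have lohi k : lo k <= hi k - s / 2.
  by rewrite /lo /hi -[(_.+1)%:R]natr1 mulrDl mul1r; move: delta_s; lra.
have loE k : k%:R * (E%:R * s) <= lo k.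
  by rewrite /lo natrD natrM mulrDl mulrA; have := ltW s0; have := ler0n R r; move: delta0; nra.
have hiE k : hi k <= k.+1%:R * (E%:R * s).
  rewrite /hi mulrA -natrM ler_pM2r // ler_nat mulSn addnC -addSn addnC [(E + _)%N]addnC leq_add2l.
  exact: ltn_ord.
have Sset i : i \in [set i in S] -> i \in S by rewrite inE.
have bnd i : i \in [set i in S] -> [/\ 0 <= y i, y i + h i <= 1 & 0 < h i].
  by move=> /Sset/subA/uA[_ _ ? ? []].
have ap' i j : i \in [set i in S] -> j \in [set i in S] -> i != j -> apart y h i j.
  by move=> /Sset iS /Sset jS; apply: ap.
have [/existsP[k /forall_inP free]|nofree] :=
  boolP [exists k : 'I_P, [forall i in [set i in S], (y i + h i <= lo k) || (hi k <= y i)]].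
  apply: (@le_trans _ _ (1 - (hi k - lo k))); last by have := lohi k; lra.
  apply: (@sum_gap _ _ _ y) => //.
  - by apply: le_trans (loE k); apply: mulr_ge0; rewrite ?ler0n ?ltW.
  - by have := lohi k; have := s0; lra.
  - by apply: le_trans (hiE k) _; rewrite -[X in _ <= X]PEs ler_pM2r // ler_nat.
  - by move=> i /free/orP.
exfalso; apply: (nopure (S := S)); split=> //.
have meetV (k : 'I_P) : exists i, [/\ i \in VS isH S, lo k < y i + h i & y i < hi k].
  move: nofree; rewrite negb_exists => /forallP/(_ k); rewrite negb_forall => /existsP[i].
  rewrite negb_imply negb_or -!ltNge => /and3P[/Sset iS h1 h2]; exists i; split=> //.
  rewrite inE iS /=; apply/negP => Hi; case: (slab i k (sub i iS) Hi); rewrite -/(lo k) -/(hi k); lra.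
have cardV : (#|VS isH S| <= q)%N.
  apply: (@card_long _ _ _ h) => [i|]; first by rewrite inE => /andP[/subA Ai Vi]; case: (Vlong Ai Vi).
  have -> : 1 = 1 - (0 - 0) :> R by lra.
  apply: (@sum_gap _ _ _ y) => // [i|i j|i]; rewrite ?inE ?ler01 // => /andP[iS Vi].
  - by apply: bnd; rewrite inE.
  - by move=> /andP[jS _]; apply: ap.
  - by right; have [] := bnd i ltac:(by rewrite inE).
pose pi : R := E%:R * s.
have piE : pi * P%:R = 1 by rewrite mulrC.
have P0R : 0 < P%:R :> R by rewrite ltr0n.
(* Enlarged by two periods at both ends, the V items cover the unit interval, as every period
   contains a point near one of them. The enlargement costs [4 * pi] for each of at most [q] items,
   less than [beta] in total by [Pbig]. *)
have cov : 1 - 0 <= \sum_(i in VS isH S) (h i + 4 * pi).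
  apply: (@cover_sum _ _ _ (fun i => y i - 2 * pi)) => //.
    by move=> i; rewrite inE => /andP[iS _]; have [] := bnd i ltac:(by rewrite inE); rewrite /pi; lra.
  move=> t /andP[t0 t1].
  have [k [k1 k2]] : exists k : 'I_P, k%:R * pi <= t /\ t <= k.+1%:R * pi.
    have tp : 0 <= t / pi by apply: divr_ge0 => //; apply: ltW.
    have /andP[] := truncn_itv tp; rewrite ler_pdivlMr // ltr_pdivrMr // => a1 a2.
    have [lt|ge] := ltnP (Num.truncn (t / pi)) P.
      by exists (Ordinal lt) => /=; split=> //; apply: ltW.
    have lt : (P.-1 < P)%N by rewrite prednK.
    exists (Ordinal lt) => /=; rewrite prednK // -/pi PEs; split=> //.
    apply: le_trans a1; rewrite ler_pM2r // ler_nat; apply: leq_trans ge; exact: leq_pred.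
  have [i [iV i1 i2]] := meetV k; exists i => //.
  have := loE k; have := hiE k; rewrite -/pi -[(k.+1)%:R]natr1 mulrDl mul1r => b1 b2.
  move: k2; rewrite -[(k.+1)%:R]natr1 mulrDl mul1r => k2.
  by have := Es0; rewrite -/pi => pi0; apply/andP; split; lra.
rewrite big_split /= sumr_const -mulr_natr in cov.
have cq : 4 * pi * #|VS isH S|%:R <= 4 * pi * q%:R.
  by apply: ler_wpM2l; rewrite ?ler_nat // /pi; have := Es0; lra.
have pq : 4 * pi * q%:R < beta.
  have pi0 : 0 < pi := Es0.
  have := Pbig; rewrite -(ltr_pM2r pi0) -[beta * _ * _]mulrA [P%:R * pi]mulrC piE mulr1.
  by lra.
by lra.
Qed.

(** After compaction the top of an item is the total height of a chain ending with it, so the bound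
    on chains bounds the whole packing. *)
Lemma compress : exists (A2 : {set T}) (y' : T -> R), [/\ A2 \subset A,
   (E * \sum_(i in A :\: A2) p i <= \sum_(i in A) p i)%N,
   packed x w y' h A2 & forall i, i \in A2 -> y' i + h i <= 1 - s / 2].
Proof.
have [A2 [r [A2A pA2 slab]]] := slab_drop.
have uA2 i : i \in A2 -> in_unit x w y h i by move/(subsetP A2A)/uA.
have [|y' [y'1 y'2 y'3]] := @compaction _ _ x w y h A2.
  by move=> i /uA2[_ _ ? _ []].
have hp i : i \in A2 -> 0 < h i by move=> /uA2[_ _ _ _ []].
exists A2, y'.
have top i : i \in A2 -> y' i + h i <= 1 - s / 2.
  move=> A2i; have [t [t1 t2 ->]] := compaction_chain hp y'3 A2i.
  have sub : {subset i :: t <= A2} by move=> j; rewrite inE => /orP[/eqP->|/t1].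
  have -> : \sum_(j <- t) h j + h i = \sum_(j <- rev (i :: t)) h j.
    rewrite addrC -(big_cons _ _ _ _ xpredT) /=.
    by apply: perm_big; rewrite perm_sym perm_rev.
  apply: (chain_height A2A slab); first by move=> j; rewrite mem_rev; apply: sub.
  by rewrite rev_sorted.
split=> //; split=> [i A2i|i j A2i A2j xo yo].
  have [? ? ? ? [? ?]] := uA2 i A2i; have /andP[? ?] := y'1 i A2i.
  by split=> //; have := top i A2i; have := s0; lra.
case: pkd => _; apply=> //; [exact: (subsetP A2A)|exact: (subsetP A2A)|].
apply/andP; split; rewrite ltNge; apply/negP => le.
  by have := y'2 j i A2j A2i; rewrite /below xoverC xo le => /(_ isT); case/andP: yo; lra.
by have := y'2 i j A2i A2j; rewrite /below xo le => /(_ isT); case/andP: yo; lra.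
Qed.

End Compress.

Lemma packedC (R : realType) (T : finType) (x w y h : T -> R) A :
  packed x w y h A -> packed y h x w A.
Proof.
by move=> [u d]; split=> [i /u[? ? ? ? [? ?]]|i j Ai Aj h1 h2]; [split | apply: d].
Qed.

Lemma sum_nat_setU (T : finType) (p : T -> nat) (B C : {set T}) :
  (\sum_(i in B :|: C) p i <= \sum_(i in B) p i + \sum_(i in C) p i)%N.
Proof.
rewrite [X in (X <= _)%N](bigID (mem B)) /=; apply: leq_add.
  rewrite [X in (X <= _)%N](eq_bigl (fun i => i \in B)) // => i.
  by rewrite !inE; case: (i \in B); rewrite ?andbT ?andbF.
rewrite [X in (_ <= X)%N](bigID (mem B)) /= addnC; apply: leq_trans (leq_addr _ _).
by apply: eq_leq; apply: eq_bigl => i; rewrite !inE; case: (i \in B); rewrite ?andbF.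
Qed.

Lemma sum_nat_sub (T : finType) (p : T -> nat) (B C : {set T}) : B \subset C ->
  (\sum_(i in B) p i <= \sum_(i in C) p i)%N.
Proof.
move=> /subsetP BC; rewrite [X in (_ <= X)%N](bigID (mem B)) /=.
rewrite [X in (_ <= X + _)%N](eq_bigl (fun i => i \in B)) ?leq_addr // => i.
by case iB: (i \in B); rewrite ?andbF // BC.
Qed.

Lemma sum_nat_setD (T : finType) (p : T -> nat) (B C : {set T}) : B \subset C ->
  (\sum_(i in C) p i = \sum_(i in B) p i + \sum_(i in C :\: B) p i)%N.
Proof.
move=> BC; rewrite (big_setID B) /=; congr (_ + _)%N.
by apply: eq_bigl => i; rewrite (setIidPr BC).
Qed.

(** * The sequence of scales *)

Section Contraction.
Variables (R : realType) (E q : nat) (eta : R).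
Hypotheses (E0 : (0 < E)%N) (q0 : (0 < q)%N) (eta0 : 0 < eta).

(** Enough periods for the condition [4 * q < b * P] of the compression at purity [b]; [sg b] is
    then the freed height, half of a slab. *)
Definition Pn (b : R) := (Num.truncn (4 * q%:R / b)).+1.
Definition sg (b : R) : R := (E * Pn b)%:R^-1 / 2.
(** The three terms make the scales decrease, keep the item thickness below the height freed at
    coarser scales, and make [E] hitting sets of finer scales together at most [eta * sg b]
    thick. *)
Definition nxt (b : R) := Num.min b (Num.min (sg b) (eta * sg b / (E * Kd q).+1%:R)).
Definition bet (j : nat) : R := iter j nxt (2 * q%:R)^-1.

Lemma sg_gt0 b : 0 < sg b.
Proof. by rewrite /sg divr_gt0 // invr_gt0 ltr0n muln_gt0 E0. Qed.

Lemma sg_le1 b : sg b <= 1.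
Proof.
rewrite /sg ler_pdivrMr // mul1r; apply: (@le_trans _ _ 1); last by rewrite ler1n.
by rewrite invf_le1 ?ltr0n ?ler1n muln_gt0 E0.
Qed.

Lemma nxt_le b : [/\ nxt b <= b, nxt b <= sg b & (E * Kd q)%:R * nxt b <= eta * sg b].
Proof.
rewrite /nxt !ge_min !lexx !orbT; split=> //.
set m := Num.min _ _; have m0 : m <= eta * sg b / (E * Kd q).+1%:R.
  by rewrite /m !ge_min lexx !orbT.
have c0 : 0 < eta * sg b by rewrite mulr_gt0 ?sg_gt0.
apply: (@le_trans _ _ ((E * Kd q)%:R * (eta * sg b / (E * Kd q).+1%:R))).
  by rewrite ler_wpM2l ?ler0n.
rewrite mulrCA; apply: ler_piMr; first exact: ltW.
by rewrite ler_pdivrMr ?ltr0n // mul1r ler_nat.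
Qed.

Lemma bet_gt0 j : 0 < bet j.
Proof.
elim: j => [|j IH]; first by rewrite /bet /= invr_gt0 mulr_gt0 // ltr0n.
rewrite /bet iterS -/(bet j) /nxt !lt_min IH sg_gt0 /= divr_gt0 ?ltr0n //.
by rewrite mulr_gt0 // sg_gt0.
Qed.

Lemma bet_dec i j : (i <= j)%N -> bet j <= bet i.
Proof.
move=> /subnK <-; elim: (j - i)%N => // k IH.
by rewrite addSn /bet iterS; apply: le_trans IH; case: (nxt_le (iter (k + i) nxt (2 * q%:R)^-1)).
Qed.

(** If [D] meets all nearly pure V chains, the items outside [D] are compressed vertically; if it
    meets all nearly pure H chains, the same argument runs with the axes and the two kinds
    exchanged. *)
Lemma one_scale (T : finType) (x w y h : T -> R) (A : {set T}) (isH : pred T) (p : T -> nat) j :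
  packed x w y h A ->
  (forall i, i \in A -> isH i -> 1 < w i * q%:R /\ h i <= bet E) ->
  (forall i, i \in A -> ~~ isH i -> 1 < h i * q%:R /\ w i <= bet E) ->
  (j < E)%N ->
  exists D : {set T}, [/\ D \subset A, \sum_(i in D) thick w h isH i <= (Kd q)%:R * bet j &
    forall B : {set T}, B \subset A -> [disjoint B & D] ->
      exists A2 : {set T}, [/\ A2 \subset B,
        (E * \sum_(i in B :\: A2) p i <= \sum_(i in B) p i)%N &
        (exists2 y', packed x w y' h A2 & forall i, i \in A2 -> y' i + h i <= 1 - sg (bet j)) \/
        (exists2 x', packed x' w y h A2 & forall i, i \in A2 -> x' i + w i <= 1 - sg (bet j))]].
Proof.
move=> pkd HH VV jE.
have bE := bet_gt0 E; have bj := bet_gt0 j; have bEj : bet E <= bet j by apply/bet_dec/ltnW.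
have [bs1 bs2 _] := nxt_le (bet j).
have bEs : bet E <= sg (bet j) by apply: le_trans bs2; rewrite -[nxt _]/(bet j.+1); apply: bet_dec.
have q1 : 0 < q%:R :> R by rewrite ltr0n.
have bq : 2 * bet j * q%:R <= 1.
  have := bet_dec (leq0n j); rewrite {2}/bet /= -(ler_pM2r (_ : 0 < 2 * q%:R)); last by lra.
  by rewrite mulVf; [lra | apply: lt0r_neq0; lra].
have Pb : 4 * q%:R < bet j * (Pn (bet j))%:R.
  by rewrite [bet j * _]mulrC -ltr_pdivrMr // /Pn truncnS_gt.
have [D [DA Dth Dch]] := dichotomy pkd HH VV q0 bE bEj bq.
exists D; split=> // B BA BD.
have subA i : i \in B -> i \in A := subsetP BA i.
have hit (S : seq T) : {subset S <= B} -> (exists2 i, i \in S & i \in D) -> False.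
  by move=> sub [i /sub iB iD]; move/pred0P: BD => /(_ i) /=; rewrite iB iD.
have pB : packed x w y h B.
  by case: pkd => u d; split=> [i /subA/u|i k /subA Ai /subA Ak]; [|apply: d].
case: Dch => Dch.
  have [|||S|A2 [y' [A2B pA2 pk top]]] := @compress R T x w y h B isH p q E (Pn (bet j)) (bet j) (bet E) pB _ _ E0 isT Pb bE _ _.
  - by move=> i /subA; apply: HH.
  - by move=> i /subA; apply: VV.
  - exact: bEs.
  - move=> [sub srt pur]; apply: (hit S sub); apply: Dch; split=> // i /sub; exact: subA.
  by exists A2; split=> //; left; exists y'.
have [|||S|A2 [x' [A2B pA2 pk top]]] := @compress R T y h x w B (predC isH) p q E (Pn (bet j)) (bet j) (bet E) (packedC pB) _ _ E0 isT Pb bE _ _.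
- by move=> i /subA; apply: VV.
- by move=> i /subA Ai; rewrite /= negbK; apply: HH.
- exact: bEs.
- move=> [sub srt pur]; apply: (hit S sub); apply: Dch; split=> //; first by move=> i /sub; exact: subA.
  rewrite (eq_bigl (fun i => i \in VS (predC isH) S)) // => i.
  by rewrite !inE /= negbK.
by exists A2; split=> //; right; exists x' => //; apply: packedC.
Qed.

(* The scale is chosen so that the items hitting chains at this scale but at no
   finer scale carry little profit; the finer ones are thin compared to the
   height freed at this scale. *)
Theorem contraction (T : finType) (x w y h : T -> R) (A : {set T}) (isH : pred T) (p : T -> nat) :
  packed x w y h A ->
  (forall i, i \in A -> isH i -> 1 < w i * q%:R /\ h i <= bet E) ->
  (forall i, i \in A -> ~~ isH i -> 1 < h i * q%:R /\ w i <= bet E) ->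
  exists (A2 U : {set T}) (s : R), [/\ [/\ A2 \subset A, U \subset A, [disjoint A2 & U] &
      (E * \sum_(i in A :\: (A2 :|: U)) p i <= 2 * \sum_(i in A) p i)%N],
    bet E <= s <= 1, \sum_(i in U) thick w h isH i <= eta * s &
    (exists2 y', packed x w y' h A2 & forall i, i \in A2 -> y' i + h i <= 1 - s) \/
    (exists2 x', packed x' w y h A2 & forall i, i \in A2 -> x' i + w i <= 1 - s)].
Proof.
move=> pkd HH VV.
have uA i : i \in A -> 0 <= thick w h isH i := thick_ge0 isH pkd (i := i).
have /fin_all_exists[D DP] (j : 'I_E) := one_scale p pkd HH VV (ltn_ord j).
(* [U j] unites the hitting sets of scale [j] and finer. For the chosen [j] the items outside [U j]
   are compressed, the cheap layer between [U j] and [U j.+1] is dropped, and [U j.+1] is the thin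
   remainder returned as [U]. *)
pose U j : {set T} := \bigcup_(k < E | (j <= k)%N) D k.
have UA j : U j \subset A by apply/bigcupsP => k _; have [] := DP k.
have Udec j : U j.+1 \subset U j.
  by apply/bigcupsP => k jk; apply: bigcup_sup; apply: ltnW.
pose a j := \sum_(i in U j) p i.
have [||j jE Hj] := @pigeon_chain E a (\sum_(i in A) p i)%N E0.
- by move=> j; apply: sum_nat_sub (Udec j).
- exact: sum_nat_sub (UA 0%N).
have aE : (a j - a j.+1 = \sum_(i in U j :\: U j.+1) p i)%N.
  by rewrite /a (sum_nat_setD p (Udec j)) addKn.
have [DA Dth DB] := DP (Ordinal jE).
have [||A2 [A2B pA2 out]] := DB (A :\: U j); first by apply: subsetDl.
  rewrite disjoint_sym disjoints_subset; apply/subsetP => i iD; rewrite !inE negb_and negbK.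
  by apply/orP; left; apply/bigcupP; exists (Ordinal jE) => /=.
have A2A : A2 \subset A by apply: subset_trans A2B (subsetDl _ _).
have [bs1 bs2 bs3] := nxt_le (bet j).
exists A2, (U j.+1), (sg (bet j)); split; last exact: out.
- split=> //.
    rewrite disjoints_subset; apply: subset_trans A2B _; apply/subsetP => i.
    by rewrite !inE => /andP[iU _]; apply: contra iU; apply: subsetP.
  apply: (@leq_trans (E * (\sum_(i in (A :\: U j) :\: A2) p i + \sum_(i in U j :\: U j.+1) p i))).
    rewrite leq_mul2l; apply/orP; right; apply: leq_trans (sum_nat_setU _ _ _).
    apply: sum_nat_sub; apply/subsetP => i; rewrite !inE negb_or => /andP[/andP[-> ->] ->].
    by case: (i \in U j).
  rewrite mulnDr mul2n -addnn; apply: leq_add; last by rewrite -aE.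
  by apply: leq_trans pA2 _; apply: sum_nat_sub; apply: subsetDl.
- apply/andP; split; first by apply: le_trans bs2; rewrite -[nxt _]/(bet j.+1); apply: bet_dec.
  exact: sg_le1.
- pose f i := if i \in A then thick w h isH i else 0.
  have f0 i : 0 <= f i by rewrite /f; case: ifP => // /uA.
  have fE (B : {set T}) : B \subset A -> \sum_(i in B) thick w h isH i = \sum_(i in B) f i.
    by move=> BA; apply: eq_bigr => i /(subsetP BA); rewrite /f => ->.
  rewrite fE //; apply: le_trans bs3.
  rewrite (eq_bigl (fun i => has (fun k : 'I_E => (j < k)%N && (i \in D k)) (enum 'I_E))); last first.
    move=> i; apply/bigcupP/hasP => [[k jk iD]|[k _ /andP[jk iD]]]; last by exists k.
    by exists k; rewrite ?mem_enum // jk.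
  apply: le_trans (sum_has_le _ _ f0) _.
  rewrite big_enum /= natrM -mulrA -[E in X in _ <= X](card_ord E) -sumr_const mulr_suml.
  apply: ler_sum => k _; rewrite mul1r.
  have [jk|_] /= := boolP (j < k)%N; last first.
    rewrite big_pred0 // mulr_ge0 ?ler0n //; exact: ltW (bet_gt0 j.+1).
  have [DkA Dkth _] := DP k; rewrite -fE //; apply: le_trans Dkth _.
  by rewrite ler_wpM2l ?ler0n // -[nxt _]/(bet j.+1); apply: bet_dec.
Qed.

End Contraction.

(** * Maximal runs of a boolean sequence *)

Section Runs.
Variables (c : nat -> bool) (n : nat).

Definition isrun lo hi := [&& (lo < hi <= n)%N, all c (iota lo (hi - lo)),
  (lo == 0%N) || ~~ c lo.-1 & (hi == n) || ~~ c hi].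

Lemma isrunP lo hi : isrun lo hi -> [/\ (lo < hi <= n)%N, forall i, (lo <= i < hi)%N -> c i,
  (0 < lo)%N -> ~~ c lo.-1 & (hi < n)%N -> ~~ c hi].
Proof.
move=> /and4P[b /allP al l h]; split=> //.
- move=> i /andP[i1 i2]; apply: al; rewrite mem_iota i1 subnKC //.
  by apply: ltnW; case/andP: b.
- by move=> l0; move: l; rewrite eqn0Ngt l0.
- by move=> hn; move: h; rewrite (ltn_eqF hn).
Qed.

Lemma isrun_disj lo hi lo' hi' : isrun lo hi -> isrun lo' hi' -> (lo, hi) <> (lo', hi') ->
  (hi <= lo')%N \/ (hi' <= lo)%N.
Proof.
move=> /isrunP[b1 c1 l1 h1] /isrunP[b2 c2 l2 h2] ne.
have [?|h3] := leqP hi lo'; first by left.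
have [?|h4] := leqP hi' lo; first by right.
exfalso; apply: ne; congr pair.
  have [lt|gt|//] := ltngtP lo lo'.
    by have /negP := l2 (leq_ltn_trans (leq0n _) lt); case; apply: c1; lia.
  by have /negP := l1 (leq_ltn_trans (leq0n _) gt); case; apply: c2; lia.
have [lt|gt|//] := ltngtP hi hi'.
  by have /negP := h1 ltac:(lia); case; apply: c2; lia.
by have /negP := h2 ltac:(lia); case; apply: c1; lia.
Qed.

Lemma run_exists i1 i2 : (i1 < i2 <= n)%N -> (forall i, (i1 <= i < i2)%N -> c i) ->
  exists lo hi, [/\ isrun lo hi, (lo <= i1)%N & (i2 <= hi)%N].
Proof.
move=> b ci.
pose P lo := (lo <= i1)%N && all c (iota lo (i1 - lo)).
have exP : exists lo, P lo by exists i1; rewrite /P leqnn subnn.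
case: (ex_minnP exP) => lo /andP[lo1 /allP lo2] min.
pose Q hi := [&& (i2 <= hi)%N, (hi <= n)%N & all c (iota i2 (hi - i2))].
have exQ : exists hi, Q hi by exists i2; rewrite /Q leqnn subnn andbT; case/andP: b.
have Qn hi : Q hi -> (hi <= n)%N by case/and3P.
case: (ex_maxnP exQ Qn) => hi /and3P[hi1 hi2 /allP hi3] max.
exists lo, hi; split=> //.
have cc i : (lo <= i < hi)%N -> c i.
  move=> /andP[k1 k2]; have [k3|k3] := ltnP i i1.
    by apply: lo2; rewrite mem_iota k1 subnKC.
  have [k4|k4] := ltnP i i2; first by apply: ci; rewrite k3.
  by apply: hi3; rewrite mem_iota k4 subnKC.
apply/and4P; split; first by lia.
- by apply/allP => i; rewrite mem_iota => ?; apply: cc; lia.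
- case: lo lo1 lo2 min cc => // lo lo1 lo2 min cc; rewrite /= ; apply/negP => cl.
  suff : P lo by move/min; rewrite ltnn.
  rewrite /P (ltnW lo1) /=.
  apply/allP => i; rewrite mem_iota => /andP[i3 i4]; have [->//|ne] := eqVneq i lo.
  by apply: lo2; rewrite mem_iota; lia.
- have [//|hn] := eqVneq hi n; rewrite /=; apply/negP => ch.
  suff : Q hi.+1 by move/max; rewrite ltnn.
  rewrite /Q; apply/and3P; split; [lia|lia|].
  apply/allP => i; rewrite mem_iota => /andP[i3 i4]; have [->//|ne] := eqVneq i hi.
  by apply: cc; lia.
Qed.

End Runs.

Section Grid.
Variable R : realType.

Lemma sorted_grid (X : seq R) : 0 \in X -> 1 \in X -> (forall t, t \in X -> 0 <= t <= 1) ->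
  exists (n : nat) (e : nat -> R), [/\ (n < size X)%N, e 0%N = 0, e n = 1,
    forall i j, (i < j <= n)%N -> e i < e j &
    forall t, t \in X <-> exists2 i, (i <= n)%N & t = e i].
Proof.
move=> X0 X1 bX; pose s := sort <=%R (undup X); pose e i := nth 0 s i.
have ms t : (t \in s) = (t \in X) by rewrite mem_sort mem_undup.
have lts : sorted <%R s by rewrite lt_sorted_uniq_le sort_uniq undup_uniq sort_le_sorted.
have s0 : (0 < size s)%N by case: (s) (ms 0) => //; rewrite X0 in_nil.
have lt i j : (i < j < size s)%N -> e i < e j.
  move=> /andP[ij js]; rewrite /e; apply: (sorted_ltn_nth lt_trans) => //.
  by rewrite inE; apply: ltn_trans js.
have es i : (i < size s)%N -> 0 <= e i <= 1 by move=> i1; apply: bX; rewrite -ms mem_nth.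
have exi t : t \in X -> exists2 i, (i <= (size s).-1)%N & t = e i.
  by rewrite -ms => /(nthP 0)[i i1 <-]; exists i => //; rewrite -ltnS prednK.
exists (size s).-1, e; split.
- by rewrite prednK // size_sort size_undup.
- have [i i1 e0] := exi 0 X0; have [i00|i0] := posnP i; first by rewrite -i00 -e0.
  have := lt 0%N i; rewrite i0 -e0 -ltnS prednK // in i1 *; rewrite i1 => /(_ isT).
  by have /andP[] := es 0%N s0; lra.
- have [i i1 e1] := exi 1 X1; have [ii|ne] := eqVneq i (size s).-1; first by rewrite -ii -e1.
  have ii : (i < (size s).-1 < size s)%N by rewrite ltn_neqAle ne i1 prednK /=.
  have := lt _ _ ii; rewrite -e1; have /andP[_] := es (size s).-1 ltac:(by rewrite prednK).
  by lra.
- by move=> i j /andP[ij js]; apply: lt; rewrite ij /= -(prednK s0) ltnS.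
- move=> t; split=> [/exi//|[i i1 ->]].
  by rewrite -ms mem_nth // -(prednK s0) ltnS.
Qed.

Lemma strip_exists (n : nat) (e : nat -> R) x w : e 0%N = 0 -> e n = 1 ->
  0 <= x -> x + w <= 1 -> 0 < w ->
  (forall i, (i <= n)%N -> e i <= x \/ x + w <= e i) ->
  exists2 a, (a < n)%N & e a <= x /\ x + w <= e a.+1.
Proof.
move=> e0 en x0 x1 w0 no.
pose P a := (a <= n)%N && (e a <= x).
have exP : exists a, P a by exists 0%N; rewrite /P e0 x0.
have Pn a : P a -> (a <= n)%N by case/andP.
case: (ex_maxnP exP Pn) => a /andP[an ax] max.
have an' : (a < n)%N.
  by rewrite ltn_neqAle an andbT; apply/eqP => aa; move: ax; rewrite aa en; lra.
exists a => //; split=> //; case: (no a.+1 an') => // h.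
by have := max a.+1; rewrite /P an' h ltnn => /(_ isT).
Qed.

End Grid.

(** * Separating H items from V items by boxes *)

Section Boxes.
Variables (R : realType) (T : finType).
Variables (x w y h : T -> R) (A : {set T}) (isH : pred T).
Variables (q M : nat) (delta s : R).
Hypothesis pkd : packed x w y h A.
Hypothesis Hlong : forall i, i \in A -> isH i -> 1 < w i * q%:R /\ h i <= delta.
Hypothesis Vlong : forall i, i \in A -> ~~ isH i -> 1 < h i * q%:R /\ w i <= delta.
Hypothesis top : forall i, i \in A -> y i + h i <= 1 - s.
Hypothesis q0 : (0 < q)%N.
Hypothesis s0 : 0 < s.
Hypothesis s1 : s <= 1.
Hypothesis Ms : 4 * q%:R <= s * M%:R.
Hypothesis delta0 : 0 <= delta.

Let uA i : i \in A -> in_unit x w y h i. Proof. by case: pkd => + _; apply. Qed.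
Let qR : 1 <= q%:R :> R. Proof. by rewrite ler1n. Qed.
Let M0 : 0 < M%:R :> R.
Proof. by rewrite lt_neqAle ler0n andbT; apply/eqP => e; move: Ms; rewrite -e; have := qR; lra. Qed.

(** The stretch turns half of the freed height into slack: the top stays below [1 - s / 2], and a V
    item, longer than [1/q], gains more than two slabs of height [1/M] by [Ms]. *)
Let y1 i := (1 + s / 2) * y i.
Let h1 i := (1 + s / 2) * h i.

Let y1h1 i : i \in A -> [/\ 0 <= y1 i, y1 i + h1 i <= 1 - s / 2, h i <= h1 i & y1 i + h i <= 1 - s / 2].
Proof.
move=> Ai; have [? ? ? ? [? ?]] := uA Ai; have := top Ai; have := s0; have := s1.
by rewrite /y1 /h1 => ? ? ?; split; nra.
Qed.

Let dis1 i j : i \in A -> j \in A -> xover x w i j -> xover y1 h1 i j -> i = j.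
Proof.
move=> Ai Aj xo yo; case: pkd => _; apply=> //.
have c0 : 0 < 1 + s / 2 by have := s0; lra.
by move: yo; rewrite /xover /y1 /h1 -!mulrDr !ltr_pM2l.
Qed.

Let tr (t : R) := Num.truncn t.
(** The stretched V item spans all slabs from [r1 i] up to but excluding [r2 i]. Rounding inwards
    costs at most one slab at each end, so the original height still fits. *)
Let r1 i := (tr (y1 i * M%:R)).+1.
Let r2 i := tr ((y1 i + h1 i) * M%:R).

Let r12 i : i \in A -> ~~ isH i ->
  [/\ y1 i * M%:R <= (r1 i)%:R, (r2 i)%:R <= (y1 i + h1 i) * M%:R &
      h i * M%:R <= (r2 i)%:R - (r1 i)%:R].
Proof.
move=> Ai Vi; have [a b c d] := y1h1 Ai; have [hq _] := Vlong Ai Vi; have [_ _ _ _ [_ h0]] := uA Ai.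
have t1 : 0 <= y1 i * M%:R by apply: mulr_ge0 => //; apply: ltW.
have t2 : 0 <= (y1 i + h1 i) * M%:R by apply: mulr_ge0; [lra | apply: ltW].
have /andP[a1 a2] := truncn_itv t1; have /andP[b1 b2] := truncn_itv t2.
split; [exact: ltW | by [] |].
have e : (r1 i)%:R = (Num.truncn (y1 i * M%:R))%:R + 1 :> R by rewrite /r1 -natr1.
have e2 : (Num.truncn ((y1 i + h1 i) * M%:R)).+1%:R = (r2 i)%:R + 1 :> R by rewrite -natr1.
suff : 2 <= s / 2 * h i * M%:R by rewrite e2 in b2; rewrite e; move: b2; rewrite /h1; lra.
have : 4 * q%:R * h i <= s * M%:R * h i by rewrite ler_pM2r.
by move: hq; lra.
Qed.

Let y2 i := if isH i then y1 i else (r1 i)%:R / M%:R.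

Let occ r i := [&& i \in A, ~~ isH i & (r1 i <= r < r2 i)%N].
Let ln (k : nat) : R := k%:R / q%:R.
(** Together with [rf], the largest interval around the line [k/q] that is free of V items in slab
    [r]. An H item inside the slab contains such a line, hence lies in one of these boundedly many
    intervals; their ends form [X]. *)
Let lf r k := \big[Num.max/0]_(i | occ r i && (x i + w i <= ln k)) (x i + w i).
Let rf r k := \big[Num.min/1]_(i | occ r i && (ln k <= x i)) x i.
Let valid r k := [forall i, occ r i ==> ~~ ((x i < ln k) && (ln k < x i + w i))].
Let X := 0 :: 1 :: [seq lf r k | r <- iota 0 M, k <- iota 0 q] ++ [seq rf r k | r <- iota 0 M, k <- iota 0 q].

Let lf_bnd r k : 0 <= lf r k <= 1.
Proof.
rewrite /lf bigmax_ge_id /=.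
by apply: bigmax_le => // i /andP[/andP[Ai _] _]; have [] := uA Ai.
Qed.

Let rf_bnd r k : 0 <= rf r k <= 1.
Proof.
rewrite /rf bigmin_le_id andbT.
by apply: le_bigmin => // i /andP[/andP[Ai _] _]; have [] := uA Ai.
Qed.

Let inX r k : (r < M)%N -> (k < q)%N -> lf r k \in X /\ rf r k \in X.
Proof.
move=> rM kq; rewrite !inE !mem_cat; split; apply/or3P; apply: Or33; apply/orP; [left|right];
by apply/allpairsP; exists (r, k); rewrite /= !mem_iota.
Qed.

Let bX t : t \in X -> 0 <= t <= 1.
Proof.
rewrite !inE mem_cat => /or3P[/eqP->|/eqP->|/orP[|]]; rewrite ?lexx ?ler01 //.
  by case/allpairsP => -[r k] /= [_ _ ->].
by case/allpairsP => -[r k] /= [_ _ ->].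
Qed.

Definition NX := (2 + (M * q + M * q))%N.

Let sizeX : size X = NX.
Proof. by rewrite /X /= size_cat !size_allpairs !size_iota. Qed.

(** Kept are the H items contained in a single slab and the V items not cut by a vertical line of
    [X]. Each of these boundedly many lines cuts at most [q] items. *)
Let A3 := [set i in A | if isH i then (y1 i + h i) * M%:R <= (tr (y1 i * M%:R)).+1%:R
                        else all (fun t => (t <= x i) || (x i + w i <= t)) X].

Let dropped : \sum_(i in A :\: A3) thick w h isH i <= ((M + NX) * q)%:R * delta.
Proof.
pose f i := if i \in A then thick w h isH i else 0.
have f0 i : 0 <= f i by rewrite /f; case: ifP => // /(thick_ge0 isH pkd).
pose P1 (m : 'I_M) i := [&& i \in A, isH i, y1 i < m%:R / M%:R & m%:R / M%:R < y1 i + h i].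
pose P2 t i := [&& i \in A, ~~ isH i, x i < t & t < x i + w i].
have -> : \sum_(i in A :\: A3) thick w h isH i = \sum_(i in A :\: A3) f i.
  by apply: eq_bigr => i; rewrite inE /f => /andP[_ ->].
have sub : A :\: A3 \subset [set i | has (P1^~ i) (enum 'I_M)] :|: [set i | has (P2^~ i) X].
  apply/subsetP => i /setDP[Ai nA3]; rewrite in_setU [i \in finset _]inE [i \in finset _ in X in _ || X]inE.
  move: nA3; rewrite inE Ai andTb; case: (ifP) => Hi; last first.
    move=> /allPn[t tX]; rewrite negb_or -!ltNge => /andP[t1 t2].
    by apply/orP; right; apply/hasP; exists t; rewrite // /P2 Ai Hi t1.
  rewrite -ltNge => hm; apply/orP; left; apply/hasP.
  have [a b c d] := y1h1 Ai.
  have t1 : 0 <= y1 i * M%:R by apply: mulr_ge0 => //; apply: ltW.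
  have /andP[a1 a2] := truncn_itv t1.
  have mM : ((tr (y1 i * M%:R)).+1 < M)%N.
    rewrite -(ltr_nat R); apply: lt_le_trans hm _; rewrite -[X in _ <= X]mul1r ler_pM2r //.
    by have := s0; lra.
  exists (Ordinal mM); first by rewrite mem_enum.
  by rewrite /P1 Ai Hi /= ltr_pdivlMr // ltr_pdivrMr // a2.
have le1 : \sum_(i in A :\: A3) f i <=
    \sum_(i in [set i | has (P1^~ i) (enum 'I_M)] :|: [set i | has (P2^~ i) X]) f i.
  rewrite [X in _ <= X](bigID (mem (A :\: A3))) /=.
  rewrite [X in _ <= X + _](eq_bigl (fun i => i \in A :\: A3)).
    by rewrite lerDl; apply: sumr_ge0.
  by move=> i; case iA: (i \in A :\: A3); rewrite ?andbF ?andbT //; exact: (subsetP sub).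
apply: le_trans le1 _; apply: le_trans (sum_setU_le _ _ f0) _.
rewrite mulnDl natrD mulrDl; apply: lerD.
  rewrite [X in X <= _](eq_bigl (fun i => has (P1^~ i) (enum 'I_M))); last by move=> i; rewrite inE.
  apply: le_trans (sum_has_le _ _ f0) _; rewrite big_enum /=.
  rewrite natrM -mulrA -[M in X in _ <= X](card_ord M) -sumr_const mulr_suml.
  apply: ler_sum => m _; rewrite mul1r.
  have cq : (#|[set i | P1 m i]| <= q)%N.
    apply: (@card_long _ _ _ w) => [i|]; first by rewrite inE => /and4P[Ai Hi _ _]; case: (Hlong Ai Hi).
    rewrite -[X in _ <= X]subr0; apply: (@sum_disjoint_intervals _ _ _ x) => // [i|i j].
      by rewrite inE => /and4P[Ai _ _ _]; have [? ? ? ? [? ?]] := uA Ai.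
    rewrite !inE => /and4P[Ai _ i1 i2] /and4P[Aj _ j1 j2] ij.
    have [?|k1] := leP (x i + w i) (x j); first by left.
    have [?|k2] := leP (x j + w j) (x i); first by right.
    exfalso; move/eqP: ij; apply; apply: dis1 => //; apply/andP; split=> //.
      by have [_ _ ? _] := y1h1 Aj; lra.
    by have [_ _ ? _] := y1h1 Ai; lra.
  apply: (@le_trans _ _ (\sum_(i in [set i | P1 m i]) delta)).
    rewrite [X in X <= _](eq_bigl (fun i => i \in [set i | P1 m i])); last by move=> i; rewrite inE.
    apply: ler_sum => i; rewrite inE => /and4P[Ai Hi _ _]; rewrite /f /thick Ai Hi.
    by case: (Hlong Ai Hi).
  by rewrite sumr_const -[X in X <= _]mulr_natl ler_wpM2r // ler_nat.
rewrite [X in X <= _](eq_bigl (fun i => has (P2^~ i) X)); last by move=> i; rewrite inE.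
apply: le_trans (sum_has_le _ _ f0) _.
apply: (@le_trans _ _ (\sum_(t <- X) q%:R * delta)); last first.
  by rewrite big_const_seq count_predT iter_addr_0 -mulr_natr natrM sizeX; lra.
apply: ler_sum => t _.
have cq : (#|[set i | P2 t i]| <= q)%N.
  apply: (@card_long _ _ _ h) => [i|]; first by rewrite inE => /and4P[Ai Hi _ _]; case: (Vlong Ai Hi).
  rewrite -[X in _ <= X]subr0; apply: (@sum_disjoint_intervals _ _ _ y) => // [i|i j].
    by rewrite inE => /and4P[Ai _ _ _]; have [? ? ? ? [? ?]] := uA Ai.
  rewrite !inE => /and4P[Ai _ i1 i2] /and4P[Aj _ j1 j2] ij.
  have [?|k1] := leP (y i + h i) (y j); first by left.
  have [?|k2] := leP (y j + h j) (y i); first by right.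
  by exfalso; move/eqP: ij; apply; case: pkd => _; apply=> //; apply/andP; split=> //; lra.
apply: (@le_trans _ _ (\sum_(i in [set i | P2 t i]) delta)).
  rewrite [X in X <= _](eq_bigl (fun i => i \in [set i | P2 t i])); last by move=> i; rewrite inE.
  apply: ler_sum => i; rewrite inE => /and4P[Ai Hi _ _]; rewrite /f /thick Ai (negPf Hi).
  by case: (Vlong Ai Hi).
by rewrite sumr_const -[X in X <= _]mulr_natl ler_wpM2r // ler_nat.
Qed.

Definition Nb := (M + NX).+1.

(* Slabs of height [1/M] and strips between consecutive elements of [X] cut the
   square into cells; a cell is coloured when it lies in a V-free interval of its
   slab.  Boxes are maximal horizontal runs of coloured cells and maximal vertical
   runs of uncoloured ones. *)
Theorem boxes : exists (B : {set T}) (y' : T -> R) (KS : {set bool * ('I_Nb * 'I_Nb * 'I_Nb)})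
    (BX BW BY BH : bool * ('I_Nb * 'I_Nb * 'I_Nb) -> R) (f : T -> bool * ('I_Nb * 'I_Nb * 'I_Nb)),
  [/\ B \subset A, \sum_(i in A :\: B) thick w h isH i <= ((M + NX) * q)%:R * delta,
      packed x w y' h B,
      forall i, i \in B -> [/\ f i \in KS, (f i).1 = isH i, BX (f i) <= x i /\ x i + w i <= BX (f i) + BW (f i)
        & BY (f i) <= y' i /\ y' i + h i <= BY (f i) + BH (f i)] &
      (forall k, k \in KS -> [/\ 0 <= BX k, BX k + BW k <= 1, 0 <= BY k & BY k + BH k <= 1 - s / 4]) /\
      (forall k k', k \in KS -> k' \in KS -> xover BX BW k k' -> xover BY BH k k' -> k = k')].
Proof.
have X0 : 0 \in X by rewrite inE eqxx.
have X1 : 1 \in X by rewrite !inE eqxx orbT.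
have [n [e [nX e0 en elt eX]]] := sorted_grid X0 X1 bX.
have ele i j : (i <= j <= n)%N -> e i <= e j.
  by rewrite leq_eqVlt => /andP[/orP[/eqP->//|ij] jn]; apply/ltW/elt/andP.
have einv i j : (i <= n)%N -> (j <= n)%N -> e i < e j -> (i < j)%N.
  by move=> ii jj h2; rewrite ltnNge; apply/negP => ji; have := ele j i; rewrite ji ii => /(_ isT); lra.
have ebnd i : (i <= n)%N -> 0 <= e i <= 1 by move=> ii; apply: bX; apply/eX; exists i.
(* Only slabs below [1 - s / 4] are used, so the boxes leave a full-width strip at the top. *)
pose M2 := tr ((1 - s / 4) * M%:R).
have c4 : 0 <= (1 - s / 4) * M%:R by apply: mulr_ge0; [have := s1; lra | apply: ltW].
have M2le (r : nat) : (r <= M2)%N = (r%:R <= (1 - s / 4) * M%:R) by rewrite /M2 /tr truncn_ge_nat.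
have M2M : (M2 <= M)%N.
  have := M2le M2; rewrite leqnn => /esym h2; rewrite -(ler_nat R); apply: le_trans h2 _.
  by rewrite ler_piMl ?ltW //; have := s0; lra.
have nNX : (n < NX)%N by rewrite -sizeX.
pose col r a := [exists k : 'I_q, [&& valid r k, lf r k <= e a & e a.+1 <= rf r k]].
pose KT := (bool * ('I_Nb * 'I_Nb * 'I_Nb))%type.
(* In an index [(b, (u, v, t))] an H box lies in slab [u] over the strips from [v] to [t], a V box
   in strip [u] over the slabs from [v] to [t]. *)
pose BX (k : KT) := let: (b, (u, v, t)) := k in if b then e v else e u.
pose BW (k : KT) := let: (b, (u, v, t)) := k in if b then e t - e v else e u.+1 - e u.
pose BY (k : KT) : R := let: (b, (u, v, t)) := k in if b then u%:R / M%:R else v%:R / M%:R.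
pose BH (k : KT) : R := let: (b, (u, v, t)) := k in if b then 1 / M%:R else (t%:R - v%:R) / M%:R.
pose KS := [set k : KT | let: (b, (u, v, t)) := k in
  if b then (u < M2)%N && isrun (col u) n v t else (u < n)%N && isrun (fun r => ~~ col r u) M2 v t].
have inside i : i \in A3 -> [/\ 0 <= y2 i, y1 i <= y2 i & y2 i + h i <= y1 i + h1 i].
  rewrite inE => /andP[Ai _]; have [a b c d] := y1h1 Ai; rewrite /y2.
  have [Hi|Vi] := boolP (isH i); first by split; lra.
  have [a1 a2 a3] := r12 Ai Vi; split; first by apply: divr_ge0; rewrite ?ler0n.
    by rewrite ler_pdivlMr.
  by rewrite -(ler_pM2r M0) mulrDl divfK ?gt_eqF //; lra.
have A3A : A3 \subset A by apply/subsetP => i; rewrite inE => /andP[].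
have pk3 : packed x w y2 h A3.
  split=> [i i3|i j i3 j3 xo yo].
    have Ai := subsetP A3A _ i3; have [? ? ? ? [? ?]] := uA Ai; have [? ? ?] := inside i i3.
    by have [? ? ? ?] := y1h1 Ai; split=> //; have := s0; lra.
  have [? ? ?] := inside i i3; have [? ? ?] := inside j j3.
  apply: dis1 => //; try exact: (subsetP A3A).
  by case/andP: yo => ? ?; apply/andP; split; lra.
pose good i (k : KT) := [/\ k \in KS, k.1 = isH i, BX k <= x i /\ x i + w i <= BX k + BW k
        & BY k <= y2 i /\ y2 i + h i <= BY k + BH k].
have aB (a b : R) : a + (b - a) = b by lra.
have oN : forall a, (a < Nb)%N -> nat_of_ord (inord a : 'I_Nb) = a by move=> a; apply: inordK.
have ex i : exists k, i \in A3 -> good i k.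
  have [i3|] := boolP (i \in A3); last by exists (true, (inord 0, inord 0, inord 0)).
  have Ai := subsetP A3A _ i3; have [x0 x1 _ _ [w0 h0]] := uA Ai; have [a b c d] := y1h1 Ai.
  move: i3; rewrite inE Ai andTb; case: ifPn => [Hi|Vi] i3.
    have t1 : 0 <= y1 i * M%:R by apply: mulr_ge0 => //; apply: ltW.
    have := truncn_itv t1; move: i3; rewrite -/(tr _); set r := tr _ => i3 /andP[a1 a2].
    have rM2 : (r < M2)%N.
      rewrite M2le -natr1; apply: (@le_trans _ _ ((1 - s / 2) * M%:R + 1)).
        rewrite lerD2r; apply: le_trans a1 _; rewrite ler_pM2r //; lra.
      by have := Ms; have := qR; lra.
    have rM : (r < M)%N by apply: leq_trans M2M.
    (* An H item contains a line [k/q] and overlaps no V item occupying its slab, so it lies between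
       [lf r k] and [rf r k], whose cells are all coloured. *)
    have [wq _] := Hlong Ai Hi; have [k /andP[k1 k2]] := grid_line q0 x0 x1 wq.
    have ovl j : occ r j -> x j + w j <= x i \/ x i + w i <= x j.
      move=> /and3P[Aj Vj /andP[rj1 rj2]]; have [b1 b2 b3] := r12 Aj Vj.
      have [?|k3] := leP (x j + w j) (x i); first by left.
      have [?|k4] := leP (x i + w i) (x j); first by right.
      exfalso; have ij : i = j.
        apply: dis1 => //; apply/andP; split=> //.
          rewrite -(ltr_pM2r M0); apply: lt_le_trans a2 _; apply: le_trans b2.
          by rewrite ler_nat.
        rewrite -(ltr_pM2r M0); apply: le_lt_trans b1 _.
        apply: (@le_lt_trans _ _ (y1 i * M%:R)); first by apply: le_trans a1; rewrite ler_nat.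
        by rewrite ltr_pM2r //; lra.
      by move: Vj; rewrite -ij Hi.
    have lx : lf r k <= x i.
      apply: bigmax_le => // j /andP[oj lj]; case: (ovl j oj) => // h2.
      by have := k1; rewrite -/(ln k) => k1'; have := k2; rewrite -/(ln k); have [_ _ _ _ [? _]] := uA (let: And3 Aj _ _ := elimT and3P oj in Aj); lra.
    have rx : x i + w i <= rf r k.
      apply: le_bigmin => // j /andP[oj lj]; case: (ovl j oj) => // h2.
      by have := k1; rewrite -/(ln k); have [_ _ _ _ [? _]] := uA (let: And3 Aj _ _ := elimT and3P oj in Aj); lra.
    have vk : valid r k.
      apply/forallP => j; apply/implyP => oj; apply/negP => /andP[j1 j2].
      by move: k1 k2; rewrite -/(ln k) => k1 k2; case: (ovl j oj); lra.
    have [lX rX] := inX rM (ltn_ord k).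
    have [p1' p1n lE] := (eX _).1 lX; have [p2' p2n rE] := (eX _).1 rX.
    have p12 : (p1' < p2')%N by apply: einv => //; rewrite -lE -rE; lra.
    have [lo [hi [run lo1 hi1]]] : exists lo hi, [/\ isrun (col r) n lo hi, (lo <= p1')%N & (p2' <= hi)%N].
      apply: run_exists; first by rewrite p12.
      move=> p /andP[pp1 pp2]; apply/existsP; exists k; rewrite vk lE rE /=.
      by rewrite !ele ?pp1 ?pp2 //= ltnW // (leq_trans pp2).
    have [/andP[lohi hin] _ _ _] := isrunP run.
    exists (true, (inord r, inord lo, inord hi)) => _.
    have [N1 N2 N3] : [/\ (r < Nb)%N, (lo < Nb)%N & (hi < Nb)%N].
      by rewrite /Nb; split; rewrite ltnS; move: rM hin lohi nNX; clear; lia.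
    split; rewrite ?inE /= ?oN ?rM2 ?run //.
      rewrite aB; split.
        by apply: le_trans lx; rewrite lE ele // lo1.
      by apply: le_trans rx _; rewrite rE ele // hi1.
    rewrite /y2 Hi -mulrDl natr1; split; first by rewrite ler_pdivrMr.
    by rewrite ler_pdivlMr.
  have nocut j : (j <= n)%N -> e j <= x i \/ x i + w i <= e j.
    by move=> jn; apply/orP; apply: (allP i3); apply/eX; exists j.
  have [p pn [p1' p2']] := strip_exists e0 en x0 x1 w0 nocut.
  have [b1 b2 b3] := r12 Ai Vi.
  have r12n : (r1 i < r2 i)%N.
    by rewrite -(ltr_nat R); have : 0 < h i * M%:R by [apply: mulr_gt0]; lra.
  have r2M : (r2 i <= M2)%N.
    by rewrite M2le; apply: le_trans b2 _; rewrite ler_pM2r //; have := s0; lra.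
  (* No cell of the strip is coloured in a slab occupied by [i]: the V-free interval behind the
     colour would have to contain the strip, and with it [i]. *)
  have [lo [hi [run lo1 hi1]]] : exists lo hi, [/\ isrun (fun r => ~~ col r p) M2 lo hi, (lo <= r1 i)%N & (r2 i <= hi)%N].
    apply: run_exists; first by rewrite r12n.
    move=> r rr; apply/negP => /existsP[k /and3P[vk lk rk]].
    have oi : occ r i by rewrite /occ Ai Vi.
    have := forallP vk i; rewrite oi /= negb_and -!leNgt => /orP[h2|h2].
      have : rf r k <= x i by apply: bigmin_le_cond; rewrite oi.
      by lra.
    have : x i + w i <= lf r k by apply: (@le_bigmax_cond _ _ _ _ _ _ (fun i => x i + w i)); rewrite oi.
    by lra.
  have [/andP[lohi hin] _ _ _] := isrunP run.
  exists (false, (inord p, inord lo, inord hi)) => _.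
  have [N1 N2 N3] : [/\ (p < Nb)%N, (lo < Nb)%N & (hi < Nb)%N].
    by rewrite /Nb; split; rewrite ltnS; move: M2M pn hin lohi nNX; clear; lia.
  split; rewrite ?inE /= ?oN ?pn ?run ?(negPf Vi) //.
    by rewrite aB.
  rewrite /y2 (negPf Vi) -mulrDl aB; split.
    by rewrite ler_pM2r ?invr_gt0 // ler_nat.
  rewrite ler_pdivlMr // mulrDl divfK ?gt_eqF //.
  by move: hi1; rewrite -(ler_nat R); lra.
have /fin_all_exists[f fP] := ex.
exists A3, y2, KS, BX, BW, BY, BH, f; split=> //; split.
  move=> [b [[u v] t]]; rewrite inE /=; case: b => /andP[uM /isrunP[/andP[lohi hin] _ _ _]].
    rewrite -mulrDl natr1 aB; have /andP[? _] := ebnd v (ltnW (leq_trans lohi hin)); have /andP[_ ?] := ebnd t hin.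
    split=> //; first by apply: divr_ge0; rewrite ler0n.
    by rewrite ler_pdivrMr // -M2le.
  rewrite -mulrDl !aB.
  have /andP[? _] := ebnd u (ltnW uM); have /andP[_ ?] := ebnd u.+1 uM.
  split=> //; first by apply: divr_ge0; rewrite ler0n.
  by rewrite ler_pdivrMr // -M2le.
have ltM a b : (a%:R / M%:R < b%:R / M%:R :> R) = (a < b)%N.
  by rewrite ltr_pM2r ?invr_gt0 // ltr_nat.
have HV u v t u' v' t' : (true, (u, v, t)) \in KS -> (false, (u', v', t')) \in KS ->
   xover BX BW (true, (u, v, t)) (false, (u', v', t')) ->
   xover BY BH (true, (u, v, t)) (false, (u', v', t')) -> False.
  rewrite !inE /= /xover /= => /andP[uM /isrunP[/andP[lh hn] c1 _ _]] /andP[un /isrunP[/andP[lh' hn'] c2 _ _]].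
  rewrite -!mulrDl !natr1 !aB !ltM => /andP[x2 x3] /andP[k1 k2].
  have := c2 u ltac:(move: k1 k2; clear; lia).
  have k3 := einv _ _ (ltnW (leq_trans lh hn)) un x2.
  have k4 := einv _ _ (ltnW un) hn x3.
  by rewrite c1 //; move: k3 k4; clear; lia.
move=> [b [[u v] t]] [b' [[u' v'] t']]; case: b; case: b' => K1 K2 xo yo.
- move: K1 K2 xo yo; rewrite !inE /= /xover /=.
  move=> /andP[uM r]; have [/andP[lh hn] _ _ _] := isrunP r.
  move=> /andP[uM' r']; have [/andP[lh' hn'] _ _ _] := isrunP r'.
  rewrite -!mulrDl !natr1 !aB !ltM => /andP[x2 x3] /andP[k1 k2].
  have uu : u = u' by apply: val_inj => /=; move: k1 k2; clear; lia.
  subst u'; have [[/val_inj-> /val_inj->]//|ne] := eqVneq (v : nat, t : nat) (v' : nat, t' : nat).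
  have k3 := einv _ _ (ltnW (leq_trans lh hn)) hn' x2.
  have k4 := einv _ _ (ltnW (leq_trans lh' hn')) hn x3.
  by case: (isrun_disj r r') => [|h2|h2]; [apply/eqP|move: h2 k4; clear; lia|move: h2 k3; clear; lia].
- by exfalso; apply: (HV u v t u' v' t').
- by exfalso; apply: (HV u' v' t' u v t) => //; rewrite xoverC.
- move: K1 K2 xo yo; rewrite !inE /= /xover /=.
  move=> /andP[uM r]; have [/andP[lh hn] _ _ _] := isrunP r.
  move=> /andP[uM' r']; have [/andP[lh' hn'] _ _ _] := isrunP r'.
  rewrite -!mulrDl !aB !ltM => /andP[x2 x3] /andP[k1 k2].
  have k3 := einv _ _ (ltnW uM) uM' x2.
  have k4 := einv _ _ (ltnW uM') uM x3.
  have uu : u = u' by apply: val_inj => /=; move: k3 k4; clear; lia.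
  subst u'; have [[/val_inj-> /val_inj->]//|ne] := eqVneq (v : nat, t : nat) (v' : nat, t' : nat).
  by case: (isrun_disj r r') => [|h2|h2]; [apply/eqP|move: h2 k2; clear; lia|move: h2 k1; clear; lia].
Qed.

End Boxes.

(** * Cutting into levels and grouping lengths *)

Section Levels.
Variables (R : realType) (T : finType).

Lemma sorted_enum (X : seq R) : exists (m : nat) (e : nat -> R),
  (forall i j, (i < j < m)%N -> e i < e j) /\
  (forall t, t \in X <-> exists2 i, (i < m)%N & t = e i).
Proof.
pose s := sort <=%R (undup X).
have ms t : (t \in s) = (t \in X) by rewrite mem_sort mem_undup.
have lts : sorted <%R s by rewrite lt_sorted_uniq_le sort_uniq undup_uniq sort_le_sorted.
exists (size s), (nth 0 s); split.
  move=> i j /andP[ij js]; apply: (sorted_ltn_nth lt_trans) => //.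
  by rewrite inE; apply: ltn_trans js.
move=> t; rewrite -ms; split=> [/(nthP 0)[i i1 <-]|[i i1 ->]]; last exact: mem_nth.
by exists i.
Qed.

Lemma telescope_ord (n a b : nat) (e : nat -> R) : (a <= b)%N ->
  \sum_(j < n | (a <= j)%N && (j < b)%N) (e j.+1 - e j) = e (minn b n) - e (minn a n).
Proof.
move=> ab; elim: n => [|n IH]; first by rewrite big_ord0 !minn0 subrr.
rewrite big_mkcond big_ord_recr /= -big_mkcond IH.
case: (boolP (a <= n)%N) => [an|]; case: (boolP (n < b)%N) => [nb|]; rewrite -?leqNgt -?ltnNge /=.
- by rewrite (minn_idPr nb) (minn_idPr (ltnW nb)) (minn_idPl an) (minn_idPl (leqW an)); lra.
- by move=> bn; rewrite (minn_idPl bn) (minn_idPl (leqW bn)) (minn_idPl an) (minn_idPl (leqW an)); lra.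
- by move=> na; rewrite (minn_idPr nb) (minn_idPr (ltnW nb)) (minn_idPr (ltnW na)) (minn_idPr na); lra.
- by move=> bn na; have := leq_ltn_trans (leq_trans ab bn) na; rewrite ltnn.
Qed.

Definition onlevel (y h : T -> R) (e d : R) i := (y i <= e) && (e + d <= y i + h i).

(** All bottoms and tops serve as cuts, so every item is a union of levels and sums over items can
    be exchanged for sums over levels. *)
Lemma levels (S : {set T}) (y h : T -> R) : (forall i, i \in S -> 0 < h i) ->
  exists (n : nat) (e d : 'I_n -> R), [/\ forall j, 0 < d j,
    forall j k, j != k -> apart e d j k &
    forall i, i \in S -> h i = \sum_(j | onlevel y h (e j) (d j) i) d j].
Proof.
move=> hp; pose X := [seq y i | i <- enum S] ++ [seq y i + h i | i <- enum S].
have [m [e [elt eX]]] := sorted_enum X.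
have ele i j : (i <= j < m)%N -> e i <= e j.
  by rewrite leq_eqVlt => /andP[/orP[/eqP->//|ij] jn]; apply/ltW/elt/andP.
have einv i j : (i < m)%N -> e i <= e j -> (i <= j)%N.
  by move=> im h2; rewrite leqNgt; apply/negP => ji; have := elt j i; rewrite ji im => /(_ isT); lra.
have jm (j : 'I_m.-1) : (j.+1 < m)%N by case: m j {elt eX ele einv} => [[]//|m] [j] /=; rewrite ltnS.
exists m.-1, (fun j => e j), (fun j => e j.+1 - e j); split.
- by move=> j; rewrite subr_gt0 elt // ltnSn jm.
- move=> j k jk; rewrite /apart !subrKC.
  have [lt|gt|/val_inj ee] := ltngtP j k; last by rewrite ee eqxx in jk.
    by left; apply: ele; rewrite lt ltnW.
  by right; apply: ele; rewrite gt ltnW.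
- move=> i iS.
  have [a am ya] : exists2 a, (a < m)%N & y i = e a.
    by apply/eX; rewrite mem_cat map_f ?mem_enum.
  have [b bm yb] : exists2 b, (b < m)%N & y i + h i = e b.
    by apply/eX; rewrite mem_cat; apply/orP; right; apply: (map_f (fun i => y i + h i)); rewrite mem_enum.
  have ab : (a <= b)%N by apply: einv => //; rewrite -ya -yb; have := hp i iS; lra.
  rewrite (eq_bigl (fun j : 'I_m.-1 => (a <= j)%N && (j < b)%N)).
    have m0 : (0 < m)%N by apply: leq_ltn_trans am.
    have a' : (a <= m.-1)%N by rewrite -ltnS prednK.
    have b' : (b <= m.-1)%N by rewrite -ltnS prednK.
    by rewrite telescope_ord // (minn_idPl a') (minn_idPl b') -yb -ya; lra.
  move=> j; rewrite /onlevel subrKC yb ya.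
  by apply/andP/andP => -[h1 h2]; split; [exact: einv|exact: einv|apply: ele; rewrite h1 ltnW|apply: ele; rewrite h2].
Qed.

(* Item lengths partition the items, ordered by decreasing length, into groups of
   total thickness at most [g]. *)
Lemma thresholds (S : {set T}) (w : T -> R) (F : R -> R) (g : R) n :
  exists L : seq R, [/\ (size L <= n)%N, forall t, t \in L -> exists2 i, i \in S & t = w i &
    forall k, (0 < k <= n)%N -> (exists2 i, i \in S & k%:R * g <= F (w i)) ->
      exists2 t, t \in L & k%:R * g <= F t /\ forall i, i \in S -> k%:R * g <= F (w i) -> w i <= t].
Proof.
elim: n => [|n [L [sL Lw LP]]].
  by exists [::]; split=> // k; rewrite leqn0 lt0n => /andP[/negPf->].
case: (pickP (fun i => (i \in S) && (n.+1%:R * g <= F (w i)))) => [i0 Pi0|none]; last first.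
  exists L; split=> //; first exact: leqW.
  move=> k /andP[k0]; rewrite leq_eqVlt => /orP[/eqP->|kn] [i iS Fi].
    by have := none i; rewrite iS Fi.
  by apply: LP; [rewrite k0|exists i].
case: (@arg_maxP _ _ _ i0 (fun i => (i \in S) && (n.+1%:R * g <= F (w i))) w Pi0) => i /andP[iS Fi] maxi.
exists (w i :: L); split=> //.
  by move=> t; rewrite inE => /orP[/eqP->|/Lw//]; exists i.
move=> k /andP[k0]; rewrite leq_eqVlt => /orP[/eqP->|kn].
  move=> _; exists (w i); first by rewrite inE eqxx.
  by split=> // j jS Fj; apply: maxi; rewrite jS.
move=> exk; have [|t tL tP] := LP k _ exk; first by rewrite k0.
by exists t; rewrite // inE tL orbT.
Qed.

End Levels.

Record cont (R : realType) := Cont { ca : R; cb : R; cx : R; cy : R; cv : bool }.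
Definition cw (R : realType) (c : cont R) := if cv c then cb c else ca c.
Definition ch (R : realType) (c : cont R) := if cv c then ca c else cb c.
Definition cdisj (R : realType) (c c' : cont R) :=
  [|| cx c + cw c <= cx c', cx c' + cw c' <= cx c, cy c + ch c <= cy c' | cy c' + ch c' <= cy c].

Lemma cdisjC (R : realType) (c c' : cont R) : cdisj c c' = cdisj c' c.
Proof. by rewrite /cdisj; do ![case: (_ <= _)]. Qed.

(** * Containers replacing the contents of one box *)

Section BoxConts.
Variables (R : realType) (T : finType) (S : {set T}) (x w y h : T -> R).
Variables (X0 W Y0 H g : R) (q G : nat).
Hypothesis inbox : forall i, i \in S -> [/\ X0 <= x i, x i + w i <= X0 + W, Y0 <= y i & y i + h i <= Y0 + H].
Hypothesis hpos : forall i, i \in S -> 0 < h i.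
Hypothesis wlong : forall i, i \in S -> 1 < w i * q%:R.
Hypothesis dis : forall i j, i \in S -> j \in S -> xover x w i j -> xover y h i j -> i = j.
Hypothesis W1 : W <= 1.
Hypothesis H1 : H <= 1.
Hypothesis H0 : 0 <= H.
Hypothesis g0 : 0 < g.
Hypothesis Gg : q%:R <= g * G%:R.

Let wpos i : i \in S -> 0 < w i.
Proof. by move/wlong; rewrite ltNge => h2; rewrite ltNge; apply: contra h2 => h2; apply: (@le_trans _ _ 0); rewrite // mulr_le0_ge0 // ler0n. Qed.

Let F lam := \sum_(i in S | lam <= w i) h i.

Definition Cbox := (q.+1 ^ G * G * q.+1)%N.

(** Each length is rounded down to the largest threshold below it. The total thickness is at most
    [q], so [G] groups of thickness [g] exhaust it, and for every [lam] only the items between two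
    neighbouring thresholds are lost. *)
Lemma rounded_lengths : exists (L : seq R) (kap : T -> option 'I_(size L)),
  [/\ (size L <= G)%N, forall t, t \in L -> exists2 i, i \in S & t = w i,
      forall i k, kap i = Some k -> nth 0 L k <= w i &
      forall lam, 0 < lam -> F lam - g <= \sum_(i in S | if kap i is Some k then lam <= nth 0 L k else false) h i].
Proof.
have [L [sL Lw LP]] := thresholds S w F g G.
pose kap i : option 'I_(size L) := [pick k : 'I_(size L) | (nth 0 L k <= w i) &&
   [forall k' : 'I_(size L), (nth 0 L k' <= w i) ==> (nth 0 L k' <= nth 0 L k)]].
exists L, kap; split=> //.
  by move=> i k; rewrite /kap; case: pickP => // k' /andP[h1 _] [<-].
move=> lam lam0.
have F0 : 0 <= F lam by apply: sumr_ge0 => i /andP[/hpos/ltW].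
have [small|big] := ltP (F lam) g.
  apply: (@le_trans _ _ 0); first lra.
  by apply: sumr_ge0 => i /andP[/hpos/ltW].
(* [F lam] lies between [k * g] and [k.+1 * g]; the threshold chosen for [k] is at least [lam], and
   the items above it still have thickness [k * g]. *)
pose k := Num.truncn (F lam / g).
have Fg : 0 <= F lam / g by apply: divr_ge0 => //; apply: ltW.
have /andP[k1 k2] := truncn_itv Fg; move: k1 k2; rewrite -/k ler_pdivlMr // ltr_pdivrMr // => k1 k2.
have kpos : (0 < k)%N by rewrite truncn_gt0 ler_pdivlMr // mul1r.
have Fq : F lam <= q%:R.
  rewrite /F (eq_bigl (fun i => i \in [set i in S | lam <= w i])); last by move=> i; rewrite inE.
  apply: (@le_trans _ _ (q%:R * H)); last by rewrite ler_piMr ?ler0n.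
  have e : H = (Y0 + H) - Y0 by lra.
  have q0 : (0 < q)%N.
    have [i iS] : exists i, i \in S.
      case: (set_0Vmem S) => [S0|[i iS]]; last by exists i.
      by move: big; rewrite /F S0 big1 ?leNgt ?g0 // => i; rewrite inE.
    by rewrite lt0n; apply/eqP => q0; have := wlong iS; rewrite q0 mulr0; lra.
  rewrite [in X in _ <= X]e; apply: (@window_thickness _ _ _ (fun i => x i - X0) w y h) => //; first by have := H0; lra.
    move=> i; rewrite inE => /andP[iS _]; have [? ? ? ?] := inbox iS.
    by split; [lra|have := W1; lra|exact: wlong|exact: hpos|split].
  move=> i j; rewrite !inE => /andP[iS _] /andP[jS _] ij h1 h2.
  have [?|h3] := leP (y i + h i) (y j); first by left.
  have [?|h4] := leP (y j + h j) (y i); first by right.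
  by exfalso; move/eqP: ij; apply; apply: dis => //; apply/andP; split; lra.
have kG : (k <= G)%N.
  rewrite -(ler_nat R) -(ler_pM2r g0); apply: le_trans k1 _; apply: le_trans Fq _.
  by rewrite mulrC.
have [i iS /andP[li mini]] : exists2 i, i \in S & (lam <= w i) && (k%:R * g <= F (w i)).
  have [i0 i0P] : exists i, (i \in S) && (lam <= w i).
    apply/existsP; apply: contraLR big; rewrite negb_exists => /forallP none.
    by rewrite -ltNge /F big_pred0 // => i; apply: negbTE.
  case: (@arg_minP _ _ _ i0 (fun i => (i \in S) && (lam <= w i)) w i0P) => i /andP[iS li] mini.
  exists i => //; rewrite li /=; apply: le_trans k1 _; rewrite /F le_eqVlt; apply/orP; left.
  apply/eqP/eq_bigl => j; case jS: (j \in S) => //=.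
  apply/idP/idP => lj; first by apply: mini; rewrite jS.
  exact: le_trans lj.
have [|t tL [Ft tmax]] := LP k _ (ex_intro2 _ _ i iS mini); first by rewrite kpos.
have lt : lam <= t by apply: le_trans li (tmax i iS mini).
apply: (@le_trans _ _ (F t)); first by move: k2 Ft; rewrite -natr1 mulrDl mul1r; move: (k%:R * g) (F lam) (F t) => ? ? ?; lra.
rewrite /F big_mkcond [X in _ <= X]big_mkcond /=; apply: ler_sum => j _.
case: (boolP (j \in S)) => //= jS; case: (boolP (t <= w j)) => tj; last first.
  by case: (match _ with Some _ => _ | None => _ end) => //; apply: ltW (hpos jS).
suff e : (if kap j is Some k0 then lam <= nth 0 L k0 else false) = true by rewrite e.
have tsize : (index t L < size L)%N by rewrite index_mem.
pose kt := Ordinal tsize.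
have tE : nth 0 L kt = t by apply: nth_index.
have ktP : nth 0 L kt <= w j by rewrite tE.
rewrite /kap; case: pickP => [k' /andP[_ /forallP/(_ kt)]|none].
  by rewrite ktP /= tE; apply: le_trans.
exfalso; case: (@arg_maxP _ _ _ kt (fun k : 'I_(size L) => nth 0 L k <= w j) (fun k : 'I_(size L) => nth 0 L k) ktP) => k' k'P k'max.
have := none k'; rewrite k'P /= => /negP; apply; apply/forallP => k''; apply/implyP; exact: k'max.
Qed.

End BoxConts.

Lemma sum_fiber (R : realType) (T K : finType) (B : {set T}) (kap : T -> option K) (phi : K -> R) :
  \sum_k #|[set i in B | kap i == Some k]|%:R * phi k = \sum_(i in B) (if kap i is Some k then phi k else 0).
Proof.
under eq_bigr => k _ do rewrite -sum1_card natr_sum mulr_suml.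
rewrite (exchange_big_dep (mem B)) /=; last by move=> k i _; rewrite inE => /andP[].
apply: eq_bigr => i iB; case e: (kap i) => [k|]; last first.
  by rewrite big_pred0 // => k; rewrite inE e andbF.
rewrite (big_pred1 k) ?mul1r // => k'; rewrite inE iB e /=.
by apply/eqP/eqP => [[]|->].
Qed.

Section BoxConts.
Variables (R : realType) (T : finType) (S : {set T}) (x w y h : T -> R).
Variables (X0 W Y0 H g : R) (q G : nat).
Hypothesis inbox : forall i, i \in S -> [/\ X0 <= x i, x i + w i <= X0 + W, Y0 <= y i & y i + h i <= Y0 + H].
Hypothesis hpos : forall i, i \in S -> 0 < h i.
Hypothesis wlong : forall i, i \in S -> 1 < w i * q%:R.
Hypothesis dis : forall i j, i \in S -> j \in S -> xover x w i j -> xover y h i j -> i = j.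
Hypothesis W1 : W <= 1.
Hypothesis W0 : 0 <= W.
Hypothesis H0 : 0 <= H.
Hypothesis H1 : H <= 1.
Hypothesis g0 : 0 < g.
Hypothesis Gg : q%:R <= g * G%:R.

Let wpos i : i \in S -> 0 < w i.
Proof. by move/wlong; rewrite ltNge => h2; rewrite ltNge; apply: contra h2 => h2; apply: (@le_trans _ _ 0); rewrite // mulr_le0_ge0 // ler0n. Qed.

Section Types.
Variables (L : seq R) (kap : T -> option 'I_(size L)) (n : nat) (e d : 'I_n -> R).
Hypothesis sL : (size L <= G)%N.
Hypothesis LS : forall t, t \in L -> exists2 i, i \in S & t = w i.
Hypothesis kapw : forall i k, kap i = Some k -> nth 0 L k <= w i.
Hypothesis d0 : forall j, 0 < d j.
Hypothesis ed : forall j k, j != k -> apart e d j k.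
Hypothesis hlev : forall i, i \in S -> h i = \sum_(j | onlevel y h (e j) (d j) i) d j.

Let Li (k : 'I_(size L)) := nth 0 L k.
Let on j i := onlevel y h (e j) (d j) i.
Let At j := [set i in S | on j i].
Let J := [set j | At j != set0].
Let ty := {ffun 'I_(size L) -> 'I_q.+1}.
(** The configuration of a level: how many items of each rounded length it cuts, at most [q] in all.
    As in fractional strip packing, the levels of equal configuration are merged into one layer of
    thickness [b c], in which the rounded lengths stand side by side as containers. The bound [Cbox]
    counts configurations, lengths and copies. *)
Let tau j : ty := [ffun k => inord #|[set i in At j | kap i == Some k]|].
Let b (c : ty) := \sum_(j in J | tau j == c) d j.
Let I := (ty * 'I_(size L) * 'I_q.+1)%type.
Let valid (p : I) := (p.2 < p.1.1 p.1.2)%N && (0 < b p.1.1).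
Let off (p : I) := \sum_(k < size L | (k < p.1.2)%N) (p.1.1 k : nat)%:R * Li k + (p.2 : nat)%:R * Li p.1.2.
Let yoff (c : ty) := \sum_(c' | (enum_rank c' < enum_rank c)%N) b c'.
Let mk (p : I) := Cont (Li p.1.2) (b p.1.1) (X0 + off p) (Y0 + yoff p.1.1) false.

Let Lpos k : 0 < Li k.
Proof. by rewrite /Li; have [i iS ->] := LS (mem_nth 0 (ltn_ord k)); apply: wpos. Qed.

Let b0 c : 0 <= b c.
Proof. by apply: sumr_ge0 => j _; apply: ltW. Qed.

Let At_apart j i k : i \in At j -> k \in At j -> i != k -> apart x w i k.
Proof.
rewrite !inE => /andP[iS /andP[i1 i2]] /andP[kS /andP[k1 k2]] ik; rewrite /apart.
have [?|h1] := leP (x i + w i) (x k); first by left.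
have [?|h2] := leP (x k + w k) (x i); first by right.
exfalso; move/eqP: ik; apply; apply: dis => //; apply/andP; split=> //; have := d0 j; lra.
Qed.

Let At_width j : \sum_(i in At j) w i <= W.
Proof.
have eW : W = (X0 + W) - X0 by lra.
rewrite [X in _ <= X]eW; apply: (@sum_disjoint_intervals _ _ _ x); first by rewrite lerDl.
  by move=> i; rewrite inE => /andP[iS _]; have [? ? ? ?] := inbox iS; split=> //; apply: wpos.
exact: At_apart.
Qed.

Let At_card j : (#|At j| <= q)%N.
Proof.
apply: (@card_long _ _ _ w) => [i|]; first by rewrite inE => /andP[/wlong].
exact: le_trans (At_width j) W1.
Qed.

Let tauE j k : (tau j k : nat) = #|[set i in At j | kap i == Some k]|.
Proof.
rewrite ffunE inordK // ltnS; apply: leq_trans (At_card j); apply: subset_leq_card.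
by apply/subsetP => i; rewrite inE => /andP[].
Qed.

Let tau_width j : \sum_k (tau j k : nat)%:R * Li k <= W.
Proof.
under eq_bigr => k _ do rewrite tauE.
rewrite sum_fiber; apply: le_trans (At_width j); apply: ler_sum => i iA.
case ek: (kap i) => [k|]; first exact: kapw.
by apply/ltW/wpos; move: iA; rewrite inE => /andP[].
Qed.

(** An exchange of summation: a container collects its length once for every level of its
    configuration, and the levels cut by an item add up to its height. Thickness above a threshold
    and area are both instances of [phi]. *)
Let count phi : \sum_(p : I | valid p) phi p.1.2 * b p.1.1 =
  \sum_(i in S) (if kap i is Some k then phi k else 0) * h i.
Proof.
transitivity (\sum_(c : ty) \sum_k (c k : nat)%:R * (phi k * b c)).
  rewrite pair_big /= [RHS](eq_bigr (fun p : ty * 'I_(size L) => \sum_(r < q.+1 | valid (p, r)) phi p.2 * b p.1)).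
    by rewrite pair_big_dep /=; apply: eq_big => [[]|[]].
  move=> [c k] _ /=; rewrite /valid /=.
  case: (boolP (0 < b c)) => [bc|]; last first.
    rewrite -leNgt => bc; have -> : b c = 0 by [apply: le_anti; rewrite bc b0].
    by rewrite !mulr0 big1 // => r _; rewrite mulr0.
  rewrite (eq_bigl (fun r : 'I_q.+1 => (r < c k)%N)); last by move=> r; rewrite andbT.
  rewrite -(big_ord_widen q.+1 (fun=> phi k * b c)); last exact: ltnW.
  by rewrite sumr_const card_ord mulr_natl.
transitivity (\sum_(j in J) d j * \sum_k (tau j k : nat)%:R * phi k).
  rewrite (partition_big tau xpredT) //=; apply: eq_bigr => c _.
  rewrite (eq_bigr (fun j => d j * \sum_k (c k : nat)%:R * phi k)); last first.
    by move=> j /andP[_ /eqP->].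
  rewrite -mulr_suml -/(b c) mulr_sumr; apply: eq_bigr => k _; lra.
transitivity (\sum_j d j * \sum_(i in At j) (if kap i is Some k then phi k else 0)).
  rewrite big_mkcond /=; apply: eq_bigr => j _; rewrite inE.
  case: eqP => [A0|_] /=; first by rewrite A0 big_set0 mulr0.
  by under eq_bigr => k _ do rewrite tauE; rewrite sum_fiber.
under eq_bigr => j _ do rewrite mulr_sumr.
rewrite (exchange_big_dep (mem S)) /=; last by move=> j i _; rewrite inE => /andP[].
apply: eq_bigr => i iS; rewrite (hlev iS) mulr_sumr; apply: eq_big => [j|j _]; last by rewrite mulrC.
by rewrite inE iS.
Qed.

Let bH : \sum_c b c <= H.
Proof.
have -> : \sum_c b c = \sum_(j in J) d j by rewrite [RHS](partition_big tau xpredT).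
have eH : H = (Y0 + H) - Y0 by lra.
rewrite [X in _ <= X]eH; apply: (@sum_disjoint_intervals _ _ _ e); first by rewrite lerDl.
  move=> j; rewrite inE => /set0Pn[i]; rewrite inE => /andP[iS /andP[i1 i2]].
  by have [? ? ? ?] := inbox iS; split=> //; lra.
by move=> j k _ _; apply: ed.
Qed.

Let off_le p : valid p -> [/\ 0 <= off p & off p + Li p.1.2 <= \sum_k (p.1.1 k : nat)%:R * Li k].
Proof.
move=> /andP[rc _]; split.
  apply: addr_ge0; last by rewrite mulr_ge0 ?ler0n // ltW.
  by apply: sumr_ge0 => k _; rewrite mulr_ge0 ?ler0n // ltW.
rewrite [X in _ <= X](bigID (fun k : 'I_(size L) => (k < p.1.2)%N)) /= /off -addrA lerD2l.
rewrite (bigD1 p.1.2) /= ?ltnn //.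
have h2 : 0 <= \sum_(i < size L | ~~ (i < p.1.2)%N && (i != p.1.2)) (p.1.1 i : nat)%:R * Li i.
  by apply: sumr_ge0 => k _; rewrite mulr_ge0 ?ler0n // ltW.
have h1 : (p.2.+1)%:R * Li p.1.2 <= (p.1.1 p.1.2 : nat)%:R * Li p.1.2.
  by rewrite ler_pM2r // ler_nat.
by rewrite -natr1 mulrDl mul1r in h1; lra.
Qed.

Let valid_tau p : valid p -> exists j, p.1.1 = tau j.
Proof.
move=> /andP[_ bp]; have [j /andP[_ /eqP<-]|none] := pickP (fun j => (j \in J) && (tau j == p.1.1)).
  by exists j.
by move: bp; rewrite /b big_pred0 ?ltxx.
Qed.

Let mk_apart p p' : valid p -> valid p' -> p != p' -> cdisj (mk p) (mk p').
Proof.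
move=> vp vp' ne; rewrite /cdisj /cw /ch /= .
have yo c c' : (enum_rank c < enum_rank c')%N -> Y0 + yoff c + b c <= Y0 + yoff c'.
  move=> lt; rewrite -addrA lerD2l /yoff [X in _ <= X](bigD1 c) //= addrC lerD2l.
  rewrite [X in _ <= X](bigID (fun c0 => (enum_rank c0 < enum_rank c)%N)) /=.
  rewrite [X in _ <= X + _](eq_bigl (fun c0 => (enum_rank c0 < enum_rank c)%N)).
    by rewrite lerDl; apply: sumr_ge0.
  move=> c0; case: (boolP (enum_rank c0 < enum_rank c)%N) => h1; rewrite ?andbF ?andbT //.
  rewrite (ltn_trans h1 lt) /=; apply/eqP => ee; by rewrite ee ltnn in h1.
have xo (c : ty) (k k' : 'I_(size L)) (r r' : 'I_q.+1) : (r < c k)%N -> (k < k')%N \/ (k = k' /\ (r < r')%N) ->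
    X0 + off (c, k, r) + Li k <= X0 + off (c, k', r').
  move=> rc h1; rewrite -addrA lerD2l /off /=.
  have h2 : r.+1%:R * Li k = r%:R * Li k + Li k by rewrite -natr1 mulrDl mul1r.
  case: h1 => [kk|[kk rr]]; last first.
    rewrite -kk -addrA lerD2l -h2 ler_pM2r // ler_nat //.
  have h3 : r.+1%:R * Li k <= (c k : nat)%:R * Li k by rewrite ler_pM2r // ler_nat.
  have h4 : 0 <= (r' : nat)%:R * Li k' by rewrite mulr_ge0 ?ler0n // ltW.
  rewrite [X in _ <= X + _](bigD1 k) //=.
  rewrite [X in _ <= _ + X + _](bigID (fun k0 : 'I_(size L) => (k0 < k)%N)) /=.
  rewrite [X in _ <= _ + (X + _) + _](eq_bigl (fun k0 : 'I_(size L) => (k0 < k)%N)).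
    have h5 : 0 <= \sum_(i < size L | (i < k')%N && (i != k) && ~~ (i < k)%N) (c i : nat)%:R * Li i.
      by apply: sumr_ge0 => k0 _; rewrite mulr_ge0 ?ler0n // ltW.
    move: h2 h3 h4 h5; move: (_ * Li k) (_ * Li k) => u v; lra.
  move=> k0; case: (boolP (k0 < k)%N) => h1; rewrite ?andbF ?andbT //.
  rewrite (ltn_trans h1 kk) /=; apply/eqP => ee; by rewrite ee ltnn in h1.
case: p vp ne => [[c k] r] vp; case: p' vp' => [[c' k'] r'] vp' ne /=.
have [lt|gt|ee] := ltngtP (enum_rank c) (enum_rank c').
- by rewrite (yo _ _ lt) !orbT.
- by rewrite (yo _ _ gt) !orbT.
have cc : c = c' by apply: enum_rank_inj; apply: val_inj.
subst c'; move: vp vp' => /andP[/= v1 _] /andP[/= v2 _].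
have [lt|gt|/val_inj kk] := ltngtP k k'.
- by rewrite (xo c k k' r r') //; left.
- by rewrite (xo c k' k r' r) ?orbT //; left.
subst k'; have [lt|gt|/val_inj rr] := ltngtP r r'.
- by rewrite (xo c k k r r') //; right.
- by rewrite (xo c k k r' r) ?orbT //; right.
by move: ne; rewrite rr eqxx.
Qed.

Let out := [seq mk p | p <- enum valid].

Lemma types_conts : [/\ (size out <= Cbox q G)%N,
  forall c, c \in map (fun p => p) (enum valid) -> True,
  forall p, p \in enum valid -> [/\ cv (mk p) = false, X0 <= cx (mk p) /\ cx (mk p) + cw (mk p) <= X0 + W,
    Y0 <= cy (mk p) /\ cy (mk p) + ch (mk p) <= Y0 + H, 0 < cb (mk p) & exists2 i, i \in S & ca (mk p) = w i] &
  pairwise (@cdisj R) out] /\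
  (forall phi : R -> R, \sum_(c <- out) phi (ca c) * cb c =
     \sum_(i in S) (if kap i is Some k then phi (Li k) else 0) * h i).
Proof.
split; last first.
  move=> phi; rewrite big_map big_enum /=.
  by rewrite -(count (fun k => phi (Li k))).
split=> //.
- rewrite size_map -cardE; apply: leq_trans (max_card _) _.
  rewrite !card_prod card_ffun !card_ord /Cbox leq_mul2r; apply/orP; right.
  by apply: leq_mul => //; rewrite leq_pexp2l.
- move=> p; rewrite mem_enum => vp; rewrite /cw /ch /=.
  have [o1 o2] := off_le vp; have [j pj] := valid_tau vp.
  have o3 := tau_width j; rewrite -pj in o3.
  have [i iS ei] := LS (mem_nth 0 (ltn_ord p.1.2)).
  split=> //; [by split; lra| |by case/andP: vp|by exists i].
  have y0 : 0 <= yoff p.1.1 by apply: sumr_ge0.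
  split; first by lra.
  suff : yoff p.1.1 + b p.1.1 <= H by lra.
  apply: le_trans bH; rewrite [X in _ <= X](bigD1 p.1.1) //= [yoff _ + _]addrC lerD2l.
  rewrite [X in _ <= X](bigID (fun c0 => (enum_rank c0 < enum_rank p.1.1)%N)) /=.
  rewrite [X in _ <= X + _](eq_bigl (fun c0 => (enum_rank c0 < enum_rank p.1.1)%N)).
    by rewrite lerDl; apply: sumr_ge0.
  move=> c0; case: (boolP (enum_rank c0 < enum_rank p.1.1)%N) => h1; rewrite ?andbF ?andbT //.
  by apply/eqP => ee; rewrite ee ltnn in h1.
- rewrite pairwise_map; move: (enum_uniq valid); have : {subset enum valid <= valid} by move=> p; rewrite mem_enum.
  elim: (enum valid) => //= p s IH sub /andP[ps us]; apply/andP; split; last first.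
    by apply: IH us => p' p's; apply: sub; rewrite inE p's orbT.
  apply/allP => p' p's; apply: mk_apart; [apply: sub; rewrite inE eqxx //|apply: sub; rewrite inE p's orbT //|].
  by apply: contraNneq ps => ->.
Qed.

End Types.

Lemma box_conts : exists Lc : seq (cont R), [/\ (size Lc <= Cbox q G)%N,
  pall (fun c => [/\ cv c = false, X0 <= cx c /\ cx c + cw c <= X0 + W,
    Y0 <= cy c /\ cy c + ch c <= Y0 + H, 0 < cb c & exists2 i, i \in S & ca c = w i]) Lc,
  pairwise (@cdisj R) Lc,
  \sum_(c <- Lc) ca c * cb c <= \sum_(i in S) w i * h i &
  forall lam, 0 < lam -> \sum_(i in S | lam <= w i) h i - g <= \sum_(c <- Lc | lam <= ca c) cb c].
Proof.
have [L [kap [sL LS kapw dom]]] := rounded_lengths inbox hpos wlong dis W1 H1 H0 g0 Gg.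
have [n [e [d [d0 ed hlev]]]] := levels y hpos.
have [[s1 _ s2 s3] s4] := types_conts sL LS kapw d0 ed hlev.
eexists; split; [exact: s1| |exact: s3| |].
- elim: (enum _) s2 => //= p s IH s2; split; first by apply: s2; rewrite inE eqxx.
  by apply: IH => p' p's; apply: s2; rewrite inE p's orbT.
- rewrite (s4 (fun t => t)); apply: ler_sum => i iS; rewrite ler_wpM2r //; first exact: ltW (hpos iS).
  case ek: (kap i) => [k|]; [exact: kapw|exact: ltW (wpos iS)].
- move=> lam lam0; apply: le_trans (dom lam lam0) _.
  rewrite [X in _ <= X]big_mkcond /=.
  rewrite (eq_bigr (fun c => (if lam <= ca c then 1 else 0) * cb c)); last first.
    by move=> c _; case: ifP => _; rewrite ?mul1r ?mul0r.
  rewrite (s4 (fun t => if lam <= t then 1 else 0)) big_mkcondr /=.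
  apply: ler_sum => i iS; case ek: (kap i) => [k|]; last by rewrite mul0r.
  by case: ifP => _; rewrite ?mul1r ?mul0r.
Qed.

End BoxConts.

Lemma pall_all (X : Type) (P : X -> Prop) (b : pred X) s : (forall a, P a -> b a) -> pall P s -> all b s.
Proof. by move=> Pb; elim: s => //= a s IH [/Pb-> /IH->]. Qed.

Lemma pall_cat (X : Type) (P : X -> Prop) s t : pall P (s ++ t) <-> pall P s /\ pall P t.
Proof. by elim: s => [|a s IH] /=; [tauto | rewrite IH; tauto]. Qed.

Lemma pall_flatten (X : Type) (K : eqType) (Q : X -> Prop) (F : K -> seq X) (s : seq K) :
  (forall k, k \in s -> pall Q (F k)) -> pall Q (flatten [seq F k | k <- s]).
Proof.
elim: s => //= k s IH h; apply/pall_cat; split; first by apply: h; rewrite inE eqxx.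
by apply: IH => k' k's; apply: h; rewrite inE k's orbT.
Qed.

Lemma pairwise_flatten (X : Type) (K : eqType) (r : rel X) (P : K -> X -> Prop) (F : K -> seq X) (s : seq K) :
  uniq s -> (forall k, k \in s -> pall (P k) (F k) /\ pairwise r (F k)) ->
  (forall k k' a b, k \in s -> k' \in s -> k != k' -> P k a -> P k' b -> r a b) ->
  pairwise r (flatten [seq F k | k <- s]).
Proof.
elim: s => //= k s IH /andP[ks us] Fk dis.
rewrite pairwise_cat; apply/and3P; split.
- have [Pk _] := Fk k (mem_head _ _); apply: pall_all Pk => a Pa.
  apply: (@pall_all _ (fun b => r a b)) => //; apply: pall_flatten => k' k's.
  have k's' : k' \in k :: s by rewrite inE k's orbT.
  have [Pk' _] := Fk k' k's'; apply: pall_sub Pk' => b Pb.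
  apply: dis Pa Pb => //; first by rewrite inE eqxx.
  by apply: contraNneq ks => ->.
- by have [] := Fk k (mem_head _ _).
- apply: IH => // [k' k's|k' k'' a b k's k''s]; first by apply: Fk; rewrite inE k's orbT.
  by apply: dis; rewrite inE ?k's ?k''s orbT.
Qed.

(** * The structure of packings of long items *)

Section Long.
Variables (R : realType) (T : finType).
Implicit Types (x w y h : T -> R) (A B S : {set T}) (isH : pred T).

Definition ell w h isH i := if isH i then w i else h i.

Definition flipc (c : cont R) := Cont (ca c) (cb c) (cy c) (cx c) (~~ cv c).

Lemma box_any S x w y h isH (X0 W Y0 H g : R) (q G : nat) (b : bool) :
  (forall i, i \in S -> isH i = b) ->
  (forall i, i \in S -> [/\ X0 <= x i, x i + w i <= X0 + W, Y0 <= y i & y i + h i <= Y0 + H]) ->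
  (forall i, i \in S -> 0 < w i /\ 0 < h i) ->
  (forall i, i \in S -> 1 < ell w h isH i * q%:R) ->
  (forall i j, i \in S -> j \in S -> xover x w i j -> xover y h i j -> i = j) ->
  0 <= W <= 1 -> 0 <= H <= 1 -> 0 < g -> q%:R <= g * G%:R ->
  exists Lc : seq (cont R), [/\ (size Lc <= Cbox q G)%N,
    pall (fun c => [/\ X0 <= cx c /\ cx c + cw c <= X0 + W,
      Y0 <= cy c /\ cy c + ch c <= Y0 + H, 0 < cb c & exists2 i, i \in S & ca c = ell w h isH i]) Lc,
    pairwise (@cdisj R) Lc,
    \sum_(c <- Lc) ca c * cb c <= \sum_(i in S) w i * h i &
    forall lam, 0 < lam -> \sum_(i in S | lam <= ell w h isH i) thick w h isH i - g <=
       \sum_(c <- Lc | lam <= ca c) cb c].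
Proof.
move=> Sb inb pos long dis /andP[W0 W1] /andP[H0 H1] g0 Gg; case: b Sb => Sb.
  have ellw i : i \in S -> ell w h isH i = w i by move=> iS; rewrite /ell Sb.
  have thh i : i \in S -> thick w h isH i = h i by move=> iS; rewrite /thick Sb.
  have [||Lc [l1 l2 l3 l4 l5]] := @box_conts R T S x w y h X0 W Y0 H g q G inb _ _ dis W1 W0 H0 H1 g0 Gg.
  - by move=> i /pos[].
  - by move=> i iS; rewrite -ellw // long.
  exists Lc; split=> //.
  - apply: pall_sub l2 => c [_ ? ? ? [i iS ->]]; split=> //; exists i => //; exact/esym/ellw.
  - move=> lam lam0; apply: le_trans (l5 lam lam0); rewrite lerD2r le_eqVlt; apply/orP; left; apply/eqP.
    apply: eq_big => [i|i /andP[iS _]]; last exact: thh.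
    by case iS: (i \in S) => //=; rewrite ellw.
have ellw i : i \in S -> ell w h isH i = h i by move=> iS; rewrite /ell Sb.
have thh i : i \in S -> thick w h isH i = w i by move=> iS; rewrite /thick Sb.
have [||||Lc [l1 l2 l3 l4 l5]] := @box_conts R T S y h x w Y0 H X0 W g q G _ _ _ _ H1 H0 W0 W1 g0 Gg.
- by move=> i /inb[].
- by move=> i /pos[].
- by move=> i iS; rewrite -ellw // long.
- by move=> i j iS jS h1 h2; apply: dis.
exists (map flipc Lc); split.
- by rewrite size_map.
- apply/pall_map; apply: pall_sub l2 => c [e [a1 a2] [a3 a4] a5 [i iS ei]].
  move: a1 a2 a3 a4; rewrite /cw /ch /= e /= => a1 a2 a3 a4; split; [by []|by []|by []|].
  by exists i; rewrite //= ellw.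
- rewrite pairwise_map; elim: Lc l2 l3 {l1 l4 l5} => //= c Lc IH [[e _ _ _ _] al] /andP[dc pw].
  rewrite (IH al pw) andbT; elim: Lc al dc {IH pw} => //= c' Lc IH [[e' _ _ _ _] al] /andP[dc al'].
  rewrite IH // andbT; move: dc; rewrite /cdisj /cw /ch /= e e' /=.
  by case/or4P => ->; rewrite ?orbT.
- by rewrite big_map /=; apply: le_trans l4 _; rewrite le_eqVlt; apply/orP; left; apply/eqP/eq_bigr => i _; rewrite mulrC.
- move=> lam lam0; rewrite big_map /=; apply: le_trans (l5 lam lam0); rewrite lerD2r le_eqVlt; apply/orP; left; apply/eqP.
  apply: eq_big => [i|i /andP[iS _]]; last exact: thh.
  by case iS: (i \in S) => //=; rewrite ellw.
Qed.

(** The last clause is the condition on length thresholds with a deficit [eta * s], to be covered by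
    the strip that is left free above [1 - s / 4]. The area clause guarantees later that small items
    still find room. *)
Definition struct_ok w h isH (s eta : R) (C : nat) B (Lc : seq (cont R)) :=
  [/\ (size Lc <= C)%N,
      pall (fun c => [/\ 0 <= cx c /\ cx c + cw c <= 1, 0 <= cy c /\ cy c + ch c <= 1 - s / 4,
         0 < cb c & exists2 i, i \in B & ca c = ell w h isH i]) Lc,
      pairwise (@cdisj R) Lc,
      \sum_(c <- Lc) ca c * cb c <= \sum_(i in B) w i * h i &
      forall lam, 0 < lam -> \sum_(i in B | lam <= ell w h isH i) thick w h isH i - eta * s <=
       \sum_(c <- Lc | lam <= ca c) cb c].

Section Compressed.
Variables (x w y h : T -> R) (A : {set T}) (isH : pred T) (q M : nat) (delta s eta sigma : R).
Hypothesis pkd : packed x w y h A.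
Hypothesis Hlong : forall i, i \in A -> isH i -> 1 < w i * q%:R /\ h i <= delta.
Hypothesis Vlong : forall i, i \in A -> ~~ isH i -> 1 < h i * q%:R /\ w i <= delta.
Hypothesis top : forall i, i \in A -> y i + h i <= 1 - s.
Hypothesis q0 : (0 < q)%N.
Hypothesis eta0 : 0 < eta.
Hypothesis sigma0 : 0 < sigma.
Hypothesis ss : sigma <= s.
Hypothesis s1 : s <= 1.
Hypothesis Ms : 4 * q%:R <= sigma * M%:R.
Hypothesis delta0 : 0 <= delta.

Definition nK := #|{: bool * ('I_(Nb q M) * 'I_(Nb q M) * 'I_(Nb q M))}|.
(** Half of the deficit [eta * sigma] is shared among at most [nK] boxes; the other half pays for
    the items cut by the grid, see [delta_small]. *)
Definition gK := eta * sigma / (2 * nK.+1%:R).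
Definition GK := (Num.truncn (q%:R / gK)).+1.
Definition CK := (nK * Cbox q GK)%N.
Hypothesis delta_small : ((M + NX q M) * q)%:R * delta <= eta * sigma / 2.

Lemma compressed_struct : exists Lc, struct_ok w h isH s eta CK A Lc.
Proof.
have s0 : 0 < s by apply: lt_le_trans ss.
have Ms' : 4 * q%:R <= s * M%:R by apply: le_trans Ms _; rewrite ler_wpM2r ?ler0n.
have [B [y' [KS [BX [BW [BY [BH [f [BA dropB pkB inB [bnd dis]]]]]]]]]] :=
  boxes pkd Hlong Vlong top q0 s0 s1 Ms' delta0.
pose S k := [set i in B | f i == k].
have g0 : 0 < gK by rewrite /gK divr_gt0 ?mulr_gt0 // ltr0n.
have Gg : q%:R <= gK * GK%:R.
  by rewrite mulrC -ler_pdivrMr // /GK ltW // truncnS_gt.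
have uB i : i \in B -> in_unit x w y' h i by case: pkB => + _; apply.
have perbox k : exists Lc : seq (cont R), k \in KS -> [/\ (size Lc <= Cbox q GK)%N,
    pall (fun c => [/\ BX k <= cx c /\ cx c + cw c <= BX k + BW k,
      BY k <= cy c /\ cy c + ch c <= BY k + BH k, 0 < cb c & exists2 i, i \in S k & ca c = ell w h isH i]) Lc,
    pairwise (@cdisj R) Lc,
    \sum_(c <- Lc) ca c * cb c <= \sum_(i in S k) w i * h i &
    forall lam, 0 < lam -> \sum_(i in S k | lam <= ell w h isH i) thick w h isH i - gK <=
       \sum_(c <- Lc | lam <= ca c) cb c].
  have [kK|] := boolP (k \in KS); last by exists [::].
  have [b1 b2 b3 b4] := bnd k kK.
  have [E0|[i0 i0S]] := set_0Vmem (S k).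
    exists [::] => _; split=> //; first by rewrite E0 !big_nil big_set0.
    by move=> lam _; rewrite E0 big_nil big_pred0 => [|i]; [lra|rewrite inE].
  have inS i : i \in S k -> [/\ BX k <= x i, x i + w i <= BX k + BW k, BY k <= y' i & y' i + h i <= BY k + BH k].
    by rewrite inE => /andP[iB /eqP<-]; have [_ _ [? ?] [? ?]] := inB i iB.
  have posS i : i \in S k -> 0 < w i /\ 0 < h i.
    by rewrite inE => /andP[/uB[_ _ _ _ ?] _].
  have [i1 i2 i3 i4] := inS i0 i0S; have [i5 i6] := posS i0 i0S.
  have [|||||Lc hLc] := @box_any (S k) x w y' h isH (BX k) (BW k) (BY k) (BH k) gK q GK k.1 _ inS posS _ _ _ _ g0 Gg.
  - by move=> i; rewrite inE => /andP[iB /eqP<-]; have [_ -> _ _] := inB i iB.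
  - move=> i; rewrite inE => /andP[/(subsetP BA) Ai _]; rewrite /ell.
    by case: ifP => Hi; [case: (Hlong Ai Hi)|case: (Vlong Ai (negbT Hi))].
  - move=> i j; rewrite !inE => /andP[iB _] /andP[jB _]; case: pkB => _; apply=> //.
  - by apply/andP; split; lra.
  - by apply/andP; split; lra.
  by exists Lc.
have /fin_all_exists[F FP] := perbox.
exists (flatten [seq F k | k <- enum KS]).
have memK k : k \in enum KS -> k \in KS by rewrite mem_enum.
have sumS (phi : T -> R) : \sum_(i in B) phi i = \sum_(k <- enum KS) \sum_(i in S k) phi i.
  rewrite big_enum /= (partition_big f (mem KS)) /=; last by move=> i /inB[].
  by apply: eq_bigr => k _; apply: eq_bigl => i; rewrite inE.
have cK : (size (enum KS) <= nK)%N by rewrite -cardE; apply: max_card.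
split.
- rewrite size_flatten /shape -map_comp sumnE big_map /=.
  apply: (@leq_trans (\sum_(k <- enum KS) Cbox q GK)%N).
    by rewrite big_seq [X in (_ <= X)%N]big_seq; apply: leq_sum => k /memK kK; have [] := FP k kK.
  by rewrite big_const_seq count_predT iter_addn_0 /CK mulnC leq_mul2r cK orbT.
- apply: pall_flatten => k /memK kK; have [_ Fk _ _ _] := FP k kK; have [? ? ? ?] := bnd k kK.
  apply: pall_sub Fk => c [[? ?] [? ?] ? [i iS ei]]; split=> //; [split; lra|split; lra|].
  by exists i => //; apply: (subsetP BA); move: iS; rewrite inE => /andP[].
- apply: (@pairwise_flatten _ _ _ (fun k c => [/\ BX k <= cx c /\ cx c + cw c <= BX k + BW k,
      BY k <= cy c /\ cy c + ch c <= BY k + BH k, 0 < cb c & exists2 i, i \in S k & ca c = ell w h isH i])).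
  + exact: enum_uniq.
  + by move=> k /memK kK; have [] := FP k kK.
  move=> k k' c c' /memK kK /memK k'K kk' [[? ?] [? ?] _ _] [[? ?] [? ?] _ _].
  apply/negPn; rewrite !negb_or -!ltNge; apply/negP => /and4P[? ? ? ?].
  by move/eqP: kk'; apply; apply: dis => //; apply/andP; split; lra.
- rewrite big_flatten /= big_map.
  have areaA : \sum_(i in B) w i * h i <= \sum_(i in A) w i * h i.
    rewrite [X in _ <= X](big_setID B) /= (setIidPr BA) lerDl; apply: sumr_ge0 => i.
    rewrite inE => /andP[_ Ai]; case: pkd => /(_ i Ai)[_ _ _ _ [? ?]] _; apply: mulr_ge0; exact: ltW.
  apply: le_trans areaA; rewrite sumS big_seq [X in _ <= X]big_seq.
  by apply: ler_sum => k /memK kK; have [] := FP k kK.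
- move=> lam lam0; rewrite [X in _ <= X]big_mkcond big_flatten /= big_map.
  have thk i : i \in A -> 0 <= thick w h isH i by apply: (thick_ge0 isH pkd).
  have sA : \sum_(i in A | lam <= ell w h isH i) thick w h isH i <=
      \sum_(i in B) (if lam <= ell w h isH i then thick w h isH i else 0) + eta * sigma / 2.
    rewrite big_mkcondr /= (big_setID B) /= (setIidPr BA) lerD2l.
    apply: le_trans delta_small; apply: le_trans dropB; apply: ler_sum => i; rewrite inE => /andP[_ Ai].
    by case: ifP => // _; apply: thk.
  have sB : \sum_(i in B) (if lam <= ell w h isH i then thick w h isH i else 0) - nK%:R * gK <=
      \sum_(k <- enum KS) \sum_(c <- F k) (if lam <= ca c then cb c else 0).
    rewrite sumS; apply: (@le_trans _ _ (\sum_(k <- enum KS) (\sum_(i in S k)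
        (if lam <= ell w h isH i then thick w h isH i else 0) - gK))).
      rewrite sumrB lerD2l lerN2 big_const_seq count_predT iter_addr_0 -[gK *+ _]mulr_natl.
      by apply: ler_wpM2r; [exact: ltW|rewrite ler_nat].
    rewrite big_seq [X in _ <= X]big_seq; apply: ler_sum => k /memK kK.
    have [_ _ _ _ /(_ lam lam0)] := FP k kK; by rewrite big_mkcondr /= [X in _ <= X -> _]big_mkcond.
  have nkg : nK%:R * gK <= eta * sigma / 2.
    rewrite /gK; have n1 : 0 < 2 * nK.+1%:R :> R by rewrite mulr_gt0 // ltr0n.
    rewrite mulrA ler_pdivrMr // -[nK.+1%:R]natr1.
    have es : 0 < eta * sigma by apply: mulr_gt0.
    move: es; move: (eta * sigma) => b b0; move: (nK%:R : R) => n.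
    have -> : b / 2 * (2 * (n + 1)) = n * b + b by field.
    by rewrite lerDl ltW.
  have es : eta * sigma <= eta * s by apply: ler_wpM2l => //; exact: ltW.
  move: sA sB nkg es.
  move: (\sum_(i in B) _) (\sum_(k <- _) _) (nK%:R * gK) (eta * s) (eta * sigma) => u v z a b.
  move: (\sum_(i in A | _) _) => t. lra.
Qed.

End Compressed.

End Long.

Section LongStructure.
Variables (R : realType) (E q : nat) (eta : R).
Hypotheses (E0 : (0 < E)%N) (q0 : (0 < q)%N) (eta0 : 0 < eta).

(** The thin set [U] gets no container of its own; its thickness is charged to the deficit, which
    therefore doubles. *)
Lemma struct_add (T : finType) (w h : T -> R) (isH : pred T) s C (A U : {set T}) Lc :
  (forall i, i \in A :|: U -> 0 <= w i /\ 0 <= h i) -> [disjoint A & U] ->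
  \sum_(i in U) thick w h isH i <= eta * s ->
  struct_ok w h isH s eta C A Lc -> struct_ok w h isH s (2 * eta) C (A :|: U) Lc.
Proof.
move=> pos dAU Us [s1 s2 s3 s4 s5].
have posU i : i \in U -> 0 <= w i /\ 0 <= h i by move=> iU; apply: pos; rewrite inE iU orbT.
split=> //.
- by apply: pall_sub s2 => c [? ? ? [i iA ?]]; split=> //; exists i; rewrite // inE iA.
- rewrite (eq_bigl [predU A & U]); last by move=> i; rewrite !inE.
  rewrite bigU //=; apply: le_trans s4 _; rewrite lerDl; apply: sumr_ge0 => i /posU[? ?]; exact: mulr_ge0.
- move=> lam lam0; apply: le_trans (s5 lam lam0); rewrite big_mkcondr /=.
  rewrite (eq_bigl [predU A & U]); last by move=> i; rewrite !inE.
  rewrite bigU //= -big_mkcondr /=.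
  suff : \sum_(i in U) (if lam <= ell w h isH i then thick w h isH i else 0) <= eta * s.
    have -> : 2 * eta * s = eta * s + eta * s by ring.
    by rewrite opprD addrA lerD2r -addrA gerDl subr_le0.
  apply: le_trans Us; apply: ler_sum => i /posU[? ?]; rewrite /thick.
  by case: ifP => // _; case: ifP.
Qed.

Lemma struct_swap (T : finType) (w h : T -> R) (isH : pred T) s C (A : {set T}) Lc :
  struct_ok h w (predC isH) s eta C A Lc -> struct_ok w h isH s eta C A Lc.
Proof.
have e1 i : ell h w (predC isH) i = ell w h isH i by rewrite /ell /=; case: (isH i).
have e2 i : thick h w (predC isH) i = thick w h isH i by rewrite /thick /=; case: (isH i).
move=> [s1 s2 s3 s4 s5]; split=> //.
- by apply: pall_sub s2 => c [? ? ? [i iA ->]]; split=> //; exists i.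
- by apply: le_trans s4 _; rewrite le_eqVlt; apply/orP; left; apply/eqP/eq_bigr => i _; rewrite mulrC.
- move=> lam lam0; have := s5 lam lam0; congr (_ - _ <= _); apply: eq_big => i; first by rewrite e1.
  by rewrite e2.
Qed.

Lemma long_structure : exists (delta0 sigma : R) (C : nat), [/\ 0 < delta0, 0 < sigma &
  forall (T : finType) (x w y h : T -> R) (A : {set T}) (isH : pred T) (p : T -> nat),
  packed x w y h A ->
  (forall i, i \in A -> 1 < ell w h isH i * q%:R /\ thick w h isH i <= delta0) ->
  exists (B : {set T}) (s : R) Lc, [/\ B \subset A, (E * \sum_(i in A :\: B) p i <= 2 * \sum_(i in A) p i)%N,
    sigma <= s <= 1 & struct_ok w h isH s (2 * eta) C B Lc]].
Proof.
pose sigma := bet E q eta E.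
have sg0 : 0 < sigma by apply: bet_gt0.
pose M := (Num.truncn (4 * q%:R / sigma)).+1.
have Ms : 4 * q%:R <= sigma * M%:R.
  by rewrite [sigma * _]mulrC -ler_pdivrMr // ltW // truncnS_gt.
pose D : R := ((M + NX q M) * q)%:R.
pose d1 := eta * sigma / (2 * (D + 1)).
have D0 : 0 <= D by apply: ler0n.
have es0 : 0 < eta * sigma by apply: mulr_gt0.
have d10 : 0 < d1 by rewrite /d1 divr_gt0 // mulr_gt0 // ltr_wpDl.
pose dl := Num.min sigma d1.
have dl0 : 0 < dl by rewrite lt_min sg0.
exists dl, sigma, (CK q M eta sigma); split=> // T x w y h A isH p pkd lng.
have dD : D * dl <= eta * sigma / 2.
  apply: (@le_trans _ _ (D * d1)); first by rewrite ler_wpM2l // ge_min lexx orbT.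
  rewrite /d1 mulrA ler_pdivrMr ?mulr_gt0 // ?ltr_wpDl //.
  have -> : eta * sigma / 2 * (2 * (D + 1)) = D * (eta * sigma) + eta * sigma by field.
  by rewrite lerDl ltW.
have HH i : i \in A -> isH i -> 1 < w i * q%:R /\ h i <= dl.
  by move=> Ai Hi; have := lng i Ai; rewrite /ell /thick Hi.
have VV i : i \in A -> ~~ isH i -> 1 < h i * q%:R /\ w i <= dl.
  by move=> Ai Hi; have := lng i Ai; rewrite /ell /thick (negbTE Hi).
have dls : dl <= sigma by rewrite ge_min lexx.
have [||A2 [U [s [[A2A UA dAU dr] /andP[ss s1] Us alt]]]] := @contraction R E q eta E0 q0 eta0 T x w y h A isH p pkd.
- by move=> i Ai Hi; have [? ?] := HH i Ai Hi; split=> //; apply: le_trans dls.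
- by move=> i Ai Hi; have [? ?] := VV i Ai Hi; split=> //; apply: le_trans dls.
have [Lc hLc] : exists Lc, struct_ok w h isH s eta (CK q M eta sigma) A2 Lc.
  case: alt => [] [z pk top].
    apply: (compressed_struct pk (delta := dl)) => //; last exact: ltW.
      by move=> i /(subsetP A2A); apply: HH.
    by move=> i /(subsetP A2A); apply: VV.
  have [||||Lc hLc] := @compressed_struct R T y h z w A2 (predC isH) q M dl s eta sigma (packedC pk) _ _ top q0 eta0 sg0 ss s1 Ms.
  - by move=> i /(subsetP A2A); apply: VV.
  - by move=> i /(subsetP A2A) Ai; rewrite /= negbK; apply: HH.
  - exact: ltW.
  - exact: dD.
  by exists Lc; apply: struct_swap.
exists (A2 :|: U), s, Lc; split=> //.
- by rewrite subUset A2A.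
- by rewrite ss.
- apply: struct_add => // i; rewrite inE => iAU.
  have Ai : i \in A by case/orP: iAU => /subsetP; apply.
  by case: pkd => /(_ i Ai)[_ _ _ _ [? ?]] _; split; apply: ltW.
Qed.

End LongStructure.

(** Cavalieri over levels: within a level the widths add up to at most [W], and the levels that are
    cut at all add up to at most [H]. *)
Lemma area_le (R : realType) (T : finType) (A : {set T}) (x w y h : T -> R) X0 W Y0 H :
  0 <= W -> 0 <= H ->
  (forall i, i \in A -> [/\ X0 <= x i, x i + w i <= X0 + W, Y0 <= y i & y i + h i <= Y0 + H]) ->
  (forall i, i \in A -> 0 < w i /\ 0 < h i) ->
  (forall i j, i \in A -> j \in A -> xover x w i j -> xover y h i j -> i = j) ->
  \sum_(i in A) w i * h i <= W * H.
Proof.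
move=> W0 H0 bnd pos dis.
have [|n [e [d [d0 ed hl]]]] := @levels R T A y h; first by move=> i /pos[].
pose on j i := onlevel y h (e j) (d j) i.
pose J := [set j | [exists i in A, on j i]].
have rowle j : \sum_(i in A | on j i) w i <= (if j \in J then W else 0).
  case: ifPn => [_|]; last first.
    rewrite inE => /existsPn none; rewrite big_pred0 // => i.
    by case iA: (i \in A) => //=; apply/negbTE; have := none i; rewrite iA.
  rewrite (eq_bigl (fun i => i \in [set i in A | on j i])); last by move=> i; rewrite inE.
  have -> : W = (X0 + W) - X0 by ring.
  apply: (@sum_disjoint_intervals _ _ _ x w) => [|i|i i']; first by rewrite lerDl.
    by rewrite inE => /andP[iA _]; have [? ? _ _] := bnd i iA; have [? _] := pos i iA.
  rewrite !inE => /andP[iA /andP[o1 o2]] /andP[i'A /andP[o3 o4]] ii'.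
  have [?|h1] := leP (x i + w i) (x i'); first by left.
  have [?|h2] := leP (x i' + w i') (x i); first by right.
  exfalso; move/eqP: ii'; apply; apply: dis => //; first by rewrite /xover h1 h2.
  have dj := d0 j; apply/andP; split.
    by apply: le_lt_trans o1 (lt_le_trans _ o4); rewrite ltrDl.
  by apply: le_lt_trans o3 (lt_le_trans _ o2); rewrite ltrDl.
have JH : \sum_(j in J) d j <= H.
  have -> : H = (Y0 + H) - Y0 by ring.
  apply: (@sum_disjoint_intervals _ _ _ e d) => [|j|j j' _ _ jj']; first by rewrite lerDl.
    rewrite inE => /existsP[i /andP[iA /andP[o1 o2]]]; have [_ _ b1 b2] := bnd i iA.
    by split; [exact: le_trans o1|exact: le_trans b2|exact: d0].
  by have := ed _ _ jj'.
have -> : \sum_(i in A) w i * h i = \sum_j d j * \sum_(i in A | on j i) w i.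
  rewrite (eq_bigr (fun i => \sum_(j | on j i) w i * d j)); last by move=> i iA; rewrite [in LHS]hl // mulr_sumr.
  rewrite (exchange_big_dep xpredT) //=; apply: eq_bigr => j _.
  by rewrite mulr_sumr; apply: eq_bigr => i _; rewrite mulrC.
apply: (@le_trans _ _ (\sum_(j in J) d j * W)); last by rewrite -mulr_suml mulrC ler_wpM2l.
rewrite [X in _ <= X]big_mkcond; apply: ler_sum => j _.
apply: (@le_trans _ _ (d j * (if j \in J then W else 0))); first by rewrite ler_wpM2l // ltW.
by case: ifP; rewrite ?mulr0.
Qed.

Lemma area_conts (R : realType) (Lc : seq (cont R)) (H : R) : 0 <= H ->
  pall (fun c => [/\ 0 <= cx c /\ cx c + cw c <= 1, 0 <= cy c /\ cy c + ch c <= H & 0 < ca c /\ 0 < cb c]) Lc ->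
  pairwise (@cdisj R) Lc -> \sum_(c <- Lc) ca c * cb c <= H.
Proof.
move=> H0 al pw; pose c0 : cont R := Cont 0 0 0 0 false.
pose c (k : 'I_(size Lc)) := nth c0 Lc k.
have alk k : (k < size Lc)%N -> [/\ 0 <= cx (nth c0 Lc k) /\ cx (nth c0 Lc k) + cw (nth c0 Lc k) <= 1,
    0 <= cy (nth c0 Lc k) /\ cy (nth c0 Lc k) + ch (nth c0 Lc k) <= H & 0 < ca (nth c0 Lc k) /\ 0 < cb (nth c0 Lc k)].
  by elim: Lc al k {pw c} => //= c1 s IH [c1P al] [|k] // ks; apply: IH.
rewrite (big_nth c0) big_mkord.
rewrite (eq_bigl (fun k => k \in [set: 'I_(size Lc)])); last by move=> k; rewrite inE.
rewrite (eq_bigr (fun k => cw (c k) * ch (c k))); last first.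
  by move=> k _; rewrite /cw /ch -/(c k); case: (cv _) => //; rewrite mulrC.
rewrite -[H]mul1r; apply: (@area_le R _ [set: 'I_(size Lc)] (fun k => cx (c k)) (fun k => cw (c k)) (fun k => cy (c k)) (fun k => ch (c k)) 0 1 0 H) => // [i _|i _|i j _ _].
- by rewrite !add0r; have [[? ?] [? ?] _] := alk i (ltn_ord i); split.
- by have [_ _ [? ?]] := alk i (ltn_ord i); rewrite /= /cw /ch -/(c i); case: (cv _).
rewrite /xover /= => /andP[h1 h2] /andP[h3 h4]; apply/eqP/negPn/negP => ij.
have [lij|lji|e] := ltngtP i j; last by case/eqP: ij; apply: val_inj.
  move/(pairwiseP c0): pw => /(_ _ _ (ltn_ord i) (ltn_ord j) lij).
  by rewrite /cdisj -/(c i) -/(c j) !leNgt h1 h2 h3 h4.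
move/(pairwiseP c0): pw => /(_ _ _ (ltn_ord j) (ltn_ord i) lji).
by rewrite /cdisj -/(c i) -/(c j) !leNgt h1 h2 h3 h4.
Qed.

(** * Free grid cells for small items *)

Section Cells.
Variables (R : realType) (G : nat).
Hypothesis G0 : (0 < G)%N.

Lemma count_cells (X W : R) : 0 <= W ->
  #|[set i : 'I_G | (X < i.+1%:R / G%:R) && (i%:R / G%:R < X + W)]|%:R <= W * G%:R + 2.
Proof.
move=> W0; have g0 : 0 < G%:R :> R by rewrite ltr0n.
set B := [set i | _].
have sumB : \sum_(i in B) (G%:R^-1 : R) <= (X + W + G%:R^-1) - (X - G%:R^-1).
  have gi0 : 0 < G%:R^-1 :> R by rewrite invr_gt0.
  apply: (@sum_disjoint_intervals _ _ _ (fun i : 'I_G => i%:R / G%:R) (fun=> G%:R^-1)).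
  - by rewrite lerBlDr -addrA; rewrite -[X in X <= _]addr0 -addrA lerD2l !addr_ge0 // ltW.
  - move=> i; rewrite inE -natr1 mulrDl mul1r => /andP[h1 h2]; split=> //.
      by rewrite lerBlDr ltW.
    by rewrite lerD2r ltW.
  - move=> i j _ _ ij; have [lij|lji|e] := ltngtP i j; last by case/eqP: ij; apply: val_inj.
      by left; rewrite -[X in _ + X]mul1r -mulrDl natr1 ler_wpM2r ?ler_nat // ltW.
    by right; rewrite -[X in _ + X]mul1r -mulrDl natr1 ler_wpM2r ?ler_nat // ltW.
move: sumB; rewrite sumr_const -[_ *+ _]mulr_natl.
have -> : (X + W + G%:R^-1) - (X - G%:R^-1) = (W * G%:R + 2) * G%:R^-1 :> R.
  by field; rewrite gt_eqF.
by rewrite ler_pM2r // invr_gt0.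
Qed.

Definition cell (ij : 'I_G * 'I_G) : cont R :=
  Cont G%:R^-1 G%:R^-1 (ij.1%:R / G%:R) (ij.2%:R / G%:R) false.
Definition freecells (Lc : seq (cont R)) := [set ij | all (cdisj (cell ij)) Lc].

Lemma cell_touch (c : cont R) : 0 <= ca c -> 0 <= cb c ->
  #|[set ij | ~~ cdisj (cell ij) c]|%:R <= (ca c * G%:R + 2) * (cb c * G%:R + 2).
Proof.
move=> a0 b0; have g0 : 0 < G%:R :> R by rewrite ltr0n.
have -> : (ca c * G%:R + 2) * (cb c * G%:R + 2) = (cw c * G%:R + 2) * (ch c * G%:R + 2).
  by rewrite /cw /ch; case: (cv c); rewrite // mulrC.
have w0 : 0 <= cw c by rewrite /cw; case: ifP.
have h0 : 0 <= ch c by rewrite /ch; case: ifP.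
have sub : [set ij | ~~ cdisj (cell ij) c] \subset
    setX [set i : 'I_G | (cx c < i.+1%:R / G%:R) && (i%:R / G%:R < cx c + cw c)]
         [set i : 'I_G | (cy c < i.+1%:R / G%:R) && (i%:R / G%:R < cy c + ch c)].
  apply/subsetP => ij; rewrite !inE !negb_or -!ltNge /= -[ij.1.+1%:R]natr1 -[ij.2.+1%:R]natr1 !mulrDl !mul1r.
  by move=> /and4P[-> -> -> ->].
apply: le_trans (_ : _ <= #|setX _ _|%:R) _; first by rewrite ler_nat; apply: subset_leq_card sub.
rewrite cardsX natrM; apply: ler_pM; rewrite ?ler0n //; exact: count_cells.
Qed.

Lemma free_count (Lc : seq (cont R)) : pall (fun c => 0 <= ca c /\ 0 <= cb c) Lc ->
  G%:R * G%:R - \sum_(c <- Lc) (ca c * G%:R + 2) * (cb c * G%:R + 2) <= #|freecells Lc|%:R.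
Proof.
elim: Lc => [_|c Lc IH /= [[a0 b0] al]].
  rewrite big_nil subr0 /freecells (_ : [set _ | _] = setT); last by apply/setP => ij; rewrite !inE.
  by rewrite cardsT card_prod card_ord natrM.
rewrite big_cons; have := IH al; have := cell_touch a0 b0; set D := [set ij | ~~ _] => hD hL.
have : (#|freecells Lc| <= #|freecells (c :: Lc)| + #|D|)%N.
  apply: leq_trans (leq_card_setU _ _); apply: subset_leq_card; apply/subsetP => ij.
  by rewrite !inE /= => ->; case: (cdisj _ c).
rewrite -(ler_nat R) natrD => hc.
have h := le_trans hL (le_trans hc (lerD (lexx _) hD)).
by rewrite [X in _ - X]addrC opprD addrA lerBlDr.
Qed.

Lemma cell_disj (ij ij' : 'I_G * 'I_G) : ij != ij' -> cdisj (cell ij) (cell ij').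
Proof.
have g0 : 0 <= G%:R^-1 :> R by rewrite invr_ge0 ler0n.
have lt (i j : 'I_G) : (i < j)%N -> i%:R / G%:R + G%:R^-1 <= j%:R / G%:R :> R.
  by move=> hij; rewrite -[X in _ + X]mul1r -mulrDl natr1 ler_wpM2r ?ler_nat.
case: ij ij' => [i j] [i' j'] ne; rewrite /cdisj /=.
have [/lt->//|/lt->|ii] := ltngtP i i'; first by rewrite orbT.
have [/lt->|/lt->|jj] := ltngtP j j'; rewrite ?orbT //.
by case/eqP: ne; congr (_, _); apply: val_inj.
Qed.
End Cells.

(** The set is large enough to be divided into [E.+1] disjoint parts of size at least [L], and the
    cheapest of them is taken. A part chosen minimal exceeds [L] by at most the maximal single size
    [m]. *)
Lemma drop_bucket (R : realType) (T : finType) (a : T -> R) (p : T -> nat) (L m : R) E (S : {set T}) :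
  (forall i, i \in S -> 0 <= a i <= m) -> 0 <= m -> E.+1%:R * (L + m) <= \sum_(i in S) a i ->
  exists D : {set T}, [/\ D \subset S, L <= \sum_(i in D) a i & (E.+1 * \sum_(i in D) p i <= \sum_(i in S) p i)%N].
Proof.
move=> am m0; elim: E S am => [|E IH] S am.
  rewrite mul1r => h; exists S; split; rewrite ?mul1n //; apply: le_trans h; by rewrite lerDl.
move=> big.
have [Lneg|L0] := ltP (L + m) 0.
  by exists set0; rewrite sub0set !big_set0 muln0; split=> //; apply: le_trans (ltW Lneg); rewrite lerDl.
have PS : L <= \sum_(i in S) a i.
  apply: le_trans big; rewrite -natr1 mulrDl mul1r; apply: (@le_trans _ _ (L + m)); first by rewrite lerDl.
  by rewrite lerDr mulr_ge0.
have [D minD DS] := minset_exists (P := [pred D : {set T} | L <= \sum_(i in D) a i]) PS.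
have LD : L <= \sum_(i in D) a i by exact: (minsetp minD).
have Dmin (F : {set T}) : L <= \sum_(i in F) a i -> F \subset D -> F = D by case/minsetP: minD => _; apply.
have aD i : i \in D -> 0 <= a i <= m by move/(subsetP DS); apply: am.
have Dm : \sum_(i in D) a i <= L + m.
  have [D0|[i iD]] := set_0Vmem D; first by rewrite D0 big_set0.
  rewrite (big_setD1 i) //= addrC lerD //; last by have /andP[] := aD i iD.
  rewrite leNgt; apply/negP => /ltW h; have := Dmin _ h (subsetDl _ _).
  by move/setP/(_ i); rewrite !inE eqxx iD.
have splitS (f : T -> R) : \sum_(i in S) f i = \sum_(i in D) f i + \sum_(i in S :\: D) f i.
  by rewrite (big_setID D) /= (setIidPr DS).
have [||D' [D'S LD' pD']] := IH (S :\: D).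
- by move=> i; rewrite inE => /andP[_]; apply: am.
- have e : E.+2%:R * (L + m) = (L + m) + E.+1%:R * (L + m) by rewrite -[E.+2%:R]nat1r mulrDl mul1r.
  rewrite -(lerD2l (L + m)) -e; apply: le_trans big _; by rewrite splitS lerD2r.
have pS := sum_nat_setD p DS.
have [pp|/ltnW pp] := leqP (\sum_(i in D) p i)%N (\sum_(i in D') p i)%N.
  exists D; split=> //; rewrite pS mulSn leq_add2l; apply: leq_trans pD'.
  by rewrite leq_mul2l pp orbT.
exists D'; split=> //; first by apply: subset_trans D'S (subsetDl _ _).
by rewrite pS mulSn leq_add.
Qed.

(** * Packings of long and small items *)

Section Structure.
Variables (R : realType) (E q : nat).
Hypothesis q0 : (0 < q)%N.
(** Chosen so that [E.+1] buckets of area [5 * (eta * s)] take [s / 16]; together with another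
    [s / 16] for the granularity of small items this is the [s / 8] available when a bucket has to
    be dropped. *)
Let eta : R := (80 * E.+1%:R)^-1.

Let E0 : 0 < E.+1%:R :> R. Proof. by rewrite ltr0n. Qed.
Let eta0 : 0 < eta. Proof. by rewrite /eta invr_gt0 mulr_gt0. Qed.
Let Eeta : 80 * E.+1%:R * eta = 1. Proof. by rewrite /eta mulfV // mulf_neq0 // gt_eqF. Qed.
Let eta80 : 80 * eta <= 1.
Proof.
apply: (@le_trans _ _ (80 * E.+1%:R * eta)); last by rewrite Eeta.
by rewrite ler_pM2r // ler_peMr // ler1n.
Qed.

Definition lmax (T : finType) (w h : T -> R) i := Num.max (w i) (h i).
Definition tmin (T : finType) (w h : T -> R) i := Num.min (w i) (h i).
Definition isL (T : finType) (w h : T -> R) i := 1 < lmax w h i * q%:R.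
(** A small item is treated as if it had the length of a grid cell; its weight in [wt] is then the
    thickness which its area has at that length, so that both kinds obey the same threshold
    conditions. *)
Definition l' (G : nat) (T : finType) (w h : T -> R) i := if isL w h i then lmax w h i else G%:R^-1.
Definition wt (G : nat) (T : finType) (w h : T -> R) i := if isL w h i then tmin w h i else G%:R * (w i * h i).

(** The loss is two parts of the profit of the long items and one part of the small ones. [r] is
    quantified last, so it can still be raised to what the algorithm needs. [theta] is slack in
    every threshold condition, kept for rounding. *)
Lemma structure : exists (delta0 theta : R) (G C r0 : nat), [/\ 0 < delta0, 0 < theta, (q <= G)%N &
  forall r, (r0 <= r)%N -> forall (T : finType) (x w y h : T -> R) (A : {set T}) (p : T -> nat),
  (forall i, i \in A -> [/\ 0 <= x i /\ x i + w i <= 1, 0 <= y i /\ y i + h i <= 1, 0 <= w i & 0 <= h i]) ->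
  (forall i j, i \in A -> j \in A -> 0 < w i -> 0 < h i -> 0 < w j -> 0 < h j ->
     xover x w i j -> xover y h i j -> i = j) ->
  (forall i, i \in A -> isL w h i /\ tmin w h i <= delta0 \/ ~~ isL w h i /\ lmax w h i * r%:R <= 1) ->
  exists (X : {set T}) Lc, [/\ X \subset A /\ (E.+1 * \sum_(i in A :\: X) p i <= 3 * \sum_(i in A) p i)%N,
    (size Lc <= C)%N,
    pall (fun c => [/\ 0 <= cx c /\ cx c + cw c <= 1, 0 <= cy c /\ cy c + ch c <= 1, 0 < ca c /\ 0 < cb c &
       [\/ ca c = 1, ca c = G%:R^-1 | exists i, [/\ i \in A, isL w h i & ca c = lmax w h i]]]) Lc,
    pairwise (@cdisj R) Lc &
    forall lam, 0 < lam <= 1 -> \sum_(i in X | lam <= l' G w h i) wt G w h i + theta <= \sum_(c <- Lc | lam <= ca c) cb c]].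
Proof.
have [delta0 [sigma [C [dl0 sg0 LS]]]] := @long_structure R E.+1 q eta isT q0 eta0.
have es0 : 0 < eta * sigma by apply: mulr_gt0.
pose G := ((Num.truncn (8 * C.+1%:R / (eta * sigma))).+1 + q)%N.
have G0 : (0 < G)%N by rewrite /G addSn.
have g0 : 0 < G%:R :> R by rewrite ltr0n.
have Gbig : 8 * C.+1%:R <= eta * sigma * G%:R.
  rewrite [eta * sigma * _]mulrC -ler_pdivrMr // ltW //; apply: lt_le_trans (truncnS_gt _) _.
  by rewrite ler_nat leq_addr.
have qG : (q <= G)%N by rewrite leq_addl.
pose r0 := (Num.truncn (16 * E.+1%:R / sigma)).+1.
exists delta0, (eta * sigma), G, (C.+1 + G * G)%N, r0; split=> // r rr T x w y h A p bnd dis cls.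
have rbig : 16 * E.+1%:R <= sigma * r%:R.
  rewrite [sigma * _]mulrC -ler_pdivrMr // ltW //; apply: lt_le_trans (truncnS_gt _) _.
  by rewrite ler_nat.
have r0' : 0 < r%:R :> R.
  by rewrite -(pmulr_rgt0 _ sg0); apply: lt_le_trans rbig; rewrite mulr_gt0.
pose isH i := h i <= w i.
have ellE i : ell w h isH i = lmax w h i.
  by rewrite /ell /isH /lmax; case: (leP (h i) (w i)).
have thE i : thick w h isH i = tmin w h i.
  by rewrite /thick /isH /tmin; case: (leP (h i) (w i)).
pose Lp := [set i in A | [&& isL w h i, 0 < w i & 0 < h i]].
(* Long items of thickness zero stand outside the geometric argument but weigh nothing, so they are
   kept. *)
pose Z := [set i in A | isL w h i && ~~ ((0 < w i) && (0 < h i))].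
pose Sm := [set i in A | ~~ isL w h i].
have pkd : packed x w y h Lp.
  split=> [i|i j]; first by rewrite inE => /and4P[/bnd[[? ?] [? ?] ? ?] _ ? ?]; split.
  by rewrite !inE => /and4P[iA _ ? ?] /and4P[jA _ ? ?]; apply: dis.
have [i|B [s [Lc [BL pB /andP[ss s1] [c1 c2 c3 c4 c5]]]]] := LS T x w y h Lp isH p pkd.
  rewrite inE ellE thE => /and4P[iA iL _ _]; have [[_ ?]|[]] := cls i iA; last by rewrite iL.
  by split.
have s0 : 0 < s by apply: lt_le_trans ss.
have ess : eta * sigma <= eta * s by apply: ler_wpM2l => //; exact: ltW.
have Bpos i : i \in B -> 0 < w i /\ 0 < h i by move/(subsetP BL); rewrite inE => /and4P[].
have BLg i : i \in B -> i \in A /\ isL w h i by move/(subsetP BL); rewrite inE => /and4P[].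
have es80 : 80 * (eta * s) <= s by rewrite mulrA ler_piMl // ltW.
(* A container of full length in the strip above [1 - s / 4]. Being longest it counts for every
   threshold: [2 * (eta * s)] covers the deficit, and the rest is at least [theta]. *)
pose st := Cont 1 (4 * (eta * s)) 0 (1 - s / 4) false.
have es0' : 0 < eta * s by apply: mulr_gt0.
have lenpos i : isL w h i -> 0 < lmax w h i.
  rewrite /isL => h1; rewrite ltNge; apply/negP => h2.
  by move: h1; rewrite ltNge => /negP; apply; apply: (@le_trans _ _ 0); rewrite // mulr_le0_ge0 // ler0n.
have LcP : pall (fun c => [/\ 0 <= cx c /\ cx c + cw c <= 1, 0 <= cy c /\ cy c + ch c <= 1 - s / 4, 0 < ca c /\ 0 < cb c &
    exists i, [/\ i \in A, isL w h i & ca c = lmax w h i]]) Lc.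
  apply: pall_sub c2 => c [? ? ? [i iB e]]; have [iA iL] := BLg i iB.
  by split=> //; [split=> //; rewrite e ellE; apply: lenpos|exists i; rewrite -ellE].
have stP : pairwise (@cdisj R) (st :: Lc).
  rewrite /= c3 andbT; apply: pall_all LcP => c [_ [_ h1] _ _].
  by rewrite /cdisj /= h1 !orbT.
pose Lf := [seq @cell R G ij | ij <- enum (@freecells R G (st :: Lc))].
have cat_ij ij : ij \in enum (@freecells R G (st :: Lc)) -> all (cdisj (@cell R G ij)) (st :: Lc).
  by rewrite mem_enum inE.
have pwf : pairwise (@cdisj R) ((st :: Lc) ++ Lf).
  rewrite pairwise_cat stP andTb allrelC /Lf /allrel all_map pairwise_map; apply/andP; split.
    apply/allP => ij /cat_ij /= /andP[al1 al2]; rewrite cdisjC al1 /=.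
    by rewrite (eq_all (a2 := cdisj (cell R ij))) // => c; rewrite cdisjC.
  apply: (@sub_in_pairwise _ xpredT (fun ij ij' => ij != ij')).
  - by move=> ij ij' _ _; apply: cell_disj.
  - by apply/allP.
  - by rewrite -uniq_pairwise enum_uniq.
have stb : 4 * (eta * s) <= s / 8 by lra.
have inC : pall (fun c => [/\ 0 <= cx c /\ cx c + cw c <= 1, 0 <= cy c /\ cy c + ch c <= 1 & 0 < ca c /\ 0 < cb c]) (st :: Lc).
  split; first by rewrite /cw /ch /=; split; split; lra.
  apply: pall_sub LcP => c [? [? h1] ? _]; split=> //; split=> //; apply: le_trans h1 _; lra.
set F : R := #|@freecells R G (st :: Lc)|%:R.
pose aL := \sum_(c <- Lc) ca c * cb c; pose aS := \sum_(i in Sm) w i * h i.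
(* The lost area is [4 * (eta * s)] for the strip and at most [eta * s] for cells cut by the borders
   of the [C.+1] containers, the latter by the choice of [G]. *)
have GF : G%:R * G%:R * (1 - 5 * (eta * s) - aL) <= F.
  have := free_count G0 (pall_sub (fun c cP => conj (ltW (proj1 (let: And3 _ _ d := cP in d))) (ltW (proj2 (let: And3 _ _ d := cP in d)))) inC).
  apply: le_trans.
  have g1 : 1 <= G%:R :> R by rewrite ler1n.
  have tot : \sum_(c <- st :: Lc) (ca c * G%:R + 2) * (cb c * G%:R + 2) <=
      G%:R * G%:R * \sum_(c <- st :: Lc) ca c * cb c + 8 * G%:R * (size (st :: Lc))%:R.
    elim: (st :: Lc) inC => [|c t IH]; first by rewrite !big_nil mulr0 mulr0 addr0.
    rewrite !big_cons [pall _ _]/= => -[[[x0 x1] [y0 y1] [a0 b0]] /IH {}IH].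
    have [a1 b1] : ca c <= 1 /\ cb c <= 1.
      have [w1 h1] : cw c <= 1 /\ ch c <= 1.
        by split; [apply: le_trans x1|apply: le_trans y1]; rewrite lerDr.
      by move: w1 h1; rewrite /cw /ch; case: (cv c).
    have es : 8 * G%:R * (size (c :: t))%:R = 8 * G%:R + 8 * G%:R * (size t)%:R :> R.
      by rewrite /= -[(size t).+1%:R]nat1r mulrDr mulr1.
    rewrite es [G%:R * G%:R * (_ + _)]mulrDr addrACA; apply: lerD IH.
    have := ler_wpM2r (ler0n R G) a1; have := ler_wpM2r (ler0n R G) b1.
    move: (G%:R : R) g1 => g g1 hb ha.
    have -> : (ca c * g + 2) * (cb c * g + 2) = g * g * (ca c * cb c) + (2 * (ca c * g) + 2 * (cb c * g) + 4) by ring.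
    by rewrite lerD2l; lra.
  have sz : 8 * G%:R * (size (st :: Lc))%:R <= G%:R * G%:R * (eta * s) :> R.
    apply: (@le_trans _ _ (8 * G%:R * C.+1%:R)).
      by apply: ler_wpM2l; [rewrite mulr_ge0|rewrite ler_nat /= ltnS].
    have -> : 8 * G%:R * C.+1%:R = G%:R * (8 * C.+1%:R) :> R by ring.
    rewrite -[G%:R * G%:R * _]mulrA ler_pM2l // [G%:R * _]mulrC; apply: le_trans Gbig _.
    by rewrite ler_pM2r.
  have sE : \sum_(c <- st :: Lc) ca c * cb c = 4 * (eta * s) + aL by rewrite big_cons /= mul1r.
  move: tot sz; rewrite sE.
  move: (\sum_(c <- st :: Lc) _) (8 * _ * _) (G%:R * G%:R) => t u g2 h1 h2.
  have -> : g2 * (1 - 5 * (eta * s) - aL) = g2 - (g2 * (4 * (eta * s) + aL) + g2 * (eta * s)) by ring.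
  by rewrite lerD2l lerN2; apply: le_trans h1 _; rewrite lerD2l.
have areaA : \sum_(i in A) w i * h i <= 1.
  rewrite (bigID (fun i => (0 < w i) && (0 < h i))) /= [X in _ + X]big1 ?addr0; last first.
    move=> i /andP[/bnd[_ _ w0 h0]]; rewrite negb_and -!leNgt => /orP[h1|h1].
      by rewrite (_ : w i = 0) ?mul0r //; apply/le_anti/andP.
    by rewrite (_ : h i = 0) ?mulr0 //; apply/le_anti/andP.
  rewrite (eq_bigl (fun i => i \in [set i in A | (0 < w i) && (0 < h i)])); last by move=> i; rewrite inE.
  rewrite -[X in _ <= X]mulr1; apply: (@area_le R T _ x w y h 0 1 0 1) => // [i|i|i j].
  - by rewrite inE !add0r => /andP[/bnd[[? ?] [? ?] _ _] _]; split.
  - by rewrite inE => /andP[_ /andP[]].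
  - by rewrite !inE => /and3P[iA ? ?] /and3P[jA ? ?]; apply: dis.
have wh0 i : i \in A -> 0 <= w i * h i by move=> /bnd[_ _ ? ?]; apply: mulr_ge0.
have areaLS : aL + aS <= 1.
  have AS : A :&: Sm = Sm by apply/setIidPr/subsetP => i; rewrite inE => /andP[].
  apply: le_trans areaA; rewrite [X in _ <= X](big_setID Sm) /= AS [aL + _]addrC /aS lerD2l; apply: le_trans c4 _.
  rewrite [X in _ <= X](big_setID B) /= (setIidPr _); last first.
    by apply/subsetP => i iB; have [? iL] := BLg i iB; rewrite !inE iL andbF.
  by rewrite lerDl; apply: sumr_ge0 => i; rewrite !inE => /andP[_ /andP[_]]; apply: wh0.
have areaL4 : aL <= 1 - s / 4.
  apply: area_conts c3; first by lra.
  by apply: pall_sub LcP => c [].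
have SmA i : i \in Sm -> i \in A /\ ~~ isL w h i by rewrite inE => /andP[].
(* If the small items have area at most [s / 8], the space above the containers suffices for all of
   them; otherwise a cheap bucket of area [5 * (eta * s)] is dropped to make up for the lost
   cells. *)
have [Sm' [SmS pS aS']] : exists Sm' : {set T}, [/\ Sm' \subset Sm,
    (E.+1 * \sum_(i in Sm :\: Sm') p i <= \sum_(i in Sm) p i)%N &
    \sum_(i in Sm') w i * h i <= 1 - 5 * (eta * s) - aL].
  have [aS8|aS8] := leP aS (s / 8).
    exists Sm; split=> //; first by rewrite setDv big_set0 muln0.
    apply: le_trans aS8 _; rewrite lerBrDr lerBrDr.
    have h5 : 5 * (eta * s) <= s / 16 by lra.
    by apply: le_trans (lerD (lerD (lexx _) areaL4) h5) _; lra.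
  have [|||D [DS LD pD]] := @drop_bucket R T (fun i => w i * h i) p (5 * (eta * s)) r%:R^-1 E Sm _ _ _.
  - move=> i /SmA[iA iS]; rewrite wh0 //=; have [[]|[_ lr]] := cls i iA; first by move=> iL; rewrite iL in iS.
    have [_ [y0 y1] w0 h0] := bnd i iA.
    have hh1 : h i <= 1 by apply: le_trans y1; rewrite lerDr.
    apply: (@le_trans _ _ (lmax w h i)); last by rewrite -[_^-1]mul1r ler_pdivlMr.
    by apply: (@le_trans _ _ (w i)); [rewrite ler_piMr|rewrite /lmax le_max lexx].
  - by rewrite invr_ge0 ltW.
  - apply: le_trans (ltW aS8); have er : E.+1%:R * r%:R^-1 <= s / 16.
      rewrite ler_pdivrMr // mulrAC ler_pdivlMr // mulrC; apply: le_trans rbig _.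
      by rewrite ler_pM2r.
    have e5 : E.+1%:R * (5 * (eta * s)) = s / 16.
      have -> : s / 16 = (80 * E.+1%:R * eta) * s / 16 by rewrite Eeta mul1r.
      by field.
    have -> : s / 8 = s / 16 + s / 16 by field.
    by rewrite mulrDr e5 lerD2l.
  exists (Sm :\: D); split; first exact: subsetDl.
    by rewrite setDDr setDv set0U (setIidPr DS).
  have eS : aS = \sum_(i in D) w i * h i + \sum_(i in Sm :\: D) w i * h i by rewrite /aS (big_setID D) /= (setIidPr DS).
  rewrite lerBrDr lerBrDr; apply: le_trans areaLS; rewrite eS.
  by rewrite [_ + aL]addrC -addrA lerD2l [_ + 5 * _]addrC lerD2r.
exists (B :|: (Z :|: Sm')), ((st :: Lc) ++ Lf); split.
- split.
    rewrite !subUset; apply/and3P; split; apply/subsetP => i.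
    + by move/BLg => [].
    + by rewrite inE => /andP[].
    + by move/(subsetP SmS)/SmA => [].
  have sub : A :\: (B :|: (Z :|: Sm')) \subset (Lp :\: B) :|: (Sm :\: Sm').
    apply/subsetP => i; rewrite !inE !negb_or !negb_and => /andP[/and3P[-> h1 ->] iA].
    by move: h1; rewrite iA /=; case: (isL w h i); case: (0 < w i); case: (0 < h i).
  apply: (@leq_trans (E.+1 * (\sum_(i in Lp :\: B) p i + \sum_(i in Sm :\: Sm') p i))%N).
    by rewrite leq_mul2l /=; apply: leq_trans (sum_nat_sub p sub) (sum_nat_setU _ _ _).
  have pL : (\sum_(i in Lp) p i <= \sum_(i in A) p i)%N by apply: sum_nat_sub; apply/subsetP => i; rewrite inE => /andP[].
  have pSm : (\sum_(i in Sm) p i <= \sum_(i in A) p i)%N by apply: sum_nat_sub; apply/subsetP => i; rewrite inE => /andP[].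
  rewrite mulnDr (_ : 3 = 2 + 1)%N // mulnDl mul1n; apply: leq_add.
    by apply: leq_trans pB _; rewrite leq_mul2l pL orbT.
  exact: leq_trans pS pSm.
- rewrite size_cat /= size_map -cardE ; apply: (@leq_add _ _ C.+1); first by rewrite ltnS.
  by apply: leq_trans (max_card _) _; rewrite card_prod card_ord.
- apply/pall_cat; split; first split.
  + by case: inC => -[? ? ?] _; split=> //; constructor 1.
  + by apply: pall_sub LcP => c [? [? h1] ? ?]; split=> //; [split=> //; apply: le_trans h1 _; lra|constructor 3].
  + apply/pall_map; elim: (enum _) => //= ij u IH; split=> //.
    have gi : 0 < G%:R^-1 :> R by rewrite invr_gt0.
    have cb1 (k : 'I_G) : 0 <= k%:R / G%:R :> R /\ k%:R / G%:R + G%:R^-1 <= 1 :> R.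
      split; first by rewrite divr_ge0 ?ler0n.
      by rewrite -[X in _ + X]mul1r -mulrDl natr1 ler_pdivrMr // mul1r ler_nat.
    by rewrite /cell /cw /ch /=; split; [exact: cb1|exact: cb1|by []|constructor 2].
- by [].
move=> lam /andP[lam0 lam1].
have mon i : i \in B -> lmax w h i <= 1.
  move=> /BLg[/bnd[[x0 x1] [y0 y1] _ _] _]; rewrite /lmax ge_max; apply/andP; split.
    by apply: le_trans x1; rewrite lerDr.
  by apply: le_trans y1; rewrite lerDr.
have dBU : [disjoint B & Z :|: Sm'].
  apply/pred0P => i /=; apply/negP => /andP[iB]; have [_ iL] := BLg i iB; have [w0 h0] := Bpos i iB.
  by rewrite !inE iL w0 h0 /= andbF /= => /(subsetP SmS)/SmA[_]; rewrite iL.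
have dZ : [disjoint Z & Sm'].
  apply/pred0P => i /=; apply/negP => /andP[]; rewrite inE => /and3P[_ iL _] /(subsetP SmS)/SmA[_].
  by rewrite iL.
have sumX : \sum_(i in B :|: (Z :|: Sm') | lam <= l' G w h i) wt G w h i =
    \sum_(i in B | lam <= ell w h isH i) thick w h isH i + (if lam <= G%:R^-1 then G%:R * \sum_(i in Sm') w i * h i else 0).
  rewrite big_mkcondr /= (eq_bigl [predU B & Z :|: Sm']); last by move=> i; rewrite !inE.
  rewrite bigU //= [X in _ + X = _](eq_bigl [predU Z & Sm']); last by move=> i; rewrite !inE.
  rewrite bigU //= [X in _ + (X + _)]big1 ?add0r; last first.
    move=> i; rewrite inE => /and3P[iA iL ne]; rewrite /wt iL; have [_ _ w0 h0] := bnd i iA.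
    have -> : tmin w h i = 0; last by case: ifP.
    move: ne; rewrite negb_and -!leNgt /tmin => /orP[h1|h1]; apply/le_anti; rewrite ge_min le_min w0 h0 h1 ?orbT //.
  rewrite [X in _ = X + _]big_mkcondr /=; congr (_ + _).
    by apply: eq_bigr => i /BLg[_ iL]; rewrite /l' /wt iL ellE thE.
  rewrite (eq_bigr (fun i => if lam <= G%:R^-1 then G%:R * (w i * h i) else 0)); last first.
    by move=> i /(subsetP SmS)/SmA[_ iS]; rewrite /l' /wt (negbTE iS).
  by case: ifP => _; [rewrite mulr_sumr|rewrite big1].
have sumC : \sum_(c <- (st :: Lc) ++ Lf | lam <= ca c) cb c =
    4 * (eta * s) + \sum_(c <- Lc | lam <= ca c) cb c + (if lam <= G%:R^-1 then F / G%:R else 0).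
  rewrite big_cat big_cons /= lam1; congr (_ + _); rewrite /Lf big_map /=.
  case: ifP => _; last by rewrite big_pred0.
  by rewrite big_const_seq count_predT iter_addr_0 -cardE -[_ *+ _]mulr_natl.
rewrite sumX sumC; have h5 := c5 lam lam0.
have base : \sum_(i in B | lam <= ell w h isH i) thick w h isH i + eta * sigma <= 4 * (eta * s) + \sum_(c <- Lc | lam <= ca c) cb c.
  move: h5; have -> : 2 * eta * s = 2 * (eta * s) by ring.
  move: ess es0'; move: (eta * sigma) (eta * s) (\sum_(i in B | _) _) (\sum_(c <- Lc | _) _) => ? ? ? ?; lra.
rewrite addrAC; apply: lerD base _; case: ifP => // _.
rewrite ler_pdivlMr // mulrC mulrA; apply: le_trans GF.
by rewrite ler_pM2l // mulr_gt0.
Qed.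
End Structure.

(* Length, thickness, whether the length is vertical, lower-left corner.  In an
   instance of size [N] the unit is [1/M] with [M = G * m], so the knapsack has
   side [N * M]. *)
Definition nbox := (nat * nat * bool * (nat * nat))%type.
Definition blen (c : nbox) := c.1.1.1.
Definition bth (c : nbox) := c.1.1.2.
Definition bvert (c : nbox) := c.1.2.
Definition bx (c : nbox) := c.2.1.
Definition bby (c : nbox) := c.2.2.
Definition bw (c : nbox) := if bvert c then bth c else blen c.
Definition bh (c : nbox) := if bvert c then blen c else bth c.
Definition bdisj (c c' : nbox) :=
  [|| bx c + bw c <= bx c', bx c' + bw c' <= bx c, bby c + bh c <= bby c' | bby c' + bh c' <= bby c]%N.
Definition binside (K : nat) (c : nbox) := ((bx c + bw c <= K) && (bby c + bh c <= K))%N.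

(* Kind of length (the full side, a grid cell, the length of a guessed item),
   thickness in multiples of [N], whether the length is vertical, and two masks:
   the corner is the sum of the widths, resp. heights, of the selected
   containers. *)
Definition spec := (nat * nat * bool * (bitseq * bitseq))%type.
Definition slen (G m N : nat) (sa : spec * nat) : nat :=
  match sa.1.1.1.1 with 0 => N * (G * m) | 1 => N * m | _ => G * m * sa.2 end%N.
Definition sth (N : nat) (sa : spec * nat) : nat := (sa.1.1.1.2 * N)%N.
Definition sw G m N (sa : spec * nat) := if sa.1.1.2 then sth N sa else slen G m N sa.
Definition sh G m N (sa : spec * nat) := if sa.1.1.2 then slen G m N sa else sth N sa.
Definition nconts G m N (l : seq (spec * nat)) : seq nbox :=
  [seq (slen G m N sa, sth N sa, sa.1.1.2,
        (sumn (mask sa.1.2.1 (map (sw G m N) l)), sumn (mask sa.1.2.2 (map (sh G m N) l)))) | sa <- l].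

Definition ll (it : item) := maxn (iw it) (ih it).
Definition tt (it : item) := minn (iw it) (ih it).
Definition islong (q N : nat) (it : item) := (N < ll it * q)%N.
Definition nl (q G m N : nat) (it : item) : nat := (if islong q N it then G * m * ll it else N * m)%N.
Definition nwt (q G m N : nat) (it : item) : nat :=
  (if islong q N it then G * m * N * tt it else G * m * G * (iw it * ih it))%N.

(** * Container corners as subset sums *)

Lemma compact1 (R : realType) (n : nat) (x w y h : 'I_n -> R) :
  (forall i, 0 < h i /\ 0 <= y i) ->
  exists (y' : 'I_n -> R) (b : 'I_n -> pred 'I_n), [/\ forall i, 0 <= y' i <= y i,
    forall i j, xover x w i j -> y i + h i <= y j -> y' i + h i <= y' j &
    forall i, y' i = \sum_(j | b i j) h j].
Proof.
move=> hy; have [|y' [y1 y2 y3]] := @compaction R 'I_n x w y h setT; first by move=> i _; apply: hy.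
have ch (i : 'I_n) : exists s : seq 'I_n, uniq s /\ y' i = \sum_(j <- s) h j.
  have [|j _|s [_ ps ->]] := @compaction_chain R _ x w y h setT y' _ _ i (in_setT i).
  - by move=> j _; have [] := hy j.
  - by apply: y3; rewrite inE.
  exists s; split=> //.
  have : path (fun i j => y j < y i) i s.
    apply: sub_path ps => j k /andP[_ h1]; apply: lt_le_trans h1.
    by rewrite ltrDl; have [] := hy k.
  move/path_sorted; apply: sorted_uniq => [k j l|j]; first by move=> h1 h2; exact: lt_trans h2 h1.
  by rewrite ltxx.
have /fin_all_exists[s sP] := ch.
exists y', (fun i j => j \in s i); split=> [i|i j xo yy|i].
- by apply: y1; rewrite inE.
- by apply: y2; rewrite ?inE // /below xo.
- have [us ->] := sP i; exact: big_uniq.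
Qed.

(** First [y] is compacted for fixed [x], then [x] for the new [y]. A pair separated in the
    direction being compacted either keeps its order there or is separated in the other
    direction. *)
Lemma compact2 (R : realType) (n : nat) (x w y h : 'I_n -> R) :
  (forall i, [/\ 0 < w i, 0 < h i, 0 <= x i & 0 <= y i]) ->
  (forall i j, i != j -> [|| x i + w i <= x j, x j + w j <= x i, y i + h i <= y j | y j + h j <= y i]) ->
  exists (x' y' : 'I_n -> R) (bx by_ : 'I_n -> pred 'I_n),
  [/\ forall i, 0 <= x' i <= x i /\ 0 <= y' i <= y i,
    forall i j, i != j -> [|| x' i + w i <= x' j, x' j + w j <= x' i, y' i + h i <= y' j | y' j + h j <= y' i],
    forall i, x' i = \sum_(j | bx i j) w j & forall i, y' i = \sum_(j | by_ i j) h j].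
Proof.
move=> pos dis.
have [|y' [b1 [y1 y2 y3]]] := @compact1 R n x w y h; first by move=> i; have [] := pos i.
have dis1 i j : i != j -> [|| x i + w i <= x j, x j + w j <= x i, y' i + h i <= y' j | y' j + h j <= y' i].
  move=> /dis /or4P[->//|->|h1|h1]; rewrite ?orbT //.
    have [//|] := boolP (xover x w i j); first by move=> xo; rewrite y2 ?orbT.
    by rewrite /xover negb_and -!leNgt => /orP[->|->]; rewrite ?orbT.
  have [|] := boolP (xover x w j i); first by move=> xo; rewrite (y2 j i) ?orbT.
  by rewrite /xover negb_and -!leNgt => /orP[->|->]; rewrite ?orbT.
have [|x' [b2 [x1 x2 x3]]] := @compact1 R n y' h x w; first by move=> i; have [] := pos i.
exists x', y', b2, b1; split=> // i j /dis1 /or4P[h1|h1|->|->]; rewrite ?orbT //.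
  have [|] := boolP (xover y' h i j); first by move=> xo; rewrite x2.
  by rewrite /xover negb_and -!leNgt => /orP[->|->]; rewrite ?orbT.
have [|] := boolP (xover y' h j i); first by move=> xo; rewrite (x2 j i) ?orbT.
by rewrite /xover negb_and -!leNgt => /orP[->|->]; rewrite ?orbT.
Qed.

Lemma sumn_mask (T : eqType) (b : pred T) (f : T -> nat) (s : seq T) :
  sumn (mask (map b s) (map f s)) = (\sum_(j <- s | b j) f j)%N.
Proof. by rewrite -map_mask -filter_mask sumnE big_map big_filter. Qed.

Lemma pall_nth (X : Type) (P : X -> Prop) (d : X) s k : pall P s -> (k < size s)%N -> P (nth d s k).
Proof. by elim: s k => //= a s IH [|k] [Pa al] // ks; apply: IH. Qed.

(** Thicknesses are rounded down to multiples of [1/M] while lengths stay exact. Compacting the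
    shrunken containers makes each corner a sum of their own widths or heights, which the masks
    record; so the corners need not be guessed as numbers. *)
Lemma nconts_real (R : realType) (G m N : nat) (Lc : seq (cont R)) (srcs : 'I_(size Lc) -> nat * nat) :
  (0 < N)%N -> (0 < G * m)%N ->
  pall (fun c => [/\ 0 <= cx c /\ cx c + cw c <= 1, 0 <= cy c /\ cy c + ch c <= 1, 0 < ca c & 1 <= cb c * (G * m)%:R]) Lc ->
  pairwise (@cdisj R) Lc ->
  (forall (j : 'I_(size Lc)) v k b, ca (nth (Cont 0 0 0 0 false) Lc j) * N%:R * (G * m)%:R = (slen G m N (((srcs j).1, k, v, b), (srcs j).2))%:R) ->
  exists (mx my : 'I_(size Lc) -> bitseq),
  let c j := nth (Cont 0 0 0 0 false) Lc j in
  let l := [seq ((((srcs j).1, Num.truncn (cb (c j) * (G * m)%:R), cv (c j), (mx j, my j)), (srcs j).2) : spec * nat) | j <- enum 'I_(size Lc)] in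
  [/\ forall j, size (mx j) = size Lc /\ size (my j) = size Lc,
      all (binside (N * (G * m))) (nconts G m N l) & pairwise bdisj (nconts G m N l)].
Proof.
move=> N0 M0 al pw srcP; set M := (G * m)%N in al srcP *.
pose c0 : cont R := Cont 0 0 0 0 false.
pose n := size Lc; pose c (j : 'I_n) := nth c0 Lc j.
have alk (k : 'I_n) : [/\ 0 <= cx (c k) /\ cx (c k) + cw (c k) <= 1, 0 <= cy (c k) /\ cy (c k) + ch (c k) <= 1, 0 < ca (c k) & 1 <= cb (c k) * M%:R].
  exact: (pall_nth c0 al (ltn_ord k)).
have disc (i j : 'I_n) : i != j -> cdisj (c i) (c j).
  move=> ij; have [lij|lji|e] := ltngtP i j; last by case/eqP: ij; apply: val_inj.
    by move/(pairwiseP c0): pw => /(_ _ _ (ltn_ord i) (ltn_ord j) lij).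
  by rewrite cdisjC; move/(pairwiseP c0): pw => /(_ _ _ (ltn_ord j) (ltn_ord i) lji).
have M0' : 0 < M%:R :> R by rewrite ltr0n.
have N0' : 0 < N%:R :> R by rewrite ltr0n.
pose k j := Num.truncn (cb (c j) * M%:R).
have kP j : (0 < k j)%N /\ (k j)%:R / M%:R <= cb (c j).
  have [_ _ _ h1] := alk j; split; first by rewrite /k truncn_gt0.
  by rewrite ler_pdivrMr // /k truncn_le (le_trans _ h1).
pose w j := if cv (c j) then (k j)%:R / M%:R else ca (c j).
pose h j := if cv (c j) then ca (c j) else (k j)%:R / M%:R.
have wcw j : w j <= cw (c j) by have [_ k1] := kP j; rewrite /w /cw; case: (cv _).
have hch j : h j <= ch (c j) by have [_ k1] := kP j; rewrite /h /ch; case: (cv _).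
have wh0 j : 0 < w j /\ 0 < h j.
  have [k0 _] := kP j; have [_ _ a0 _] := alk j.
  by rewrite /w /h; case: (cv _); split=> //; rewrite divr_gt0 // ltr0n.
have [|i j ij|x' [y' [b1 [b2 [bnd dis ex ey]]]]] := @compact2 R n (fun j => cx (c j)) w (fun j => cy (c j)) h.
- by move=> i; have [? ?] := wh0 i; have [[? _] [? _] _ _] := alk i; split.
- case/or4P: (disc i j ij) => h1.
  + by apply/or4P; constructor 1; apply: le_trans h1; rewrite lerD2l.
  + by apply/or4P; constructor 2; apply: le_trans h1; rewrite lerD2l.
  + by apply/or4P; constructor 3; apply: le_trans h1; rewrite lerD2l.
  + by apply/or4P; constructor 4; apply: le_trans h1; rewrite lerD2l.
pose mx j := map (b1 j) (enum 'I_n); pose my j := map (b2 j) (enum 'I_n).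
exists mx, my => /=; set l := map _ _.
pose sa j : spec * nat := (((srcs j).1, k j, cv (c j), (mx j, my j)), (srcs j).2).
have lE : l = map sa (enum 'I_n) by [].
have swE j : (sw G m N (sa j))%:R = w j * (N * M)%:R :> R.
  rewrite /sw /w /=; case: (cv (c j)); last by rewrite -srcP natrM mulrA.
  by rewrite /sth /= (natrM R (k j)) (natrM R N M) mulrCA divfK ?gt_eqF // mulrC.
have shE j : (sh G m N (sa j))%:R = h j * (N * M)%:R :> R.
  rewrite /sh /h /=; case: (cv (c j)); first by rewrite -srcP natrM mulrA.
  by rewrite /sth /= (natrM R (k j)) (natrM R N M) mulrCA divfK ?gt_eqF // mulrC.
pose X j := sumn (mask (mx j) (map (sw G m N) l)); pose Y j := sumn (mask (my j) (map (sh G m N) l)).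
have NM0 : 0 < (N * M)%:R :> R by rewrite ltr0n muln_gt0 N0.
have XE j : (X j)%:R = x' j * (N * M)%:R :> R.
  rewrite /X lE -map_comp sumn_mask ex natr_sum mulr_suml big_enum_cond /=.
  by apply: eq_bigr => i _; rewrite swE.
have YE j : (Y j)%:R = y' j * (N * M)%:R :> R.
  rewrite /Y lE -map_comp sumn_mask ey natr_sum mulr_suml big_enum_cond /=.
  by apply: eq_bigr => i _; rewrite shE.
pose bo j : nbox := (slen G m N (sa j), sth N (sa j), cv (c j), (X j, Y j)).
have ncE : nconts G m N l = map bo (enum 'I_n) by rewrite /nconts; set F := (F in map F l); rewrite lE -map_comp; apply: eq_map.
have bwE j : (bw (bo j))%:R = w j * (N * M)%:R :> R by rewrite -swE.
have bhE j : (bh (bo j))%:R = h j * (N * M)%:R :> R by rewrite -shE.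
split; rewrite ?ncE.
- by move=> j; split; rewrite size_map size_enum_ord.
- rewrite all_map; apply/allP => j _ /=; have [[_ hx] [_ hy] _ _] := alk j; have [/andP[_ x1] /andP[_ y1]] := bnd j.
  rewrite /binside; apply/andP; split; rewrite -(ler_nat R) natrD ?bwE ?bhE /= ?XE ?YE -mulrDl -[X in _ <= X]mul1r ler_pM2r //.
    by apply: le_trans hx; apply: lerD.
  by apply: le_trans hy; apply: lerD.
- rewrite pairwise_map; apply: (@sub_in_pairwise _ xpredT (fun i j => i != j)) => [i j _ _ ij| |]; last first.
    by rewrite -uniq_pairwise enum_uniq.
    by apply/allP.
  by have := dis i j ij; rewrite /= /bdisj -!(ler_nat R) !natrD !bwE !bhE /= !XE !YE -!mulrDl !ler_pM2r.
Qed.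

(** * An instance scaled to the unit square *)

Section Items.
Variables (R : realType) (N : nat) (I : seq item) (S : seq (placement R)).
Hypothesis N0 : (0 < N)%N.
Hypothesis fea : feasible N I S.

Let n := size S.
Let pl (i : 'I_n) := nth (place0 R) S i.
Definition pit (i : 'I_n) := nth item0 I (pidx (pl i)).
Definition ux (i : 'I_n) : R := px (pl i) / N%:R.
Definition uy (i : 'I_n) : R := py (pl i) / N%:R.
Definition uw (i : 'I_n) : R := (pwidth I (pl i))%:R / N%:R.
Definition uh (i : 'I_n) : R := (pheight I (pl i))%:R / N%:R.

Lemma N0R : 0 < N%:R :> R. Proof. by rewrite ltr0n. Qed.

Lemma unit_bnd i : [/\ 0 <= ux i /\ ux i + uw i <= 1, 0 <= uy i /\ uy i + uh i <= 1, 0 <= uw i & 0 <= uh i].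
Proof.
have [_ al _] := fea; have /andP[_ /and4P[h1 h2 h3 h4]] := all_nthP (place0 R) al i (ltn_ord i).
have := N0R => n0; have gi : 0 <= N%:R^-1 :> R by rewrite invr_ge0 ltW.
by rewrite /ux /uy /uw /uh; split; rewrite ?mulr_ge0 ?ler0n // -mulrDl ler_pdivrMr // mul1r.
Qed.

(** Feasibility forbids common interior points. With positive sides, overlapping projections contain
    such a point, for instance the midpoint of each overlap; a rectangle with a zero side has no
    interior. *)
Lemma unit_dis i j : 0 < uw i -> 0 < uh i -> 0 < uw j -> 0 < uh j ->
  xover ux uw i j -> xover uy uh i j -> i = j.
Proof.
move=> wi hi wj hj o1 o2; apply/eqP/negPn/negP => ij; have [_ _ dis] := fea.
have mid (u l u2 l2 : R) : 0 < l -> 0 < l2 -> (u < u2 + l2) && (u2 < u + l) ->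
    exists a, [/\ u < a, a < u + l, u2 < a & a < u2 + l2].
  move=> l0 l20 /andP[h1 h2]; exists ((Num.max u u2 + Num.min (u + l) (u2 + l2)) / 2).
  by case: (leP u u2) => h3; case: (leP (u + l) (u2 + l2)) => h4; split; lra.
have n0 := N0R.
have sc (u l a : R) : u / N%:R < a -> a < u / N%:R + l / N%:R -> u < a * N%:R /\ a * N%:R < u + l.
  by rewrite -mulrDl ltr_pdivrMr // ltr_pdivlMr.
have [a [a1 a2 a3 a4]] := mid _ _ _ _ wi wj o1; have [b [b1 b2 b3 b4]] := mid _ _ _ _ hi hj o2.
have [? ?] := sc _ _ _ a1 a2; have [? ?] := sc _ _ _ a3 a4; have [? ?] := sc _ _ _ b1 b2; have [? ?] := sc _ _ _ b3 b4.
have := dis i j (ltn_ord i) (ltn_ord j) ij (a * N%:R) (b * N%:R).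
by move/negP; apply; apply/andP; split; apply/and4P; split.
Qed.

Lemma lmaxE i : lmax uw uh i * N%:R = (ll (pit i))%:R.
Proof.
have n0 := N0R; have ne : N%:R != 0 :> R by rewrite gt_eqF.
rewrite /lmax /uw /uh /pwidth /pheight /ll -/(pit i).
have e (a b : nat) : Num.max (a%:R / N%:R) (b%:R / N%:R) * N%:R = (maxn a b)%:R :> R.
  have [ab|ba] := leqP a b; first by rewrite max_r ?divfK // ler_pM2r ?invr_gt0 // ler_nat.
  by rewrite max_l ?divfK // ler_pM2r ?invr_gt0 // ler_nat ltnW.
by case: (prot _); rewrite e // maxnC.
Qed.

Lemma tminE i : tmin uw uh i * N%:R = (tt (pit i))%:R.
Proof.
have n0 := N0R; have ne : N%:R != 0 :> R by rewrite gt_eqF.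
rewrite /tmin /uw /uh /pwidth /pheight /tt -/(pit i).
have e (a b : nat) : Num.min (a%:R / N%:R) (b%:R / N%:R) * N%:R = (minn a b)%:R :> R.
  have [ab|ba] := leqP a b; first by rewrite min_l ?divfK // ler_pM2r ?invr_gt0 // ler_nat.
  by rewrite min_r ?divfK // ler_pM2r ?invr_gt0 // ler_nat ltnW.
by case: (prot _); rewrite e // minnC.
Qed.

Lemma isLE q i : isL q uw uh i = islong q N (pit i).
Proof. by rewrite /isL /islong -(ltr_nat R) natrM -(lmaxE i) -(ltr_pM2r N0R) mul1r [lmax _ _ _ * q%:R * _]mulrAC. Qed.

Lemma areaE i : uw i * uh i * (N%:R * N%:R) = (iw (pit i) * ih (pit i))%:R.
Proof.
have ne : N%:R != 0 :> R by rewrite gt_eqF // N0R.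
rewrite natrM /uw /uh /pwidth /pheight -/(pit i); case: (prot _); by field.
Qed.

Lemma nlE q G m i : (0 < G)%N -> (nl q G m N (pit i))%:R = l' q G uw uh i * (N * (G * m))%:R.
Proof.
move=> G0; have ne : G%:R != 0 :> R by rewrite pnatr_eq0 -lt0n.
rewrite /nl /l' isLE; case: ifP => _; first by rewrite !natrM -lmaxE; ring.
by rewrite !natrM; field.
Qed.

Lemma nwtE q G m i : (nwt q G m N (pit i))%:R = wt q G uw uh i * (N * N * (G * m))%:R.
Proof.
rewrite /nwt /wt isLE; case: ifP => _; first by rewrite !natrM -tminE; ring.
by rewrite (natrM R (G * m * G)%N) -areaE !natrM; ring.
Qed.
End Items.

(* One unit of thickness is kept back for the space wasted by first fit. *)
Definition boxcap (N : nat) (c : nbox) : nat := ((bth c - N) * N)%N.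

(** Each container loses at most [1/M] by rounding down and [1/M] by the reserved unit; one thinner
    than [1/M] is lost altogether, which is no more. *)
Lemma round_caps (R : realType) (Lc : seq (cont R)) (M : nat) (lam : R) : (0 < M)%N ->
  pall (fun c => 0 < cb c) Lc ->
  \sum_(c <- Lc | lam <= ca c) cb c - 2 * (size Lc)%:R / M%:R <=
  \sum_(c <- Lc | (1 <= cb c * M%:R) && (lam <= ca c)) (Num.truncn (cb c * M%:R) - 1)%:R / M%:R.
Proof.
move=> M0; have m0 : 0 < M%:R :> R by rewrite ltr0n.
have m2 : 0 <= 2 / M%:R :> R by rewrite divr_ge0.
elim: Lc => [_|c Lc IH [c0 /IH {}IH]]; first by rewrite !big_nil mulr0 mul0r subr0.
rewrite !big_cons /= -[(size Lc).+1%:R]nat1r mulrDr mulr1 mulrDl.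
case: ifP => lc; rewrite ?andbT ?andbF; last first.
  by apply: le_trans IH; rewrite lerD2l lerN2 lerDr.
have cM : cb c * M%:R <= (Num.truncn (cb c * M%:R)).+1%:R by rewrite ltW // truncnS_gt.
case: ifP => c1; last first.
  rewrite opprD addrACA; apply: (@le_trans _ _ (0 + (\sum_(j <- Lc | lam <= ca j) cb j - 2 * (size Lc)%:R / M%:R))); last by rewrite add0r.
  rewrite lerD2r subr_le0 ler_pdivlMr //.
  by move/negbT: c1; rewrite -ltNge => /ltW h; apply: le_trans h _; rewrite ler1n.
rewrite opprD addrACA; apply: lerD => //.
rewrite lerBlDr -mulrDl ler_pdivlMr // natrB; last by rewrite truncn_gt0.
by apply: le_trans cM _; rewrite -natr1; lra.
Qed.

Definition spec_ok (C M : nat) (sp : spec) :=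
  [&& (sp.1.1.1 < 3)%N, (sp.1.1.2 <= M)%N, (size sp.2.1 <= C)%N & (size sp.2.2 <= C)%N].

Lemma pall_filter (X : Type) (P : X -> Prop) (b : pred X) s :
  pall P s -> pall (fun a => P a /\ b a) (filter b s).
Proof. by elim: s => //= a s IH [Pa /IH]; case ba: (b a). Qed.

Lemma structure_nat (R : realType) (E q : nat) : (0 < q)%N ->
  exists (delta0 : R) (G m C r0 : nat), [/\ 0 < delta0, (0 < m)%N, (q <= G)%N &
  forall r, (r0 <= r)%N -> forall (N : nat) (I : seq item) (S : seq (placement R)), (0 < N)%N -> feasible N I S ->
  (forall i : 'I_(size S), let it := pit I i in
     islong q N it /\ (tt it)%:R <= delta0 * N%:R \/ ~~ islong q N it /\ (ll it * r <= N)%N) ->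
  exists (l : seq (spec * nat)) (X : seq nat),
   [/\ (size l <= C)%N, all (fun sa => spec_ok C (G * m) sa.1 && (sa.2 \in 0%N :: map ll I)) l,
       all (binside (N * (G * m))) (nconts G m N l), pairwise bdisj (nconts G m N l) &
       has (fun c => (N * (G * m) <= blen c) && (N <= bth c))%N (nconts G m N l)] /\
   [/\ uniq X, {subset X <= map (@pidx R) S},
       (E.+1 * profit I S <= 3 * profit I S + E.+1 * \sum_(i <- X) ip (nth item0 I i))%N &
       forall kap, (0 < kap <= N * (G * m))%N ->
         (\sum_(i <- X | kap <= nl q G m N (nth item0 I i)) nwt q G m N (nth item0 I i) <=
          \sum_(c <- nconts G m N l | kap <= blen c) boxcap N c)%N]].
Proof.
move=> q0; have [delta0 [theta [G [C [r0 [dl0 th0 qG str]]]]]] := @structure R E q q0.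
have G0 : (0 < G)%N by apply: leq_trans qG.
(* The resolution is so fine that the slack [theta] pays for [2/M] in each of at most [C]
   containers. *)
pose m := (Num.truncn (2 * C%:R / theta)).+1.
have m0 : (0 < m)%N by [].
have M0 : (0 < G * m)%N by rewrite muln_gt0 G0.
exists delta0, G, m, C, r0; split=> // r rr N I S N0 fea cls.
have n0 : 0 < N%:R :> R by rewrite ltr0n.
set M := (G * m)%N in M0 *.
have m0R : 0 < M%:R :> R by rewrite ltr0n.
have Mbig : 2 * C%:R / M%:R < theta.
  rewrite ltr_pdivrMr // [theta * _]mulrC -ltr_pdivrMr //; apply: lt_le_trans (truncnS_gt _) _.
  by rewrite ler_nat /M -/m leq_pmull.
pose T := 'I_(size S).
have [|i j _ _|i _|X [Lc [[_ pX] sL al pw dom]]] := str r rr T (ux N (S := S)) (uw N I (S := S)) (uy N (S := S)) (uh N I (S := S)) setT (fun i => ip (pit I i)).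
- by move=> i _; apply: unit_bnd.
- exact: (unit_dis N0 fea).
- rewrite isLE //; case: (cls i) => -[h1 h2]; [left|right]; split=> //.
    by rewrite -(ler_pM2r n0) tminE.
  by rewrite -(ler_pM2r n0) mul1r mulrAC lmaxE // -natrM ler_nat.
pose big1 (c : cont R) := 1 <= cb c * M%:R.
pose Lc1 := filter big1 Lc.
have al1 := pall_filter big1 al.
pose c0 : cont R := Cont 0 0 0 0 false.
have srcE (j : 'I_(size Lc1)) : exists sa : nat * nat, [/\ (sa.1 < 3)%N, sa.2 \in 0%N :: map ll I &
   forall v k b, ca (nth c0 Lc1 j) * N%:R * M%:R = (slen G m N ((sa.1, k, v, b), sa.2))%:R].
  have [[_ _ _ src] _] := pall_nth c0 al1 (ltn_ord j).
  case: src => [->|->|[i [_ _ ->]]].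
  - by exists (0%N, 0%N); split; rewrite ?inE // => v k b; rewrite /slen /= natrM mul1r.
  - exists (1%N, 0%N); split; rewrite ?inE // => v k b; rewrite /slen /= /M !natrM.
    by field; rewrite pnatr_eq0 -lt0n.
  - exists (2%N, ll (pit I i)); split => // [|v k b]; last by rewrite /slen /= lmaxE // natrM mulrC.
    have [_ al2 _] := fea; have /andP[iI _] := all_nthP (place0 R) al2 i (ltn_ord i).
    by rewrite /= in_cons /pit -(nth_map _ 0%N) // mem_nth ?orbT // size_map.
have /fin_all_exists[srcs srcsP] := srcE.
have [||j v k b|mx [my /= [smxy ins pwb]]] := @nconts_real R G m N Lc1 srcs N0 M0.
- by apply: pall_sub al1 => c [[? ? [? _] _] ?]; split.
- exact: pairwise_filter.
- by have [_ _] := srcsP j; apply.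
move: ins pwb; set l := map _ _ => ins pwb.
have szl : size l = size Lc1 by rewrite /l size_map size_enum_ord.
have szn : size (nconts G m N l) = size Lc1 by rewrite /nconts size_map szl.
have nE (F : nbox -> nat) (P : pred nbox) : (\sum_(c <- nconts G m N l | P c) F c =
   \sum_(j < size Lc1 | P (nth (0, 0, false, (0, 0)) (nconts G m N l) j)) F (nth (0, 0, false, (0, 0)) (nconts G m N l) j))%N.
  by rewrite (big_nth (0, 0, false, (0, 0))%N) big_mkord szn.
pose sa (j : 'I_(size Lc1)) : spec * nat := ((((srcs j).1, Num.truncn (cb (nth c0 Lc1 j) * M%:R), cv (nth c0 Lc1 j), (mx j, my j)), (srcs j).2)).
have nthE (j : 'I_(size Lc1)) : blen (nth (0, 0, false, (0, 0))%N (nconts G m N l) j) = slen G m N (sa j) /\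
    bth (nth (0, 0, false, (0, 0))%N (nconts G m N l) j) = sth N (sa j).
  have h : (j < size l)%N by rewrite szl.
  rewrite (nth_map ((0, 0, false, ([::], [::])), 0)%N) // /blen /bth /=.
  by rewrite (nth_map j) ?size_enum_ord // nth_ord_enum.
have lenE j : (slen G m N (sa j))%:R = ca (nth c0 Lc1 j) * (N * M)%:R :> R.
  by have [_ _ h] := srcsP j; rewrite -h natrM mulrA.
have NM0 : 0 < (N * M)%:R :> R by rewrite ltr0n muln_gt0 N0.
have dom1 lam : 0 < lam <= 1 -> \sum_(i in X | lam <= l' q G (uw N I (S := S)) (uh N I (S := S)) i) wt q G (uw N I (S := S)) (uh N I (S := S)) i + (theta - 2 * C%:R / M%:R) <=
   \sum_(j < size Lc1 | lam <= ca (nth c0 Lc1 j)) (Num.truncn (cb (nth c0 Lc1 j) * M%:R) - 1)%:R / M%:R.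
  move=> lb; have h1 := dom lam lb.
  have h2 : \sum_(c <- Lc | lam <= ca c) cb c - 2 * (size Lc)%:R / M%:R <= _ := round_caps lam M0 (pall_sub (fun c cP => proj2 (let: And4 _ _ d _ := cP in d)) al).
  have -> : \sum_(j < size Lc1 | lam <= ca (nth c0 Lc1 j)) (Num.truncn (cb (nth c0 Lc1 j) * M%:R) - 1)%:R / M%:R =
     \sum_(c <- Lc | (1 <= cb c * M%:R) && (lam <= ca c)) (Num.truncn (cb c * M%:R) - 1)%:R / M%:R :> R.
    by rewrite -big_filter_cond -/Lc1 (big_nth c0) big_mkord.
  apply: le_trans h2; rewrite addrA lerD // lerN2 ler_wpM2r ?invr_ge0 ?ler0n // ler_wpM2l ?ler0n // ler_nat.
  exact: sL.
pose f (i : T) := pidx (nth (place0 R) S i).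
have fI : injective f.
  move=> i j; rewrite /f -!(nth_map _ 0%N) ?ltn_ord // => /eqP; have [us _ _] := fea.
  by rewrite nth_uniq ?size_map ?ltn_ord // => /eqP/val_inj.
exists l, [seq f i | i <- enum X]; split; split.
- by rewrite szl; apply: leq_trans sL; rewrite size_filter count_size.
- rewrite all_map; apply/allP => j _ /=; have [h1 h2 _] := srcsP j; have [h3 h4] := smxy j.
  have sC : (size Lc1 <= C)%N by apply: leq_trans sL; rewrite size_filter count_size.
  have [[x01 y01 [_ b0] _] hb] := pall_nth c0 al1 (ltn_ord j).
  rewrite h2 andbT /spec_ok /= h1 h3 h4 sC !andbT /= -(ler_nat R).
  apply: (@le_trans _ _ (cb (nth c0 Lc1 j) * M%:R)).
    by rewrite truncn_le; apply: le_trans hb.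
  rewrite ler_piMl ?ler0n //; move: x01 y01 => [x1 x2] [y1 y2].
  have wh : cw (nth c0 Lc1 j) <= 1 /\ ch (nth c0 Lc1 j) <= 1.
    by split; [apply: le_trans x2|apply: le_trans y2]; rewrite lerDr.
  by move: wh; rewrite /cw /ch; case: (cv _) => -[].
- exact: ins.
- exact: pwb.
(* At [lam = 1] the slack forces a positive capacity, so some container of full length survives the
   rounding. *)
- have h := dom1 1; rewrite ltr01 lexx in h; have {}h := h isT.
  have [j jP] : exists j : 'I_(size Lc1), 1 <= ca (nth c0 Lc1 j).
    case: (boolP [exists j : 'I_(size Lc1), 1 <= ca (nth c0 Lc1 j)]) => [/existsP //|/existsPn none].
    exfalso; move: h.
    rewrite [X in _ <= X]big_pred0 => [|j]; last exact/negbTE/none.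
    rewrite leNgt => /negP; apply; apply: ltr_wpDl; last by rewrite subr_gt0.
    apply: sumr_ge0 => i _; rewrite /wt; have [_ _ w0' h0'] := unit_bnd N0 fea i.
    by case: ifP => _; [rewrite /tmin le_min w0'|rewrite mulr_ge0 ?ler0n // mulr_ge0].
  apply/(has_nthP (0, 0, false, (0, 0))%N); exists (val j); first by rewrite szn; exact: ltn_ord.
  have [-> ->] := nthE j; rewrite -(ler_nat R) lenE -[X in X <= _]mul1r ler_pM2r // jP /sth /=.
  by rewrite leq_pmull // truncn_gt0; have [] := pall_nth c0 al1 (ltn_ord j).
- by rewrite map_inj_uniq ?enum_uniq.
- move=> _ /mapP[i _ ->]; rewrite /f -(nth_map _ 0%N) ?ltn_ord //.
  by apply: mem_nth; rewrite size_map ltn_ord.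
- have -> : profit I S = (\sum_(i : T) ip (pit I i))%N by rewrite /profit (big_nth (place0 R)) big_mkord.
  rewrite big_map big_enum /= -/(pit I _).
  have -> : (\sum_(i : T) ip (pit I i) = \sum_(i in [set: T]) ip (pit I i))%N by apply: eq_bigl => i; rewrite inE.
  rewrite {1}(sum_nat_setD (fun i : T => ip (pit I i)) (subsetT X)) mulnDr addnC leq_add2r.
  exact: pX.
move=> kap /andP[k0 k1]; pose lam : R := kap%:R / (N * M)%:R.
have lam01 : 0 < lam <= 1.
  by apply/andP; split; [rewrite divr_gt0 // ltr0n|rewrite ler_pdivrMr // mul1r ler_nat].
have lamE (a : R) (b : nat) : b%:R = a * (N * M)%:R -> (kap <= b)%N = (lam <= a).
  by move=> e; rewrite -(ler_nat R) e /lam ler_pdivrMr.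
have h := dom1 lam lam01.
rewrite -(ler_nat R) big_map big_enum_cond /= nE !natr_sum.
have -> : \sum_(i in X | (kap <= nl q G m N (nth item0 I (f i)))%N) (nwt q G m N (nth item0 I (f i)))%:R =
   (\sum_(i in X | lam <= l' q G (uw N I (S := S)) (uh N I (S := S)) i) wt q G (uw N I (S := S)) (uh N I (S := S)) i) * (N * N * M)%:R :> R.
  rewrite mulr_suml; apply: eq_big => [i|i _]; last exact: nwtE.
  by congr (_ && _); apply: lamE; apply: nlE.
have -> : \sum_(j < size Lc1 | (kap <= blen (nth (0, 0, false, (0, 0)) (nconts G m N l) j))%N) (boxcap N (nth (0, 0, false, (0, 0)) (nconts G m N l) j))%:R =
   (\sum_(j < size Lc1 | lam <= ca (nth c0 Lc1 j)) (Num.truncn (cb (nth c0 Lc1 j) * M%:R) - 1)%:R / M%:R) * (N * N * M)%:R :> R.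
  rewrite mulr_suml; apply: eq_big => [j|j _]; first by have [-> _] := nthE j; apply/lamE/lenE.
  rewrite /boxcap; have [_ ->] := nthE j; rewrite /sth /= -[X in (_ - X)%N]mul1n -mulnBl.
  rewrite -mulnA; move: (_ - 1)%N => t.
  by rewrite (natrM R t) (natrM R (N * N)%N M) mulrCA divfK ?gt_eqF // mulrC.
rewrite ler_pM2r; last by rewrite ltr0n (muln_gt0 (N * N)%N) muln_gt0 N0.
by apply: le_trans h; rewrite lerDl subr_ge0 ltW.
Qed.

End Geometry.

(** * Packing into guessed containers *)
Module Algorithm.
Set Implicit Arguments. Unset Strict Implicit. Unset Printing Implicit Defensive.
Import Geometry.
Local Close Scope ring_scope.
Local Open Scope nat_scope.

(** * Sorting and the greedy selection *)

Definition ins (X : Type) (r : rel X) (s : seq X) (x : X) : seq X :=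
  [seq y <- s | r y x] ++ x :: [seq y <- s | ~~ r y x].
Definition isort (X : Type) (r : rel X) (s : seq X) : seq X := foldl (ins r) [::] s.

Lemma perm_isort (X : eqType) (r : rel X) (s : seq X) : perm_eq (isort r s) s.
Proof.
rewrite /isort -[s in X in perm_eq _ X]cat0s; elim: s [::] => [|x s IH] t /=; first by rewrite cats0.
apply: perm_trans (IH _) _; rewrite -cat_rcons perm_cat2r perm_sym perm_rcons /ins perm_sym -cat1s perm_catCA /= perm_cons.
by have /permPl -> := perm_filterC (fun y => r y x) t.
Qed.

(** Order properties are asked for on [D] only: the cross-multiplied comparison of densities is
    transitive among entries of positive profit. *)
Lemma pairwise_isort (X : eqType) (D : pred X) (r : rel X) (s : seq X) :
  {in D &, total r} -> {in D & &, transitive r} -> all D s -> pairwise r (isort r s).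
Proof.
move=> tot tra; rewrite /isort; have : all D [::] && pairwise r [::] by [].
elim: s [::] => [|x s IH] t /= /andP[Dt pt] => [//|/andP[Dx Ds]]; apply: IH => //.
have fD (a : pred X) : all D (filter a t) by apply/allP => y; rewrite mem_filter => /andP[_ /(allP Dt)].
rewrite /ins all_cat /= Dx !fD /=.
rewrite pairwise_cat /= !pairwise_filter // andbT /allrel; apply/andP; split.
  apply/allP => y; rewrite mem_filter => /andP[ryx yt]; rewrite /= ryx /=.
  apply/allP => z; rewrite mem_filter => /andP[rzx zt].
  have Dz := allP Dt z zt; have Dy := allP Dt y yt.
  apply: (tra x) => //; have := tot x z Dx Dz; by rewrite (negbTE rzx) orbF.
apply/allP => z; rewrite mem_filter => /andP[rzx zt]; have Dz := allP Dt z zt.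
by have := tot x z Dx Dz; rewrite (negbTE rzx) orbF.
Qed.

(* index, width < height, long, key length, own length, thickness, weight, profit *)
Definition rent := (nat * bool * bool * nat * nat * nat * nat * nat)%type.
Definition rP (e : rent) := e.2.
Definition rW (e : rent) := e.1.2.
Definition rT (e : rent) := e.1.1.2.
Definition rA (e : rent) := e.1.1.1.2.
Definition rL (e : rent) := e.1.1.1.1.2.
Definition rlong (e : rent) := e.1.1.1.1.1.2.
Definition rrot (e : rent) := e.1.1.1.1.1.1.2.
Definition ridx (e : rent) := e.1.1.1.1.1.1.1.

Definition wsum (k : nat) (s : seq rent) := sumn [seq rW e | e <- [seq e <- s | k <= rL e]].
Definition capsum (N k : nat) (cs : seq nbox) := sumn [seq boxcap N c | c <- [seq c <- cs | k <= blen c]].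
Definition psum (s : seq rent) := sumn [seq rP e | e <- s].
Definition dens (e f : rent) := rW e * rP f <= rW f * rP e.

(** The load is tested before [e] is added, so each constraint may be overshot once, by at most one
    weight. In return greedy loses nothing against selections that respect all capacities. *)
Definition accept (N : nat) (cs : seq nbox) (ks : seq nat) (acc : seq rent) (e : rent) :=
  all (fun k => (k <= rL e) ==> (wsum k acc <= capsum N k cs)) ks.
Definition greedy N cs ks (s : seq rent) : seq rent :=
  foldl (fun acc e => if accept N cs ks acc e then e :: acc else acc) [::] s.

Lemma wsum_cons k e s : wsum k (e :: s) = (if k <= rL e then rW e else 0) + wsum k s.
Proof. by rewrite /wsum /=; case: ifP. Qed.

Lemma wsum_cat k s t : wsum k (s ++ t) = wsum k s + wsum k t.
Proof. by rewrite /wsum filter_cat map_cat sumn_cat. Qed.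

Section Greedy.
Variables (N : nat) (cs : seq nbox) (ks : seq nat).
Notation acc p := (greedy N cs ks p).

Lemma greedy_rcons p e : acc (rcons p e) = if accept N cs ks (acc p) e then e :: acc p else acc p.
Proof. by rewrite /greedy -cats1 foldl_cat. Qed.

Lemma greedy_sub p : {subset acc p <= p}.
Proof.
elim/last_ind: p => [//|p e IH] f; rewrite greedy_rcons mem_rcons in_cons.
case: ifP => _; last by move/IH => ->; rewrite orbT.
by rewrite in_cons => /orP[->//|/IH->]; rewrite orbT.
Qed.

Lemma greedy_uniq p : uniq (map ridx p) -> uniq (map ridx (acc p)).
Proof.
elim/last_ind: p => [//|p e IH]; rewrite map_rcons rcons_uniq greedy_rcons => /andP[ep /IH up].
case: ifP => //= _; rewrite up andbT; apply: contra ep => /mapP[f /greedy_sub fp ->].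
exact: map_f.
Qed.

Lemma greedy_cap p k wmax : k \in ks -> all (fun e => rW e <= wmax) p -> wsum k (acc p) <= capsum N k cs + wmax.
Proof.
move=> kk; elim/last_ind: p => [_|p e IH]; first by rewrite /wsum.
rewrite all_rcons greedy_rcons => /andP[we /IH {}IH]; case: ifP => // /allP/(_ k kk).
rewrite wsum_cons; case: ifP => //= ke h; by rewrite addnC leq_add.
Qed.

Definition tight k p := (k \in ks) && (capsum N k cs < wsum k (acc p)).

Lemma tight_mono k p e : tight k p -> tight k (rcons p e).
Proof.
move=> /andP[kk h]; rewrite /tight kk greedy_rcons; case: ifP => // _.
by rewrite wsum_cons; apply: leq_trans h _; rewrite leq_addl.
Qed.

Definition wlow k (s : seq rent) := sumn [seq rW e | e <- [seq e <- s | rL e < k]].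

(** A rejection is caused by a tight threshold not above the length of the entry, so entries shorter
    than all tight thresholds have all been accepted. *)
Lemma wlow_acc p k : (forall k', tight k' p -> k <= k') -> wlow k (acc p) = wlow k p.
Proof.
elim/last_ind: p => [//|p e IH] kP.
have -> : wlow k (rcons p e) = (if rL e < k then rW e else 0) + wlow k p.
  by rewrite /wlow -cats1 filter_cat map_cat sumn_cat addnC /=; case: ifP => //=; rewrite addn0.
rewrite -IH; last by move=> k' /(tight_mono e)/kP.
rewrite greedy_rcons; case: ifP => [_|/negbT]; first by rewrite /wlow /=; case: ifP.
rewrite /accept -has_predC => /hasP[k' k'k] /=; rewrite negb_imply -ltnNge => /andP[le lt].
have : tight k' (rcons p e) by apply: tight_mono; rewrite /tight k'k lt.
by move/kP => kk'; rewrite ltnNge (leq_trans kk' le).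
Qed.

Lemma w_split k s : sumn [seq rW e | e <- s] = wlow k s + wsum k s.
Proof.
elim: s => //= e s ->; rewrite wsum_cons /wlow /=; case: (ltnP (rL e) k) => h.
  by rewrite /= add0n addnA.
by rewrite /= addnCA.
Qed.

Lemma wlow_filter k (x : pred rent) s : wlow k (filter x s) <= wlow k s.
Proof.
elim: s => //= e s IH; rewrite /wlow /=; case: (x e) => /=; case: ifP => //= _.
  by rewrite leq_add2l.
by apply: leq_trans IH _; rewrite leq_addl.
Qed.

Variables (x : pred rent) (s : seq rent).
Hypothesis capX : forall k, k \in ks -> wsum k (filter x s) <= capsum N k cs.

(** Take the least tight threshold [k]. Below it greedy holds everything seen; from [k] on its load
    exceeds the capacity, which bounds that of the competitor [x]. If nothing is tight, nothing was
    rejected. *)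
Lemma greedy_dom p t : s = p ++ t ->
  sumn [seq rW e | e <- filter x p] <= sumn [seq rW e | e <- acc p].
Proof.
move=> sE; case: (boolP (has (fun k => tight k p) ks)) => [/hasP[k0 _ tk0]|/hasPn none].
  have ex : exists k, tight k p by exists k0.
  case: (ex_minnP ex) => k tk kmin; rewrite !(w_split k); apply: leq_add.
    by rewrite (wlow_acc kmin) wlow_filter.
  have /andP[kk lt] := tk; apply: leq_trans (ltnW lt); apply: leq_trans (capX kk).
  by rewrite sE filter_cat wsum_cat leq_addr.
pose k := (sumn [seq rL e | e <- p]).+1.
have allp (q : seq rent) : {subset q <= p} -> sumn [seq rW e | e <- q] = wlow k q.
  move=> qp; rewrite /wlow (_ : [seq e <- q | _] = q) //; apply/all_filterP/allP => e /qp ep.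
  by rewrite /k ltnS sumnE big_map (big_rem e) //= leq_addr.
have kP : forall k', tight k' p -> k <= k'.
  by move=> k' tk; have /andP[k'k _] := tk; have := none k' k'k; rewrite /= tk.
rewrite (allp (filter x p)); last by move=> e; rewrite mem_filter => /andP[].
by rewrite (allp (acc p)) ?(wlow_acc kP) ?wlow_filter //; apply: greedy_sub.
Qed.

Hypothesis srt : pairwise dens s.
Hypothesis Ppos : all (fun e => 0 < rP e) s.

(** Abel summation without divisions: [a / b] is a lower bound on the densities seen so far, at
    which the surplus weight of greedy is valued. In the inductive step the prefix is compared at
    the density of the new entry; prefix dominance makes the surplus nonnegative. *)
Lemma greedy_abel p t a b : s = p ++ t -> all (fun e => a * rW e <= b * rP e) p ->
  b * psum (filter x p) + a * sumn [seq rW e | e <- acc p] <=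
  b * psum (acc p) + a * sumn [seq rW e | e <- filter x p].
Proof.
elim/last_ind: p t a b => [|p e IH] t a b sE; first by rewrite /psum /= !muln0.
rewrite all_rcons => /andP[abe abp].
have sE' : s = p ++ e :: t by rewrite sE cat_rcons.
have ds : all (fun f => rP e * rW f <= rW e * rP f) p.
  move: srt; rewrite sE' pairwise_cat => /and3P[h _ _].
  apply/allP => f fp; have := allP (allP h f fp) e (mem_head _ _).
  by rewrite /dens => h1; rewrite mulnC.
have e0 : 0 < rP e by move: Ppos; rewrite sE' all_cat => /and3P[_ /=].
have domn := greedy_dom sE.
have fr : filter x (rcons p e) = if x e then rcons (filter x p) e else filter x p by rewrite filter_rcons.
have sr (f : rent -> nat) (q : seq rent) : sumn [seq f e0 | e0 <- rcons q e] = sumn [seq f e0 | e0 <- q] + f e.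
  by rewrite map_rcons sumn_rcons.
move: domn; rewrite greedy_rcons; case: ifP => [acE|rej].
  have -> : sumn [seq rW e0 | e0 <- e :: acc p] = sumn [seq rW e0 | e0 <- acc p] + rW e by rewrite /= addnC.
  have -> : psum (e :: acc p) = psum (acc p) + rP e by rewrite /psum /= addnC.
  rewrite fr; case: (x e); last first.
    case: (posnP (rW e)) => [w0|wpos] domn; first by have := IH _ a b sE' abp; rewrite w0; lia.
    have := IH _ (rP e) (rW e) sE' ds; move: domn abe wpos e0.
    move: (psum _) (psum _) (sumn _) (sumn _) (rW e) (rP e) => PX PA WX WA w p'. clear; nia.
  rewrite /psum !sr -!/(psum _) => domn; have := IH _ a b sE' abp; lia.
have wpos : 0 < rW e.
  rewrite lt0n; apply/eqP => w0; move/negP: rej; apply.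
  rewrite /accept; apply/allP => k _; apply/implyP => _; rewrite (_ : wsum k (acc p) = 0) //.
  have z : all (fun f => rW f == 0) (acc p).
    apply/allP => f /greedy_sub fp; have := allP ds f fp; rewrite w0 mul0n leqn0 muln_eq0.
    by rewrite (gtn_eqF e0).
  by rewrite /wsum; elim: (acc p) z => //= f q IH' /andP[/eqP f0 /IH'{}IH']; case: ifP; rewrite //= f0.
rewrite fr; have h := IH _ (rP e) (rW e) sE' ds; case: (x e) => domn.
  move: h domn abe wpos e0; rewrite /psum !sr -!/(psum _).
  move: (psum _) (psum _) (sumn _) (sumn _) (rW e) (rP e) => PX PA WX WA w p'. clear; nia.
by apply: IH sE' abp.
Qed.

Lemma greedy_opt : psum (filter x s) <= psum (acc s).
Proof.
have := @greedy_abel s [::] 0 1; rewrite cats0 !mul1n !mul0n !addn0; apply=> //.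
by apply/allP.
Qed.
End Greedy.

(* length, thickness, items with their offset along the length *)
Definition elem := (nat * nat * seq (rent * nat))%type.
Definition eL (e : elem) := e.1.1.
Definition eT (e : elem) := e.1.2.
Definition eits (e : elem) := e.2.
Definition wfe (e : elem) :=
  all (fun iu => (iu.2 + rA iu.1 <= eL e) && (rT iu.1 <= eT e)) (eits e) &&
  pairwise (fun iu jv => (iu.2 + rA iu.1 <= jv.2) || (jv.2 + rA jv.1 <= iu.2)) (eits e).

(** * Shelves and first fit *)

Definition sing (i : rent) : elem := (rA i, rT i, [:: (i, 0)]).
Definition addshelf (SL : nat) (st : seq elem) (i : rent) : seq elem :=
  if st is e :: st' then
    if eL e + rA i <= SL then (eL e + rA i, eT e, (i, eL e) :: eits e) :: st' else sing i :: st
  else [:: sing i].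
Definition shelves0 SL (s : seq rent) : seq elem := foldl (addshelf SL) [::] s.
Definition shelves SL s : seq elem := [seq (SL, eT e, eits e) | e <- shelves0 SL s].
Definition ritems (st : seq elem) : seq rent := flatten [seq [seq iu.1 | iu <- eits e] | e <- st].

Lemma ritems_cat s t : ritems (s ++ t) = ritems s ++ ritems t.
Proof. by rewrite /ritems map_cat flatten_cat. Qed.

Definition fillst := (nat * (seq elem * seq (nat * elem)))%type.
Definition fstep (c : nbox) (a : fillst) (e : elem) : fillst :=
  if (eL e <= blen c) && (a.1 + eT e <= bth c) then (a.1 + eT e, (a.2.1, a.2.2 ++ [:: (a.1, e)]))
  else (a.1, (a.2.1 ++ [:: e], a.2.2)).
Definition fill1 c (s : seq elem) : fillst := foldl (fstep c) (0, ([::], [::])) s.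
Definition placed := (nbox * (nat * elem))%type.
Definition fillstep (a : seq elem * seq placed) (c : nbox) : seq elem * seq placed :=
  let r := fill1 c a.1 in (r.2.1, a.2 ++ [seq (c, ze) | ze <- r.2.2]).
Definition fill (cs : seq nbox) (s : seq elem) := foldl fillstep (s, [::]) cs.

Lemma fill1_rcons c s e : fill1 c (rcons s e) = fstep c (fill1 c s) e.
Proof. by rewrite /fill1 -cats1 foldl_cat. Qed.

Lemma fill_rcons cs c s : fill (rcons cs c) s = fillstep (fill cs s) c.
Proof. by rewrite /fill -cats1 foldl_cat. Qed.

Definition zdisj (a b : nat * elem) := (a.1 + eT a.2 <= b.1) || (b.1 + eT b.2 <= a.1).

Lemma fill1_ok c s : let r := fill1 c s in
  [/\ all (fun ze => [&& eL ze.2 <= blen c, ze.1 + eT ze.2 <= r.1 & r.1 <= bth c]) r.2.2,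
      pairwise zdisj r.2.2, r.1 = sumn [seq eT ze.2 | ze <- r.2.2] &
      perm_eq (ritems r.2.1 ++ ritems [seq ze.2 | ze <- r.2.2]) (ritems s)].
Proof.
elim/last_ind: s => [//|s e]; rewrite fill1_rcons; case: (fill1 c s) => o [re pl] /= [h1 h2 h3 h4].
rewrite /fstep /=; case: ifP => [/andP[le lt]|_] /=.
  split.
  - rewrite all_cat /= le lt leqnn !andbT; apply/allP => ze /(allP h1)/and3P[-> h5 _] /=.
    by rewrite (leq_trans h5) ?leq_addr.
  - rewrite pairwise_cat h2 /= andbT allrel1r; apply/allP => ze /(allP h1)/and3P[_ h5 _].
    by rewrite /zdisj /= h5.
  - by rewrite map_cat sumn_cat /= addn0 -h3.
  - rewrite map_cat ritems_cat catA -cats1 ritems_cat; exact: perm_cat h4 _.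
split=> //; rewrite ritems_cat -cats1 ritems_cat -catA.
rewrite perm_sym; apply: perm_trans (_ : perm_eq ((ritems re ++ ritems [seq ze.2 | ze <- pl]) ++ ritems [:: e]) _).
  by rewrite perm_cat2r perm_sym.
by rewrite -catA perm_cat2l perm_catC.
Qed.

Lemma fill1_wf c s (P : pred elem) : all P s -> all P (fill1 c s).2.1 /\ all (fun ze => P ze.2) (fill1 c s).2.2.
Proof.
elim/last_ind: s => [//|s e IH]; rewrite all_rcons fill1_rcons => /andP[Pe /IH[h1 h2]].
by rewrite /fstep; case: ifP => _ /=; rewrite ?all_cat /= ?h1 ?h2 ?Pe.
Qed.

Lemma fill1_sorted c s (r : rel elem) : pairwise r s -> pairwise r (fill1 c s).2.1.
Proof.
elim/last_ind: s => [//|s e IH]; rewrite pairwise_rcons fill1_rcons => /andP[al /IH h].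
rewrite /fstep; case: ifP => _ //=; rewrite cats1 pairwise_rcons h andbT.
by have [] := fill1_wf c al.
Qed.

(** Elements arrive by decreasing length, so everything placed before [e] was refused is at least as
    long as [e]. *)
Lemma fill1_rest c s e : pairwise (fun e f => eL f <= eL e) s -> e \in (fill1 c s).2.1 ->
  (blen c < eL e) || (bth c < sumn [seq eT ze.2 | ze <- [seq ze <- (fill1 c s).2.2 | eL e <= eL ze.2]] + eT e).
Proof.
elim/last_ind: s => [//|s f IH]; rewrite pairwise_rcons fill1_rcons => /andP[al pw].
have [_ al2] := fill1_wf c al; have [_ _ offE _] := fill1_ok c s.
have {}IH := IH pw; rewrite /fstep; case: ifP => [_|/negbT] /=.
  move/IH => /orP[->//|h]; apply/orP; right; rewrite filter_cat map_cat sumn_cat; apply: leq_trans h _.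
  by rewrite leq_add2r leq_addr.
rewrite negb_and -!ltnNge => nf; rewrite mem_cat inE => /orP[/IH//|/eqP->].
case/orP: nf => [->//|h]; apply/orP; right.
by rewrite (_ : [seq ze <- _ | _] = (fill1 c s).2.2) -?offE //; apply/all_filterP.
Qed.

Definition pdisj (a b : placed) := bdisj a.1 b.1 || ((a.1 == b.1) && zdisj a.2 b.2).
Definition pwf (a : placed) := [&& wfe a.2.2, eL a.2.2 <= blen a.1 & a.2.1 + eT a.2.2 <= bth a.1].

Lemma fill_ok cs s : all wfe s -> pairwise bdisj cs ->
  [/\ all wfe (fill cs s).1, all pwf (fill cs s).2, all (fun a => a.1 \in cs) (fill cs s).2,
      pairwise pdisj (fill cs s).2 & perm_eq (ritems (fill cs s).1 ++ ritems [seq a.2.2 | a <- (fill cs s).2]) (ritems s)].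
Proof.
move=> ws; elim/last_ind: cs => [|cs c IH]; first by rewrite /fill /= ws cats0.
rewrite pairwise_rcons fill_rcons => /andP[al /IH]; case: (fill cs s) => re out /= [h1 h2 h3 h4 h5].
have [k1 k2 k3 k4] := fill1_ok c re; have [w1 w2] := fill1_wf c h1.
rewrite /fillstep /=; split=> //.
- rewrite all_cat h2 /= all_map; apply/allP => ze zP; rewrite /= /pwf /= (allP w2 ze zP).
  by have /and3P[-> a b] := allP k1 ze zP; rewrite (leq_trans a b).
- rewrite all_cat; apply/andP; split.
    by apply: sub_all h3 => a; rewrite mem_rcons in_cons => ->; rewrite orbT.
  by rewrite all_map; apply/allP => ze _ /=; rewrite mem_rcons mem_head.
- rewrite pairwise_cat h4 /=; apply/andP; split.
    apply/allrelP => a b aP /mapP[ze zP ->]; rewrite /pdisj /= (allP al) //.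
    exact: (allP h3).
  rewrite pairwise_map; apply: sub_pairwise k2 => a b /= ab.
  by rewrite /pdisj /= eqxx ab orbT.
- rewrite map_cat ritems_cat -map_comp /=.
  rewrite perm_catCA catA; apply: perm_trans h5; rewrite perm_sym perm_catC perm_sym -catA perm_cat2l //.
Qed.

Lemma fill_sorted cs s (r : rel elem) : pairwise r s -> pairwise r (fill cs s).1.
Proof.
elim/last_ind: cs => [//|cs c IH] /IH; rewrite fill_rcons; case: (fill cs s) => re out /=.
exact: fill1_sorted.
Qed.

Definition eload (k : nat) (s : seq elem) := sumn [seq eT e | e <- [seq e <- s | k <= eL e]].

Lemma eload_cat k s t : eload k (s ++ t) = eload k s + eload k t.
Proof. by rewrite /eload filter_cat map_cat sumn_cat. Qed.

Lemma fill1_load k c s : eload k [seq ze.2 | ze <- (fill1 c s).2.2] + eload k (fill1 c s).2.1 = eload k s.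
Proof.
elim/last_ind: s => [//|s e IH]; rewrite -[in RHS]cats1 eload_cat -IH fill1_rcons /fstep.
by case: ifP => _; rewrite /= ?map_cat eload_cat /=; rewrite ?addnA // addnAC.
Qed.

(** Every container long enough for the leftover [e] is filled up to less than [eT e] by elements at
    least as long as [e], so the containers above this length bound the load above this length from
    below. *)
Lemma fill_rest cs s e : pairwise (fun e f => eL f <= eL e) s -> e \in (fill cs s).1 ->
  sumn [seq (bth c).+1 | c <- [seq c <- cs | eL e <= blen c]] + eload (eL e) (fill cs s).1 <=
  eload (eL e) s + eT e * count (fun c => eL e <= blen c) cs.
Proof.
move=> srt; elim/last_ind: cs => [|cs c IH]; first by rewrite /fill /= muln0 addn0.
rewrite fill_rcons; move: IH (fill_sorted cs srt); case: (fill cs s) => re out /= IH srt' er.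
have ere : e \in re.
  have := fill1_wf c (P := fun f => f \in re) (_ : all (fun f => f \in re) re); case; first exact/allP.
  by move=> /allP h _; apply: h.
have {}IH := IH ere; have ld := fill1_load (eL e) c re.
rewrite -cats1 filter_cat map_cat sumn_cat count_cat /= addn0.
case: ifP => le /=; last by rewrite !addn0; apply: leq_trans IH; rewrite leq_add2l -ld leq_addl.
have := fill1_rest srt' er; rewrite ltnNge le /= => h.
have lE : eload (eL e) [seq ze.2 | ze <- (fill1 c re).2.2] = sumn [seq eT ze.2 | ze <- [seq ze <- (fill1 c re).2.2 | eL e <= eL ze.2]].
  by rewrite /eload filter_map -map_comp.
by rewrite mulnDr muln1; move: h IH ld; rewrite -lE; lia.
Qed.

Section Shelves.
Variables (SL : nat) (s : seq rent).

Definition wfs (st : seq elem) := all (fun e => wfe e && (eL e <= SL) && (0 < size (eits e))) st.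

Lemma shelves0_rcons t i : shelves0 SL (rcons t i) = addshelf SL (shelves0 SL t) i.
Proof. by rewrite /shelves0 -cats1 foldl_cat. Qed.

Lemma wfe_sing i : wfe (sing i).
Proof. by rewrite /wfe /sing /= /eL /eT /= !leqnn. Qed.

Lemma shelves_perm t : perm_eq (ritems (shelves0 SL t)) t.
Proof.
elim/last_ind: t => [//|t i IH]; rewrite shelves0_rcons perm_sym perm_rcons perm_sym.
case: (shelves0 SL t) IH => [|e st] IH /=; first by rewrite perm_cons.
case: ifP => _; by rewrite /ritems /= perm_cons.
Qed.

(* the shelf under construction has the thickness of its first, thickest, item *)
Lemma shelves_wf t : all (fun i => rA i <= SL) t -> pairwise (fun i j => rT j <= rT i) t ->
  wfs (shelves0 SL t) /\ (if shelves0 SL t is e :: _ then exists2 j, j \in t & eT e = rT j else t = [::]).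
Proof.
elim/last_ind: t => [//|t i IH]; rewrite all_rcons pairwise_rcons => /andP[iA tA] /andP[iT tT].
rewrite shelves0_rcons; have [] := IH tA tT.
have wsi : wfe (sing i) && (eL (sing i) <= SL) && (0 < size (eits (sing i))) by rewrite wfe_sing /sing /eL /= iA.
case: (shelves0 SL t) => [|e st] /=.
  move=> _ _; split; first by rewrite wsi.
  by exists i; rewrite // mem_rcons mem_head.
move=> /andP[/andP[/andP[we el] es] wst] [j jt ej]; case: ifP => [fit|_]; last first.
  split; first by apply/andP; split=> //; apply/andP; split=> //; rewrite we el es.
  by exists i; rewrite // mem_rcons mem_head.
split; last by exists j; rewrite // mem_rcons in_cons jt orbT.
apply/andP; split; last exact: wst.
rewrite /eL /= fit !andbT.
have /andP[w1 w2] := we; apply/andP; split => /=.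
  rewrite /eL /eT /= leqnn /= -/(eL e) -/(eT e) ej (allP iT j jt) /=.
  apply/allP => iu /(allP w1)/andP[h1 h2]; apply/andP; split; first exact: leq_trans h1 (leq_addr _ _).
  by rewrite -ej.
by rewrite w2 andbT; apply/allP => iu /(allP w1)/andP[h _] /=; rewrite -/(eL e) h orbT.
Qed.

(* a closed shelf is full up to [amax], and its items are at least as thick as
   the next shelf *)
Lemma shelves_load (t : seq rent) (amax tmax : nat) :
  all (fun i => rA i <= amax) t -> all (fun i => rT i <= tmax) t -> pairwise (fun i j => rT j <= rT i) t ->
  (SL - amax) * sumn [seq eT e | e <- shelves0 SL t] +
    (if shelves0 SL t is e :: _ then minn (eL e) (SL - amax) * last 0 [seq rT i | i <- t] else 0) <=
    (SL - amax) * tmax + sumn [seq rA i * rT i | i <- t] /\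
  (if shelves0 SL t is e :: _ then last 0 [seq rT i | i <- t] <= eT e else t = [::]).
Proof.
elim/last_ind: t => [|t i IH]; first by rewrite /= muln0 add0n leq0n.
rewrite !all_rcons pairwise_rcons => /andP[iA tA] /andP[im tm] /andP[iT tT].
have [] := IH tA tm tT; rewrite shelves0_rcons !map_rcons last_rcons sumn_rcons.
have lastT : last 0 [seq rT i | i <- t] = 0 /\ t = [::] \/ rT i <= last 0 [seq rT i | i <- t].
  case/lastP: t iT {IH tA tm tT} => [|t j]; first by left.
  by rewrite all_rcons map_rcons last_rcons => /andP[-> _]; right.
case E: (shelves0 SL t) => [|e st] /=.
  move=> _ t0; rewrite t0 /= addn0; split=> //; rewrite /eL /eT /=.
  apply: leq_add; first by rewrite leq_mul2l im orbT.
  by rewrite leq_mul2r geq_minl orbT.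
move=> h1 h2; case: lastT => [[_ t0]|lt].
  by move: E; rewrite t0.
move: h1 h2 lt iA {E}; set l := last _ _; set Su := sumn [seq eT e | e <- st]; set Sg := sumn [seq _ * _ | i <- t].
move=> h1 h2 lt iA.
case: ifP => fit /=; rewrite ?/eL ?/eT /= -?/(eL e) -?/(eT e) -/Su.
  split; last exact: leq_trans lt h2.
  have m1 : minn (eL e + rA i) (SL - amax) <= minn (eL e) (SL - amax) + rA i by clear; lia.
  have m2 : minn (eL e) (SL - amax) * rT i <= minn (eL e) (SL - amax) * l by rewrite leq_mul2l lt orbT.
  have m3 := leq_mul m1 (leqnn (rT i)); rewrite mulnDl in m3; lia.
split; last by [].
have full : minn (eL e) (SL - amax) = SL - amax by move/negbT: fit; move: iA; clear; lia.
rewrite full in h1.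
have m2 : (SL - amax) * rT i <= (SL - amax) * l by rewrite leq_mul2l lt orbT.
have m3 : minn (rA i) (SL - amax) * rT i <= rA i * rT i by rewrite leq_mul2r geq_minl orbT.
by rewrite mulnDr; lia.
Qed.
End Shelves.

Definition lenge (i j : rent) := rA j <= rA i.
Definition thge (i j : rent) := rT j <= rT i.
Definition stack (SL : nat) (g : seq rent) : seq elem :=
  [seq sing i | i <- isort lenge [seq i <- g | rlong i]] ++ shelves SL (isort thge [seq i <- g | ~~ rlong i]).
Definition runcs N SL (s : seq rent) ks cs : seq placed := (fill cs (stack SL (greedy N cs ks s))).2.
(** Coordinates are numerators over [M]. [rrot] tells that the item must be turned to lie with its
    long side horizontal, so in a vertical container the answer is negated. *)
Definition outent (M : nat) (c : nbox) (z : nat) (iu : rent * nat) : out_entry :=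
  (ridx iu.1, (bx c + (if bvert c then z else iu.2), M), (bby c + (if bvert c then iu.2 else z), M),
   if bvert c then ~~ rrot iu.1 else rrot iu.1).
Definition solution (M : nat) (pl : seq placed) : seq out_entry :=
  flatten [seq [seq outent M a.1 a.2.1 iu | iu <- eits a.2.2] | a <- pl].

Lemma pairwise_flat (X : Type) (r : rel X) (ss : seq (seq X)) :
  pairwise r (flatten ss) = all (pairwise r) ss && pairwise (fun s t => allrel r s t) ss.
Proof.
elim: ss => //= s ss IH; rewrite pairwise_cat IH.
have -> : allrel r s (flatten ss) = all (fun t => allrel r s t) ss.
  by elim: ss {IH} => [|t ss IH] /=; [rewrite allrel0r|rewrite allrel_catr IH].
by case: (pairwise r s); rewrite ?andbT ?andbF //= andbCA.
Qed.

Lemma ritems_sing s : ritems [seq sing i | i <- s] = s.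
Proof. by rewrite /ritems -map_comp /=; elim: s => //= i s ->. Qed.

Lemma ritems_shelves SL s : ritems (shelves SL s) = ritems (shelves0 SL s).
Proof. by rewrite /ritems /shelves -map_comp. Qed.

Lemma stack_perm SL g : perm_eq (ritems (stack SL g)) g.
Proof.
rewrite /stack ritems_cat ritems_sing ritems_shelves.
apply: perm_trans (_ : perm_eq _ ([seq i <- g | rlong i] ++ [seq i <- g | ~~ rlong i])) _; last first.
  by apply/permPl; exact: perm_filterC.
apply: perm_cat; first exact: perm_isort.
by apply: perm_trans (shelves_perm _ _) (perm_isort _ _).
Qed.

Lemma isort_all (a : pred rent) r s : all a (isort r s) = all a s.
Proof. by apply: perm_all; apply: perm_isort. Qed.

Lemma isort_pw (f : rent -> nat) s : pairwise (fun i j => f j <= f i) (isort (fun i j => f j <= f i) s).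
Proof.
apply: (@pairwise_isort _ predT) => [i j _ _|j i k _ _ _ h1 h2|]; first exact: leq_total.
  exact: leq_trans h1.
by apply/allP.
Qed.

Lemma stack_wf SL g : all (fun i => rlong i || (rA i <= SL)) g -> all wfe (stack SL g).
Proof.
move=> al; rewrite /stack all_cat; apply/andP; split.
  by rewrite all_map; apply/allP => i _; exact: wfe_sing.
have [|w _] := @shelves_wf SL _ _ (isort_pw rT [seq i <- g | ~~ rlong i]).
  rewrite isort_all; apply/allP => i; rewrite mem_filter => /andP[nl /(allP al)].
  by rewrite (negbTE nl).
rewrite all_map; apply: sub_all w => e /andP[/andP[/andP[w1 w2] le] _]; apply/andP; split=> //=.
by apply: sub_all w1 => iu /andP[h1 h2]; rewrite /= /eL /eT /= h2 andbT; apply: leq_trans h1 le.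
Qed.

(** Pure arithmetic behind the disjointness of items in disjoint containers, stated apart so that
    all orientations are settled by [lia]. *)
Lemma sep_num (v v' : bool) X Y L T u A z t X' Y' L' T' u' A' z' t' :
  u + A <= L -> z + t <= T -> u' + A' <= L' -> z' + t' <= T' ->
  [|| X + (if v then T else L) <= X', X' + (if v' then T' else L') <= X,
      Y + (if v then L else T) <= Y' | Y' + (if v' then L' else T') <= Y] ->
  [|| X + (if v then z else u) + (if v then t else A) <= X' + (if v' then z' else u'),
      X' + (if v' then z' else u') + (if v' then t' else A') <= X + (if v then z else u),
      Y + (if v then u else z) + (if v then A else t) <= Y' + (if v' then u' else z') |
      Y' + (if v' then u' else z') + (if v' then A' else t') <= Y + (if v then u else z)].
Proof. by case: v; case: v'; lia. Qed.

Lemma zsep_num (v : bool) X Y u A z t e u' A' z' t' e' :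
  z + t <= z + e -> z' + t' <= z' + e' -> (z + e <= z') || (z' + e' <= z) ->
  [|| X + (if v then z else u) + (if v then t else A) <= X + (if v then z' else u'),
      X + (if v then z' else u') + (if v then t' else A') <= X + (if v then z else u),
      Y + (if v then u else z) + (if v then A else t) <= Y + (if v then u' else z') |
      Y + (if v then u' else z') + (if v then A' else t') <= Y + (if v then u else z)].
Proof. by case: v; lia. Qed.

Lemma inside_num (v : bool) X Y L T u A z t K : u + A <= L -> z + t <= T ->
  (X + (if v then T else L) <= K) && (Y + (if v then L else T) <= K) ->
  (X + (if v then z else u) + (if v then t else A) <= K) && (Y + (if v then u else z) + (if v then A else t) <= K).
Proof. by case: v; lia. Qed.

(** * Feasibility of the produced packing *)

Section Feasible.
Variables (R : realFieldType) (N M : nat) (I : seq item).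
Hypothesis M0 : 0 < M.

Definition rvalid (i : rent) := let it := nth item0 I (ridx i) in
  [&& ridx i < size I, rrot i == (iw it < ih it), rA i == M * ll it & rT i == M * tt it].

Definition owid (e : out_entry) := let: (i, _, _, r) := e in let it := nth item0 I i in if r then ih it else iw it.
Definition ohei (e : out_entry) := let: (i, _, _, r) := e in let it := nth item0 I i in if r then iw it else ih it.
Definition oX (e : out_entry) := e.1.1.2.1.
Definition oY (e : out_entry) := e.1.2.1.
Definition osep (e f : out_entry) :=
  [|| oX e + M * owid e <= oX f, oX f + M * owid f <= oX e, oY e + M * ohei e <= oY f | oY f + M * ohei f <= oY e].

Lemma outent_dim c z iu : rvalid iu.1 ->
  M * owid (outent M c z iu) = (if bvert c then rT iu.1 else rA iu.1) /\
  M * ohei (outent M c z iu) = (if bvert c then rA iu.1 else rT iu.1).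
Proof.
move=> /and4P[_ /eqP rr /eqP-> /eqP->]; rewrite /owid /ohei /outent rr /ll /tt.
move: (nth _ _ _) => it; case: (bvert c); case: (ltnP (iw it) (ih it)) => /= h; split; congr (_ * _).
Qed.

Lemma solution_sep (pl : seq placed) : all pwf pl -> pairwise pdisj pl ->
  all rvalid (ritems [seq a.2.2 | a <- pl]) -> pairwise osep (solution M pl).
Proof.
move=> wf pd val.
have valid a iu : a \in pl -> iu \in eits a.2.2 -> rvalid iu.1.
  move=> apl iue; apply: (allP val); apply/flattenP; exists [seq jv.1 | jv <- eits a.2.2].
    by apply/mapP; exists a.2.2 => //; apply: map_f.
  exact: map_f.
have bnd a iu : a \in pl -> iu \in eits a.2.2 -> [/\ iu.2 + rA iu.1 <= blen a.1, a.2.1 + rT iu.1 <= a.2.1 + eT a.2.2 & a.2.1 + eT a.2.2 <= bth a.1].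
  move=> apl iue; have /and3P[/andP[w1 _] w2 w3] := allP wf a apl.
  have /andP[h1 h2] := allP w1 iu iue; split=> //; first exact: leq_trans h1 w2.
  by rewrite leq_add2l.
rewrite /solution pairwise_flat; apply/andP; split.
  apply/allP => _ /mapP[a apl ->]; rewrite pairwise_map.
  have /and3P[/andP[_ w2] _ _] := allP wf a apl.
  apply: (sub_in_pairwise (P := fun iu => iu \in eits a.2.2) _ _ w2); last by apply/allP.
  move=> iu jv iue jve; have [d1 d2] := outent_dim a.1 a.2.1 (valid a iu apl iue).
  have [d3 d4] := outent_dim a.1 a.2.1 (valid a jv apl jve).
  rewrite /= /osep d1 d2 d3 d4 /oX /oY /=; case: (bvert a.1); rewrite -!addnA !leq_add2l.
    by case/orP => ->; rewrite !orbT.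
  by case/orP => ->; rewrite ?orbT.
rewrite pairwise_map; apply: (sub_in_pairwise (P := fun a => a \in pl) _ _ pd); last by apply/allP.
move=> a b apl bpl ab; apply/allrelP => _ _ /mapP[iu iue ->] /mapP[jv jve ->].
have [d1 d2] := outent_dim a.1 a.2.1 (valid a iu apl iue).
have [d3 d4] := outent_dim b.1 b.2.1 (valid b jv bpl jve).
have [l1 t1 t1'] := bnd a iu apl iue; have [l2 t2 t2'] := bnd b jv bpl jve.
rewrite /osep d1 d2 d3 d4 /oX /oY /=; case/orP: ab => [|/andP[/eqP ab zd]].
  by rewrite /bdisj /bw /bh; apply: sep_num l1 (leq_trans t1 t1') l2 (leq_trans t2 t2').
by rewrite -ab; apply: zsep_num t1 t2 zd.
Qed.

Lemma solution_inside (cs : seq nbox) (pl : seq placed) : all pwf pl -> all (fun a => a.1 \in cs) pl -> all (binside (N * M)) cs ->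
  all rvalid (ritems [seq a.2.2 | a <- pl]) ->
  all (fun e => [&& e.1.1.1 < size I, oX e + M * owid e <= N * M, oY e + M * ohei e <= N * M, e.1.1.2.2 == M & e.1.2.2 == M]) (solution M pl).
Proof.
move=> wf incs ins val; apply/allP => e /flattenP[_ /mapP[a apl ->] /mapP[iu iue ->]].
have vi : rvalid iu.1.
  apply: (allP val); apply/flattenP; exists [seq jv.1 | jv <- eits a.2.2].
    by apply/mapP; exists a.2.2 => //; apply: map_f.
  exact: map_f.
have [d1 d2] := outent_dim a.1 a.2.1 vi; rewrite d1 d2 /oX /oY /= !eqxx !andbT.
have /and4P[-> _ _ _] /= := vi.
have /and3P[/andP[w1 _] w2 w3] := allP wf a apl; have /andP[h1 h2] := allP w1 iu iue.
have := allP ins a.1 (allP incs a apl); rewrite /binside /bw /bh.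
by apply: inside_num; [exact: leq_trans h1 w2|apply: leq_trans w3; rewrite leq_add2l].
Qed.

Lemma solution_feasible (cs : seq nbox) (pl : seq placed) :
  all pwf pl -> all (fun a => a.1 \in cs) pl -> all (binside (N * M)) cs -> pairwise pdisj pl ->
  all rvalid (ritems [seq a.2.2 | a <- pl]) -> uniq (map ridx (ritems [seq a.2.2 | a <- pl])) ->
  all entry_ok (solution M pl) /\ feasible N I (map (@entry_place R) (solution M pl)).
Proof.
move=> wf incs ins pd val un.
have sep := solution_sep wf pd val; have ind := solution_inside wf incs ins val.
have M0R : (0 < M%:R :> R)%R by rewrite ltr0n.
have Mn : (M%:R != 0 :> R)%R by rewrite gt_eqF.
split; first by apply: sub_all ind => -[[[i [x xd]] [y yd]] r] /= /and5P[_ _ _ /eqP-> /eqP->]; rewrite M0.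
split.
- rewrite -map_comp (_ : map _ _ = map ridx (ritems [seq a.2.2 | a <- pl])) //.
  rewrite /solution /ritems -!map_comp !map_flatten -!map_comp; congr flatten; apply: eq_map => a /=.
  by rewrite -!map_comp.
- rewrite all_map; apply: sub_all ind => -[[[i [x xd]] [y yd]] r] /= /and5P[-> hx hy /eqP xM /eqP yM] /=.
  rewrite xM yM /fits /= !divr_ge0 ?ler0n //=; move: hx hy; rewrite /oX /oY /pwidth /pheight /owid /ohei /=.
  rewrite -!(ler_nat R) !natrD !natrM => hx hy; apply/andP; split.
    by rewrite -(ler_pM2r M0R) mulrDl divfK // [X in (_ + X <= _)%R]mulrC.
  by rewrite -(ler_pM2r M0R) mulrDl divfK // [X in (_ + X <= _)%R]mulrC.
- move=> j k; rewrite size_map => js ks jk a b; pose e0 : out_entry := (0, (0, 0), (0, 0), false).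
  have sepC e f : osep e f = osep f e by apply/idP/idP; rewrite /osep => /or4P[]->; rewrite ?orbT.
  have sjk : osep (nth e0 (solution M pl) j) (nth e0 (solution M pl) k).
    case: (ltngtP j k) jk => // h _; first by move/(pairwiseP e0): sep; apply.
    by rewrite sepC; move/(pairwiseP e0): sep; apply.
  have Mj := all_nthP e0 ind j js; have Mk := all_nthP e0 ind k ks.
  rewrite !(nth_map e0) //; move: sjk Mj Mk; move: (nth e0 _ j) (nth e0 _ k).
  move=> [[[i [x xd]] [y yd]] r] [[[i' [x' xd']] [y' yd']] r'] /= sjk /and5P[_ _ _ /eqP-> /eqP->] /and5P[_ _ _ /eqP-> /eqP->].
  rewrite /in_open /=; apply/negP => /andP[/and4P[a1 a2 b1 b2] /and4P[a3 a4 b3 b4]].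
  have key (u v l : nat) (t : R) : u + M * l <= v -> (t < u%:R / M%:R + l%:R)%R -> (v%:R / M%:R < t)%R -> False.
    move=> h h1 h2; have := lt_trans h2 h1; rewrite -(ltr_pM2r M0R) mulrDl !divfK // mulrC -natrM -natrD ltr_nat.
    by rewrite ltnNge h.
  case/or4P: sjk; rewrite /oX /oY /owid /ohei /= => h.
  - exact: key h a2 a3.
  - exact: key h a4 a1.
  - exact: key h b2 b3.
  - exact: key h b4 b1.
Qed.
End Feasible.

Lemma fill_all (P : pred elem) cs s : all P s -> all P (fill cs s).1.
Proof.
elim/last_ind: cs => [//|cs c IH] /IH; rewrite fill_rcons; case: (fill cs s) => re out /= h.
by have [] := fill1_wf c h.
Qed.

Lemma psum_perm s t : perm_eq s t -> psum s = psum t.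
Proof. by move=> st; rewrite /psum !sumnE !big_map; apply: perm_big. Qed.

Lemma fill_profit cs s : all wfe s -> pairwise bdisj cs -> (fill cs s).1 = [::] ->
  psum (ritems [seq a.2.2 | a <- (fill cs s).2]) = psum (ritems s).
Proof. by move=> ws pd r0; have [_ _ _ _] := fill_ok ws pd; rewrite r0; apply: psum_perm. Qed.

Lemma sumn_leq_const (X : Type) (f : X -> nat) (b : nat) s : all (fun a => f a <= b) s ->
  sumn [seq f a | a <- s] <= size s * b.
Proof. by elim: s => //= a s IH /andP[h /IH]; rewrite mulSn; apply: leq_add. Qed.

(** * First fit places everything that greedy selected *)

Section GoodRun.
Variables (N G M SL C r tmax : nat) (s : seq rent) (cs : seq nbox).
Notation ks := (map rL s).
Notation g := (greedy N cs ks s).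
Hypothesis N0 : 0 < N.
Hypothesis M0 : 0 < M.
Hypothesis SLG : SL * G = N * M.
Hypothesis longP : forall i, i \in s -> rlong i -> [/\ rL i = rA i, SL <= rA i & N * rT i = rW i].
Hypothesis smallP : forall i, i \in s -> ~~ rlong i -> [/\ rL i = SL, rA i * r <= N * M & rA i * rT i * G = M * rW i].
Hypothesis allP' : forall i, i \in s -> [/\ rT i <= tmax, rW i <= N * rT i & rL i <= N * M].
Hypothesis tm : 8 * (C + 4) * tmax <= N.
Hypothesis csC : size cs <= C.
Hypothesis csfull : has (fun c => (N * M <= blen c) && (N <= bth c)) cs.
Hypothesis csM : all (fun c => bth c <= M * N) cs.
Hypothesis rbig : 16 * G * (C * M + 2) <= r.
Hypothesis G0 : 0 < G.

Let gs i : i \in g -> i \in s. Proof. exact: greedy_sub. Qed.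

Lemma stack_sorted : pairwise (fun e f => eL f <= eL e) (stack SL g).
Proof.
rewrite /stack pairwise_cat; apply/and3P; split.
- apply/allrelP => _ _ /mapP[i ii ->] /mapP[e _ ->]; rewrite /eL /=.
  move: ii; rewrite (perm_mem (perm_isort _ _)) mem_filter => /andP[li /gs ig].
  by have [_ ? _] := longP ig li.
- by rewrite pairwise_map; apply: sub_pairwise (isort_pw rA _).
- by rewrite /shelves pairwise_map; elim: (shelves0 _ _) => //= e t ->; rewrite andbT; apply/allP => f _; exact: leqnn.
Qed.

Let shs := shelves0 SL (isort thge [seq i <- g | ~~ rlong i]).
Let sm_in i : i \in isort thge [seq i <- g | ~~ rlong i] -> i \in s /\ ~~ rlong i.
Proof. by rewrite (perm_mem (perm_isort _ _)) mem_filter => /andP[-> /gs]. Qed.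

Let rAsm i : i \in s -> ~~ rlong i -> rA i <= (N * M) %/ r.
Proof.
move=> si ni; have [_ h _] := smallP si ni; rewrite leq_divRL //.
by apply: leq_trans rbig; rewrite !muln_gt0 G0 addn2.
Qed.

Let rASL i : i \in s -> ~~ rlong i -> rA i <= SL.
Proof.
move=> si ni; have [_ h _] := smallP si ni.
rewrite -(leq_pmul2r G0) SLG; apply: leq_trans h; rewrite leq_mul2l; apply/orP; right.
by apply: leq_trans rbig; rewrite mulnAC -[X in X <= _]mul1n leq_mul2r muln_gt0 addn2 orbT.
Qed.

Lemma shelves_eT t e : e \in shelves0 SL t -> exists2 j, j \in t & eT e = rT j.
Proof.
elim/last_ind: t e => [//|t i IH] e; rewrite shelves0_rcons.
have lift f : f \in shelves0 SL t -> exists2 j, j \in rcons t i & eT f = rT j.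
  by move=> /IH[j jt ->]; exists j; rewrite // mem_rcons in_cons jt orbT.
have new : exists2 j, j \in rcons t i & eT (sing i) = rT j by exists i; rewrite // mem_rcons mem_head.
case E: (shelves0 SL t) => [|f st] /=; first by rewrite inE => /eqP->.
have lf := lift f; have ls f' : f' \in st -> exists2 j, j \in rcons t i & eT f' = rT j.
  by move=> h; apply: lift; rewrite E in_cons h orbT.
case: ifP => _; rewrite !in_cons.
  by case/orP => [/eqP->|/ls//]; apply: lf; rewrite E mem_head.
by case/or3P => [/eqP->//|/eqP->|/ls//]; apply: lf; rewrite E mem_head.
Qed.

Lemma stack_elem : all (fun e => (eT e <= tmax) && (eL e \in ks)) (stack SL g).
Proof.
rewrite /stack all_cat; apply/andP; split.
  rewrite all_map; apply/allP => i; rewrite (perm_mem (perm_isort _ _)) mem_filter => /andP[li /gs ig] /=.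
  have [e _ _] := longP ig li; have [h _ _] := allP' ig; rewrite /eT /eL /= h -e; exact: map_f.
rewrite /shelves all_map; apply/allP => e /shelves_eT[j /sm_in[js nj] ej] /=.
have [h _ _] := allP' js; have [l _ _] := smallP js nj.
by rewrite /eT /eL /= -/(eT e) ej h /= -l map_f.
Qed.

(** The container of full length counts for every threshold and is at least [N] thick, so its
    reserved unit contributes [N * N] beyond the capacities. *)
Lemma caps_bth k : k <= N * M -> capsum N k cs + N * N <= N * sumn [seq bth c | c <- [seq c <- cs | k <= blen c]].
Proof.
move=> kK; have step c : boxcap N c <= N * bth c by rewrite /boxcap mulnC leq_mul2l leq_subr orbT.
have weak (t : seq nbox) : capsum N k t <= N * sumn [seq bth c | c <- [seq c <- t | k <= blen c]].
  by rewrite /capsum; elim: t => //= c t IH; case: ifP => //= _; rewrite mulnDr leq_add.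
elim: cs csfull => //= c t IH /orP[/andP[h1 h2]|/IH h].
  have kc : k <= blen c by apply: leq_trans kK h1.
  rewrite /capsum /= kc /= mulnDr addnAC; apply: leq_add; last exact: weak.
  by rewrite /boxcap -mulnDl subnK // mulnC.
move: h; rewrite /capsum /=; case: ifP => //= _ h; rewrite mulnDr -addnA; exact: leq_add.
Qed.

Let capSL : capsum N SL cs <= C * M * (N * N).
Proof.
apply: leq_trans (_ : size [seq c <- cs | SL <= blen c] * (M * N * N) <= _).
  apply: sumn_leq_const; apply/allP => c; rewrite mem_filter => /andP[_ cc].
  by rewrite /boxcap leq_mul2r (leq_trans (leq_subr _ _)) ?orbT // (allP csM).
rewrite -!mulnA leq_mul2r; apply/orP; right; apply: leq_trans csC.
by rewrite size_filter count_size.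
Qed.

Let wb : all (fun e => rW e <= N * tmax) s.
Proof. by apply/allP => e /allP'[h1 h2 _]; apply: leq_trans h2 _; rewrite leq_mul2l h1 orbT. Qed.

Let tm2 : 2 * tmax <= N.
Proof. by apply: leq_trans tm; rewrite leq_mul2r; apply/orP; right; lia. Qed.

(** A shelf is filled up to one small length, a fraction of order [1/r], and one shelf of thickness
    at most [tmax] comes in addition. Since greedy bounds the total weight by the capacities, the
    choice of [r] makes the relative waste at most [N * N / 8]. *)
Lemma shelves_total : 8 * (N * sumn [seq eT e | e <- shs]) <=
  8 * (N * tmax + sumn [seq rW i | i <- [seq i <- g | ~~ rlong i]]) + N * N.
Proof.
case E: [seq i <- g | ~~ rlong i] => [|i0 t0]; first by rewrite /shs E /= muln0.
have i0g : i0 \in [seq i <- g | ~~ rlong i] by rewrite E mem_head.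
rewrite -E; move: i0g; rewrite mem_filter => /andP[ni0 /gs i0s] {E t0}.
set sm := [seq i <- g | ~~ rlong i]; set T := sumn _; set W := sumn _.
have WE : sumn [seq rW i | i <- isort thge sm] = W by rewrite /W !sumnE !big_map; apply: perm_big; exact: perm_isort.
have Wcap : W <= C * M * (N * N) + N * tmax.
  have [l _ _] := smallP i0s ni0.
  apply: leq_trans (_ : wsum SL g <= _).
    rewrite /wsum /W /sm; elim: (g) (gs) => //= i u IH us.
    have {}IH := IH (fun j ju => us j (mem_behead (s := i :: u) ju)); have is_ := us i (mem_head _ _).
    case: ifP => ni /=.
      by have [-> _ _] := smallP is_ ni; rewrite leqnn /= leq_add2l.
    by case: ifP => _ //=; apply: leq_trans IH _; rewrite leq_addl.
  have SLk : SL \in ks by rewrite -l map_f.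
  by apply: leq_trans (@greedy_cap N cs ks s SL (N * tmax) SLk wb) _; rewrite leq_add2r.
pose A := (N * M) %/ r.
have ld : (SL - A) * T <= (SL - A) * tmax + sumn [seq rA i * rT i | i <- isort thge sm].
  have a1 : all (fun i => rA i <= A) (isort thge sm) by apply/allP => i /sm_in[]; apply: rAsm.
  have a2 : all (fun i => rT i <= tmax) (isort thge sm) by apply/allP => i /sm_in[/allP'[]].
  have [h _] := shelves_load SL a1 a2 (isort_pw rT sm).
  rewrite /T /shs; move: h; rewrite -/thge; apply: leq_trans; exact: leq_addr.
have AWe : sumn [seq rA i * rT i | i <- isort thge sm] * G = M * W.
  rewrite -WE; have := sm_in; rewrite -/sm; elim: (isort thge sm) => /= [|i u IH us]; first by rewrite muln0.
  rewrite mulnDl mulnDr IH; last by move=> j ju; apply: us; rewrite in_cons ju orbT.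
  by have [is_ ni] := us i (mem_head _ _); have [_ _ ->] := smallP is_ ni.
have Ar : A * r <= N * M by apply: leq_divM.
have Ar' : 16 * (C * M + 2) * (G * A) <= N * M.
  by apply: leq_trans Ar; rewrite [A * r]mulnC mulnA leq_mul2r; apply/orP; right; rewrite mulnAC.
have main : N * M * T <= G * A * T + N * M * tmax + M * W.
  have := leq_mul ld (leqnn G); rewrite mulnDl AWe ![(SL - A) * _ * G]mulnAC mulnBl SLG [A * G]mulnC !mulnBl.
  clear; lia.
move: main Ar' Wcap tm2; clear -N0 M0; move: (G * A) => X main Ar' Wcap tm2.
pose D := 16 * (C * M + 2); rewrite -/D in Ar'.
have h1 : D * (N * T) <= N * T + D * (N * tmax + W).
  rewrite -(leq_pmul2l M0).
  have e1 : D * (N * M * T) <= D * (X * T + N * M * tmax + M * W) by rewrite leq_mul2l main orbT.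
  have e2 : D * X * T <= N * M * T by rewrite leq_mul2r Ar' orbT.
  have -> : M * (D * (N * T)) = D * (N * M * T) by ring.
  have -> : M * (N * T + D * (N * tmax + W)) = N * M * T + (D * (N * M * tmax) + D * (M * W)) by ring.
  apply: leq_trans e1 _; rewrite !mulnDr -addnA; apply: leq_add => //.
  by rewrite mulnA.
move: h1; set Y := N * T; set B := N * tmax + W => h1.
have BB : B <= (C * M + 1) * (N * N).
  have := leq_mul (leqnn N) tm2; rewrite /B mulnDl mul1n; move: Wcap; clear; lia.
have D0 : 0 < D by rewrite /D muln_gt0 addn2.
have h2 : Y <= 2 * B.
  have : D * Y <= Y + D * B := h1.
  have : 2 <= D by rewrite /D; clear; lia.
  clear; nia.
have h3 : 16 * (C * M + 2) * (N * N) = D * (N * N) by [].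
rewrite -(leq_pmul2l D0).
have h4 : 8 * (2 * B) <= D * (N * N).
  rewrite -h3; apply: leq_trans (_ : 16 * ((C * M + 1) * (N * N)) <= _); first by rewrite mulnA leq_mul2l BB orbT.
  by rewrite mulnA leq_mul2r leq_mul2l leq_add2l orbT.
have -> : D * (8 * Y) = 8 * (D * Y) by ring.
have -> : D * (8 * B + N * N) = 8 * (D * B) + D * (N * N) by ring.
move: h1 h2 h4; clear; lia.
Qed.

Lemma stack_load k : k \in ks -> 8 * (N * eload k (stack SL g)) <= 8 * wsum k g + 8 * (N * tmax) + N * N.
Proof.
move=> kk; have longE : N * eload k [seq sing i | i <- isort lenge [seq i <- g | rlong i]] =
    sumn [seq rW i | i <- [seq i <- [seq i <- g | rlong i] | k <= rL i]].
  have -> : eload k [seq sing i | i <- isort lenge [seq i <- g | rlong i]] =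
     sumn [seq rT i | i <- [seq i <- isort lenge [seq i <- g | rlong i] | k <= rA i]].
    by rewrite /eload filter_map -map_comp.
  have -> : sumn [seq rT i | i <- [seq i <- isort lenge [seq i <- g | rlong i] | k <= rA i]] =
     sumn [seq rT i | i <- [seq i <- [seq i <- g | rlong i] | k <= rA i]].
    by apply: perm_sumn; apply: perm_map; apply: perm_filter; exact: perm_isort.
  elim: (g) (gs) => /= [|i u IH us]; first by rewrite muln0.
  have {}IH := IH (fun j ju => us j (mem_behead (s := i :: u) ju)).
  case: ifP => //= li; have [e _ w] := longP (us i (mem_head _ _)) li.
  by rewrite e; case: ifP => //= _; rewrite mulnDr IH w.
have split_ : wsum k g = sumn [seq rW i | i <- [seq i <- [seq i <- g | rlong i] | k <= rL i]] +
   sumn [seq rW i | i <- [seq i <- [seq i <- g | ~~ rlong i] | k <= rL i]].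
  rewrite /wsum; elim: (g) => //= i u IH; case: (rlong i) => /=; case: ifP => //= _; rewrite IH ?addnA //.
  by congr (_ + _); rewrite addnC.
rewrite /stack eload_cat [N * (_ + _)]mulnDr longE split_.
suff : 8 * (N * eload k (shelves SL (isort thge [seq i <- g | ~~ rlong i]))) <=
  8 * sumn [seq rW i | i <- [seq i <- [seq i <- g | ~~ rlong i] | k <= rL i]] + 8 * (N * tmax) + N * N.
  move: (sumn _) (sumn _) (N * eload _ _) (N * tmax) (N * N); clear; lia.
have [kS|Sk] := leqP k SL; last first.
  have -> : eload k (shelves SL (isort thge [seq i <- g | ~~ rlong i])) = 0; last by rewrite !muln0.
  rewrite /eload /shelves filter_map (eq_filter (a2 := pred0)) ?filter_pred0 //.
  by move=> e; rewrite /= /eL /= leqNgt Sk.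
have -> : eload k (shelves SL (isort thge [seq i <- g | ~~ rlong i])) = sumn [seq eT e | e <- shs].
  rewrite /eload /shelves filter_map -map_comp /shs; move: (shelves0 _ _) => t.
  rewrite (_ : filter _ t = t) //; apply/all_filterP/allP => e _; exact: kS.
have -> : [seq i <- [seq i <- g | ~~ rlong i] | k <= rL i] = [seq i <- g | ~~ rlong i].
  apply/all_filterP/allP => i; rewrite mem_filter => /andP[ni /gs si].
  by have [-> _ _] := smallP si ni.
have := shelves_total; move: (sumn _) (N * sumn _) (N * tmax) (N * N); clear; lia.
Qed.

(** For a leftover element the loads would give [7 * N * N <= (16 + 8 * C) * N * tmax]: overshoot of
    greedy, one extra shelf, and a last place of thickness [tmax] in each of [C] containers. The
    bound [tm] makes the right side at most [N * N]. *)
Lemma good_run : (fill cs (stack SL g)).1 = [::].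
Proof.
apply/nilP/nilP; case E: (fill cs (stack SL g)).1 => [//|e t]; exfalso.
have ein : e \in (fill cs (stack SL g)).1 by rewrite E mem_head.
have /andP[et ek] := allP (fill_all cs stack_elem) e ein.
have eK : eL e <= N * M by case/mapP: ek => i /allP'[_ _ h] ->.
have h1 := fill_rest stack_sorted ein; have h2 := stack_load ek; have h3 := caps_bth eK.
have h4 := @greedy_cap N cs ks s (eL e) (N * tmax) ek wb.
have h5 : eT e * count (fun c => eL e <= blen c) cs <= tmax * C.
  by apply: leq_mul => //; apply: leq_trans csC; rewrite count_size.
have h6 : sumn [seq bth c | c <- [seq c <- cs | eL e <= blen c]] <= sumn [seq (bth c).+1 | c <- [seq c <- cs | eL e <= blen c]].
  by elim: [seq c <- cs | _] => //= c u; apply: leq_add.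
have h7 : sumn [seq bth c | c <- [seq c <- cs | eL e <= blen c]] <= eload (eL e) (stack SL g) + tmax * C.
  by apply: leq_trans h6 (leq_trans _ (leq_trans h1 _)); rewrite ?leq_addr // leq_add2l.
have h8 := leq_mul (leqnn N) h7; rewrite mulnDr in h8.
have h9 := leq_mul (leqnn N) tm.
have nn : 0 < N * N by rewrite muln_gt0 N0.
have e1 : N * (8 * (C + 4) * tmax) = 8 * (N * (tmax * C)) + 32 * (N * tmax) by ring.
move: h2 h3 h4 h8 h9 nn; rewrite e1.
move: (wsum _ _) (capsum _ _ _) (N * eload _ _) (N * sumn _) (N * (tmax * C)) (N * tmax) (N * N).
clear; lia.
Qed.
End GoodRun.

(* q, r, G, m, shapes *)
Definition params := (nat * nat * nat * nat * seq (seq spec))%type.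

(** * The algorithm for one level of lengths *)

Section Level.
Variables (q r G m : nat) (Om : seq (seq spec)) (N : nat) (I : seq item).
Let M := G * m.

Definition rentof (ke : nat * item) : rent :=
  (ke.1, iw ke.2 < ih ke.2, islong q N ke.2, nl q G m N ke.2, M * ll ke.2, M * tt ke.2, nwt q G m N ke.2, ip ke.2).
(** Items without profit would spoil the transitivity of the density order; items of medium length
    have been given up by the analysis. *)
Definition usable (it : item) := [&& 0 < ip it, ll it <= N & islong q N it || (ll it * r <= N)].
Definition numbered : seq (nat * item) := zip (iota 0 (size I)) I.
Definition rents := [seq rentof ke | ke <- [seq ke <- numbered | usable ke.2]].
Definition srents := isort dens rents.

Fixpoint allt (A : seq nat) (n : nat) : seq (seq nat) :=
  if n is n'.+1 then flatten [seq [seq x :: t | t <- allt A n'] | x <- A] else [:: [::]].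
(** The shapes in [Om] do not depend on the instance and have boundedly many containers, so only the
    lengths vary and the number of guesses is polynomial. *)
Definition guesses := flatten [seq [seq nconts G m N (zip om a) | a <- allt (0 :: map ll I) (size om)] | om <- Om].
Definition cfg_ok (cs : seq nbox) := all (binside (N * M)) cs && pairwise bdisj cs.
Definition tryone (best : seq placed) (cs : seq nbox) : seq placed :=
  if cfg_ok cs then
    let pl := runcs N (N * m) srents (map rL srents) cs in
    if psum (ritems [seq a.2.2 | a <- best]) < psum (ritems [seq a.2.2 | a <- pl]) then pl else best
  else best.
Definition level : nat * seq out_entry :=
  let pl := foldl tryone [::] guesses in (psum (ritems [seq a.2.2 | a <- pl]), solution M pl).

Lemma numberedE : numbered = [seq (k, nth item0 I k) | k <- iota 0 (size I)].
Proof.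
rewrite /numbered; apply: (@eq_from_nth _ (0, item0)); first by rewrite size_zip size_map !size_iota minnn.
move=> j; rewrite size_zip size_iota minnn => js.
by rewrite nth_zip ?size_iota //= (nth_map 0) ?size_iota // nth_iota.
Qed.

Lemma rentsE : rents = [seq rentof (k, nth item0 I k) | k <- [seq k <- iota 0 (size I) | usable (nth item0 I k)]].
Proof. by rewrite /rents numberedE filter_map -map_comp. Qed.

Lemma srentsP e : reflect (exists k, [/\ k < size I, usable (nth item0 I k) & e = rentof (k, nth item0 I k)]) (e \in srents).
Proof.
rewrite (perm_mem (perm_isort _ _)) rentsE; apply: (iffP mapP) => [[k]|[k [ks u ->]]].
  by rewrite mem_filter mem_iota => /andP[u ks] ->; exists k.
by exists k; rewrite // mem_filter u mem_iota.
Qed.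

Lemma uniq_srents : uniq (map ridx srents).
Proof.
rewrite (perm_uniq (perm_map ridx (perm_isort dens rents))) rentsE -map_comp /=.
by rewrite (eq_map (g := id)) ?map_id ?filter_uniq ?iota_uniq.
Qed.

Lemma srents_pos : all (fun e => 0 < rP e) srents.
Proof. by apply/allP => e /srentsP[k [_ /and3P[h _ _] ->]]. Qed.

Lemma srents_sorted : pairwise dens srents.
Proof.
apply: (@pairwise_isort _ (fun e => 0 < rP e)).
- by move=> e f _ _; apply: leq_total.
- move=> f e g f0 e0 g0; rewrite /dens => h1 h2; rewrite -(leq_pmul2r f0).
  apply: leq_trans (_ : rW f * rP e * rP g <= _); first by rewrite mulnAC leq_mul2r h1 orbT.
  by rewrite mulnAC [rW g * rP e * _]mulnAC leq_mul2r h2 orbT.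
- by rewrite -(perm_all _ (perm_isort dens rents)) srents_pos.
Qed.

Hypothesis N0 : 0 < N.
Hypothesis M0 : 0 < M.
Hypothesis qG : q <= G.
Hypothesis Gr : G <= r.

Lemma srents_valid : all (rvalid M I) srents.
Proof. by apply/allP => e /srentsP[k [ks _ ->]]; rewrite /rvalid /= ks !eqxx. Qed.

Lemma srents_small : all (fun i => rlong i || (rA i <= N * m)) srents.
Proof.
apply/allP => e /srentsP[k [_ /and3P[_ _ h] ->]]; case/orP: h => [h|h]; first by rewrite /rlong /= h.
apply/orP; right; rewrite /rA /= /M mulnAC leq_mul2r; apply/orP; right; rewrite mulnC.
by apply: leq_trans h; rewrite leq_mul2l Gr orbT.
Qed.

Definition plok (pl : seq placed) := [/\ all pwf pl, exists2 cs, all (fun a => a.1 \in cs) pl & all (binside (N * M)) cs,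
  pairwise pdisj pl, all (rvalid M I) (ritems [seq a.2.2 | a <- pl]) & uniq (map ridx (ritems [seq a.2.2 | a <- pl]))].

Lemma runcs_ok cs : cfg_ok cs -> plok (runcs N (N * m) srents (map rL srents) cs).
Proof.
move=> /andP[ins pd]; rewrite /runcs; set g := greedy _ _ _ _.
have gs : {subset g <= srents} by apply: greedy_sub.
have ws : all wfe (stack (N * m) g).
  by apply: stack_wf; apply/allP => e /gs; apply: (allP srents_small).
have [_ h2 h3 h4 h5] := fill_ok ws pd; set pl := (fill _ _).2 in h2 h3 h4 h5 *.
have pg : perm_eq (ritems (fill cs (stack (N * m) g)).1 ++ ritems [seq a.2.2 | a <- pl]) g.
  exact: perm_trans h5 (stack_perm _ _).
split=> //; first by exists cs.
- apply/allP => e ep; apply: (allP srents_valid); apply: gs.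
  by rewrite -(perm_mem pg) mem_cat ep orbT.
- have := perm_uniq (perm_map ridx pg); rewrite (greedy_uniq _ _ _ uniq_srents) map_cat cat_uniq => h.
  by case: (elimT and3P h).
Qed.

Lemma best_ok gl best : plok best -> plok (foldl tryone best gl).
Proof.
elim: gl best => //= cs gl IH best ok; apply: IH; rewrite /tryone; case: ifP => // /runcs_ok ok'.
by case: ifP.
Qed.

Lemma best_ge gl best : psum (ritems [seq a.2.2 | a <- best]) <= psum (ritems [seq a.2.2 | a <- foldl tryone best gl]) /\
  forall cs, cs \in gl -> cfg_ok cs ->
   psum (ritems [seq a.2.2 | a <- runcs N (N * m) srents (map rL srents) cs]) <= psum (ritems [seq a.2.2 | a <- foldl tryone best gl]).
Proof.
elim: gl best => //= cs gl IH best; have [h1 h2] := IH (tryone best cs).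
have up : psum (ritems [seq a.2.2 | a <- best]) <= psum (ritems [seq a.2.2 | a <- tryone best cs]).
  by rewrite /tryone; case: ifP => // _; case: ifP => // /ltnW.
split; first exact: leq_trans up h1.
move=> cs'; rewrite in_cons => /orP[/eqP-> ok|/h2//]; apply: leq_trans h1.
by rewrite /tryone ok; case: ifP => // /negbT; rewrite -leqNgt.
Qed.

Lemma plok0 : plok [::]. Proof. by split=> //; exists [::]. Qed.

Lemma level_feasible (R : realFieldType) : all entry_ok level.2 /\ feasible N I (map (@entry_place R) level.2).
Proof.
have [h1 [cs h2 h3] h4 h5 h6] := best_ok guesses plok0.
exact: (solution_feasible R M0 h1 h2 h3 h4 h5 h6).
Qed.

Lemma solution_profit (R : realFieldType) (pl : seq placed) : all (fun e => rP e == ip (nth item0 I (ridx e))) (ritems [seq a.2.2 | a <- pl]) ->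
  profit I (map (@entry_place R) (solution M pl)) = psum (ritems [seq a.2.2 | a <- pl]).
Proof.
rewrite /profit big_map /psum sumnE; elim: pl => [|a pl IH]; first by rewrite !big_nil.
rewrite /solution /ritems /= all_cat !map_cat !big_cat /= => /andP[ha /IH hp]; congr (_ + _); last exact: hp.
rewrite !big_map /=; elim: (eits a.2.2) ha => [|iu s IHs] /=; first by rewrite !big_nil.
by move=> /andP[/eqP e /IHs h]; rewrite !big_cons h e.
Qed.

Lemma best_mem gl best : {subset ritems [seq a.2.2 | a <- best] <= srents} -> {subset ritems [seq a.2.2 | a <- foldl tryone best gl] <= srents}.
Proof.
elim: gl best => //= cs gl IH best sb; apply: IH; rewrite /tryone; case: ifP => // /andP[ins pd]; case: ifP => // _.
rewrite /runcs; set g := greedy _ _ _ _ => e ep.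
have gs : {subset g <= srents} by apply: greedy_sub.
have ws : all wfe (stack (N * m) g) by apply: stack_wf; apply/allP => f /gs; apply: (allP srents_small).
have [_ _ _ _ h5] := fill_ok ws pd; apply: gs.
by rewrite -(perm_mem (perm_trans h5 (stack_perm _ _))) mem_cat ep orbT.
Qed.

Lemma level_profit (R : realFieldType) : profit I (map (@entry_place R) level.2) = level.1.
Proof.
apply: solution_profit; apply/allP => e /(best_mem (best := [::])) es.
by have /srentsP[k [_ _ ->]] : e \in srents by apply: es.
Qed.

Lemma allt_mem A (a : seq nat) : all (fun x => x \in A) a -> a \in allt A (size a).
Proof.
elim: a => //= x a IH /andP[xA /IH h]; apply/flattenP; exists [seq x :: t | t <- allt A (size a)]; first exact: map_f.
exact: map_f.
Qed.

Variables (C tmax : nat) (l : seq (spec * nat)) (X : seq nat).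
Hypothesis lOm : map fst l \in Om.
Hypothesis lC : size l <= C.
Hypothesis lA : all (fun sa => sa.2 \in 0 :: map ll I) l.
Hypothesis lk : all (fun sa => sa.1.1.1.2 <= M) l.
Hypothesis insl : all (binside (N * M)) (nconts G m N l).
Hypothesis pdl : pairwise bdisj (nconts G m N l).
Hypothesis full : has (fun c => (N * M <= blen c) && (N <= bth c)) (nconts G m N l).
Hypothesis uX : uniq X.
Hypothesis XI : forall i, i \in X -> let it := nth item0 I i in [&& i < size I, ll it <= N & islong q N it || (ll it * r <= N)].
Hypothesis capX : forall kap, 0 < kap <= N * M ->
  \sum_(i <- X | kap <= nl q G m N (nth item0 I i)) nwt q G m N (nth item0 I i) <=
  \sum_(c <- nconts G m N l | kap <= blen c) boxcap N c.
Hypothesis thin : forall i, i < size I -> M * tt (nth item0 I i) <= tmax.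
Hypothesis tm : 8 * (C + 4) * tmax <= N.
Hypothesis rbig : 16 * G * (C * M + 2) <= r.

Let cs := nconts G m N l.
Let inX (e : rent) := ridx e \in X.

Lemma sum_inX (F : nat -> nat) :
  \sum_(e <- [seq e <- srents | inX e]) F (ridx e) = \sum_(i <- X | 0 < ip (nth item0 I i)) F i.
Proof.
rewrite -(big_map ridx xpredT F) -[in RHS]big_filter; apply: perm_big; apply: uniq_perm.
- by rewrite -filter_map filter_uniq // uniq_srents.
- by rewrite filter_uniq.
move=> i; rewrite mem_filter; apply/mapP/andP => [[e]|[i0 iX]].
  by rewrite mem_filter => /andP[eX /srentsP[k [_ /and3P[h _ _] ee]]] ->; split=> //; rewrite ee.
have /and3P[h1 h2 h3] := XI iX; exists (rentof (i, nth item0 I i)) => //.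
by rewrite mem_filter /inX /= iX; apply/srentsP; exists i; split=> //; apply/and3P.
Qed.

(** The structured set [X], without its items of zero profit, respects all capacities of its own
    guess, so [greedy_opt] applies with [X] as competitor, and first fit places all that greedy
    takes. *)
Lemma level_good : \sum_(i <- X) ip (nth item0 I i) <= level.1.
Proof.
have G0 : 0 < G by move: M0; rewrite muln_gt0 => /andP[].
have m0 : 0 < m by move: M0; rewrite muln_gt0 => /andP[].
have ok : cfg_ok cs by rewrite /cfg_ok insl.
have csg : cs \in guesses.
  apply/flattenP; exists [seq nconts G m N (zip (map fst l) a) | a <- allt (0 :: map ll I) (size (map fst l))].
    by apply/mapP; exists (map fst l).
  apply/mapP; exists (map snd l); last by rewrite -/(unzip1 l) -/(unzip2 l) zip_unzip.
  by rewrite size_map -(size_map snd); apply: allt_mem; rewrite all_map.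
have [_ /(_ cs csg ok)] := best_ge guesses [::]; apply: leq_trans.
set g := greedy N cs (map rL srents) srents.
have ws : all wfe (stack (N * m) g).
  by apply: stack_wf; apply/allP => f /greedy_sub; apply: (allP srents_small).
have rest0 : (fill cs (stack (N * m) g)).1 = [::].
  apply: (@good_run N G M (N * m) C r tmax srents cs) => //.
  - by rewrite /M; ring.
  - move=> e /srentsP[k [_ _ ->]]; rewrite /rlong /rL /rA /rT /rW /= /nl /nwt => lg; rewrite lg; split=> //.
      rewrite (_ : M * ll _ = ll (nth item0 I k) * G * m); last by rewrite /M; ring.
      by rewrite leq_mul2r (leq_trans (ltnW lg)) ?orbT // leq_mul2l qG orbT.
    by rewrite /M; ring.
  - move=> e /srentsP[k [_ /and3P[_ _ h] ->]]; rewrite /rlong /rL /rA /rT /rW /= /nl /nwt => lg; rewrite (negbTE lg); split=> //.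
      by move: h; rewrite (negbTE lg) /= => h; rewrite -mulnA mulnC leq_mul2r h orbT.
    have wh : iw (nth item0 I k) * ih (nth item0 I k) = ll (nth item0 I k) * tt (nth item0 I k).
      by rewrite /ll /tt /maxn /minn; case: ifP => // _; rewrite mulnC.
    by rewrite wh /M; ring.
  - move=> e /srentsP[k [ks /and3P[_ lN h] ->]]; rewrite /rL /rT /rW /= /nl /nwt; split.
    + exact: thin.
    + case: ifP => lg; first by rewrite /M; apply: eq_leq; ring.
      have wh : iw (nth item0 I k) * ih (nth item0 I k) = ll (nth item0 I k) * tt (nth item0 I k).
        by rewrite /ll /tt /maxn /minn; case: ifP => // _; rewrite mulnC.
      rewrite lg /= in h; rewrite wh; have hG : ll (nth item0 I k) * G <= N by apply: leq_trans h; rewrite leq_mul2l Gr orbT.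
      have -> : G * m * G * (ll (nth item0 I k) * tt (nth item0 I k)) = (ll (nth item0 I k) * G) * (M * tt (nth item0 I k)) by rewrite /M; ring.
      by rewrite leq_mul2r hG orbT.
    + case: ifP => _; first by rewrite mulnC leq_mul2r lN orbT.
      by rewrite leq_mul2l /M leq_pmull ?orbT.
  - by rewrite size_map.
  - rewrite all_map; apply: sub_all lk => sa /= h; by rewrite /bth /= /sth leq_mul2r h orbT.
rewrite /runcs -/g fill_profit // (psum_perm (stack_perm _ _)).
apply: leq_trans (greedy_opt (x := inX) _ srents_sorted srents_pos); last first.
  move=> k /mapP[e /srentsP[j [_ /and3P[_ lN _] ->]] ->]; rewrite /rL /=.
  set kap := nl _ _ _ _ _.
  have kapb : 0 < kap <= N * M.
    rewrite /kap /nl; case: ifP => lg; last by rewrite muln_gt0 N0 m0 leq_mul2l /M leq_pmull ?orbT.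
    rewrite -/M muln_gt0 M0 mulnC leq_mul2r lN orbT andbT lt0n.
    by apply/eqP => l0; move: lg; rewrite /islong l0.
  have := capX kapb; rewrite /capsum sumnE big_map big_filter; apply: leq_trans.
  rewrite /wsum sumnE big_map big_filter big_mkcond.
  pose F i := if kap <= nl q G m N (nth item0 I i) then nwt q G m N (nth item0 I i) else 0.
  rewrite (eq_big_seq (fun e => F (ridx e))); last first.
    by move=> f; rewrite mem_filter => /andP[_ /srentsP[i [_ _ ->]]].
  rewrite (sum_inX F) [X in _ <= X]big_mkcond [X in X <= _]big_mkcond.
  by apply: leq_sum => i _; case: ifP.
rewrite /psum sumnE big_map (eq_big_seq (fun e => ip (nth item0 I (ridx e)))); last first.
  by move=> f; rewrite mem_filter => /andP[_ /srentsP[i [_ _ ->]]].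
rewrite (sum_inX (fun i => ip (nth item0 I i))) [X in _ <= X]big_mkcond.
by apply: leq_sum => i _; case: posnP => [->|].
Qed.
End Level.

Definition apr (X Y : Type) (s : seq X) (t : seq Y) := [seq (a, b) | a <- s, b <- t].
Lemma mem_apr (X Y : eqType) (s : seq X) (t : seq Y) a b : a \in s -> b \in t -> (a, b) \in apr s t.
Proof. by move=> h1 h2; apply/allpairsP; exists (a, b). Qed.

Fixpoint lists_upto (X : Type) (A : seq X) (n : nat) : seq (seq X) :=
  [::] :: (if n is n'.+1 then [seq x :: s | x <- A, s <- lists_upto A n'] else [::]).
Lemma mem_lists_upto (X : eqType) (A : seq X) n s : size s <= n -> all (fun x => x \in A) s -> s \in lists_upto A n.
Proof.
elim: n s => [|n IH] [|x s] //= sn /andP[xA sA]; rewrite in_cons; apply/orP; right.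
by apply/allpairsP; exists (x, s); split=> //; apply: IH.
Qed.

Definition specs (C M : nat) : seq spec :=
  apr (apr (apr (iota 0 3) (iota 0 M.+1)) [:: true; false])
      (apr (lists_upto [:: true; false] C) (lists_upto [:: true; false] C)).

Lemma spec_ok_mem C M sp : spec_ok C M sp -> sp \in specs C M.
Proof.
case: sp => [[[s k] v] [mx my]] /and4P[/= h1 h2 h3 h4].
have bb (b : bool) : b \in [:: true; false] by case: b.
have bs (u : bitseq) : all (fun b => b \in [:: true; false]) u by apply/allP.
by apply: mem_apr; [apply: mem_apr; [apply: mem_apr; rewrite mem_iota|]|apply: mem_apr; apply: mem_lists_upto].
Qed.

Definition pq (P : params) := P.1.1.1.1.
Definition pr (P : params) := P.1.1.1.2.
Definition pG (P : params) := P.1.1.2.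
Definition pm (P : params) := P.1.2.
Definition plevel (P : params) (N : nat) (I : seq item) := level (pq P) (pr P) (pG P) (pm P) P.2 N I.
Definition pvalid (P : params) := [&& 0 < pG P * pm P, pq P <= pG P & pG P <= pr P].
Definition best_level (Ps : seq params) N I : nat * seq out_entry :=
  foldr (fun P b => if b.1 < (plevel P N I).1 then plevel P N I else b) (0, [::]) Ps.

Lemma best_level_ok (R : realFieldType) Ps N I : 0 < N -> all pvalid Ps ->
  [/\ all entry_ok (best_level Ps N I).2, feasible N I (map (@entry_place R) (best_level Ps N I).2) &
      profit I (map (@entry_place R) (best_level Ps N I).2) = (best_level Ps N I).1].
Proof.
move=> N0; elim: Ps => [_|P Ps IH] /=; first by split=> //; rewrite /profit big_nil.
case/andP => /and3P[v1 v2 v3] /IH {}IH; case: ifP => // _.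
have [h1 h2] : all entry_ok (plevel P N I).2 /\ feasible N I (map (@entry_place R) (plevel P N I).2) by apply: level_feasible.
by split=> //; apply: level_profit.
Qed.

Lemma best_level_ge Ps N I P : P \in Ps -> (plevel P N I).1 <= (best_level Ps N I).1.
Proof.
elim: Ps => //= P' Ps IH; rewrite in_cons => /orP[/eqP<-|/IH h]; first by case: ltnP.
by case: ltnP => // /ltnW; apply: leq_trans.
Qed.

Lemma fits_ll (R : realFieldType) N I (pl : placement R) : fits N I pl -> ll (nth item0 I (pidx pl)) <= N.
Proof.
move=> /and4P[x0 y0 xw yh]; have hw : pwidth I pl <= N by rewrite -(ler_nat R); apply: le_trans xw; rewrite lerDr.
have hh : pheight I pl <= N by rewrite -(ler_nat R); apply: le_trans yh; rewrite lerDr.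
by move: hw hh; rewrite /pwidth /pheight /ll geq_max; case: (prot pl) => -> ->.
Qed.

(** * Combining the levels *)

Section Levels.
Variables (R : realType) (E : nat).

Definition good_params (dl : R) (P : params) :=
  forall (N : nat) (I : seq item) (S : seq (placement R)), 0 < N -> feasible N I S ->
  (forall i, i < size I -> ((tt (nth item0 I i))%:R <= dl * N%:R)%R) ->
  (forall i : 'I_(size S), islong (pq P) N (pit I i) || (ll (pit I i) * pr P <= N)) ->
  E.+1 * profit I S <= 3 * profit I S + E.+1 * (plevel P N I).1.

Lemma good_params_le dl dl' P : (dl' <= dl)%R -> good_params dl P -> good_params dl' P.
Proof.
move=> h g N I S N0 fea th; apply: g => // i iI; apply: le_trans (th i iI) _.
by rewrite ler_wpM2r.
Qed.

Lemma one_level q : 0 < q -> exists (dl : R) (P : params), [/\ (0 < dl)%R, pq P = q, pvalid P & good_params dl P].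
Proof.
move=> q0; have [delta0 [G [m [C [r0 [dl0 m0 qG str]]]]]] := structure_nat R E q0.
have G0 : 0 < G by apply: leq_trans qG.
pose M := G * m; have M0 : 0 < M by rewrite muln_gt0 G0.
(* The three terms serve the structure theorem, the waste bound for shelves, and the condition that
   a small item is no longer than a shelf. *)
pose r := r0 + (16 * G * (C * M + 2) + G).
have K0 : 0 < 8 * (C + 4) by rewrite muln_gt0 addn_gt0 orbT.
pose dl : R := Num.min delta0 ((M * (8 * (C + 4)))%:R^-1)%R.
have MK0 : (0 < (M * (8 * (C + 4)))%:R :> R)%R by rewrite ltr0n muln_gt0 M0.
exists dl, (q, r, G, m, lists_upto (specs C M) C); split=> //.
- by rewrite /dl lt_min dl0 invr_gt0.
- by rewrite /pvalid /pG /pm /pq /pr /= -/M M0 qG /r !addnA leq_addl.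
move=> N I S N0 fea th cls.
have thin i : i < size I -> M * tt (nth item0 I i) <= N %/ (8 * (C + 4)).
  move=> iI; rewrite leq_divRL // -(ler_nat R) (_ : M * _ * _ = tt (nth item0 I i) * (M * (8 * (C + 4)))); last by ring.
  rewrite natrM; apply: le_trans (ler_wpM2r (ltW MK0) (th i iI)) _.
  by rewrite mulrAC ler_piMl // -ler_pdivlMr // mul1r /dl ge_min lexx orbT.
have pitI (i : 'I_(size S)) : pidx (nth (place0 R) S i) < size I.
  by have [_ al _] := fea; have /andP[] := all_nthP (place0 R) al i (ltn_ord i).
have [|i|l [X [[lC lo ins pd full] [uX XS pX capX]]]] := str r _ N I S N0 fea _.
- by rewrite /r leq_addr.
- have := cls i; rewrite /pq /pr /=; case: (boolP (islong _ _ _)) => [lg _|nl h]; [left|right]; split=> //.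
  by apply: le_trans (th _ (pitI i)) _; rewrite ler_wpM2r // /dl ge_min lexx.
apply: leq_trans pX _; rewrite leq_add2l leq_mul2l /=.
apply: (@level_good q r G m (lists_upto (specs C M) C) N I N0 M0 qG _ C (N %/ (8 * (C + 4))) l X) => //.
- by rewrite /r !addnA leq_addl.
- apply: mem_lists_upto; first by rewrite size_map.
  by rewrite all_map; apply: sub_all lo => sa /andP[h _]; apply: spec_ok_mem.
- by apply: sub_all lo => sa /andP[].
- by apply: sub_all lo => sa /andP[/and4P[]].
- move=> i /XS ii; have jS : index i (map (@pidx R) S) < size S by rewrite -(size_map (@pidx R)) index_mem.
  pose j := Ordinal jS; have ij : i = pidx (nth (place0 R) S j) by rewrite -(nth_map _ 0) // nth_index.
  have [_ al _] := fea; have /andP[iI fi] := all_nthP (place0 R) al j jS.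
  by rewrite /= ij; apply/and3P; split; [exact: iI|exact: fits_ll fi|exact: cls j].
- by rewrite mulnC leq_divM.
- by rewrite /r addnCA leq_addr.
Qed.

Lemma pigeon_seq (X : eqType) (f : X -> nat) (s : seq X) T : 0 < size s -> \sum_(a <- s) f a <= T ->
  exists2 a, a \in s & size s * f a <= T.
Proof.
move=> s0 sT; case: (boolP (has (fun a => size s * f a <= T) s)) => [/hasP[a as_ h]|/hasPn none]; first by exists a.
have : size s * T.+1 <= size s * \sum_(a <- s) f a.
  rewrite big_distrr /= -[in X in X <= _]sum1_size big_distrl /= big_seq [X in _ <= X]big_seq.
  by apply: leq_sum => a as_; rewrite mul1n ltnNge none.
by rewrite leq_pmul2l // ltnNge sT.
Qed.

Lemma nth_filter_ex (X : Type) (d : X) (a : pred X) s j : j < size (filter a s) ->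
  exists2 j', j' < size s & nth d s j' = nth d (filter a s) j.
Proof.
elim: s j => //= x s IH j; case: (a x) => /=; last by move=> /IH[j' h1 h2]; exists j'.+1.
by case: j => [|j] /=; [exists 0|move=> /IH[j' h1 h2]; exists j'.+1].
Qed.

Lemma feasible_filter N I (S : seq (placement R)) a : feasible N I S -> feasible N I (filter a S).
Proof.
move=> [us al dis]; have uf : uniq (map (@pidx R) (filter a S)).
  elim: S us {al dis} => //= pl S IH /andP[h1 /IH h2]; case: (a pl) => //=; rewrite h2 andbT.
  apply: contra h1; elim: S {IH h2} => //= pl' S IH; case: (a pl') => /=; rewrite !in_cons.
    by case/orP => [->//|/IH->]; rewrite orbT.
  by move/IH => ->; rewrite orbT.
split=> //.
- by rewrite all_filter; apply: sub_all al => pl h /=; apply/implyP => _; exact: h.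
move=> j k js ks jk u v; have [j' js' ej] := nth_filter_ex (place0 R) js; have [k' ks' ek] := nth_filter_ex (place0 R) ks.
rewrite -ej -ek; apply: dis => //; apply: contraNneq jk => e.
by rewrite -(nth_uniq 0 _ _ uf) ?size_map // !(nth_map (place0 R)) // -ej -ek e.
Qed.

(** Each level takes the [r] of the previous one as its [q], so the medium ranges do not overlap;
    the thickness bound is the minimum over all levels. *)
Lemma levels_exist n q : 0 < q -> exists (dl : R) (Ps : seq params),
  [/\ (0 < dl)%R, size Ps = n, all pvalid Ps, all (fun P => q <= pq P) Ps &
      pairwise (fun P P' => pr P <= pq P') Ps /\ forall P, P \in Ps -> good_params dl P].
Proof.
elim: n q => [|n IH] q q0; first by exists 1%R, [::].
have [dl [P [dl0 Pq Pv Pg]]] := one_level q0.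
have r0 : 0 < pr P by move: Pv; rewrite /pvalid => /and3P[_ h1 h2]; apply: leq_trans q0 _; rewrite -Pq; apply: leq_trans h1 h2.
have [dl' [Ps [dl0' sP vP qP [pP gP]]]] := IH (pr P) r0.
exists (Num.min dl dl'), (P :: Ps); split=> //=.
- by rewrite lt_min dl0.
- by rewrite sP.
- by rewrite Pv.
- rewrite Pq leqnn; apply: sub_all qP => P' h; apply: leq_trans h; rewrite -Pq.
  by move: Pv => /and3P[_ h1 h2]; apply: leq_trans h1 h2.
- split; first by rewrite qP pP.
  move=> P'; rewrite in_cons => /orP[/eqP->|/gP g]; [apply: good_params_le Pg|apply: good_params_le g]; by rewrite ge_min lexx ?orbT.
Qed.

Definition medium N (P : params) (it : item) := (ll it * pq P <= N) && (N < ll it * pr P).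

Lemma medium_once N it Ps : pairwise (fun P P' => pr P <= pq P') Ps -> count (fun P => medium N P it) Ps <= 1.
Proof.
elim: Ps => //= P Ps IH /andP[al /IH h]; case: (boolP (medium N P it)) => [/andP[_ md]|_] //=.
rewrite (_ : count _ Ps = 0) //; apply/eqP; rewrite -leqn0 leqNgt -has_count; apply/hasPn => P' P's.
rewrite /medium negb_and -ltnNge (leq_trans md) // leq_mul2l; by have := allP al P' P's => ->; rewrite orbT.
Qed.

(** An item is medium at no more than one of the [E.+1] levels, so at some level the medium items
    carry at most one part of the profit. This joins the three parts lost within a level. *)
Lemma best_good Ps dl N I (S : seq (placement R)) : size Ps = E.+1 ->
  pairwise (fun P P' => pr P <= pq P') Ps -> (forall P, P \in Ps -> good_params dl P) ->
  0 < N -> feasible N I S -> (forall i, i < size I -> ((tt (nth item0 I i))%:R <= dl * N%:R)%R) ->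
  E.+1 * profit I S <= 4 * profit I S + E.+1 * (best_level Ps N I).1.
Proof.
move=> sP pP gP N0 fea th.
pose it (pl : placement R) := nth item0 I (pidx pl).
pose f P := \sum_(pl <- S | medium N P (it pl)) ip (it pl).
have [||P PP hP] := @pigeon_seq _ f Ps (profit I S).
- by rewrite sP.
- rewrite /f /profit; move: S {f fea} => S0; elim: S0 => [|pl S0 IH]; first by under eq_bigr do rewrite big_nil; rewrite big1.
  under eq_bigr do rewrite big_cons -/(it pl).
  rewrite (eq_bigr (fun P => (if medium N P (it pl) then ip (it pl) else 0) + \sum_(pl <- S0 | medium N P (it pl)) ip (it pl))); last first.
    by move=> P _; case: ifP.
  rewrite big_split big_cons /=; apply: leq_add => //.
  rewrite -big_mkcond /= big_const_seq iter_addn_0 mulnC.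
  by rewrite -[X in _ <= X]mul1n leq_mul2r medium_once ?orbT.
pose S' := [seq pl <- S | ~~ medium N P (it pl)].
have fea' : feasible N I S' by apply: feasible_filter.
have pS : profit I S = f P + profit I S'.
  by rewrite /profit /f /S' big_filter (bigID (fun pl => medium N P (it pl))).
have cls (i : 'I_(size S')) : islong (pq P) N (pit I i) || (ll (pit I i) * pr P <= N).
  have := all_nthP (place0 R) (filter_all (fun pl => ~~ medium N P (it pl)) S) i (ltn_ord i).
  rewrite /medium negb_and -leqNgt -ltnNge => /orP[h|h]; first by rewrite /islong; apply/orP; left; exact: h.
  by apply/orP; right; exact: h.
have h := gP P PP N I S' N0 fea' th cls.
have h2 := best_level_ge N I PP.
rewrite sP in hP; rewrite pS mulnDr.
have h3 : 3 * profit I S' <= 3 * profit I S by rewrite leq_mul2l pS leq_addl.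
have h4 : E.+1 * (plevel P N I).1 <= E.+1 * (best_level Ps N I).1 by rewrite leq_mul2l h2 orbT.
rewrite -pS; move: hP h h3 h4; move: (E.+1 * f P) (E.+1 * profit I S') (E.+1 * (plevel P N I).1) (E.+1 * (best_level Ps N I).1).
by clear; lia.
Qed.
End Levels.

Theorem approximation (R : realType) (eps : R) : (0 < eps)%R ->
  exists (eps_skew : R) (Ps : seq params), [/\ (0 < eps_skew)%R, all pvalid Ps &
  forall N I, 0 < N -> skewed eps_skew N I -> forall S : seq (placement R), feasible N I S ->
    ((profit I S)%:R <= (1 + eps) * (best_level Ps N I).1%:R)%R].
Proof.
move=> eps0; pose E := (Num.truncn (4 * (1 + eps) / eps)).+1.
have Ebig : (4 * (1 + eps) <= eps * E.+1%:R)%R.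
  rewrite [(eps * _)%R]mulrC -ler_pdivrMr //; apply: le_trans (ltW (truncnS_gt _)) _.
  by rewrite ler_nat.
have [dl [Ps [dl0 sP vP _ [pP gP]]]] := levels_exist R E E.+1 (isT : 0 < 1).
exists dl, Ps; split=> // N I N0 sk S fea.
have th i : i < size I -> ((tt (nth item0 I i))%:R <= dl * N%:R)%R.
  move=> iI; have := all_nthP item0 sk i iI; rewrite /tt => /orP[h|h]; apply: le_trans h; rewrite ler_nat.
    exact: geq_minr.
  exact: geq_minl.
have := best_good sP pP gP N0 fea th.
rewrite -(ler_nat R) natrD !natrM; move: (profit I S)%:R%R ((best_level Ps N I).1)%:R%R (ler0n R (profit I S)) (ler0n R (best_level Ps N I).1) Ebig.
move: (E.+1%:R : R)%R => e p b p0 b0 Ebig h.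
have e4 : (0 < e - 4)%R.
  rewrite subr_gt0 -(ltr_pM2l eps0); apply: lt_le_trans Ebig; lra.
rewrite -(ler_pM2l e4); apply: (@le_trans _ _ (e * b)%R); first by rewrite mulrBl lerBlDr addrC.
rewrite mulrA ler_wpM2r //.
have -> : ((e - 4) * (1 + eps) = e + (eps * e - 4 * (1 + eps)))%R by ring.
by rewrite lerDl subr_ge0.
Qed.

End Algorithm.

(** * Polynomial time on Turing machines *)
Module Machine.
Set Implicit Arguments. Unset Strict Implicit. Unset Printing Implicit Defensive.
Local Open Scope ring_scope.

(** * Machines on a tape indexed by the integers *)

Definition upd (f : int -> sym) (p : int) (b : sym) : int -> sym := fun z => if z == p then b else f z.

Lemma upd_id f p : upd f p (f p) = f.
Proof. by apply: functional_extensionality => z; rewrite /upd; case: eqP => [->|]. Qed.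

Lemma upd_same f p b : upd f p b p = b. Proof. by rewrite /upd eqxx. Qed.
Lemma upd_other f p b z : z <> p -> upd f p b z = f z. Proof. by rewrite /upd => /eqP/negbTE->. Qed.

Section FinTM.
Variables (S : finType) (s0 : S) (dl : S -> sym -> option (S * sym * move)).

(** The machine format fixes the start state [ord0]; it is an additional copy of [s0], while
    transitions lead to lifted states only. *)
Definition dec (i : 'I_#|S|.+1) : S := if unlift ord0 i is Some k then enum_val k else s0.
Definition mkTM : TM := @MkTM #|S| (fun i a =>
  if dl (dec i) a is Some (s, b, m) then Some (lift ord0 (enum_rank s), b, m) else None).

Definition dm (m : move) : int := match m with ML => -1 | MR => 1 | MS => 0 end.
Definition sconf := (S * int * (int -> sym))%type.
Definition sst (x : sconf) : option sconf :=
  let: (s, p, f) := x in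
  if dl s (f p) is Some (s', b, m) then Some (s', p + dm m, upd f p b) else None.
Fixpoint srun n (x : sconf) : option sconf :=
  if n is n'.+1 then (if sst x is Some y then srun n' y else None) else Some x.

Lemma srunD n m x y z : srun n x = Some y -> srun m y = Some z -> srun (n + m) x = Some z.
Proof. by elim: n x => [|n IH] x /=; [move=> [->]|case: (sst x) => // x' /IH h /h]. Qed.

(** Reading the two lists with default [SB] pads them by blanks, so moves that lengthen the tape
    fall under the same invariant. *)
Definition rep (c : config mkTM) (x : sconf) := let: (s, p, f) := x in
  [/\ dec (c_state c) = s, c_head c = f p, forall i : nat, nth SB (c_left c) i = f (p - 1 - i%:Z) &
      forall i : nat, nth SB (c_right c) i = f (p + 1 + i%:Z)].

Lemma rep_step c x y : rep c x -> sst x = Some y -> exists2 c', step c = Some c' & rep c' y.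
Proof.
case: x => [[s p] f] [h1 h2 h3 h4] /=; rewrite /step /= h1 h2.
case: (dl s (f p)) => [[[s' b] m]|] // [<-].
have decE : dec (lift ord0 (enum_rank s')) = s' by rewrite /dec liftK enum_rankK.
case: m => /=.
- exists (@MkConfig mkTM (lift ord0 (enum_rank s')) (behead (c_left c)) (head SB (c_left c)) (b :: c_right c)).
    by case: (c_left c).
  split=> //=.
  + rewrite upd_other; last by lia.
    by rewrite -nth0 h3; congr f; lia.
  + move=> i; rewrite nth_behead h3 upd_other; last by lia.
    by congr f; lia.
  + case=> [|i] /=; first by rewrite (_ : p + -1 + 1 + 0%:Z = p) ?upd_same //; lia.
    by rewrite h4 upd_other; [congr f; lia|lia].
- exists (@MkConfig mkTM (lift ord0 (enum_rank s')) (b :: c_left c) (head SB (c_right c)) (behead (c_right c))).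
    by case: (c_right c).
  split=> //=.
  + rewrite upd_other; last by lia.
    by rewrite -nth0 h4; congr f; lia.
  + case=> [|i] /=; first by rewrite (_ : p + 1 - 1 - 0%:Z = p) ?upd_same //; lia.
    by rewrite h3 upd_other; [congr f; lia|lia].
  + move=> i; rewrite nth_behead h4 upd_other; last by lia.
    by congr f; lia.
- exists (@MkConfig mkTM (lift ord0 (enum_rank s')) (c_left c) b (c_right c)) => //.
  by split=> //= [|i|i]; rewrite addr0 ?upd_same // ?h3 ?h4 upd_other //; lia.
Qed.

Lemma rep_halt c x : rep c x -> sst x = None -> step c = None.
Proof. by case: x => [[s p] f] [h1 h2 h3 h4] /=; rewrite /step /= h1 h2; case: (dl s (f p)) => [[[? ?] ?]|]. Qed.

Lemma rep_run n c x y : rep c x -> srun n x = Some y -> sst y = None -> exists2 c', run n c = Some c' & rep c' y.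
Proof.
elim: n c x => [|n IH] c x cx /=.
  by move=> [<-] hx; exists c; rewrite // /run (rep_halt cx hx).
case hx: (sst x) => [x'|] // rn hy; have [c' st c'x'] := rep_step cx hx.
by have [c2 r2 c2y] := IH _ _ c'x' rn hy; exists c2; rewrite //= st.
Qed.

Definition tape_of (w : seq sym) : int -> sym := fun z => if z is Posz n then nth SB w n else SB.

Lemma rep_init w : rep (@init mkTM w) (s0, 0, tape_of w).
Proof.
have d0 : dec ord0 = s0 by rewrite /dec; case: unliftP => // j /(congr1 val).
have neg (u : seq sym) (i : nat) : tape_of u (0 - 1 - i%:Z) = SB by rewrite (_ : 0 - 1 - i%:Z = Negz i) //; lia.
have psv (u : seq sym) (i : nat) : tape_of u (0 + 1 + i%:Z) = nth SB u i.+1 by rewrite (_ : 0 + 1 + i%:Z = i.+1%:Z) //; lia.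
by case: w => [|a w]; split=> // i; rewrite ?neg ?psv //= ?nth_nil.
Qed.

Lemma nonblank_word (s : seq sym) (u : seq bool) :
  (forall i, (i < size u)%N -> nth SB s i = sym_of_bool (nth false u i)) -> nth SB s (size u) = SB ->
  nonblank_prefix s = map sym_of_bool u.
Proof.
elim: u s => [|b u IH] [|a s] //=.
- by move=> _ ->.
- by move=> /(_ 0%N isT) /=; case: b.
move=> h hb; have := h 0%N isT => /= ->; rewrite -(IH s) //; last by move=> i iu; apply: (h i.+1).
by case: b {h}.
Qed.
End FinTM.

(** * Moves by a bounded distance *)

Section Macro.
Variables (S1 : finType) (s1 : S1) (D : nat) (dl1 : S1 -> sym -> option (S1 * sym * int)).
Hypothesis bnd : forall s a s' b m, dl1 s a = Some (s', b, m) -> (`|m| <= D)%N.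

Definition mst (x : S1 * int * (int -> sym)) : option (S1 * int * (int -> sym)) :=
  let: (s, p, f) := x in if dl1 s (f p) is Some (s', b, m) then Some (s', p + m, upd f p b) else None.
Fixpoint mrun n x := if n is n'.+1 then (if mst x is Some y then mrun n' y else None) else Some x.

Lemma mrunD n m x y z : mrun n x = Some y -> mrun m y = Some z -> mrun (n + m) x = Some z.
Proof. by elim: n x => [|n IH] x /=; [move=> [->]|case: (mst x) => // x' /IH h /h]. Qed.

(** The state remembers the direction and the number of unit moves still due; at [ord0] the next
    transition fires. *)
Definition uS := (S1 * (bool * 'I_D.+1))%type.
Definition udl (x : uS) (a : sym) : option (uS * sym * move) :=
  let: (s, (d, k)) := x in
  if k == ord0 then
    if dl1 s a is Some (s', b, m) then Some ((s', (0 <= m, inord `|m|)), b, MS) else None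
  else Some ((s, (d, inord k.-1)), a, if d then MR else ML).

Lemma umove s d (k : nat) p f : (k <= D)%N ->
  srun udl k ((s, (d, inord k)), p, f) = Some ((s, (d, ord0)), (if d then p + k%:Z else p - k%:Z), f).
Proof.
elim: k p => [|k IH] p kD.
  by rewrite /= (_ : inord 0 = ord0); [case: d; rewrite ?addr0 ?subr0|apply: val_inj; rewrite /= inordK].
rewrite /= (_ : (inord k.+1 == ord0 :> 'I_D.+1) = false); last by rewrite -val_eqE /= inordK.
rewrite inordK // upd_id IH; last exact: ltnW.
by congr (Some (_, _, _)); case: d {IH} => /=; lia.
Qed.

Lemma ustep s d p f s' p' f' : mst (s, p, f) = Some (s', p', f') ->
  exists n d', (n <= D.+1)%N /\ srun udl n ((s, (d, ord0)), p, f) = Some ((s', (d', ord0)), p', f').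
Proof.
rewrite /mst; case e: (dl1 s (f p)) => [[[s2 b] m]|] // [<- <- <-].
have mD := bnd e; exists (1 + `|m|)%N, (0 <= m); split; first by rewrite add1n ltnS.
apply: (@srunD _ _ 1 _ _ ((s2, (0 <= m, inord `|m|)), p, upd f p b)); first by rewrite /= e addr0.
by rewrite umove //; congr (Some (_, _, _)); case: m {e mD} => m /=; lia.
Qed.

Lemma urun n s d p f s' p' f' : mrun n (s, p, f) = Some (s', p', f') ->
  exists N d', (N <= D.+1 * n)%N /\ srun udl N ((s, (d, ord0)), p, f) = Some ((s', (d', ord0)), p', f').
Proof.
elim: n s d p f => [|n IH] s d p f; first by move=> [<- <- <-]; exists 0%N, d; rewrite muln0.
rewrite /=; case E: (dl1 s (f p)) => [[[s2 b] m]|] //.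
have ms : mst (s, p, f) = Some (s2, p + m, upd f p b) by rewrite /= E.
have [n1 [d1 [h1 h2]]] := ustep d ms; move=> /IH - /(_ d1)[n2 [d2 [h3 h4]]].
by exists (n1 + n2)%N, d2; split; [rewrite mulnS leq_add|apply: srunD h2 h4].
Qed.
End Macro.

(** * Six stacks on one tape *)

Inductive stk := IO | A | B | C | D | W.
Record state := St { sIO : seq bool; sA : seq bool; sB : seq bool; sC : seq bool; sD : seq bool; sW : seq bool }.
Definition get (j : stk) (s : state) :=
  match j with IO => sIO s | A => sA s | B => sB s | C => sC s | D => sD s | W => sW s end.
Definition set (j : stk) (u : seq bool) (s : state) := let: St io a b c d w := s in
  match j with IO => St u a b c d w | A => St io u b c d w | B => St io a u c d w
             | C => St io a b u d w | D => St io a b c u w | W => St io a b c d u end.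
(* [IO] grows to the right over the input, which it initially is; the other stacks
   are interleaved on the left half.  The blank cell below each bottom is a
   sentinel. *)
Definition base (j : stk) : int := match j with IO => -1 | A => -2%:Z | B => -3%:Z | C => -4%:Z | D => -5%:Z | W => -6%:Z end.
Definition stride (j : stk) : int := if j is IO then 1 else -5%:Z.
Definition pos (j : stk) (d : nat) : int := base j + stride j * d%:Z.

Lemma pos_inj j d j' d' : pos j d = pos j' d' -> j = j' /\ d = d'.
Proof. by case: j; case: j'; rewrite /pos /base /stride; split=> //; lia. Qed.

Lemma get_set j u s j' : (j = j' /\ get j' (set j u s) = u) \/ (j <> j' /\ get j' (set j u s) = get j' s).
Proof. by case: s => *; case: j; case: j'; (left; by []) || (right; by []). Qed.

(** Depth is counted from the bottom, with the sentinel at depth zero, so that a push or a pop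
    changes a single cell. *)
Definition cellv (s : seq bool) (d : nat) : sym := if d is d'.+1 then nth SB (map sym_of_bool (rev s)) d' else SB.
Definition trep (s : state) (f : int -> sym) := forall j d, f (pos j d) = cellv (get j s) d.

Lemma cellv_out s d : (size s < d)%N -> cellv s d = SB.
Proof. by case: d => //= d h; rewrite nth_default // size_map size_rev. Qed.

Lemma cellv_in s d : (0 < d <= size s)%N -> cellv s d <> SB.
Proof. by case: d => //= d h; rewrite (nth_map false) ?size_rev //; case: nth. Qed.

Lemma cellv_cons b s d : cellv (b :: s) d = if d == (size s).+1 then sym_of_bool b else cellv s d.
Proof.
case: d => //= d; rewrite eqSS rev_cons map_rcons nth_rcons size_map size_rev.
by case: ltngtP => // h; rewrite nth_default // size_map size_rev ltnW.
Qed.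

Lemma trep_set s f j u d b : trep s f -> (forall d', cellv u d' = if d' == d then b else cellv (get j s) d') ->
  trep (set j u s) (upd f (pos j d) b).
Proof.
move=> sf hu j' d'; rewrite /upd; case: eqP => [/pos_inj[-> ->]|ne].
  by case: (get_set j u s j) => -[// _ ->]; rewrite hu eqxx.
rewrite sf; case: (get_set j u s j') => -[e ->] //.
by rewrite hu -e; case: eqP => // ed; case: ne; rewrite e ed.
Qed.

Inductive instr (X : Type) := IPush of stk & bool & X | IPop of stk & X & X & X.
Definition imap X Y (g : X -> Y) (i : instr X) : instr Y :=
  match i with IPush j b x => IPush j b (g x) | IPop j x y z => IPop j (g x) (g y) (g z) end.

Section StackTM.
Variables (Q : finType) (delta : Q -> instr (option Q)).
(* phases of one instruction: going to the track, scanning for its end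
   (false, false), inspecting its top (false, true), returning with a bit *)
Definition mS := (option Q * option (bool * bool))%type.
Definition istk (i : instr (option Q)) := match i with IPush j _ _ | IPop j _ _ _ => j end.
Definition target (q : Q) (c : bool) := match delta q with IPush _ _ x => x | IPop _ _ x0 x1 => if c then x1 else x0 end.
Definition mdl (x : mS) (a : sym) : option (mS * sym * int) :=
  if x.1 is Some q then
    let j := istk (delta q) in
    match x.2 with
    | None => Some ((Some q, Some (false, false)), a, base j + stride j)
    | Some (false, false) =>
           if a is SB then
             match delta q with
             | IPush _ b _ => Some ((Some q, Some (true, false)), sym_of_bool b, - stride j)
             | _ => Some ((Some q, Some (false, true)), SB, - stride j)
             end
           else Some ((Some q, Some (false, false)), a, stride j)
    | Some (false, true) =>
           match delta q, a with
           | IPop _ xe _ _, SB => Some ((xe, None), SB, - base j)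
           | _, S1 => Some ((Some q, Some (true, true)), SB, - stride j)
           | _, _ => Some ((Some q, Some (true, false)), SB, - stride j)
           end
    | Some (true, c) =>
           if a is SB then Some ((target q c, None), SB, - base j)
           else Some ((Some q, Some (true, c)), a, - stride j)
    end
  else None.

(** The longest jump is from the origin to the first cell of track [W], where
    [base W + stride W = -11]. *)
Lemma mdl_bnd s a s' b m : mdl s a = Some (s', b, m) -> (`|m| <= 11)%N.
Proof.
case: s => [[q|] [[[] c]|]] //=.
- by case: a => -[_ _ <-]; case: (istk _).
- rewrite /mdl /=; case: c => /=; case: a; case: (delta q) => [j b' x|j x y z] /= [] _ _ <-; by case: j.
- by move=> [_ _ <-]; case: (istk _).
Qed.

Notation run := (mrun mdl).

Lemma posS j d : pos j d.+1 = pos j d + stride j. Proof. by rewrite /pos -addn1 PoszD mulrDr mulr1 addrA. Qed.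

Lemma scan q f s k d : trep s f -> let j := istk (delta q) in (d + k)%N = size (get j s) ->
  run k ((Some q, Some (false, false)), pos j d.+1, f) = Some ((Some q, Some (false, false)), pos j (size (get j s)).+1, f).
Proof.
move=> sf j; elim: k d => [|k IH] d e; first by rewrite -e addn0.
have nb : f (pos j d.+1) <> SB by rewrite sf; apply: cellv_in; move: e; move: (size _) => n; clear; lia.
rewrite /= -/j; case fe: (f _) nb => //= _; rewrite -fe upd_id -posS; apply: IH; move: e; clear; lia.
Qed.

Lemma back q f s d c : trep s f -> let j := istk (delta q) in (d <= size (get j s))%N ->
  run d.+1 ((Some q, Some (true, c)), pos j d, f) = Some ((target q c, None), 0, f).
Proof.
move=> sf j; elim: d => [|d IH] dle.
  have f0 : f (pos j 0) = SB by rewrite sf.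
  have u0 : upd f (pos j 0) SB = f by rewrite -f0 upd_id.
  have p0 : pos j 0 + - base j = 0 by rewrite /pos mulr0; lia.
  by rewrite /= f0 /= -/j u0 p0.
have nb : f (pos j d.+1) <> SB by rewrite sf; apply: cellv_in.
have step1 : mst mdl ((Some q, Some (true, c)), pos j d.+1, f) = Some ((Some q, Some (true, c)), pos j d, f).
  have -> : pos j d = pos j d.+1 - stride j by rewrite posS; lia.
  by rewrite /= -/j; case fe: (f _) nb => //= _; rewrite -fe upd_id.
have runS n x : run n.+1 x = if mst mdl x is Some y then run n y else None by [].
by rewrite runS step1 IH // ltnW.
Qed.

Lemma start_run q f j : istk (delta q) = j -> run 1 ((Some q, None), 0, f) = Some ((Some q, Some (false, false)), pos j 1, f).
Proof. by move=> ji; rewrite /= ji upd_id /pos mulr1 add0r. Qed.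

Lemma push_run q j b x s f : delta q = IPush j b x -> trep s f -> exists n f',
  [/\ (n <= 2 * size (get j s) + 4)%N, run n ((Some q, None), 0, f) = Some ((x, None), 0, f') & trep (set j (b :: get j s) s) f'].
Proof.
move=> dq sf; have ji : istk (delta q) = j by rewrite dq.
set u := get j s; pose f' := upd f (pos j (size u).+1) (sym_of_bool b).
have sf' : trep (set j (b :: u) s) f' by apply: trep_set => // d'; rewrite cellv_cons.
have get' : get j (set j (b :: u) s) = b :: u by case: (get_set j (b :: u) s j) => -[].
exists (1 + (size u + (1 + (size u).+1)))%N, f'; split=> //; first by lia.
apply: mrunD (start_run _ ji) _.
apply: mrunD (_ : run _ _ = Some ((Some q, Some (false, false)), pos j (size u).+1, f)) _.
  by have := @scan q f s (size u) 0 sf; rewrite /= ji => ->.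
apply: (@mrunD _ _ 1 _ _ ((Some q, Some (true, false)), pos j (size u), f')).
  by rewrite /= sf cellv_out // /mdl /= dq /=; congr (Some (_, _, _)); rewrite posS addrK.
have := @back q f' _ (size u) false sf'; rewrite /= ji get' /target dq => -> //=.
Qed.

Lemma pop_run q j xe x0 x1 s f : delta q = IPop j xe x0 x1 -> trep s f -> exists n f',
  [/\ (n <= 2 * size (get j s) + 4)%N,
   run n ((Some q, None), 0, f) = Some ((if get j s is b :: _ then if b then x1 else x0 else xe, None), 0, f') &
   trep (set j (behead (get j s)) s) f'].
Proof.
move=> dq sf; have ji : istk (delta q) = j by rewrite dq.
set u := get j s.
have start : run (1 + (size u + 1)) ((Some q, None), 0, f) = Some ((Some q, Some (false, true)), pos j (size u), f).
  apply: mrunD (start_run _ ji) _.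
  apply: mrunD (_ : run _ _ = Some ((Some q, Some (false, false)), pos j (size u).+1, f)) _.
    by have := @scan q f s (size u) 0 sf; rewrite /= ji => ->.
  have fb : f (pos j (size u).+1) = SB by rewrite sf cellv_out.
  by rewrite /= fb /mdl /= dq /= -[X in upd _ _ X]fb upd_id posS addrK.
case ue: u => [|b v].
  exists (1 + (size u + 1) + 1)%N, f; split; first by rewrite ue.
    apply: mrunD start _; rewrite ue; have f0 : f (pos j 0) = SB by rewrite sf.
    by rewrite /= f0 /mdl /= dq /= -[X in upd _ _ X]f0 upd_id; congr (Some (_, _, _)); rewrite /pos mulr0; lia.
  by move=> j' d'; rewrite sf; case: (get_set j [::] s j') => -[e ->] //; rewrite -e -/u ue.
pose f' := upd f (pos j (size v).+1) SB.
have sf' : trep (set j v s) f'.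
  apply: trep_set => // d'; rewrite -/u ue cellv_cons; case: eqP => // ->; exact: cellv_out.
have get' : get j (set j v s) = v by case: (get_set j v s j) => -[].
exists (1 + (size u + 1) + (1 + (size v).+1))%N, f'; split=> //; first by rewrite ue /=; lia.
apply: mrunD start _; rewrite ue.
have ft : f (pos j (size v).+1) = sym_of_bool b by rewrite sf -/u ue cellv_cons eqxx.
apply: (@mrunD _ _ 1 _ _ ((Some q, Some (true, b)), pos j (size v), f')).
  by rewrite /= ft /mdl /= dq; case: (b) => /=; congr (Some (_, _, _)); rewrite posS addrK.
have := @back q f' _ (size v) b sf'; rewrite /= ji get' /target dq => -> //.
Qed.
End StackTM.

Lemma tape_neg w (z : int) : z < 0 -> tape_of w z = SB. Proof. by case: z. Qed.
Lemma pos_neg j d : j <> IO \/ d = 0%N -> pos j d < 0.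
Proof. by rewrite /pos /base /stride => -[|->]; case: j => //; lia. Qed.
Lemma pos_IO d : pos IO d.+1 = d%:Z. Proof. rewrite /pos /base /stride; lia. Qed.

Local Close Scope ring_scope.
Local Open Scope nat_scope.

(* [CIf] and [CLoop] pop a symbol and branch on it; a loop stops on the empty
   stack, and after the body of symbol [b] unless the flag [xb] is set *)
Inductive cmd :=
  | CSkip
  | CPush of stk & bool
  | CSeq of cmd & cmd
  | CIf of stk & cmd & cmd & cmd
  | CLoop of stk & bool & bool & cmd & cmd.

Inductive ex : cmd -> nat -> state -> state -> Prop :=
  | ex_skip s : ex CSkip 0 s s
  | ex_push j b s : ex (CPush j b) 1 s (set j (b :: get j s) s)
  | ex_seq c d n m s t u : ex c n s t -> ex d m t u -> ex (CSeq c d) (n + m) s u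
  | ex_if_e j ce c0 c1 n s t : get j s = [::] -> ex ce n s t -> ex (CIf j ce c0 c1) n.+1 s t
  | ex_if_b j ce c0 c1 n s t (b : bool) v : get j s = b :: v ->
      ex (if b then c1 else c0) n (set j v s) t -> ex (CIf j ce c0 c1) n.+1 s t
  | ex_loop_e j x0 x1 c0 c1 s : get j s = [::] -> ex (CLoop j x0 x1 c0 c1) 1 s s
  | ex_loop_x j x0 x1 c0 c1 n s t (b : bool) v : get j s = b :: v -> (if b then x1 else x0) = false ->
      ex (if b then c1 else c0) n (set j v s) t -> ex (CLoop j x0 x1 c0 c1) n.+1 s t
  | ex_loop_c j x0 x1 c0 c1 n m s t u (b : bool) v : get j s = b :: v -> (if b then x1 else x0) = true ->
      ex (if b then c1 else c0) n (set j v s) t -> ex (CLoop j x0 x1 c0 c1) m t u ->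
      ex (CLoop j x0 x1 c0 c1) (n + m).+1 s u.

Definition tot (s : state) := size (sIO s) + size (sA s) + size (sB s) + size (sC s) + size (sD s) + size (sW s).

Lemma tot_pop j s b v : get j s = b :: v -> (tot (set j v s)).+1 = tot s.
Proof. by case: s => ? ? ? ? ? ?; case: j => /= ->; rewrite /tot /= ?addnS. Qed.

Lemma get_tot j s : size (get j s) <= tot s.
Proof. by case: s => io a b c d w; rewrite /tot; case: j => /=; lia. Qed.

Lemma ex_tot c n s t : ex c n s t -> tot t <= tot s + n.
Proof.
elim=> {c n s t}.
- by move=> s; rewrite addn0.
- by move=> j b [io a b' c d w]; case: j; rewrite /tot /=; lia.
- by move=> c d n m s t u _ h1 _ h2; lia.
- by move=> j ce c0 c1 n s t _ _ h; lia.
- by move=> j ce c0 c1 n s t b v /tot_pop e _ h; lia.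
- by move=> j x0 x1 c0 c1 s _; lia.
- by move=> j x0 x1 c0 c1 n s t b v /tot_pop e _ _ h; lia.
- by move=> j x0 x1 c0 c1 n m s t u b v /tot_pop e _ _ h1 _ h2; lia.
Qed.

(** * Compiling commands to stack automata *)

Fixpoint st (c : cmd) : finType :=
  match c with
  | CSkip => void
  | CPush _ _ => unit
  | CSeq c d => (st c + st d)%type
  | CIf _ ce c0 c1 => (unit + (st ce + (st c0 + st c1)))%type
  | CLoop _ _ _ c0 c1 => (unit + (st c0 + st c1))%type
  end.

(** [None] stands for a command without instructions, such as [CSkip], whose entry is its exit. *)
Fixpoint ent (c : cmd) : option (st c) :=
  match c return option (st c) with
  | CSkip => None
  | CPush _ _ => Some tt
  | CSeq c d => if ent c is Some q then Some (inl q) else omap inr (ent d)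
  | CIf _ _ _ _ => Some (inl tt)
  | CLoop _ _ _ _ _ => Some (inl tt)
  end.

Definition kseq (X Y : Type) (e : option Y) (o : option X) : option (X + Y) := if o is Some q then Some (inl q) else omap inr e.
Definition kloop (X Y : Type) (g : X -> Y) (back : option Y) (o : option X) : option Y := if o is Some q then Some (g q) else back.
Definition lback (Y : Type) (x : bool) : option (unit + Y) := if x then Some (inl tt) else None.

Fixpoint dlt (c : cmd) : st c -> instr (option (st c)) :=
  match c return st c -> instr (option (st c)) with
  | CSkip => fun q => match q with end
  | CPush j b => fun _ => IPush j b None
  | CSeq c d => fun q => match q with
      | inl q => imap (kseq (ent d)) (dlt q)
      | inr q => imap (omap inr) (dlt q) end
  | CIf j ce c0 c1 => fun q => match q with
      | inl _ => IPop j (omap (fun q => inr (inl q)) (ent ce)) (omap (fun q => inr (inr (inl q))) (ent c0)) (omap (fun q => inr (inr (inr q))) (ent c1))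
      | inr (inl q) => imap (omap (fun q => inr (inl q))) (dlt q)
      | inr (inr (inl q)) => imap (omap (fun q => inr (inr (inl q)))) (dlt q)
      | inr (inr (inr q)) => imap (omap (fun q => inr (inr (inr q)))) (dlt q) end
  | CLoop j x0 x1 c0 c1 => fun q => match q with
      | inl _ => IPop j None (kloop (fun q => inr (inl q)) (lback _ x0) (ent c0)) (kloop (fun q => inr (inr q)) (lback _ x1) (ent c1))
      | inr (inl q) => imap (kloop (fun q => inr (inl q)) (lback _ x0)) (dlt q)
      | inr (inr q) => imap (kloop (fun q => inr (inr q)) (lback _ x1)) (dlt q) end
  end.

Lemma imap_comp X Y Z (g : Y -> Z) (f : X -> Y) (h : X -> Z) i : (forall x, g (f x) = h x) -> imap g (imap f i) = imap h i.
Proof. by move=> e; case: i => [j b x|j x y z] /=; rewrite !e. Qed.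

Section Sim.
Variables (QP : finType) (dP : QP -> instr (option QP)).
Definition gst (x : option QP * state) : option (option QP * state) :=
  let: (o, s) := x in
  if o is Some q then
    match dP q with
    | IPush j b x => Some (x, set j (b :: get j s) s)
    | IPop j xe x0 x1 => Some (if get j s is b :: _ then if b then x1 else x0 else xe, set j (behead (get j s)) s)
    end
  else None.
Fixpoint grun n x := if n is n'.+1 then (if gst x is Some y then grun n' y else None) else Some x.

Lemma grunD n m x y z : grun n x = Some y -> grun m y = Some z -> grun (n + m) x = Some z.
Proof. by elim: n x => [|n IH] x /=; [move=> [->]|case: (gst x) => // x' /IH h /h]. Qed.

Lemma set_get j s : set j (get j s) s = s. Proof. by case: s => *; case: j. Qed.

(** [phi] places the states of a subcommand inside the whole program and sends its exit [None] to
    the continuation. Proving the simulation for every such placement makes the induction pass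
    through nested commands and loops. *)
Definition emb c (phi : option (st c) -> option QP) :=
  forall q, exists2 q', phi (Some q) = Some q' & dP q' = imap phi (dlt q).

Lemma ex_grun c n s t : ex c n s t -> forall phi, emb phi -> grun n (phi (ent c), s) = Some (phi None, t).
Proof.
elim=> {c n s t}.
- by [].
- move=> j b s phi e; have [q' h1 h2] := e tt.
  by rewrite /= h1 /= h2.
- move=> c d n m s t u _ h1 _ h2 phi e.
  have e1 : emb (fun o => phi (kseq (ent d) o)).
    by move=> q; have [q' k1 k2] := e (inl q); exists q' => //; rewrite k2; apply: imap_comp.
  have e2 : emb (fun o => phi (omap inr o)).
    by move=> q; have [q' k1 k2] := e (inr q); exists q' => //; rewrite k2; apply: imap_comp.
  have -> : ent (CSeq c d) = kseq (ent d) (ent c) by [].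
  exact: grunD (h1 _ e1) (h2 _ e2).
- move=> j ce c0 c1 n s t g _ h phi e; have [q' k1 k2] := e (inl tt).
  have e1 : emb (fun o => phi (omap (fun q => inr (inl q)) o)).
    by move=> q; have [q2 l1 l2] := e (inr (inl q)); exists q2 => //; rewrite l2; apply: imap_comp.
  by rewrite /= k1 k2 /= g /= -g set_get; exact: h _ e1.
- move=> j ce c0 c1 n s t b v g _ h phi e; have [q' k1 k2] := e (inl tt).
  rewrite /= k1 k2 /= g /=; case: b g h => g h.
    apply: (h (fun o => phi (omap (fun q => inr (inr (inr q))) o))).
    by move=> q; have [q2 l1 l2] := e (inr (inr (inr q))); exists q2 => //; rewrite l2; apply: imap_comp.
  apply: (h (fun o => phi (omap (fun q => inr (inr (inl q))) o))).
  by move=> q; have [q2 l1 l2] := e (inr (inr (inl q))); exists q2 => //; rewrite l2; apply: imap_comp.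
- move=> j x0 x1 c0 c1 s g phi e; have [q' k1 k2] := e (inl tt).
  by rewrite /= k1 k2 /= g /= -g set_get.
- move=> j x0 x1 c0 c1 n s t b v g xb _ h phi e; have [q' k1 k2] := e (inl tt).
  rewrite /= k1 k2 /= g /=; case: b g xb h => g xb h.
    rewrite xb in e k1 k2 *; apply: (h (fun o => phi (kloop (fun q => inr (inr q)) (lback _ false) o))).
    by move=> q; have [q2 l1 l2] := e (inr (inr q)); exists q2 => //; rewrite l2; apply: imap_comp.
  rewrite xb in e k1 k2 *; apply: (h (fun o => phi (kloop (fun q => inr (inl q)) (lback _ false) o))).
  by move=> q; have [q2 l1 l2] := e (inr (inl q)); exists q2 => //; rewrite l2; apply: imap_comp.
- move=> j x0 x1 c0 c1 n m s t u b v g xb _ h _ h2 phi e; have [q' k1 k2] := e (inl tt).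
  have {}h2 := h2 phi e.
  rewrite /= k1 k2 /= g /=; apply: grunD h2; case: b g xb h => g xb h.
    rewrite xb in e k1 k2 *; apply: (h (fun o => phi (kloop (fun q => inr (inr q)) (lback _ true) o))).
    by move=> q; have [q2 l1 l2] := e (inr (inr q)); exists q2 => //; rewrite l2; apply: imap_comp.
  rewrite xb in e k1 k2 *; apply: (h (fun o => phi (kloop (fun q => inr (inl q)) (lback _ true) o))).
  by move=> q; have [q2 l1 l2] := e (inr (inl q)); exists q2 => //; rewrite l2; apply: imap_comp.
Qed.

Lemma gst_tot o s o' s' : gst (o, s) = Some (o', s') -> tot s' <= (tot s).+1.
Proof.
rewrite /gst; case: o => // q; case: (dP q) => [j b x|j x y z] [_ <-].
  by case: s => *; case: j; rewrite /tot /=; lia.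
by case: s => io a b c d w; case: j; rewrite /tot /= size_behead; lia.
Qed.

(** One instruction walks to the top of one track and back, and the tracks grow by at most one cell
    per instruction; hence a quadratic bound. *)
Lemma grun_mrun n o s f o' t : grun n (o, s) = Some (o', t) -> trep s f -> exists N f',
  [/\ N <= n * (2 * (tot s + n) + 4), mrun (mdl dP) N ((o, None), 0%R, f) = Some ((o', None), 0%R, f') & trep t f'].
Proof.
elim: n o s f => [|n IH] o s f; first by move=> [<- <-] sf; exists 0, f.
case: o => [q|] //= ; case e: (gst (Some q, s)) => [[o1 s1]|]; last by move: e => /= ->.
have le := gst_tot e; move: (e) => /= ->; move=> g sf.
have [n1 [f1 [b1 r1 t1]]] : exists n1 f1, [/\ n1 <= 2 * tot s + 4, mrun (mdl dP) n1 ((Some q, None), 0%R, f) = Some ((o1, None), 0%R, f1) & trep s1 f1].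
  move: e => /=; case dq: (dP q) => [j b x|j x y z] [<- <-].
    have [n1 [f1 [h1 h2 h3]]] := push_run dq sf; exists n1, f1; split=> //.
    by apply: leq_trans h1 _; rewrite leq_add2r leq_mul2l get_tot.
  have [n1 [f1 [h1 h2 h3]]] := pop_run dq sf; exists n1, f1; split=> //.
  by apply: leq_trans h1 _; rewrite leq_add2r leq_mul2l get_tot.
have [n2 [f2 [b2 r2 t2]]] := IH _ _ _ g t1.
exists (n1 + n2), f2; split=> //; last exact: mrunD r1 r2.
apply: leq_trans (leq_add b1 b2) _; rewrite mulSn; apply: leq_add; first by lia.
by rewrite leq_mul2l; apply/orP; right; lia.
Qed.
End Sim.

Section Compile.
Variable c : cmd.
Definition cTM : TM := @mkTM (uS (mS (st c)) 11) ((ent c, None), (true, ord0)) (udl (mdl (@dlt c))).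

(** [IO] starts as the reversed input because its top is the last symbol. The factor 12 is one step
    and up to 11 unit moves for each macro step. *)
Lemma cTM_run n (u v : seq bool) a b cc d w :
  ex c n (St (rev u) [::] [::] [::] [::] [::]) (St v a b cc d w) ->
  exists t cf, [/\ t <= 12 * (n * (2 * (size u + n) + 4)), run t (@init cTM (map sym_of_bool u)) = Some cf &
    tm_output cf = map sym_of_bool (rev v)].
Proof.
move=> hex; have emb_id : emb (@dlt c) (fun o => o).
  by move=> q; exists q => //; case: (dlt q).
have gr := ex_grun hex emb_id.
pose f := tape_of (map sym_of_bool u).
have tf : trep (St (rev u) [::] [::] [::] [::] [::]) f.
  move=> j d'; have cn e : cellv [::] e = SB by case: e => //= ?; rewrite nth_nil.
  have [->|jn] : j = IO \/ j <> IO by case: j; (by left) || (by right).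
    case: d' => [|d']; first by rewrite /f tape_neg //; apply: pos_neg; right.
    by rewrite pos_IO /f /= revK.
  by rewrite /f tape_neg; [case: j jn => //=; rewrite cn|apply: pos_neg; left].
have [N [f' [bN rN tN]]] := grun_mrun gr tf.
have [t [d' [bt rt]]] := urun (@mdl_bnd _ (@dlt c)) true rN.
have [cf rc rp] := rep_run (rep_init _ _ (map sym_of_bool u)) rt erefl.
exists t, cf; split=> //.
  apply: leq_trans bt _; rewrite leq_mul2l /=; apply: leq_trans bN _.
  by rewrite /tot /= size_rev !addn0.
have [_ h1 _ h2] := rp; rewrite /tm_output.
have cell i : nth SB (c_head cf :: c_right cf) i = cellv v i.+1.
  rewrite -[cellv v i.+1]/(cellv (get IO (St v a b cc d w)) i.+1) -tN.
  by rewrite pos_IO; case: i => [|i] /=; [rewrite h1|rewrite h2].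
apply: nonblank_word => [i|].
  by rewrite cell size_rev => h; rewrite /= (nth_map false) // size_rev.
by rewrite size_rev cell cellv_out.
Qed.
End Compile.

(** * Polynomial-time maps between trees *)

Inductive tree := Lf | Nd of tree & tree.
Fixpoint code (x : tree) : seq bool := if x is Nd l r then true :: code l ++ code r else [:: false].
Fixpoint tsz (x : tree) : nat := if x is Nd l r then (tsz l + tsz r).+1 else 1.

Lemma size_code x : size (code x) = tsz x.
Proof. by elim: x => //= l <- r <-; rewrite size_cat. Qed.
Lemma tsz_gt0 x : 0 < tsz x. Proof. by case: x. Qed.

Definition clean io a := St io a [::] [::] [::] [::].

(* [W] counts in unary the trees still to be read *)
Definition mvbody0 (to : stk) := CPush to false.
Definition mvbody1 (to : stk) := CSeq (CPush to true) (CSeq (CPush W true) (CPush W true)).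
Definition mvloop (to : stk) := CLoop W true true CSkip (CIf A CSkip (mvbody0 to) (mvbody1 to)).
Definition mv (to : stk) := CSeq (CPush W true) (mvloop to).

Definition le_ex c n s t := exists2 m, m <= n & ex c m s t.

Lemma le_seq c d n m s t u : le_ex c n s t -> le_ex d m t u -> le_ex (CSeq c d) (n + m) s u.
Proof. by move=> [n' h1 h2] [m' h3 h4]; exists (n' + m'); [exact: leq_add|exact: ex_seq h2 h4]. Qed.
Lemma le_w c n m s t : n <= m -> le_ex c n s t -> le_ex c m s t.
Proof. by move=> h [k h1 h2]; exists k => //; apply: leq_trans h. Qed.
Lemma le_push j b s : le_ex (CPush j b) 1 s (set j (b :: get j s) s).
Proof. by exists 1 => //; constructor. Qed.
Lemma le_skip s : le_ex CSkip 0 s s.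
Proof. by exists 0 => //; constructor. Qed.
Lemma le_if j ce c0 c1 n s t (b : bool) v : get j s = b :: v ->
  le_ex (if b then c1 else c0) n (set j v s) t -> le_ex (CIf j ce c0 c1) n.+1 s t.
Proof. by move=> g [m h1 h2]; exists m.+1 => //; apply: ex_if_b g h2. Qed.
Lemma le_loop_e j x0 x1 c0 c1 s : get j s = [::] -> le_ex (CLoop j x0 x1 c0 c1) 1 s s.
Proof. by move=> g; exists 1 => //; apply: ex_loop_e. Qed.
Lemma le_loop_x j x0 x1 c0 c1 n s t (b : bool) v : get j s = b :: v -> (if b then x1 else x0) = false ->
  le_ex (if b then c1 else c0) n (set j v s) t -> le_ex (CLoop j x0 x1 c0 c1) n.+1 s t.
Proof. by move=> g x [m h1 h2]; exists m.+1 => //; apply: ex_loop_x g x h2. Qed.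
Lemma le_loop_c j x0 x1 c0 c1 n m s t u (b : bool) v : get j s = b :: v -> (if b then x1 else x0) = true ->
  le_ex (if b then c1 else c0) n (set j v s) t -> le_ex (CLoop j x0 x1 c0 c1) m t u ->
  le_ex (CLoop j x0 x1 c0 c1) (n + m).+1 s u.
Proof. by move=> g x [n' h1 h2] [m' h3 h4]; exists (n' + m').+1; [rewrite ltnS leq_add|exact: ex_loop_c g x h2 h4]. Qed.

(** Stated in continuation form, with an arbitrary final state, so that the runs for the two
    subtrees can be chained. Reading a node replaces one pending tree by two. *)
Lemma mvloop_tree to x io r b c d ws n t : to = B \/ to = C \/ to = D ->
  le_ex (mvloop to) n (set to (rev (code x) ++ get to (St io r b c d ws)) (St io r b c d ws)) t ->
  le_ex (mvloop to) (n + 7 * tsz x) (St io (code x ++ r) b c d (true :: ws)) t.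
Proof.
move=> hto; elim: x r b c d ws n => [|l IHl r' IHr] r b c d ws n h.
  apply: (le_w (n := (2 + n).+1)); first by rewrite /=; lia.
  apply: (@le_loop_c _ _ _ _ _ 2 n _ (set to (false :: get to (St io r b c d ws)) (St io r b c d ws)) _ true ws) => //.
    apply: (@le_if _ _ _ _ 1 _ _ false r) => //.
    by move: (le_push to false (St io r b c d ws)); case: hto => [->|[->|->]].
apply: (le_w (n := (4 + (n + 7 * tsz r' + 7 * tsz l)).+1)); first by rewrite /=; lia.
apply: (@le_loop_c _ _ _ _ _ 4 _ _ (set to (true :: get to (St io (code l ++ code r' ++ r) b c d [:: true, true & ws])) (St io (code l ++ code r' ++ r) b c d [:: true, true & ws])) _ true ws) => //.
  apply: (@le_if _ _ _ _ 3 _ _ true (code l ++ code r' ++ r)); first by rewrite /= catA.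
  apply: (@le_seq _ _ 1 2); first exact: le_push.
  apply: (@le_seq _ _ 1 1); first exact: le_push.
  have := le_push W true (set W (true :: get W (set to (true :: get to (set A (code l ++ code r' ++ r) (set W ws (St io (code (Nd l r') ++ r) b c d (true :: ws))))) (set A (code l ++ code r' ++ r) (set W ws (St io (code (Nd l r') ++ r) b c d (true :: ws)))))) (set to (true :: get to (set A (code l ++ code r' ++ r) (set W ws (St io (code (Nd l r') ++ r) b c d (true :: ws))))) (set A (code l ++ code r' ++ r) (set W ws (St io (code (Nd l r') ++ r) b c d (true :: ws)))))).
  by case: hto => [->|[->|->]].
move: h IHl IHr; case: hto => [->|[->|->]] /= h IHl IHr; apply: IHl => //=; apply: IHr => //=; move: h; rewrite rev_cons rev_cat cat_rcons -catA; exact.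
Qed.

Lemma mv_ok to x io r b c d : to = B \/ to = C \/ to = D ->
  le_ex (mv to) (9 * tsz x) (St io (code x ++ r) b c d [::])
   (set to (rev (code x) ++ get to (St io r b c d [::])) (St io r b c d [::])).
Proof.
move=> hto; have x0 := tsz_gt0 x; apply: (le_w (n := 1 + (1 + 7 * tsz x))); first by lia.
apply: le_seq; first exact: le_push.
by apply: mvloop_tree => //; apply: le_loop_e; case: hto => [->|[->|->]].
Qed.

Lemma get_same j u s : get j (set j u s) = u. Proof. by case: s => *; case: j. Qed.
Lemma get_other j j' u s : j <> j' -> get j' (set j u s) = get j' s.
Proof. by case: s => ? ? ? ? ? ?; case: j; case: j'. Qed.
Lemma set_set j u v s : set j u (set j v s) = set j u s. Proof. by case: s => *; case: j. Qed.
Lemma set_comm j j' u v s : j <> j' -> set j u (set j' v s) = set j' v (set j u s).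
Proof. by case: s => ? ? ? ? ? ?; case: j; case: j'. Qed.

Definition mvall (from to : stk) := CLoop from true true (CPush to false) (CPush to true).
Definition clear (from : stk) := CLoop from true true CSkip CSkip.

Lemma mvall_ok from to u v s : from <> to -> get from s = u -> get to s = v ->
  le_ex (mvall from to) (2 * size u + 1) s (set from [::] (set to (rev u ++ v) s)).
Proof.
move=> ft; elim: u v s => [|b u IH] v s gf gt.
  rewrite (_ : set from [::] _ = s); first exact: le_loop_e.
  by case: s gf gt => io a b' c d w; case: from ft; case: to => //= ft gf gt; rewrite ?gf ?gt //; case: ft.
apply: (le_w (n := (1 + (2 * size u + 1)).+1)); first by rewrite /=; lia.
apply: (@le_loop_c _ _ _ _ _ 1 _ _ (set to (b :: v) (set from u s)) _ b u) => //; first by case: (b).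
  rewrite (_ : (if b then CPush to true else CPush to false) = CPush to b); last by case: (b).
  by have := le_push to b (set from u s); rewrite get_other // gt.
have := IH (b :: v) (set to (b :: v) (set from u s)); rewrite rev_cons cat_rcons set_set.
have -> w : set from [::] (set to w (set from u s)) = set from [::] (set to w s).
  by rewrite (set_comm _ _ _ ft) set_set (set_comm _ _ _ (not_eq_sym ft)).
apply; last by rewrite get_same.
by rewrite get_other ?get_same //; exact: not_eq_sym.
Qed.

Lemma clear_ok from u s : get from s = u -> le_ex (clear from) (size u + 1) s (set from [::] s).
Proof.
elim: u s => [|b u IH] s gf.
  by rewrite (_ : set from [::] s = s); [exact: le_loop_e|rewrite -[RHS](set_get from) gf].
apply: (@le_loop_c _ _ _ _ _ 0 (size u + 1) _ (set from u s) _ b u) => //; first by case: (b).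
  by case: (b); apply: le_skip.
by rewrite -(set_set from [::] u s); apply: IH; rewrite get_same.
Qed.

Definition dup := CSeq (mv B) (CSeq (CLoop B true true (CSeq (CPush A false) (CPush C false)) (CSeq (CPush A true) (CPush C true)))
  (CSeq (mvall C B) (mvall B A))).

Lemma dup_ok x io r : le_ex dup (20 * tsz x) (clean io (code x ++ r)) (clean io (code x ++ code x ++ r)).
Proof.
have x0 := tsz_gt0 x; apply: (le_w (n := 9 * tsz x + ((3 * tsz x + 1) + ((2 * tsz x + 1) + (2 * tsz x + 1))))); first by lia.
apply: le_seq; first by apply: mv_ok; left.
apply: (le_seq (t := St io (code x ++ r) [::] (code x) [::] [::])).
  have gen u a c : le_ex (CLoop B true true (CSeq (CPush A false) (CPush C false)) (CSeq (CPush A true) (CPush C true)))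
      (3 * size u + 1) (St io a u c [::] [::]) (St io (rev u ++ a) [::] (rev u ++ c) [::] [::]).
    elim: u a c => [|b u IH] a c; first exact: le_loop_e.
    apply: (le_w (n := (2 + (3 * size u + 1)).+1)); first by rewrite /=; lia.
    apply: (@le_loop_c _ _ _ _ _ 2 _ _ (St io (b :: a) u (b :: c) [::] [::]) _ b u) => //; first by case: (b).
      by case: (b); apply: (@le_seq _ _ 1 1); exact: le_push.
    by rewrite rev_cons !cat_rcons.
  by have := gen (rev (code x) ++ [::]) r [::]; rewrite /= !cats0 revK size_rev size_code.
apply: (le_seq (t := St io (code x ++ r) (rev (code x)) [::] [::] [::])).
  by have := @mvall_ok C B (code x) [::] (St io (code x ++ r) [::] (code x) [::] [::]); rewrite /= cats0 size_code; apply.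
by have := @mvall_ok B A (rev (code x)) (code x ++ r) (St io (code x ++ r) (rev (code x)) [::] [::] [::]); rewrite /= revK size_rev size_code; apply.
Qed.

Definition swap := CSeq (mv B) (CSeq (mv C) (CSeq (mvall B A) (mvall C A))).
Lemma swap_ok x y io r : le_ex swap (12 * (tsz x + tsz y)) (clean io (code x ++ code y ++ r)) (clean io (code y ++ code x ++ r)).
Proof.
have x0 := tsz_gt0 x; have y0 := tsz_gt0 y.
apply: (le_w (n := 9 * tsz x + (9 * tsz y + ((2 * tsz x + 1) + (2 * tsz y + 1))))); first by lia.
apply: le_seq; first by apply: mv_ok; left.
apply: le_seq; first by apply: mv_ok; right; left.
rewrite /= !cats0; apply: (le_seq (t := St io (code x ++ r) [::] (rev (code y)) [::] [::])).
  by have := @mvall_ok B A (rev (code x)) r (St io r (rev (code x)) (rev (code y)) [::] [::]); rewrite /= revK size_rev size_code; apply.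
by have := @mvall_ok C A (rev (code y)) (code x ++ r) (St io (code x ++ r) [::] (rev (code y)) [::] [::]); rewrite /= revK size_rev size_code; apply.
Qed.

Definition drop1 := CSeq (mv D) (clear D).
Lemma drop_ok x io r : le_ex drop1 (11 * tsz x) (clean io (code x ++ r)) (clean io r).
Proof.
have x0 := tsz_gt0 x; apply: (le_w (n := 9 * tsz x + (tsz x + 1))); first by lia.
apply: le_seq; first by apply: mv_ok; right; right.
by have := @clear_ok D (rev (code x)) (St io r [::] [::] (rev (code x)) [::]); rewrite /= cats0 size_rev size_code; apply.
Qed.

(** Both encodings depend on a common index [x], so the relation speaks of maps between encoded
    types without decoding. The stack below and [IO] are preserved, which lets programs for several
    components run on one stack. *)
Definition PT (X : Type) (u v : X -> tree) := exists c K k, forall x io r,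
  le_ex c (K * tsz (u x) ^ k) (clean io (code (u x) ++ r)) (clean io (code (v x) ++ r)).

Lemma le_ex_size c n x y io r : le_ex c n (clean io (code x ++ r)) (clean io (code y ++ r)) -> tsz y <= tsz x + n.
Proof.
move=> [m mn /ex_tot]; rewrite /tot /= !size_cat !size_code; lia.
Qed.

Lemma expn_le a b k : a <= b -> a ^ k <= b ^ k.
Proof. by case: k => // k h; rewrite leq_exp2r. Qed.

Lemma pow_le s a b K : 0 < s -> a <= b -> K * s ^ a <= K * s ^ b.
Proof. by move=> s0 ab; rewrite leq_mul2l leq_pexp2l ?orbT. Qed.

Lemma bound_add s K k K' k' : 0 < s -> K * s ^ k + K' * s ^ k' <= (K + K') * s ^ (k + k').
Proof. by move=> s0; rewrite mulnDl leq_add // pow_le // ?leq_addr ?leq_addl. Qed.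

Definition ispoly (p : nat -> nat) := exists K k, forall s, 0 < s -> p s <= K * s ^ k.
Lemma ispoly_pow K k : ispoly (fun s => K * s ^ k). Proof. by exists K, k. Qed.
Lemma ispoly_id : ispoly (fun s => s). Proof. by exists 1, 1 => s _; rewrite mul1n expn1. Qed.
Lemma ispoly_const a : ispoly (fun=> a). Proof. by exists a, 0 => s _; rewrite expn0 muln1. Qed.
Lemma ispoly_add p q : ispoly p -> ispoly q -> ispoly (fun s => p s + q s).
Proof.
move=> [K [k h]] [K' [k' h']]; exists (K + K'), (k + k') => s s0.
by apply: leq_trans (bound_add _ _ _ _ s0); rewrite leq_add ?h ?h'.
Qed.
Lemma ispoly_mul p q : ispoly p -> ispoly q -> ispoly (fun s => p s * q s).
Proof.
move=> [K [k h]] [K' [k' h']]; exists (K * K'), (k + k') => s s0.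
by rewrite expnD mulnACA leq_mul ?h ?h'.
Qed.
Lemma ispoly_exp p n : ispoly p -> ispoly (fun s => p s ^ n).
Proof.
move=> hp; elim: n => [|n IH]; first exact: (ispoly_const 1).
by have [K' [k' h]] := ispoly_mul hp IH; exists K', k' => s s0; rewrite expnS h.
Qed.

Section PTclosure.
Variable X : Type.
Implicit Types (u v w : X -> tree).

Lemma PT_intro u v c p : ispoly p -> (forall x io r, le_ex c (p (tsz (u x))) (clean io (code (u x) ++ r)) (clean io (code (v x) ++ r))) -> PT u v.
Proof. by move=> [K [k hp]] h; exists c, K, k => x io r; apply: le_w (h x io r); apply: hp; apply: tsz_gt0. Qed.

Lemma PT_size u v : PT u v -> exists K k, forall x, tsz (v x) <= K * tsz (u x) ^ k.
Proof.
move=> [c [K [k h]]]; exists K.+1, k.+1 => x; have := le_ex_size (h x [::] [::]) => /leq_trans; apply.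
have x0 := tsz_gt0 (u x); have p0 : 0 < tsz (u x) ^ k by rewrite expn_gt0 x0.
rewrite expnS mulSn; apply: leq_add; first by rewrite leq_pmulr.
by rewrite leq_mul2l leq_pmull ?orbT.
Qed.

Lemma PT_id u : PT u u.
Proof. by exists CSkip, 0, 0 => x io r; rewrite mul0n; apply: le_skip. Qed.

Lemma PT_comp u v w : PT u v -> PT v w -> PT u w.
Proof.
move=> pf pg; have [Ks [ks sz]] := PT_size pf; move: pf pg => [c [K [k h]]] [c' [K' [k' h']]].
apply: (@PT_intro _ _ (CSeq c c') (fun s => K * s ^ k + K' * (Ks * s ^ ks) ^ k')).
  apply: ispoly_add; first exact: ispoly_pow.
  by apply: ispoly_mul; [exact: ispoly_const|apply: ispoly_exp; exact: ispoly_pow].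
move=> x io r; apply: le_w (le_seq (h x io r) (h' x io r)); rewrite leq_add2l leq_mul2l.
by apply/orP; right; apply: expn_le.
Qed.

Lemma PT_ext u v w : (forall x, v x = w x) -> PT u v -> PT u w.
Proof. by move=> e [c [K [k h]]]; exists c, K, k => x io r; rewrite -e. Qed.

(** After duplicating the input, the right component is computed first and swapped below, so that a
    final push of the node symbol completes the preorder code. *)
Lemma PT_pair u v w : PT u v -> PT u w -> PT u (fun x => Nd (v x) (w x)).
Proof.
move=> pf pg; have [Kg [kg sz]] := PT_size pg; move: pf pg => [c [K [k h]]] [c' [K' [k' h']]].
apply: (@PT_intro _ _ (CSeq dup (CSeq c' (CSeq swap (CSeq c (CPush A true)))))
  (fun s => 20 * s + (K' * s ^ k' + (12 * (Kg * s ^ kg + s) + (K * s ^ k + 1))))).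
  by do ?[apply: ispoly_add|apply: ispoly_mul]; do ?[exact: ispoly_id|exact: ispoly_const|apply: ispoly_exp].
move=> x io r; apply: le_seq (dup_ok _ _ _) _; apply: le_seq (h' _ _ _) _.
apply: le_seq.
  by apply: (le_w (n := 12 * (tsz (w x) + tsz (u x)))); [rewrite leq_mul2l leq_add2r sz|exact: swap_ok].
apply: le_seq (h _ _ _) _; rewrite /= -catA; exact: le_push.
Qed.

Definition hd x := if x is Nd l _ then l else Lf.
Definition tl x := if x is Nd _ r then r else Lf.

Lemma PT_tl u v : PT u v -> PT u (fun x => tl (v x)).
Proof.
move=> /PT_comp; apply; exists (CIf A CSkip (CPush A false) drop1), 12, 1 => x io r; rewrite expn1; case: (v x) => [|l r'].
  apply: (le_w (n := 2)) => //; apply: (@le_if _ _ _ _ 1 _ _ false r) => //; exact: le_push.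
apply: (le_w (n := (11 * tsz l).+1)); first by rewrite /=; lia.
by apply: (@le_if _ _ _ _ _ _ _ true (code l ++ code r' ++ r)); [rewrite /= catA|apply: drop_ok].
Qed.

Lemma PT_hd u v : PT u v -> PT u (fun x => hd (v x)).
Proof.
move=> /PT_comp; apply; exists (CIf A CSkip (CPush A false) (CSeq swap drop1)), 25, 1 => x io r; rewrite expn1; case: (v x) => [|l r'].
  apply: (le_w (n := 2)) => //; apply: (@le_if _ _ _ _ 1 _ _ false r) => //; exact: le_push.
apply: (le_w (n := (12 * (tsz l + tsz r') + 11 * tsz r').+1)); first by rewrite /=; lia.
apply: (@le_if _ _ _ _ _ _ _ true (code l ++ code r' ++ r)); first by rewrite /= catA.
by apply: le_seq (swap_ok _ _ _ _) _; apply: drop_ok.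
Qed.

Lemma PT_lf u : PT u (fun=> Lf).
Proof.
exists (CSeq drop1 (CPush A false)), 12, 1 => x io r; rewrite expn1; have x0 := tsz_gt0 (u x).
apply: (le_w (n := 11 * tsz (u x) + 1)); first by lia.
by apply: le_seq (drop_ok _ _ _) _; apply: le_push.
Qed.

Lemma PT_const u y : PT u (fun=> y).
Proof. by elim: y => [|l hl r hr]; [exact: PT_lf|exact: PT_pair hl hr]. Qed.

(* the branches are only run, and only need to be correct, where they are taken *)
Lemma PT_ite u v (b : pred X) w0 w1 w : PT u v -> (forall x, b x = if v x is Lf then false else true) ->
  (exists c K k, forall x io r, ~~ b x -> le_ex c (K * tsz (u x) ^ k) (clean io (code (u x) ++ r)) (clean io (code (w0 x) ++ r))) ->
  (exists c K k, forall x io r, b x -> le_ex c (K * tsz (u x) ^ k) (clean io (code (u x) ++ r)) (clean io (code (w1 x) ++ r))) ->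
  (forall x, w x = if b x then w1 x else w0 x) -> PT u w.
Proof.
move=> pf bE pg ph wE; have [Kf [kf sz]] := PT_size pf; move: pf pg ph => [c [K [k hf]]] [c1 [K1 [k1 hg]]] [c2 [K2 [k2 hh]]].
apply: (@PT_intro _ _ (CSeq dup (CSeq c (CIf A CSkip c1 (CSeq drop1 (CSeq drop1 c2)))))
  (fun s => 20 * s + (K * s ^ k + (1 + (11 * (Kf * s ^ kf) + (K1 * s ^ k1 + K2 * s ^ k2)))))).
  by do ?[apply: ispoly_add|apply: ispoly_mul]; do ?[exact: ispoly_id|exact: ispoly_const|apply: ispoly_exp].
move=> x io r; apply: (le_w (n := 20 * tsz (u x) + (K * tsz (u x) ^ k + (1 + (11 * tsz (v x) + (K1 * tsz (u x) ^ k1 + K2 * tsz (u x) ^ k2)))))).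
  by rewrite !leq_add2l leq_add2r leq_mul2l sz.
apply: le_seq (dup_ok _ _ _) _; apply: le_seq (hf _ _ _) _.
have := bE x; rewrite wE; case: (v x) => [|l r'] bx; rewrite bx.
  apply: (le_w (n := (K1 * tsz (u x) ^ k1).+1)); first by lia.
  by apply: (@le_if _ _ _ _ _ _ _ false (code (u x) ++ r)) => //; apply: hg; rewrite bx.
apply: (le_w (n := (11 * tsz l + (11 * tsz r' + K2 * tsz (u x) ^ k2)).+1)); first by rewrite /=; lia.
apply: (@le_if _ _ _ _ _ _ _ true (code l ++ code r' ++ code (u x) ++ r)); first by rewrite /= !catA.
by apply: le_seq (drop_ok _ _ _) _; apply: le_seq (drop_ok _ _ _) _; apply: hh; rewrite bx.
Qed.
End PTclosure.

Lemma PT_re (X Y : Type) (f : Y -> X) (u v : X -> tree) : PT u v -> PT (fun y => u (f y)) (fun y => v (f y)).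
Proof. by move=> [c [K [k h]]]; exists c, K, k => y io r; apply: h. Qed.

(** Element, remaining list and accumulator lie on [A] in this order; they are rearranged so that
    [c] finds the pair of element and accumulator. The final swap brings the list back on top, where
    the loop reads its next symbol. *)
Definition foldbody (c : cmd) := CSeq (mv B) (CSeq (mv C) (CSeq (mv D) (CSeq (mvall C A) (CSeq (mvall D A) (CSeq (mvall B A) (CSeq (CPush A true) (CSeq c swap))))))).
Definition foldcmd (c : cmd) := CIf A CSkip (CPush A false) (CSeq swap (CLoop A false true CSkip (foldbody c))).

Lemma foldbody_ok c n e l s s' io r : le_ex c n (clean io (code (Nd e s) ++ code l ++ r)) (clean io (code s' ++ code l ++ r)) ->
  le_ex (foldbody c) (n + 24 * (tsz e + tsz l + tsz s + tsz s')) (clean io (code e ++ code l ++ code s ++ r)) (clean io (code l ++ code s' ++ r)).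
Proof.
move=> h; have e0 := tsz_gt0 e; have l0 := tsz_gt0 l; have s0 := tsz_gt0 s.
apply: (le_w (n := 9 * tsz e + (9 * tsz l + (9 * tsz s + ((2 * tsz l + 1) + ((2 * tsz s + 1) + ((2 * tsz e + 1) + (1 + (n + 12 * (tsz s' + tsz l)))))))))); first by lia.
apply: le_seq; first by apply: mv_ok; left.
apply: le_seq; first by apply: mv_ok; right; left.
apply: le_seq; first by apply: mv_ok; right; right.
rewrite /= !cats0.
apply: (le_seq (t := St io (code l ++ r) (rev (code e)) [::] (rev (code s)) [::])).
  by have := @mvall_ok C A (rev (code l)) r (St io r (rev (code e)) (rev (code l)) (rev (code s)) [::]); rewrite /= revK size_rev size_code; apply.
apply: (le_seq (t := St io (code s ++ code l ++ r) (rev (code e)) [::] [::] [::])).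
  by have := @mvall_ok D A (rev (code s)) (code l ++ r) (St io (code l ++ r) (rev (code e)) [::] (rev (code s)) [::]); rewrite /= revK size_rev size_code; apply.
apply: (le_seq (t := St io (code e ++ code s ++ code l ++ r) [::] [::] [::] [::])).
  by have := @mvall_ok B A (rev (code e)) (code s ++ code l ++ r) (St io (code s ++ code l ++ r) (rev (code e)) [::] [::] [::]); rewrite /= revK size_rev size_code; apply.
apply: le_seq; first exact: le_push.
apply: le_seq; last exact: swap_ok.
by move: h; rewrite /= -!catA.
Qed.

Section Fold.
Variables (Y S : Type) (ey : Y -> tree) (es : S -> tree) (g : Y -> S -> S).
Definition lenc (t : seq Y) : tree := foldr (fun y r => Nd (ey y) r) Lf t.
Fixpoint lbound (b : nat) (s : S) (t : seq Y) : Prop :=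
  tsz (es s) <= b /\ if t is y :: t' then lbound b (g y s) t' else True.

Lemma foldloop_ok c K k b Bd io r :
  (forall y s io r, le_ex c (K * tsz (Nd (ey y) (es s)) ^ k) (clean io (code (Nd (ey y) (es s)) ++ r)) (clean io (code (es (g y s)) ++ r))) ->
  forall t s, tsz (lenc t) + b <= Bd -> lbound b s t ->
  le_ex (CLoop A false true CSkip (foldbody c)) (tsz (lenc t) * (K * Bd ^ k + 48 * Bd + 1))
    (clean io (code (lenc t) ++ code (es s) ++ r)) (clean io (code (es (foldl (fun s y => g y s) s t)) ++ r)).
Proof.
move=> h t; elim: t => [|y t IH] s lb [sb tb].
  apply: (le_w (n := 1)); first by rewrite /= mul1n addn1.
  by apply: (@le_loop_x _ _ _ _ _ 0 _ _ false (code (es s) ++ r)) => //; apply: le_skip.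
rewrite /= in lb *; have sb' : tsz (es (g y s)) <= b by case: t tb {IH lb} => [|? ?] [].
have e0 := tsz_gt0 (ey y); have l0 := tsz_gt0 (lenc t).
apply: (le_w (n := (K * tsz (Nd (ey y) (es s)) ^ k + 24 * (tsz (ey y) + tsz (lenc t) + tsz (es s) + tsz (es (g y s))) + tsz (lenc t) * (K * Bd ^ k + 48 * Bd + 1)).+1)).
  have k1 : K * tsz (Nd (ey y) (es s)) ^ k <= K * Bd ^ k by rewrite leq_mul2l expn_le ?orbT //= ; lia.
  have k2 : 24 * (tsz (ey y) + tsz (lenc t) + tsz (es s) + tsz (es (g y s))) <= 48 * Bd by lia.
  move: k1 k2; set V := K * Bd ^ k + 48 * Bd + 1 => k1 k2.
  have -> : (tsz (ey y) + tsz (lenc t)).+1 * V = V + (tsz (ey y) * V + tsz (lenc t) * V) by rewrite mulSn mulnDl.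
  have k3 : V <= tsz (ey y) * V by rewrite leq_pmull.
  move: k1 k2 k3; rewrite /V; move: (K * _ ^ k) (24 * _) (48 * _) (tsz (lenc t) * _) (tsz (ey y) * _) (K * _); clear; lia.
apply: (@le_loop_c _ _ _ _ _ _ _ _ (clean io (code (lenc t) ++ code (es (g y s)) ++ r)) _ true (code (ey y) ++ code (lenc t) ++ code (es s) ++ r)) => //=.
- by rewrite -catA.
- exact: foldbody_ok (h _ _ _ _).
- by apply: IH => //; lia.
Qed.

Lemma PT_fold (X : Type) (u : X -> tree) (s0 : X -> S) (l : X -> seq Y) p :
  PT (fun z : Y * S => Nd (ey z.1) (es z.2)) (fun z => es (g z.1 z.2)) ->
  PT u (fun x => es (s0 x)) -> PT u (fun x => lenc (l x)) -> ispoly p ->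
  (forall x, lbound (p (tsz (u x))) (s0 x) (l x)) ->
  PT u (fun x => es (foldl (fun s y => g y s) (s0 x) (l x))).
Proof.
move=> [c [K [k hf]]] ps pl pp tb; have [Kl [kl szl]] := PT_size pl.
have [c1 [K1 [k1 h1]]] := PT_pair ps pl.
pose Bd s := Kl * s ^ kl + p s.
apply: (@PT_intro _ _ _ (CSeq c1 (foldcmd c)) (fun s => K1 * s ^ k1 + (1 + (12 * Bd s + Kl * s ^ kl * (K * Bd s ^ k + 48 * Bd s + 1))))).
  have pB : ispoly Bd by apply: ispoly_add => //; exact: ispoly_pow.
  apply: ispoly_add; first exact: ispoly_pow.
  apply: ispoly_add; first exact: ispoly_const.
  apply: ispoly_add; first by apply: ispoly_mul => //; exact: ispoly_const.
  apply: ispoly_mul; first exact: ispoly_pow.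
  apply: ispoly_add; last exact: ispoly_const.
  by apply: ispoly_add; apply: ispoly_mul; try exact: ispoly_const; try exact: pB; apply: ispoly_exp.
move=> x io r; apply: le_seq (h1 _ _ _) _.
have sb : tsz (es (s0 x)) <= p (tsz (u x)) by have := tb x; case: (l x) => [|? ?] [].
apply: (@le_if _ _ _ _ _ _ _ true (code (es (s0 x)) ++ code (lenc (l x)) ++ r)); first by rewrite /= catA.
apply: le_seq.
  apply: (le_w (n := 12 * (tsz (es (s0 x)) + tsz (lenc (l x))))); last exact: swap_ok.
  by rewrite leq_mul2l /= /Bd addnC leq_add.
apply: (le_w (n := tsz (lenc (l x)) * (K * Bd (tsz (u x)) ^ k + 48 * Bd (tsz (u x)) + 1))); first by rewrite leq_mul2r szl orbT.
apply: (foldloop_ok (b := p (tsz (u x)))) => //; last by rewrite /Bd leq_add2r.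
by move=> y s io' r'; exact: (hf (y, s)).
Qed.
End Fold.

(** * Typed encodings and closure properties *)

Class Enc (X : Type) := enc : X -> tree.
#[export] Instance Enc_prod (X Y : Type) (eX : Enc X) (eY : Enc Y) : Enc (X * Y) := fun p => Nd (enc p.1) (enc p.2).
#[export] Instance Enc_seq (X : Type) (eX : Enc X) : Enc (seq X) := lenc eX.
(* Both booleans get the same size, so a boolean accumulator never grows. *)
#[export] Instance Enc_bool : Enc bool := fun b => if b then Nd (Nd Lf Lf) Lf else Nd Lf (Nd Lf Lf).
#[export] Instance Enc_nat : Enc nat := fun n => enc (bin n).

Definition sz (X : Type) (eX : Enc X) (x : X) := tsz (enc x).
Arguments sz {X eX} x.
Definition PTt (X Y : Type) (eX : Enc X) (eY : Enc Y) (f : X -> Y) := PT (fun x : X => enc x) (fun x => enc (f x)).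
Arguments PTt {X Y eX eY} f.

Section Typed.
Context {X Y Z T : Type} {eX : Enc X} {eY : Enc Y} {eZ : Enc Z} {eT : Enc T}.

Lemma sz_gt0 (x : X) : 0 < sz x. Proof. exact: tsz_gt0. Qed.

Lemma pt_id : PTt (fun x : X => x). Proof. exact: PT_id. Qed.
Lemma pt_ext (f g : X -> Y) : (forall x, f x = g x) -> PTt f -> PTt g.
Proof. by move=> e; apply: PT_ext => x; rewrite e. Qed.
Lemma pt_comp (f : X -> Y) (g : Y -> Z) : PTt g -> PTt f -> PTt (fun x => g (f x)).
Proof. by move=> pg pf; apply: PT_comp pf _; exact: (PT_re f pg). Qed.
Lemma pt_pair (f : X -> Y) (g : X -> Z) : PTt f -> PTt g -> PTt (fun x => (f x, g x)).
Proof. exact: PT_pair. Qed.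
Lemma pt_fst (f : X -> Y * Z) : PTt f -> PTt (fun x => (f x).1).
Proof. exact: PT_hd. Qed.
Lemma pt_snd (f : X -> Y * Z) : PTt f -> PTt (fun x => (f x).2).
Proof. exact: PT_tl. Qed.
Lemma pt_const (y : Y) : PTt (fun _ : X => y).
Proof. exact: PT_const. Qed.
Lemma pt_if (b : X -> bool) (f g : X -> Y) : PTt b -> PTt f -> PTt g -> PTt (fun x => if b x then f x else g x).
Proof.
move=> /PT_hd pb [c [K [k hf]]] [c' [K' [k' hg]]].
apply: (PT_ite (b := b) (w0 := fun x => enc (g x)) (w1 := fun x => enc (f x)) pb) => [x| | |x].
- by case: (b x).
- by exists c', K', k' => x io r _.
- by exists c, K, k => x io r _.
- by case: (b x).
Qed.
Lemma pt_cons (f : X -> Y) (l : X -> seq Y) : PTt f -> PTt l -> PTt (fun x => f x :: l x).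
Proof. exact: PT_pair. Qed.
Lemma pt_match (l : X -> seq Y) (f : X -> Z) (g : X -> Y -> seq Y -> Z) : PTt l -> PTt f ->
  PTt (fun z : X * (Y * seq Y) => g z.1 z.2.1 z.2.2) -> PTt (fun x => if l x is y :: t then g x y t else f x).
Proof.
move=> pl [c [K [k hf]]] [c' [K' [k' hg]]].
have [c1 [K1 [k1 h1]]] := PT_pair (PT_id _) pl.
have [Ks [ks hs]] := PT_size (PT_pair (PT_id _) pl).
pose w x := if l x is y :: t then @enc Z eZ (g x y t) else Lf.
apply: (PT_ite (b := fun x => ~~ nilp (l x)) (w0 := fun x => enc (f x)) (w1 := w) pl) => [x| | |x].
- by case: (l x).
- by exists c, K, k => x io r _.
- have [KK [kk hp]] : ispoly (fun s => K1 * s ^ k1 + K' * (Ks * s ^ ks) ^ k').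
    apply: ispoly_add; first exact: ispoly_pow.
    by apply: ispoly_mul; [exact: ispoly_const|apply: ispoly_exp; exact: ispoly_pow].
  exists (CSeq c1 c'), KK, kk => x io r nx; apply: (le_w (hp _ (tsz_gt0 _))).
  apply: le_seq (h1 _ _ _) _; have := hs x; rewrite /w; case: (l x) nx => // y t _ sb.
  apply: le_w (hg (x, (y, t)) io r); rewrite leq_mul2l; apply/orP; right; exact: expn_le.
- by rewrite /w; case: (l x).
Qed.
Lemma pt_size (f : X -> Y) : PTt f -> exists K k, forall x, sz (f x) <= K * sz x ^ k.
Proof. by move=> /PT_size. Qed.
End Typed.

Section Fold.
Context {X Y Z T : Type} {eX : Enc X} {eY : Enc Y} {eZ : Enc Z} {eT : Enc T}.

Lemma sz_cons (y : Y) s : sz (y :: s) = (sz y + sz s).+1. Proof. by []. Qed.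
Lemma sz_pair (x : X) (y : Y) : sz (x, y) = (sz x + sz y).+1. Proof. by []. Qed.

(** Each step adds at most the size of [h (x, y)], whatever the accumulator, so the sizes add up to
    a polynomial. [P] is an invariant under which this growth bound has to hold. *)
Lemma pt_foldl_inv (P : X -> T -> Prop) (step : X -> Y -> T -> T) (l : X -> seq Y) (s0 : X -> T) (h : X * Y -> Z) :
  PTt (fun z : X * Y * T => step z.1.1 z.1.2 z.2) -> PTt l -> PTt s0 -> PTt h ->
  (forall x, P x (s0 x)) -> (forall x y s, P x s -> P x (step x y s)) ->
  (forall x y s, P x s -> sz (step x y s) <= sz s + sz (h (x, y))) ->
  PTt (fun x => foldl (fun s y => step x y s) (s0 x) (l x)).
Proof.
move=> pF pl ps ph P0 PS gr; have [Kh [kh bh]] := pt_size ph; have [Kl [kl bl]] := pt_size pl; have [Ks [ks bs]] := pt_size ps.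
(* the accumulator is kept together with the environment x *)
pose g (y : Y) (a : X * T) := (a.1, step a.1 y a.2).
have foldE t x s : foldl (fun a y => g y a) (x, s) t = (x, foldl (fun s y => step x y s) s t).
  by elim: t s => //= y t IH s; rewrite IH.
pose hb n := Kh * (n + Kl * n ^ kl) ^ kh.
pose p n := 1 + (n + (Ks * n ^ ks + Kl * n ^ kl * hb n)).
have pp : ispoly p.
  have phb : ispoly hb.
    apply: ispoly_mul; first exact: ispoly_const.
    by apply: ispoly_exp; apply: ispoly_add; [exact: ispoly_id|exact: ispoly_pow].
  apply: ispoly_add; first exact: ispoly_const.
  apply: ispoly_add; first exact: ispoly_id.
  apply: ispoly_add; first exact: ispoly_pow.
  by apply: ispoly_mul => //; exact: ispoly_pow.
have bnd x t s : P x s -> sz t <= Kl * sz x ^ kl -> 1 + (sz x + (sz s + sz t * hb (sz x))) <= p (sz x) ->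
    lbound (fun a : X * T => enc a) g (p (sz x)) (x, s) t.
  elim: t s => [|y t IH] s Ps tb sb; split=> //.
  - apply: leq_trans sb; have -> : tsz (enc (x, s)) = (sz x + sz s).+1 by [].
    by rewrite add1n ltnS leq_add2l leq_addr.
  - apply: leq_trans sb; have -> : tsz (enc (x, s)) = (sz x + sz s).+1 by [].
    by rewrite add1n ltnS leq_add2l leq_addr.
  move: tb sb; rewrite sz_cons => tb sb.
  have y1 : sz (h (x, y)) <= hb (sz x).
    apply: leq_trans (bh _) _; rewrite /hb leq_mul2l; apply/orP; right; apply: expn_le.
    by rewrite sz_pair -addnS leq_add2l; apply: leq_trans tb; rewrite ltnS leq_addr.
  apply: IH; [exact: PS|by apply: leq_trans tb; rewrite leqW // leq_addl|].
  apply: leq_trans sb; rewrite leq_add2l leq_add2l mulSn mulnDl.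
  move: (gr x y s Ps) y1 => /=; move: (sz (h (x, y))) (hb _) (sz t * _) (sz y * _) (sz s) (sz (step x y s)); clear; lia.
have good x : lbound (fun a : X * T => enc a) g (p (sz x)) (x, s0 x) (l x).
  apply: bnd; [exact: P0|exact: bl|].
  rewrite /p !leq_add2l; apply: leq_add; first exact: bs.
  by rewrite leq_mul2r bl orbT.
have pg : PTt (fun z : Y * (X * T) => g z.1 z.2).
  apply: pt_pair; first by apply: pt_fst; apply: pt_snd; exact: pt_id.
  apply: (pt_comp (f := fun w : Y * (X * T) => ((w.2.1, w.1), w.2.2)) pF).
  by apply: pt_pair; [apply: pt_pair; [apply: pt_fst; apply: pt_snd|apply: pt_fst]|apply: pt_snd; apply: pt_snd]; exact: pt_id.
have pf := PT_fold (s0 := fun x => (x, s0 x)) pg (pt_pair pt_id ps) pl pp good.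
apply: pt_ext (pt_snd pf) => x; by rewrite foldE.
Qed.

Lemma pt_foldl (step : X -> Y -> T -> T) (l : X -> seq Y) (s0 : X -> T) (h : X * Y -> Z) :
  PTt (fun z : X * Y * T => step z.1.1 z.1.2 z.2) -> PTt l -> PTt s0 -> PTt h ->
  (forall x y s, sz (step x y s) <= sz s + sz (h (x, y))) ->
  PTt (fun x => foldl (fun s y => step x y s) (s0 x) (l x)).
Proof. by move=> pF pl ps ph gr; apply: (pt_foldl_inv (P := fun _ _ => True) pF pl ps ph). Qed.
End Fold.

Lemma sz_bool (b c : bool) : sz b = sz c. Proof. by case: b; case: c. Qed.

Ltac pt_var := repeat lazymatch goal with
  | |- @PTt _ _ _ _ (fun x => x) => exact: pt_id
  | |- @PTt _ _ _ _ (fun _ => ?c) => exact: (pt_const c)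
  | |- @PTt _ _ _ _ fst => apply: (pt_fst (f := fun x => x))
  | |- @PTt _ _ _ _ snd => apply: (pt_snd (f := fun x => x))
  | |- @PTt _ _ _ _ (fun x => (_, _)) => apply: pt_pair
  | |- @PTt _ _ _ _ (fun x => fst (@?f x)) => apply: (pt_fst (f := f))
  | |- @PTt _ _ _ _ (fun x => snd (@?f x)) => apply: (pt_snd (f := f))
  | |- _ => assumption
  end.

Section Bools.
Context {X : Type} {eX : Enc X}.
Lemma pt_and (a b : X -> bool) : PTt a -> PTt b -> PTt (fun x => a x && b x).
Proof. by move=> pa pb; exact: (pt_if pa pb (pt_const false)). Qed.
Lemma pt_or (a b : X -> bool) : PTt a -> PTt b -> PTt (fun x => a x || b x).
Proof. by move=> pa pb; exact: (pt_if pa (pt_const true) pb). Qed.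
Lemma pt_not (a : X -> bool) : PTt a -> PTt (fun x => ~~ a x).
Proof. by move=> pa; exact: (pt_if pa (pt_const false) (pt_const true)). Qed.
Lemma pt_imp (a b : X -> bool) : PTt a -> PTt b -> PTt (fun x => a x ==> b x).
Proof. by move=> pa pb; exact: (pt_if pa pb (pt_const true)). Qed.
Lemma pt_addb (a b : X -> bool) : PTt a -> PTt b -> PTt (fun x => a x (+) b x).
Proof. by move=> pa pb; apply: pt_ext (pt_if pa (pt_not pb) pb) => x; case: (a x). Qed.

End Bools.

Section Lists.
Context {X Y Z : Type} {eX : Enc X} {eY : Enc Y} {eZ : Enc Z}.

Lemma sz_cat (s t : seq Y) : sz (s ++ t) + 1 = sz s + sz t.
Proof.
elim: s => [|y s IH] /=; first exact: addnC.
by move: IH; rewrite !sz_cons; move: (sz _) (sz _) (sz _) (sz _) => a b c d; clear; lia.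
Qed.

Lemma pt_head (d : Y) (l : X -> seq Y) : PTt l -> PTt (fun x => head d (l x)).
Proof.
move=> pl; apply: (pt_ext (f := fun x => if l x is y :: t then y else d)) => [x|]; first by case: (l x).
apply: (pt_match (g := fun _ y _ => y)) => //; first exact: pt_const.
by apply: pt_fst; apply: pt_snd; exact: pt_id.
Qed.
Lemma pt_behead (l : X -> seq Y) : PTt l -> PTt (fun x => behead (l x)).
Proof.
move=> pl; apply: (pt_ext (f := fun x => if l x is y :: t then t else [::])) => [x|]; first by case: (l x).
apply: (pt_match (g := fun _ _ t => t)) => //; first exact: pt_const.
by apply: pt_snd; apply: pt_snd; exact: pt_id.
Qed.

Lemma pt_rev (l : X -> seq Y) : PTt l -> PTt (fun x => rev (l x)).
Proof.
move=> pl; apply: (pt_ext (f := fun x => foldl (fun s y => y :: s) [::] (l x))) => [x|].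
  by rewrite /rev; elim: (l x) [::] => //= y t IH s; rewrite IH.
apply: (pt_foldl (step := fun _ y s => y :: s) (h := fun z => z)) => //=; try exact: pt_id; try exact: pt_const.
  by apply: pt_cons; [apply: pt_snd; apply: pt_fst|apply: pt_snd]; exact: pt_id.
by move=> x y s; rewrite sz_cons sz_pair; lia.
Qed.

Lemma pt_cat (l t : X -> seq Y) : PTt l -> PTt t -> PTt (fun x => l x ++ t x).
Proof.
move=> pl pt; apply: (pt_ext (f := fun x => foldl (fun s y => y :: s) (t x) (rev (l x)))) => [x|].
  by rewrite foldl_rev; elim: (l x) => //= y s ->.
apply: (pt_foldl (step := fun _ y s => y :: s) (h := fun z => z)) => //=; try exact: pt_id; try exact: pt_rev.
  by apply: pt_cons; [apply: pt_snd; apply: pt_fst|apply: pt_snd]; exact: pt_id.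
by move=> x y s; rewrite sz_cons sz_pair; lia.
Qed.

Lemma pt_map (g : X -> Y -> Z) (l : X -> seq Y) :
  PTt (fun z : X * Y => g z.1 z.2) -> PTt l -> PTt (fun x => map (g x) (l x)).
Proof.
move=> pg pl; apply: (pt_ext (f := fun x => foldl (fun s y => g x y :: s) [::] (rev (l x)))) => [x|].
  by rewrite foldl_rev; elim: (l x) => //= y s ->.
apply: (pt_foldl (step := fun x y s => g x y :: s) (h := fun z => (z, g z.1 z.2))) => //=; try exact: pt_const.
- by apply: pt_cons; [apply: (pt_comp pg); apply: pt_fst; exact: pt_id|apply: pt_snd; exact: pt_id].
- exact: pt_rev.
- by apply: pt_pair => //; exact: pt_id.
- by move=> x y s; rewrite sz_cons !sz_pair /=; lia.
Qed.

Lemma pt_filter (g : X -> Y -> bool) (l : X -> seq Y) :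
  PTt (fun z : X * Y => g z.1 z.2) -> PTt l -> PTt (fun x => filter (g x) (l x)).
Proof.
move=> pg pl; apply: (pt_ext (f := fun x => foldl (fun s y => if g x y then y :: s else s) [::] (rev (l x)))) => [x|].
  by rewrite foldl_rev; elim: (l x) => //= y s ->.
apply: (pt_foldl (step := fun x y s => if g x y then y :: s else s) (h := fun z => z)) => //=; try exact: pt_const; try exact: pt_id.
- apply: pt_if; first by apply: (pt_comp pg); apply: pt_fst; exact: pt_id.
    by apply: pt_cons; [apply: pt_snd; apply: pt_fst|apply: pt_snd]; exact: pt_id.
  by apply: pt_snd; exact: pt_id.
- exact: pt_rev.
- by move=> x y s; case: ifP => _; rewrite ?sz_cons !sz_pair /=; lia.
Qed.

Lemma pt_all (g : X -> Y -> bool) (l : X -> seq Y) :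
  PTt (fun z : X * Y => g z.1 z.2) -> PTt l -> PTt (fun x => all (g x) (l x)).
Proof.
move=> pg pl; apply: (pt_ext (f := fun x => foldl (fun s y => g x y && s) true (rev (l x)))) => [x|].
  by rewrite foldl_rev; elim: (l x) => //= y s ->.
apply: (pt_foldl (step := fun x y s => g x y && s) (h := fun z => z)) => //=; try exact: pt_const; try exact: pt_id.
- by apply: pt_and; [apply: (pt_comp pg); apply: pt_fst; exact: pt_id|apply: pt_snd; exact: pt_id].
- exact: pt_rev.
- by move=> x y s; case: (g x y); case: s; rewrite sz_pair /sz /=; lia.
Qed.
End Lists.

Section Lists2.
Context {X Y Z : Type} {eX : Enc X} {eY : Enc Y} {eZ : Enc Z}.
Lemma pt_flatten (l : X -> seq (seq Y)) : PTt l -> PTt (fun x => flatten (l x)).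
Proof.
move=> pl; apply: (pt_ext (f := fun x => foldl (fun s y => y ++ s) [::] (rev (l x)))) => [x|].
  by rewrite foldl_rev.
apply: (pt_foldl (step := fun _ y s => y ++ s) (h := fun z => z)) => //=; try exact: pt_const; try exact: pt_id.
- by apply: pt_cat; [apply: pt_snd; apply: pt_fst|apply: pt_snd]; exact: pt_id.
- exact: pt_rev.
- by move=> x y s; have := @sz_cat Y eY y s; rewrite sz_pair; lia.
Qed.

Lemma pt_pairwise (g : X -> Y -> Y -> bool) (l : X -> seq Y) :
  PTt (fun z : X * (Y * Y) => g z.1 z.2.1 z.2.2) -> PTt l -> PTt (fun x => pairwise (g x) (l x)).
Proof.
move=> pg pl.
pose st x y (s : seq Y * bool) := (y :: s.1, all (g x y) s.1 && s.2).
have stE x t : foldl (fun s y => st x y s) ([::], true) (rev t) = (t, pairwise (g x) t).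
  by rewrite foldl_rev; elim: t => //= y t ->.
apply: (pt_ext (f := fun x => (foldl (fun s y => st x y s) ([::], true) (rev (l x))).2)) => [x|]; first by rewrite stE.
apply: pt_snd; apply: (pt_foldl (step := st) (h := fun z => z)) => /=; try exact: pt_const; try exact: pt_id.
- apply: pt_pair; first by apply: pt_cons; [apply: pt_snd; apply: pt_fst; exact: pt_id|apply: pt_fst; apply: pt_snd; exact: pt_id].
  apply: pt_and; last by apply: pt_snd; apply: pt_snd; exact: pt_id.
  apply: (pt_all (g := fun (z : X * Y * (seq Y * bool)) y => g z.1.1 z.1.2 y)); last by apply: pt_fst; apply: pt_snd; exact: pt_id.
  apply: (pt_comp (f := fun z : X * Y * (seq Y * bool) * Y => (z.1.1.1, (z.1.1.2, z.2))) pg).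
  by pt_var.
- exact: pt_rev.
- move=> x y [s b]; rewrite /st !sz_pair sz_cons /=; by rewrite (sz_bool (all (g x y) s && b) b); lia.
Qed.

Lemma pt_zip (s : X -> seq Y) (t : X -> seq Z) : PTt s -> PTt t -> PTt (fun x => zip (s x) (t x)).
Proof.
move=> ps pt.
pose st (z : Z) (a : seq Y * seq (Y * Z)) := if a.1 is y :: s' then (s', (y, z) :: a.2) else ([::], a.2).
have stE u s' o : (foldl (fun a z => st z a) (s', o) u).2 = rev (zip s' u) ++ o.
  elim: u s' o => [|z u IH] [|y s'] o //=; rewrite ?IH //; first by case: u {IH}.
  by rewrite rev_cons cat_rcons.
apply: (pt_ext (f := fun x => rev (foldl (fun a z => st z a) (s x, [::]) (t x)).2)) => [x|]; first by rewrite stE cats0 revK.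
apply: pt_rev; apply: pt_snd; apply: (pt_foldl (step := fun _ => st) (h := fun z => (z, z.2))) => //=.
- apply: (pt_match (l := fun z : X * Z * (seq Y * seq (Y * Z)) => z.2.1) (f := fun z => ([::], z.2.2)) (g := fun z y s' => (s', (y, z.1.2) :: z.2.2))).
  + by apply: pt_fst; apply: pt_snd; exact: pt_id.
  + by apply: pt_pair; [exact: pt_const|apply: pt_snd; apply: pt_snd; exact: pt_id].
  + apply: pt_pair; first by apply: pt_snd; apply: pt_snd; exact: pt_id.
    apply: pt_cons; last by apply: pt_snd; apply: pt_snd; apply: pt_fst; exact: pt_id.
    apply: pt_pair; first by apply: pt_fst; apply: pt_snd; exact: pt_id.
    by apply: pt_snd; apply: pt_fst; apply: pt_fst; exact: pt_id.
- by apply: pt_pair => //; exact: pt_const.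
- by apply: pt_pair; [exact: pt_id|apply: pt_snd; exact: pt_id].
- by move=> x z [[|y s'] o]; rewrite /st /= !sz_pair ?sz_cons ?sz_pair; have := sz_gt0 z; lia.
Qed.

End Lists2.

Section Lists3.
Context {X Y : Type} {eX : Enc X} {eY : Enc Y}.
Lemma pt_mask (m : X -> seq bool) (t : X -> seq Y) : PTt m -> PTt t -> PTt (fun x => mask (m x) (t x)).
Proof.
move=> pm pt; apply: (pt_ext (f := fun x => map snd (filter (fun z => z.1) (zip (m x) (t x))))) => [x|].
  by elim: (m x) (t x) => [|b u IH] [|y s] //=; case: b => //=; rewrite IH.
apply: (pt_map (g := fun _ z => z.2)); first by apply: pt_snd; apply: pt_snd; exact: pt_id.
apply: (pt_filter (g := fun _ z => z.1)); first by apply: pt_fst; apply: pt_snd; exact: pt_id.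
exact: pt_zip.
Qed.
End Lists3.

(** * Binary arithmetic *)

Lemma bin_aux_fuel k n : n <= k -> bin_aux k n = bin n.
Proof.
rewrite /bin; elim/ltn_ind: n k => -[|n] IH [|k] //= nk; congr cons.
have h : n.+1./2 <= n by rewrite -[X in _ <= X]/(n.+1.-1); lia.
by rewrite (IH _ _ k) 1?(IH _ _ n) //; lia.
Qed.

Lemma binE n : bin n = if n is 0 then [::] else odd n :: bin n./2.
Proof. by case: n => //= n; rewrite /bin /= bin_aux_fuel //; lia. Qed.

Lemma bin_dbl (b : bool) n : bin (b + n.*2) = if b || (0 < n) then b :: bin n else [::].
Proof.
case: ifP => h; last by case: b h; case: n.
have -> : bin (b + n.*2) = odd (b + n.*2) :: bin (b + n.*2)./2.
  by rewrite binE; case E: (b + n.*2) => [|m] //; move: E h; case: b => //=; lia.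
by rewrite half_bit_double oddD odd_double addbF oddb.
Qed.

Lemma size_bin n k : (size (bin n) <= k) = (n < 2 ^ k).
Proof.
elim: k n => [|k IH] n; first by rewrite binE expn0; case: n.
case: n => [|n]; first by rewrite expn_gt0.
rewrite binE /= ltnS IH expnS; apply/idP/idP; lia.
Qed.

Lemma size_bin_add m n : size (bin (m + n)) <= size (bin m) + size (bin n).
Proof.
case: m => [|m]; first by rewrite add0n leq_addl.
case: n => [|n]; first by rewrite addn0 leq_addr.
have : size (bin m.+1) <= size (bin m.+1) by [].
have : size (bin n.+1) <= size (bin n.+1) by [].
rewrite !size_bin; case sm: (size (bin m.+1)) => [|a]; first by rewrite binE in sm.
case sn: (size (bin n.+1)) => [|b]; first by rewrite binE in sn.
move=> h1 h2; rewrite expnD !expnS in h1 h2 *; have := expn_gt0 2 a; have := expn_gt0 2 b.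
by move: (2 ^ a) (2 ^ b) h1 h2; clear; nia.
Qed.

Lemma size_bin_le m n : m <= n -> size (bin m) <= size (bin n).
Proof. by move=> mn; rewrite size_bin; apply: leq_ltn_trans mn _; rewrite -size_bin. Qed.

Lemma sz_bits (s : seq bool) : sz s = 6 * size s + 1.
Proof. by elim: s => //= b s IH; rewrite sz_cons IH; case: b; rewrite /sz /=; lia. Qed.
Lemma sz_natE n : sz n = 6 * size (bin n) + 1. Proof. exact: sz_bits. Qed.
Lemma sz_nat_add m n : sz (m + n) <= sz m + sz n.
Proof. by rewrite !sz_natE; have := size_bin_add m n; lia. Qed.
Lemma sz_nat_le m n : m <= n -> sz m <= sz n.
Proof. by move=> /size_bin_le; rewrite !sz_natE; lia. Qed.
Lemma sz_dbl (b : bool) n : sz (b + n.*2) <= sz n + 6.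
Proof. by rewrite !sz_natE bin_dbl; case: ifP => _ /=; lia. Qed.

Definition dbls (m : nat) (s : seq bool) := foldl (fun (a : nat) (b : bool) => b + a.*2) m s.

Arguments dbls : simpl never.

Definition rdigit (a b c : bool) := a (+) b (+) c.
Definition rstep (k : bool -> bool -> bool -> bool) (st : nat * nat * (bool * seq bool)) :=
  (st.1.1./2, st.1.2./2, (k (odd st.1.1) (odd st.1.2) st.2.1, rdigit (odd st.1.1) (odd st.1.2) st.2.1 :: st.2.2)).
(** One digit more than both lengths together is processed, so both operands are used up and the
    last carry or borrow is final. Digits come out lowest first and are stacked, hence end up in the
    order that [dbls] reads. *)
Definition ripple k (a b : nat) : bool * seq bool :=
  (foldl (fun st (_ : bool) => rstep k st) (a, b, (false, [::])) (true :: bin a ++ bin b)).2.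
Definition cadd (a b c : bool) := if c then a || b else a && b.
Definition csub (a b c : bool) := if a then b && c else b || c.

Lemma dbls_lt s : dbls 0 s < 2 ^ size s.
Proof.
elim/last_ind: s => // s b; rewrite /dbls foldl_rcons size_rcons expnS => IH.
by case: b => /=; lia.
Qed.
Lemma dbls_cons (b : bool) s : dbls 0 (b :: s) = b * 2 ^ size s + dbls 0 s.
Proof.
have gen m t : dbls m t = m * 2 ^ size t + dbls 0 t.
  elim/last_ind: t => [|t c IH]; first by rewrite /dbls /= expn0; lia.
  by rewrite /dbls !foldl_rcons size_rcons expnS -!/(dbls _ _) IH; lia.
by rewrite -[LHS]/(dbls (b + 0.*2) s) gen addn0.
Qed.

Lemma fold_rstep k a b t : let st := foldl (fun st (_ : bool) => rstep k st) (a, b, (false, [::])) t in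
  [/\ st.1.1 = a %/ 2 ^ size t, st.1.2 = b %/ 2 ^ size t & size st.2.2 = size t].
Proof.
elim/last_ind: t => [|t c]; first by rewrite /= expn0 !divn1.
rewrite /= foldl_rcons size_rcons => -[h1 h2 h3].
by rewrite /rstep /= h1 h2 h3 expnSr !divnMA -!divn2.
Qed.

(** The loop invariant: unread halves and carry, shifted by the number of digits processed, plus the
    digits written make up the sum. [rstep_sub] is its analogue, rearranged to avoid truncated
    subtraction. *)
Lemma rstep_add a b t : let st := foldl (fun st (_ : bool) => rstep cadd st) (a, b, (false, [::])) t in
  (st.1.1 + st.1.2 + st.2.1) * 2 ^ size t + dbls 0 st.2.2 = a + b.
Proof.
elim/last_ind: t => [|t c]; first by rewrite /dbls /= expn0; lia.
have := fold_rstep cadd a b t; rewrite /= foldl_rcons size_rcons.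
case: (foldl _ _ t) => -[a' b'] [c' o] /= [_ _ so] <-; rewrite /rstep /= dbls_cons so expnS.
have ea := odd_double_half a'; have eb := odd_double_half b'.
move: (2 ^ size t) (dbls 0 o) => P V; rewrite /rdigit /cadd.
by move: ea eb; case: (odd a'); case: (odd b'); case: c' => /= ea eb; nia.
Qed.

Lemma rstep_sub a b t : let st := foldl (fun st (_ : bool) => rstep csub st) (a, b, (false, [::])) t in
  a + (st.1.2 + st.2.1) * 2 ^ size t = dbls 0 st.2.2 + b + st.1.1 * 2 ^ size t.
Proof.
elim/last_ind: t => [|t c]; first by rewrite /dbls /= expn0; lia.
have := fold_rstep csub a b t; rewrite /= foldl_rcons size_rcons.
case: (foldl _ _ t) => -[a' b'] [c' o] /= [_ _ so]; rewrite /rstep /= dbls_cons so expnS.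
have ea := odd_double_half a'; have eb := odd_double_half b'.
move: (2 ^ size t) (dbls 0 o) => P V; rewrite /rdigit /csub.
by move: ea eb; case: (odd a'); case: (odd b'); case: c' => /= ea eb; nia.
Qed.

Lemma ripple_div k a b : let st := foldl (fun st (_ : bool) => rstep k st) (a, b, (false, [::])) (true :: bin a ++ bin b) in
  [/\ st.1.1 = 0, st.1.2 = 0, a < 2 ^ (size (bin a ++ bin b)).+1 & b < 2 ^ (size (bin a ++ bin b)).+1].
Proof.
have := fold_rstep k a b (true :: bin a ++ bin b); move=> /= [-> -> _].
have ha : a < 2 ^ (size (bin a ++ bin b)).+1 by rewrite -size_bin size_cat; lia.
have hb : b < 2 ^ (size (bin a ++ bin b)).+1 by rewrite -size_bin size_cat; lia.
by rewrite !divn_small.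
Qed.

Lemma ripple_add a b : dbls 0 (ripple cadd a b).2 = a + b.
Proof.
have := rstep_add a b (true :: bin a ++ bin b); have := ripple_div cadd a b; rewrite /ripple.
set st := foldl _ _ _ => /= -[-> -> _ _] e.
have lt : a + b < 2 ^ (size (bin a ++ bin b)).+1.
  rewrite expnS size_cat expnD; have : a < 2 ^ size (bin a) by rewrite -size_bin.
  have : b < 2 ^ size (bin b) by rewrite -size_bin.
  by move: (2 ^ _) (2 ^ _); clear; nia.
by move: e lt; case: (st.2.1) => /=; move: (2 ^ _.+1) (dbls 0 _); clear; lia.
Qed.

Lemma ripple_sub a b : (ripple csub a b).1 = (a < b) /\ (b <= a -> dbls 0 (ripple csub a b).2 = a - b).
Proof.
have := rstep_sub a b (true :: bin a ++ bin b); have := ripple_div csub a b; rewrite /ripple.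
have := fold_rstep csub a b (true :: bin a ++ bin b).
set st := foldl _ _ _ => /= -[_ _ so] [-> -> la lb] e.
have := dbls_lt st.2.2; rewrite so.
move: e la lb; case: (st.2.1) => /=; move: (2 ^ _.+1) (dbls 0 _) => P V; clear; split; lia.
Qed.

Section NatOps.
Context {X : Type} {eX : Enc X}.

Lemma pt_bin (f : X -> nat) : PTt f -> PTt (fun x => bin (f x)). Proof. by []. Qed.
Lemma pt_odd (f : X -> nat) : PTt f -> PTt (fun x => odd (f x)).
Proof.
move=> /pt_bin /(pt_head false); apply: pt_ext => x; rewrite binE; by case: (f x).
Qed.
Lemma pt_half (f : X -> nat) : PTt f -> PTt (fun x => (f x)./2).
Proof.
move=> /pt_bin /pt_behead h; have : PTt (fun x => bin (f x)./2) by apply: pt_ext h => x; rewrite binE; case: (f x).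
by [].
Qed.
Lemma pt_dbl (b : X -> bool) (f : X -> nat) : PTt b -> PTt f -> PTt (fun x => b x + (f x).*2).
Proof.
move=> pb pf; have h : PTt (fun x => bin (b x + (f x).*2)); last exact: h.
apply: (pt_ext (f := fun x => if b x then b x :: bin (f x) else if bin (f x) is _ :: _ then b x :: bin (f x) else [::])) => [x|].
  by rewrite bin_dbl; case: (b x) => //=; case: (f x) => // n; rewrite binE.
apply: pt_if => //; first exact: pt_cons.
apply: (pt_match (g := fun x _ _ => b x :: bin (f x))) => //; first exact: pt_const.
by apply: pt_cons; [apply: (pt_comp pb)|apply: (pt_comp pf)]; pt_var.
Qed.
End NatOps.

Section NatOps2.
Context {X : Type} {eX : Enc X}.
Lemma pt_dbls (l : X -> seq bool) : PTt l -> PTt (fun x => dbls 0 (l x)).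
Proof.
move=> pl; apply: (pt_foldl (step := fun _ (b : bool) (a : nat) => b + a.*2) (h := fun z => (z.2, z.2))) => //=.
- by apply: pt_dbl; pt_var.
- exact: pt_const.
- by pt_var.
- move=> x b s; apply: leq_trans (sz_dbl _ _) _; rewrite leq_add2l sz_pair; by case: b.
Qed.

Lemma pt_ripple k (f g : X -> nat) : PTt f -> PTt g -> PTt (fun x => ripple k (f x) (g x)).
Proof.
move=> pf pg; apply: pt_snd.
apply: (pt_foldl (step := fun _ (_ : bool) st => rstep k st) (h := fun z => z)) => //=.
- apply: pt_pair; first by apply: pt_pair; apply: pt_half; pt_var.
  have po1 : PTt (fun z : X * bool * (nat * nat * (bool * seq bool)) => odd z.2.1.1) by apply: pt_odd; pt_var.
  have po2 : PTt (fun z : X * bool * (nat * nat * (bool * seq bool)) => odd z.2.1.2) by apply: pt_odd; pt_var.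
  apply: pt_pair; last by apply: pt_cons; [apply: pt_addb; [apply: pt_addb|]|]; pt_var.
  apply: (pt_ext (f := fun z : X * bool * (nat * nat * (bool * seq bool)) => if odd z.2.1.1 then
     (if odd z.2.1.2 then (if z.2.2.1 then k true true true else k true true false) else (if z.2.2.1 then k true false true else k true false false)) else
     (if odd z.2.1.2 then (if z.2.2.1 then k false true true else k false true false) else (if z.2.2.1 then k false false true else k false false false)))) => [z|].
    by case: (odd _); case: (odd _); case: (z.2.2.1).
  by do ![apply: pt_if => //]; pt_var.
- by apply: pt_cons; [exact: pt_const|apply: pt_cat].
- by apply: pt_pair; [pt_var|exact: pt_const].
- exact: pt_id.
move=> x c [[a b] [d o]]; rewrite /rstep /= !sz_pair sz_cons.
have h1 n : sz n./2 <= sz n by apply: sz_nat_le; lia.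
have b5 (e : bool) : sz e = 5 by case: e.
by rewrite !b5; have := h1 a; have := h1 b; have := sz_gt0 x; lia.
Qed.

Lemma pt_addn (f g : X -> nat) : PTt f -> PTt g -> PTt (fun x => f x + g x).
Proof.
move=> pf pg; apply: (pt_ext (f := fun x => dbls 0 (ripple cadd (f x) (g x)).2)) => [x|]; first by rewrite ripple_add.
by apply: pt_dbls; apply: pt_snd; apply: pt_ripple.
Qed.
Lemma pt_ltn (f g : X -> nat) : PTt f -> PTt g -> PTt (fun x => f x < g x).
Proof.
move=> pf pg; apply: (pt_ext (f := fun x => (ripple csub (f x) (g x)).1)) => [x|]; first by case: (ripple_sub (f x) (g x)).
by apply: pt_fst; apply: pt_ripple.
Qed.
End NatOps2.

Section NatOps3.
Context {X : Type} {eX : Enc X}.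
Lemma pt_leq (f g : X -> nat) : PTt f -> PTt g -> PTt (fun x => f x <= g x).
Proof. by move=> pf pg; apply: pt_ext (pt_not (pt_ltn pg pf)) => x; rewrite -leqNgt. Qed.
Lemma pt_subn (f g : X -> nat) : PTt f -> PTt g -> PTt (fun x => f x - g x).
Proof.
move=> pf pg; apply: (pt_ext (f := fun x => if g x <= f x then dbls 0 (ripple csub (f x) (g x)).2 else 0)) => [x|].
  by case: (leqP (g x) (f x)) => h; [case: (ripple_sub (f x) (g x)) => _ ->|apply/esym/eqP; rewrite subn_eq0 ltnW].
apply: pt_if; [exact: pt_leq|by apply: pt_dbls; apply: pt_snd; apply: pt_ripple|exact: pt_const].
Qed.
Lemma pt_minn (f g : X -> nat) : PTt f -> PTt g -> PTt (fun x => minn (f x) (g x)).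
Proof. by move=> pf pg; apply: pt_if => //; apply: pt_ltn. Qed.
Lemma pt_maxn (f g : X -> nat) : PTt f -> PTt g -> PTt (fun x => maxn (f x) (g x)).
Proof. by move=> pf pg; apply: pt_if => //; apply: pt_ltn. Qed.

(** Horner scheme over the digits of [g x], highest first; each step adds a bounded number of digits
    beyond those of [f x], as the growth condition demands. *)
Lemma pt_muln (f g : X -> nat) : PTt f -> PTt g -> PTt (fun x => f x * g x).
Proof.
move=> pf pg; apply: (pt_ext (f := fun x => foldl (fun (s : nat) (b : bool) => false + s.*2 + (if b then f x else 0)) 0 (rev (bin (g x))))) => [x|].
  rewrite foldl_rev; elim/ltn_ind: (g x) => -[|n] IH; first by rewrite muln0.
  rewrite binE /= IH; last by lia.
  rewrite -[in RHS](odd_double_half n.+1) /= mulnDr -doubleMr; case: (~~ odd n); lia.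
apply: (pt_foldl (step := fun x (b : bool) (s : nat) => false + s.*2 + (if b then f x else 0)) (h := fun z => (z.2, (z.2, f z.1)))) => //=.
- apply: pt_addn; first by apply: (pt_dbl (b := fun=> false)); pt_var.
  by apply: pt_if; [pt_var|apply: (pt_comp pf); pt_var|exact: pt_const].
- by apply: pt_rev; apply: pt_bin.
- exact: pt_const.
- by apply: pt_pair; [pt_var|apply: pt_pair; [pt_var|apply: (pt_comp pf); pt_var]].
- move=> x b s; apply: leq_trans (sz_nat_add _ _) _; apply: leq_trans (leq_add (sz_dbl false s) (leqnn _)) _.
  rewrite !sz_pair; have := sz_gt0 (f x).
  by case: b; rewrite /sz /=; lia.
Qed.
End NatOps3.

Section NatLists.
Context {X Y : Type} {eX : Enc X} {eY : Enc Y}.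
Lemma pt_sumn (l : X -> seq nat) : PTt l -> PTt (fun x => sumn (l x)).
Proof.
move=> pl; apply: (pt_ext (f := fun x => foldl (fun s y => y + s) 0 (rev (l x)))) => [x|]; first by rewrite foldl_rev.
apply: (pt_foldl (step := fun _ y s => y + s) (h := fun z => z)) => //=; try exact: pt_const.
- by apply: pt_addn; pt_var.
- exact: pt_rev.
- exact: pt_id.
- by move=> x y s; apply: leq_trans (sz_nat_add _ _) _; rewrite sz_pair; lia.
Qed.

Lemma pt_seqsize (l : X -> seq Y) : PTt l -> PTt (fun x => size (l x)).
Proof.
move=> pl; apply: (pt_ext (f := fun x => sumn (map (fun _ => 1) (l x)))) => [x|]; first by rewrite sumnE big_map sum1_size.
by apply: pt_sumn; apply: pt_map => //; exact: pt_const.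
Qed.
End NatLists.

Section Numbering.
Context {X Y : Type} {eX : Enc X} {eY : Enc Y}.
Lemma pt_numbered (l : X -> seq Y) : PTt l -> PTt (fun x => zip (iota 0 (size (l x))) (l x)).
Proof.
move=> pl; have pn := pt_seqsize pl.
(* the guard, always true, bounds the growth of the state *)
pose st x (y : Y) (s : nat * seq (nat * Y)) := if s.1 < size (l x) then (s.1 + 1, (s.1, y) :: s.2) else s.
have stE x t k o : k + size t <= size (l x) -> (foldl (fun s y => st x y s) (k, o) t).2 = rev (zip (iota k (size t)) t) ++ o.
  elim: t k o => //= y t IH k o; rewrite addnS => h; rewrite {2}/st /= (leq_trans _ h) ?ltnS ?leq_addr // IH; last by rewrite addn1 addSn.
  by rewrite rev_cons cat_rcons addn1.
apply: (pt_ext (f := fun x => rev (foldl (fun s y => st x y s) (0, [::]) (l x)).2)) => [x|]; first by rewrite stE // cats0 revK.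
apply: pt_rev; apply: pt_snd; apply: (pt_foldl (step := st) (h := fun z => (size (l z.1), (z.2, 1)))) => //=; try exact: pt_const.
- apply: pt_if; last by pt_var.
    by apply: pt_ltn; [pt_var|apply: (pt_comp pn); pt_var].
  apply: pt_pair; first by apply: pt_addn; pt_var.
  by apply: pt_cons; pt_var.
- by apply: pt_pair; [apply: (pt_comp pn); pt_var|apply: pt_pair; pt_var].
move=> x y [k o]; rewrite /st /=; case: ifP => [/ltnW/sz_nat_le|_]; rewrite !sz_pair; last by lia.
by rewrite sz_cons sz_pair; have := sz_nat_add k 1; lia.
Qed.
End Numbering.

(** * Reading the input and writing the output *)

Fixpoint pushs (w : seq bool) := if w is b :: w' then CSeq (pushs w') (CPush A b) else CSkip.
Lemma pushs_ok w io a : le_ex (pushs w) (size w) (clean io a) (clean io (w ++ a)).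
Proof.
elim: w => [|b w IH] /=; first exact: le_skip.
by rewrite -addn1; apply: le_seq IH _; apply: le_push.
Qed.

Definition pushbool (b : bool) := pushs (true :: code (enc b)).
Definition readIO := CLoop IO true true (pushbool false) (pushbool true).
(** The last input symbol is popped first, so consing in this order restores the input as a list. *)
Lemma read_ok u (l : seq bool) r :
  le_ex readIO (7 * size u + 1) (clean u (code (enc l) ++ r)) (clean [::] (code (enc (rev u ++ l)) ++ r)).
Proof.
elim: u l => [|b u IH] l; first exact: le_loop_e.
apply: (le_w (n := (6 + (7 * size u + 1)).+1)); first by rewrite /=; lia.
rewrite rev_cons cat_rcons.
apply: (@le_loop_c _ _ _ _ _ 6 _ _ (clean u (code (enc (b :: l)) ++ r)) _ b u) => //; first by case: (b).
have -> : code (enc (b :: l)) ++ r = (true :: code (enc b)) ++ (code (enc l) ++ r) by rewrite -[enc (b :: l)]/(Nd (enc b) (enc l)) /= catA.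
by case: (b); [exact: (pushs_ok (true :: code (@enc bool Enc_bool true)))|exact: (pushs_ok (true :: code (@enc bool Enc_bool false)))].
Qed.

Definition popA := CIf A CSkip CSkip CSkip.
Lemma popA_ok io b a : le_ex popA 1 (clean io (b :: a)) (clean io a).
Proof. by apply: (@le_if _ _ _ _ 0 _ _ b a) => //; case: b; apply: le_skip. Qed.

Definition emitbit (b : bool) := CSeq popA (CSeq popA (CSeq popA (CPush IO b))).
Lemma emitbit_ok b io b1 b2 b3 a : le_ex (emitbit b) 4 (clean io [:: b1, b2, b3 & a]) (clean (b :: io) a).
Proof.
apply: (@le_seq _ _ 1 3); first exact: popA_ok.
apply: (@le_seq _ _ 1 2); first exact: popA_ok.
by apply: (@le_seq _ _ 1 1); [exact: popA_ok|apply: le_push].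
Qed.
(** The two booleans have codes [11000] and [10100]: after the list node and the first symbol of the
    code, the second symbol is the bit, and three symbols remain to be discarded. *)
Definition emitIO := CLoop A false true CSkip (CSeq popA (CIf A CSkip (emitbit false) (emitbit true))).
Lemma emit_ok io (l : seq bool) r :
  le_ex emitIO (7 * size l + 1) (clean io (code (enc l) ++ r)) (clean (rev l ++ io) r).
Proof.
elim: l io => [|b l IH] io.
  by apply: (@le_loop_x _ _ _ _ _ 0 _ _ false r) => //; apply: le_skip.
apply: (le_w (n := (6 + (7 * size l + 1)).+1)); first by rewrite /=; lia.
rewrite rev_cons cat_rcons -[enc (b :: l)]/(Nd (enc b) (enc l)).
apply: (@le_loop_c _ _ _ _ _ 6 _ _ (clean (b :: io) (code (enc l) ++ r)) _ true (code (enc b) ++ code (enc l) ++ r)) => //.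
  by rewrite /= catA.
apply: (@le_seq _ _ 1 5 _ (clean io (behead (code (enc b)) ++ code (enc l) ++ r))); first by case: (b); apply: popA_ok.
apply: (@le_if _ _ _ _ 4 _ _ b (drop 2 (code (enc b)) ++ code (enc l) ++ r)); first by case: (b).
by case: (b); apply: emitbit_ok.
Qed.

Theorem PT_machine (f : seq bool -> seq bool) : PTt f ->
  exists (M : TM) (c k : nat), forall u : seq bool,
    exists t cf, [/\ t <= c * (size u).+1 ^ k, run t (@init M (map sym_of_bool u)) = Some cf &
      tm_output cf = map sym_of_bool (f u)].
Proof.
move=> pf; have [K2 [k2 sf]] := pt_size pf; have [c [K [k h]]] := pf.
pose p s := 1 + (7 * s + (K * (6 * s) ^ k + (7 * (K2 * (6 * s) ^ k2) + 1))).
have p6 : ispoly (fun s => 6 * s) by apply: ispoly_mul; [exact: ispoly_const|exact: ispoly_id].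
have pp : ispoly p.
  apply: ispoly_add; first exact: ispoly_const.
  apply: ispoly_add; first by apply: ispoly_mul; [exact: ispoly_const|exact: ispoly_id].
  apply: ispoly_add; first by apply: ispoly_mul; [exact: ispoly_const|exact: ispoly_exp].
  apply: ispoly_add; last exact: ispoly_const.
  by do 2 (apply: ispoly_mul; [exact: ispoly_const|]); exact: ispoly_exp.
have [Kt [kt bt]] : ispoly (fun s => 12 * (p s * (2 * (s + p s) + 4))).
  apply: ispoly_mul; first exact: ispoly_const.
  apply: ispoly_mul => //; apply: ispoly_add; last exact: ispoly_const.
  by apply: ispoly_mul; [exact: ispoly_const|apply: ispoly_add => //; exact: ispoly_id].
exists (cTM (CSeq (CPush A false) (CSeq readIO (CSeq c emitIO)))), Kt, kt => u.
have su : sz u <= 6 * (size u).+1 by rewrite sz_bits; lia.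
have [n np hex] : le_ex (CSeq (CPush A false) (CSeq readIO (CSeq c emitIO))) (p (size u).+1)
    (St (rev u) [::] [::] [::] [::] [::]) (clean (rev (f u)) [::]).
  apply: le_seq; first exact: le_push.
  apply: (le_w (n := (7 * size u + 1) + (K * sz u ^ k + (7 * size (f u) + 1)))).
    have h1 : K * sz u ^ k <= K * (6 * (size u).+1) ^ k by rewrite leq_mul2l; apply/orP; right; exact: expn_le.
    have h2 : size (f u) <= K2 * (6 * (size u).+1) ^ k2.
      apply: (leq_trans (n := sz (f u))); first by rewrite sz_bits; lia.
      by apply: leq_trans (sf u) _; rewrite leq_mul2l; apply/orP; right; exact: expn_le.
    by move: h1 h2; move: (K * _) (K2 * _) (K * _); clear; lia.
  have := @read_ok (rev u) [::] [::]; rewrite size_rev !cats0 revK => /le_seq; apply.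
  apply: le_seq; first by have := h u [::] [::]; rewrite !cats0; apply.
  by have := @emit_ok [::] (f u) [::]; rewrite !cats0; apply.
have [t [cf [tb rt ot]]] := cTM_run hex.
exists t, cf; split=> //; last by rewrite ot revK.
apply: leq_trans tb _; apply: leq_trans (bt _ (ltn0Sn _)).
rewrite leq_mul2l /=; apply: leq_mul => //; rewrite leq_add2r leq_mul2l /=; apply: leq_add => //; exact: leqnSn.
Qed.

(** * Decoding instances *)

Definition parsest := (bool * bool * (seq bool * seq nat))%type.
(** The flags tell whether a pair is half read and what its first symbol was. Digits arrive lowest
    first and are stacked, so [dbls] evaluates them when the end marker is met. *)
Definition pstep (y : bool) (s : parsest) : parsest :=
  if s.1.1 then (if s.1.2 then (false, false, (y :: s.2.1, s.2.2)) else (false, false, ([::], dbls 0 s.2.1 :: s.2.2)))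
  else (true, y, s.2).
Definition parse (u : seq bool) : seq nat := rev (foldl (fun s y => pstep y s) (false, false, ([::], [::])) u).2.2.

Lemma dbls_bin n : dbls 0 (rev (bin n)) = n.
Proof.
rewrite /dbls foldl_rev; elim/ltn_ind: n => -[|n] IH //.
by rewrite binE /= IH ?odd_double_half //; [exact: (odd_double_half n.+1)|lia].
Qed.

Lemma parse_enc s : parse (enc_nats s) = s.
Proof.
rewrite /parse; suff gen o : foldl (fun s y => pstep y s) (false, false, ([::], o)) (enc_nats s) = (false, false, ([::], rev s ++ o)).
  by rewrite gen cats0 revK.
elim: s o => // n s IH o; rewrite /enc_nats /= foldl_cat.
have -> : foldl (fun s y => pstep y s) (false, false, ([::], o)) (enc_nat n) = (false, false, ([::], n :: o)).
  rewrite /enc_nat foldl_cat.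
  have gen w c : foldl (fun s y => pstep y s) (false, false, (c, o)) (flatten [seq [:: true; b] | b <- w]) = (false, false, (rev w ++ c, o)).
    by elim: w c => //= b w IHw c; rewrite /pstep /= -/(pstep _ _) IHw rev_cons cat_rcons.
  by rewrite gen cats0 /= /pstep /= dbls_bin.
by rewrite -/(enc_nats s) IH rev_cons cat_rcons.
Qed.

#[export] Instance Enc_item : Enc item := fun it => enc (iw it, (ih it, ip it)).

Section Items.
Context {X : Type} {eX : Enc X}.
Lemma pt_parse (f : X -> seq bool) : PTt f -> PTt (fun x => parse (f x)).
Proof.
move=> pf; apply: pt_rev; do 2 apply: pt_snd.
apply: (pt_foldl (step := fun _ => pstep) (h := fun z => (z.2, (z.2, z.2)))) => //=; last 1 first.
- move=> x y [[[] []] [c o]]; rewrite /pstep /= !sz_pair ?sz_cons.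
  + by have := sz_gt0 y; rewrite (sz_bool true false); lia.
  + have h : sz (dbls 0 c) <= sz c by rewrite sz_natE sz_bits leq_add2r leq_mul2l /= size_bin dbls_lt.
    by move: h; have -> : @sz (seq bool) _ [::] = 1 by []; rewrite (sz_bool true false); have := sz_gt0 y; lia.
  + by rewrite (sz_bool y true); lia.
  + by rewrite (sz_bool y false) (sz_bool true false); lia.
- rewrite /pstep; apply: pt_if; [pt_var| |pt_var].
  apply: pt_if; [pt_var| |].
    by apply: pt_pair; [exact: pt_const|apply: pt_pair; [apply: pt_cons|]; pt_var].
  by apply: pt_pair; [exact: pt_const|apply: pt_pair; [exact: pt_const|apply: pt_cons; [apply: pt_dbls|]; pt_var]].
- exact: pt_const.
- by pt_var.
Qed.

Lemma pt_iw (f : X -> item) : PTt f -> PTt (fun x => iw (f x)). Proof. exact: PT_hd. Qed.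
Lemma pt_ih (f : X -> item) : PTt f -> PTt (fun x => ih (f x)). Proof. by move=> h; exact: (PT_hd (PT_tl h)). Qed.
Lemma pt_ip (f : X -> item) : PTt f -> PTt (fun x => ip (f x)). Proof. by move=> h; exact: (PT_tl (PT_tl h)). Qed.
Lemma pt_Item (f g h : X -> nat) : PTt f -> PTt g -> PTt h -> PTt (fun x => Item (f x) (g x) (h x)).
Proof. by move=> pf pg ph; exact: (pt_pair pf (pt_pair pg ph)). Qed.
End Items.

Definition istep (y : nat) (s : seq nat * seq item) : seq nat * seq item :=
  if s.1 is b :: p then (if p is a :: _ then ([::], Item a b y :: s.2) else (y :: s.1, s.2)) else (y :: s.1, s.2).
Definition items (s : seq nat) : seq item := rev (foldl (fun s y => istep y s) ([::], [::]) s).2.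

Lemma items_flatten I : items (flatten [seq [:: iw it; ih it; ip it] | it <- I]) = I.
Proof.
rewrite /items; suff gen o : (foldl (fun s y => istep y s) ([::], o) (flatten [seq [:: iw it; ih it; ip it] | it <- I])).2 = rev I ++ o.
  by rewrite gen cats0 revK.
elim: I o => // -[w h p] I IH o /=.
by rewrite -[istep p _]/([::], Item w h p :: o) IH rev_cons cat_rcons.
Qed.

Section Items2.
Context {X : Type} {eX : Enc X}.
Lemma pt_items (f : X -> seq nat) : PTt f -> PTt (fun x => items (f x)).
Proof.
move=> pf; apply: pt_rev; apply: pt_snd.
apply: (pt_foldl (step := fun _ => istep) (h := fun z => (z, z))) => //=; last 1 first.
- move=> x y [[|b [|a p]] o]; rewrite /istep /= !sz_pair ?sz_cons ?sz_pair; try lia.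
  have -> : @sz _ Enc_item (Item a b y) = (sz a + (sz b + sz y).+1).+1 by [].
  by have -> : @sz (seq nat) _ [::] = 1 by []; lia.
- rewrite /istep; apply: (pt_match (l := fun z : X * nat * (seq nat * seq item) => z.2.1) (f := fun z => (z.1.2 :: z.2.1, z.2.2))
    (g := fun z b p => if p is a :: _ then ([::], Item a b z.1.2 :: z.2.2) else (z.1.2 :: z.2.1, z.2.2))).
  + by pt_var.
  + by apply: pt_pair; [apply: pt_cons|]; pt_var.
  apply: (pt_match (l := fun z : X * nat * (seq nat * seq item) * (nat * seq nat) => z.2.2) (f := fun z => (z.1.1.2 :: z.1.2.1, z.1.2.2))
    (g := fun z a _ => ([::], Item a z.2.1 z.1.1.2 :: z.1.2.2))).
  + by pt_var.
  + by apply: pt_pair; [apply: pt_cons|]; pt_var.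
  by apply: pt_pair; [exact: pt_const|apply: pt_cons; [apply: pt_Item|]; pt_var].
- exact: pt_const.
- by pt_var.
Qed.

Lemma pt_enc_nats (f : X -> seq nat) : PTt f -> PTt (fun x => enc_nats (f x)).
Proof.
move=> pf; apply: pt_flatten; apply: (pt_map (g := fun _ n => enc_nat n)) => //=.
apply: pt_cat; last exact: pt_const.
apply: pt_flatten; apply: (pt_map (g := fun _ b => [:: true; b])); last by apply: pt_bin; pt_var.
by apply: pt_cons; [exact: pt_const|apply: pt_cons; [pt_var|exact: pt_const]].
Qed.
End Items2.

Definition getN (u : seq bool) := head 0 (parse u).
Definition getI (u : seq bool) := items (behead (behead (parse u))).

Lemma machine_for (F : nat * seq item -> seq out_entry) : PTt F ->
  exists (M : TM) (c k : nat), forall N I,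
    exists t cf, [/\ t <= c * (size (enc_instance N I)).+1 ^ k,
      run t (@init M (enc_instance N I)) = Some cf & tm_output cf = enc_solution (F (N, I))].
Proof.
move=> pF.
pose ent (e : out_entry) := let: (i, (xn, xd), (yn, yd), r) := e in [:: i; xn; xd; yn; yd; nat_of_bool r].
have pent : PTt ent.
  apply: (pt_ext (f := fun e : out_entry => [:: e.1.1.1; e.1.1.2.1; e.1.1.2.2; e.1.2.1; e.1.2.2; if e.2 then 1 else 0])).
    by case=> [[[i [xn xd]] [yn yd]] []].
  do 5 (apply: pt_cons; first by pt_var); apply: pt_cons; last exact: pt_const.
  by apply: pt_if; pt_var.
pose G u := enc_nats (flatten (map ent (F (getN u, getI u)))).
have pG : PTt G.
  apply: pt_enc_nats; apply: pt_flatten; apply: (pt_map (g := fun _ e => ent e)).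
    by apply: (pt_comp pent); pt_var.
  apply: (pt_comp pF); apply: pt_pair; first by apply: pt_head; apply: pt_parse; pt_var.
  by apply: pt_items; do 2 apply: pt_behead; apply: pt_parse; pt_var.
have [M [c [k h]]] := PT_machine pG.
exists M, c, k => N I; have := h (enc_nats (N :: size I :: flatten [seq [:: iw it; ih it; ip it] | it <- I])).
rewrite /G /getN /getI parse_enc [head _ _]/= [behead _]/= items_flatten => -[t [cf [tb rt ot]]].
by exists t, cf; split=> //; rewrite size_map.
Qed.

End Machine.

(** * The algorithm runs in polynomial time *)
Module Implementation.
Set Implicit Arguments. Unset Strict Implicit. Unset Printing Implicit Defensive.
Import Geometry Algorithm Machine.
Local Close Scope ring_scope.
Local Open Scope nat_scope.

Ltac pt := repeat (cbv beta; lazymatch goal with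
  | |- @PTt _ _ _ _ (fun x => x) => exact: pt_id
  | |- @PTt _ _ _ _ (fun _ => ?c) => exact: (pt_const c)
  | |- @PTt _ _ _ _ fst => apply: (pt_fst (f := fun x => x))
  | |- @PTt _ _ _ _ snd => apply: (pt_snd (f := fun x => x))
  | |- @PTt _ _ _ _ (fun x => (_, _)) => apply: pt_pair
  | |- @PTt _ _ _ _ (fun x => fst (@?f x)) => apply: (pt_fst (f := f))
  | |- @PTt _ _ _ _ (fun x => snd (@?f x)) => apply: (pt_snd (f := f))
  | |- @PTt _ _ _ _ (fun x => cons (@?f x) (@?g x)) => apply: (pt_cons (f := f) (l := g))
  | |- @PTt _ _ _ _ (fun x => cat (@?f x) (@?g x)) => apply: (pt_cat (l := f) (t := g))
  | |- @PTt _ _ _ _ (fun x => flatten (@?f x)) => apply: (pt_flatten (l := f))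
  | |- @PTt _ _ _ _ (fun x => map (@?f x) (@?g x)) => apply: (pt_map (g := f) (l := g))
  | |- @PTt _ _ _ _ (fun x => filter (@?f x) (@?g x)) => apply: (pt_filter (g := f) (l := g))
  | |- @PTt _ _ _ _ (fun x => all (@?f x) (@?g x)) => apply: (pt_all (g := f) (l := g))
  | |- @PTt _ _ _ _ (fun x => pairwise (@?f x) (@?g x)) => apply: (pt_pairwise (g := f) (l := g))
  | |- @PTt _ _ _ _ (fun x => mask (@?f x) (@?g x)) => apply: (pt_mask (m := f) (t := g))
  | |- @PTt _ _ _ _ (fun x => zip (@?f x) (@?g x)) => apply: (pt_zip (s := f) (t := g))
  | |- @PTt _ _ _ _ (fun x => sumn (@?f x)) => apply: (pt_sumn (l := f))
  | |- @PTt _ _ _ _ (fun x => addn (@?f x) (@?g x)) => apply: (pt_addn (f := f) (g := g))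
  | |- @PTt _ _ _ _ (fun x => subn (@?f x) (@?g x)) => apply: (pt_subn (f := f) (g := g))
  | |- @PTt _ _ _ _ (fun x => muln (@?f x) (@?g x)) => apply: (pt_muln (f := f) (g := g))
  | |- @PTt _ _ _ _ (fun x => minn (@?f x) (@?g x)) => apply: (pt_minn (f := f) (g := g))
  | |- @PTt _ _ _ _ (fun x => maxn (@?f x) (@?g x)) => apply: (pt_maxn (f := f) (g := g))
  | |- @PTt _ _ _ _ (fun x => leq (S (@?f x)) (@?g x)) => apply: (pt_ltn (f := f) (g := g))
  | |- @PTt _ _ _ _ (fun x => leq (@?f x) (@?g x)) => apply: (pt_leq (f := f) (g := g))
  | |- @PTt _ _ _ _ (fun x => negb (@?f x)) => apply: (pt_not (a := f))
  | |- @PTt _ _ _ _ (fun x => andb (@?f x) (@?g x)) => apply: (pt_and (a := f) (b := g))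
  | |- @PTt _ _ _ _ (fun x => orb (@?f x) (@?g x)) => apply: (pt_or (a := f) (b := g))
  | |- @PTt _ _ _ _ (fun x => implb (@?f x) (@?g x)) => apply: (pt_imp (a := f) (b := g))
  | |- @PTt _ _ _ _ (fun x => iw (@?f x)) => apply: (pt_iw (f := f))
  | |- @PTt _ _ _ _ (fun x => ih (@?f x)) => apply: (pt_ih (f := f))
  | |- @PTt _ _ _ _ (fun x => ip (@?f x)) => apply: (pt_ip (f := f))
  | |- _ => first [assumption | apply: pt_if]
  end).

Section Subst.
Context {X Y Z T U V W' : Type} {eX : Enc X} {eY : Enc Y} {eZ : Enc Z} {eT : Enc T} {eU : Enc U} {eV : Enc V} {eW : Enc W'}.
Lemma pt_op2 (op : Y -> Z -> T) (f : X -> Y) (g : X -> Z) : PTt (fun z : Y * Z => op z.1 z.2) -> PTt f -> PTt g ->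
  PTt (fun x => op (f x) (g x)).
Proof. by move=> po pf pg; apply: (pt_comp (f := fun x => (f x, g x)) po); pt. Qed.
Lemma pt_op3 (op : Y -> Z -> U -> T) (f : X -> Y) (g : X -> Z) (h : X -> U) :
  PTt (fun z : Y * Z * U => op z.1.1 z.1.2 z.2) -> PTt f -> PTt g -> PTt h -> PTt (fun x => op (f x) (g x) (h x)).
Proof. by move=> po pf pg ph; apply: (pt_comp (f := fun x => (f x, g x, h x)) po); pt. Qed.
Lemma pt_op5 (op : Y -> Z -> U -> V -> W' -> T) (f : X -> Y) (g : X -> Z) (h : X -> U) (k : X -> V) (l : X -> W') :
  PTt (fun z : Y * Z * U * V * W' => op z.1.1.1.1 z.1.1.1.2 z.1.1.2 z.1.2 z.2) -> PTt f -> PTt g -> PTt h -> PTt k -> PTt l ->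
  PTt (fun x => op (f x) (g x) (h x) (k x) (l x)).
Proof. by move=> po pf pg ph pk pl; apply: (pt_comp (f := fun x => (f x, g x, h x, k x, l x)) po); pt. Qed.
End Subst.

Lemma sz_rcons (Y : Type) (eY : Enc Y) (s : seq Y) (y : Y) : sz (s ++ [:: y]) = sz s + sz y + 1.
Proof. by have := @sz_cat Y eY s [:: y]; rewrite sz_cons; have -> : @sz (seq Y) _ [::] = 1 by []; lia. Qed.

Lemma pt_psum : PTt psum. Proof. by rewrite /psum /rP; pt. Qed.
Lemma pt_wsum : PTt (fun z : nat * seq rent => wsum z.1 z.2).
Proof. by rewrite /wsum /rW /rL; pt. Qed.
Lemma pt_capsum : PTt (fun z : nat * nat * seq nbox => capsum z.1.1 z.1.2 z.2).
Proof. by rewrite /capsum /boxcap /blen /bth; pt. Qed.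
Lemma pt_accept : PTt (fun z : nat * seq nbox * seq nat * seq rent * rent => accept z.1.1.1.1 z.1.1.1.2 z.1.1.2 z.1.2 z.2).
Proof.
rewrite /accept /rL; pt; first by apply: (pt_op2 (op := wsum) pt_wsum); pt.
by apply: (pt_op3 (op := capsum) pt_capsum); pt.
Qed.
Lemma pt_greedy : PTt (fun z : nat * seq nbox * seq nat * seq rent => greedy z.1.1.1 z.1.1.2 z.1.2 z.2).
Proof.
apply: (pt_foldl (step := fun (x : nat * seq nbox * seq nat * seq rent) e acc => if accept x.1.1.1 x.1.1.2 x.1.2 acc e then e :: acc else acc)
  (l := fun z => z.2) (s0 := fun=> [::]) (h := fun z => z)); [|by pt..|].
  by pt; apply: (pt_op5 (op := accept) pt_accept); pt.
by move=> x y s; case: ifP => _; rewrite ?sz_cons sz_pair; lia.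
Qed.

Section Sort.
Context {X Y : Type} {eX : Enc X} {eY : Enc Y}.
Lemma sz_filterC (p : pred Y) (s : seq Y) : sz (filter p s) + sz (filter (fun y => ~~ p y) s) = sz s + 1.
Proof. by elim: s => //= y s; case: (p y) => /=; rewrite !sz_cons; lia. Qed.
Lemma pt_isort (r : rel Y) (f : X -> seq Y) : PTt (fun z : Y * Y => r z.1 z.2) -> PTt f -> PTt (fun x => isort r (f x)).
Proof.
move=> pr pf.
have pr' (T : Type) (eT : Enc T) (a b : T -> Y) : PTt a -> PTt b -> PTt (fun x => r (a x) (b x)).
  by move=> pa pb; apply: (pt_op2 (op := r) pr).
apply: (pt_foldl (step := fun _ y s => ins r s y) (s0 := fun=> [::]) (h := fun z => z)) => //; [|by pt..|].
  by rewrite /ins; pt; apply: pr'; pt.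
move=> x y s; rewrite /ins sz_pair; have := sz_filterC (r^~ y) s.
by have := @sz_cat Y eY (filter (r^~ y) s) (y :: filter (fun z => ~~ r z y) s); rewrite sz_cons; lia.
Qed.
End Sort.

Lemma pt_addshelf : PTt (fun z : nat * seq elem * rent => addshelf z.1.1 z.1.2 z.2).
Proof.
rewrite /addshelf /sing /eL /eT /eits /rA /rT; apply: (pt_match (l := fun z : nat * seq elem * rent => z.1.2)
  (f := fun z : nat * seq elem * rent => [:: sing z.2])
  (g := fun (z : nat * seq elem * rent) e st' => if eL e + rA z.2 <= z.1.1 then (eL e + rA z.2, eT e, (z.2, eL e) :: eits e) :: st' else sing z.2 :: z.1.2)).
- by pt.
- by rewrite /sing /rA /rT; pt.
- by rewrite /sing /eL /eT /eits /rA /rT; pt.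
Qed.
Lemma pt_shelves0 : PTt (fun z : nat * seq rent => shelves0 z.1 z.2).
Proof.
apply: (pt_foldl (step := fun (x : nat * seq rent) i st => addshelf x.1 st i) (l := fun z => z.2) (s0 := fun=> [::])
  (h := fun z => (z.1.1, (z.1.1, (sing z.2, z.2)))));
  [by apply: (pt_op3 (op := addshelf) pt_addshelf); pt|by pt..|by rewrite /sing /rA /rT; pt|].
move=> [SL s0] i [|e st]; rewrite /addshelf /=; move: (sing i) => g; rewrite !sz_pair; first by rewrite sz_cons; lia.
move: e => [[l t] its]; rewrite /eL /eT /eits /=; case: ifP => [h|_]; rewrite !sz_cons; last by lia.
(* A shelf length never exceeds [SL], so its size is bounded by the environment and not by the
   accumulator. *)
have h1 := sz_nat_le h; have h2 : sz l <= sz SL by apply: sz_nat_le; lia.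
by rewrite !sz_pair sz_cons sz_pair; lia.
Qed.
Lemma pt_shelves : PTt (fun z : nat * seq rent => shelves z.1 z.2).
Proof. by rewrite /shelves /eT /eits; pt; exact: pt_shelves0. Qed.
Lemma pt_ritems : PTt ritems. Proof. by rewrite /ritems /eits; pt. Qed.

Lemma pt_fstep : PTt (fun z : nbox * elem * fillst => fstep z.1.1 z.2 z.1.2).
Proof. by rewrite /fstep /eL /eT /blen /bth; pt. Qed.
Lemma pt_fill1 : PTt (fun z : nbox * seq elem => fill1 z.1 z.2).
Proof.
apply: (pt_foldl (step := fun (x : nbox * seq elem) e a => fstep x.1 a e) (l := fun z => z.2) (s0 := fun=> (0, ([::], [::])))
  (h := fun z => (bth z.1.1, (bth z.1.1, z.2)))).
- by apply: (pt_comp (f := fun z : nbox * seq elem * elem * fillst => (z.1.1.1, z.1.2, z.2)) pt_fstep); pt.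
- by pt.
- by pt.
- by rewrite /bth; pt.
move=> [c s0] e [z [rest out]]; rewrite /fstep /=; case: ifP => [/andP[_ h]|_]; rewrite !sz_pair /= !sz_rcons; last by lia.
have h1 := sz_nat_le h; have h2 : sz z <= sz (bth c) by apply: sz_nat_le; lia.
by rewrite sz_pair; lia.
Qed.

Lemma fill1_size c s : let r := fill1 c s in size r.2.1 + size r.2.2 = size s /\
  sz r.2.1 + sz r.2.2 <= sz s + 1 + size s * (sz (bth c) + 1).
Proof.
elim/last_ind: s => [|s e]; first by split.
rewrite /fill1 foldl_rcons -/(fill1 c s) size_rcons -cats1 sz_rcons; case: (fill1 c s) => z [rest out] /= [h1 h2].
rewrite /fstep /=; case: ifP => [/andP[_ h]|_] /=; rewrite sz_rcons size_cat /= ?sz_pair; split; try lia.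
have h3 : sz z <= sz (bth c) by apply: sz_nat_le; lia.
by lia.
Qed.

(** Placing an element stores a copy of the container and an offset of at most [bth c] with it. The
    invariant that no more elements remain than were given bounds this by the environment, one pair
    [(bth c, c)] per given element. *)
Lemma pt_fill : PTt (fun z : seq nbox * seq elem => fill z.1 z.2).
Proof.
apply: (pt_foldl_inv (P := fun (x : seq nbox * seq elem) a => size a.1 <= size x.2)
  (step := fun (x : seq nbox * seq elem) c a => fillstep a c) (l := fun z => z.1) (s0 := fun z => (z.2, [::]))
  (h := fun z => [seq (bth z.2, z.2) | _ <- z.1.2])) => //.
- rewrite /fillstep; pt; first by apply: (pt_op2 (op := fill1) pt_fill1); pt.
  by apply: (pt_op2 (op := fill1) pt_fill1); pt.
- by pt.
- by pt.
- by rewrite /bth; pt.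
- move=> x c [a o] /=; rewrite /fillstep /=; have [h _] := fill1_size c a; lia.
move=> x c [a o] /= ax; rewrite /fillstep /=; have [h1 h2] := fill1_size c a.
have mapE (s : seq (nat * elem)) : sz [seq (c, ze) | ze <- s] = sz s + size s * (sz c + 1).
  by elim: s => //= ze s IH; rewrite !sz_cons sz_pair IH; lia.
have mapE' (s : seq elem) : sz [seq (bth c, c) | _ <- s] = 1 + size s * (sz (bth c) + sz c + 2).
  by elim: s => //= e s IH; rewrite !sz_cons sz_pair IH; lia.
have catE (s : seq placed) : sz (o ++ s) + 1 = sz o + sz s by exact: sz_cat.
rewrite !sz_pair mapE'; have := catE [seq (c, ze) | ze <- (fill1 c a).2.2]; rewrite mapE.
have h3 : size a * (sz (bth c) + 1) <= size x.2 * (sz (bth c) + 1) by rewrite leq_mul2r ax orbT.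
have h4 : size (fill1 c a).2.2 * (sz c + 1) <= size x.2 * (sz c + 1) by rewrite leq_mul2r; apply/orP; right; lia.
have h5 : size x.2 * (sz (bth c) + sz c + 2) = size x.2 * (sz (bth c) + 1) + size x.2 * (sz c + 1) by rewrite -mulnDr; congr muln; lia.
by rewrite h5; move: h2 h3 h4; move: (size x.2 * (sz (bth c) + 1)) (size x.2 * (sz c + 1)) (size a * _) (size (fill1 c a).2.2 * _) => *; lia.
Qed.

Lemma pt_stack : PTt (fun z : nat * seq rent => stack z.1 z.2).
Proof.
rewrite /stack; pt.
- by rewrite /sing /rA /rT; pt.
- by apply: pt_isort; [rewrite /lenge /rA|rewrite /rlong]; pt.
- apply: (pt_op2 (op := shelves) pt_shelves); first by pt.
  by apply: pt_isort; [rewrite /thge /rT|rewrite /rlong]; pt.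
Qed.
Lemma pt_runcs : PTt (fun z : nat * nat * seq rent * seq nat * seq nbox => runcs z.1.1.1.1 z.1.1.1.2 z.1.1.2 z.1.2 z.2).
Proof.
apply: pt_snd; apply: (pt_op2 (op := fill) pt_fill); first by pt.
apply: (pt_op2 (op := stack) pt_stack); first by pt.
by apply: (pt_comp (f := fun z : nat * nat * seq rent * seq nat * seq nbox => (z.1.1.1.1, z.2, z.1.2, z.1.1.2)) pt_greedy); pt.
Qed.

Lemma pt_solution M : PTt (solution M).
Proof. by rewrite /solution /outent /eits /bx /bby /bvert /rrot /ridx; pt. Qed.

Section Params.
Variables (q r G m : nat).
Lemma pt_rents : PTt (fun z : nat * seq item => rents q r G m z.1 z.2).
Proof.
rewrite /rents /rentof /usable /nl /nwt /islong /ll /tt; pt; exact: (pt_numbered (pt_snd pt_id)).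
Qed.
Lemma pt_srents : PTt (fun z : nat * seq item => srents q r G m z.1 z.2).
Proof. by apply: pt_isort; [rewrite /dens /rW /rP; pt|exact: pt_rents]. Qed.

Lemma pt_nconts : PTt (fun z : nat * seq (spec * nat) => nconts G m z.1 z.2).
Proof.
have ps : PTt (fun z : nat * (spec * nat) => slen G m z.1 z.2).
  apply: (pt_ext (f := fun z : nat * (spec * nat) => if z.2.1.1.1.1 <= 0 then z.1 * (G * m) else if z.2.1.1.1.1 <= 1 then z.1 * m else G * m * z.2.2)).
    by move=> z; rewrite /slen; case: (z.2.1.1.1.1) => [|[|]].
  by pt.
have ps2 (X : Type) (eX : Enc X) (f : X -> nat) (g : X -> spec * nat) : PTt f -> PTt g -> PTt (fun x => slen G m (f x) (g x)).
  exact: (pt_op2 (op := slen G m) ps).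
by rewrite /nconts /sw /sh /sth; pt; apply: ps2; pt.
Qed.

Lemma pt_allt n : PTt (fun A : seq nat => allt A n).
Proof. by elim: n => [|n IH] /=; pt; apply: (pt_comp IH); pt. Qed.

(** [Om] is a constant of the program, so the union over it is unrolled by induction instead of
    being computed by a fold. *)
Lemma pt_guesses (Om : seq (seq spec)) : PTt (fun z : nat * seq item => guesses G m Om z.1 z.2).
Proof.
rewrite /guesses; elim: Om => [|om Om IH] /=; first exact: pt_const.
apply: pt_cat => //; pt.
  apply: (pt_op2 (op := nconts G m) pt_nconts); pt.
by apply: (pt_comp (pt_allt _)); rewrite /ll; pt.
Qed.

(** The best packing so far is either kept or replaced by a packing computed from the instance and
    the guess alone, so its growth is bounded by the size of [rc]. *)
Lemma pt_level (Om : seq (seq spec)) : PTt (fun z : nat * seq item => level q r G m Om z.1 z.2).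
Proof.
pose rc (z : nat * seq item * seq nbox) := runcs z.1.1 (z.1.1 * m) (srents q r G m z.1.1 z.1.2) (map rL (srents q r G m z.1.1 z.1.2)) z.2.
have pq : PTt (fun z : nat * seq item * seq nbox => srents q r G m z.1.1 z.1.2) by apply: (pt_comp pt_srents); pt.
have prc : PTt rc by apply: (pt_op5 (op := runcs) pt_runcs); rewrite /rL; pt.
have pps (X : Type) (eX : Enc X) (f : X -> seq placed) : PTt f -> PTt (fun x => psum (ritems [seq a.2.2 | a <- f x])).
  by move=> pf; apply: (pt_comp pt_psum); apply: (pt_comp pt_ritems); pt.
have pl : PTt (fun z : nat * seq item => foldl (tryone q r G m z.1 z.2) [::] (guesses G m Om z.1 z.2)).
  apply: (pt_foldl (step := fun (x : nat * seq item) cs b => tryone q r G m x.1 x.2 b cs) (s0 := fun=> [::]) (h := rc)) => //.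
  - have prc' : PTt (fun z : nat * seq item * seq nbox * seq placed => rc z.1) by apply: (pt_comp prc); pt.
    rewrite /tryone /cfg_ok /binside /bdisj /bw /bh /bx /bby /bvert /blen /bth; pt; try exact: prc'; apply: pps => //; pt; exact: prc'.
  - exact: pt_guesses.
  - exact: pt_const.
  - move=> x cs b; rewrite /tryone; case: ifP => _; last exact: leq_addr.
    by rewrite -[runcs _ _ _ _ _]/(rc (x, cs)); case: ifP => _; [exact: leq_addl|exact: leq_addr].
apply: pt_pair; first exact: pps.
exact: (pt_comp (pt_solution _)).
Qed.
End Params.

Lemma pt_best Ps : PTt (fun z : nat * seq item => best_level Ps z.1 z.2).
Proof.
elim: Ps => [|P Ps IH]; first exact: pt_const.
have pP : PTt (fun z : nat * seq item => plevel P z.1 z.2) by exact: pt_level.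
by apply: (pt_ext (f := fun z : nat * seq item => if (best_level Ps z.1 z.2).1 < (plevel P z.1 z.2).1
  then plevel P z.1 z.2 else best_level Ps z.1 z.2)) => //; pt.
Qed.

End Implementation.

(* For every eps > 0 there is eps_skew > 0 and a Turing machine M running in
   time at most c * (|x|+1)^k on input x, which on every 2DKR instance (N, I)
   with N >= 1 all of whose items are eps_skew-skewed halts with (the encoding
   of) a feasible solution whose profit is at least p(OPT)/(1+eps). *)
Theorem theorem2 (R : realType) (eps : R) :
  0 < eps ->
  exists eps_skew : R, 0 < eps_skew /\
  exists (M : TM) (c k : nat),
    forall (N : nat) (I : seq item),
      (0 < N)%N -> skewed eps_skew N I ->
      exists (t : nat) (cf : config M) (sol : seq out_entry),
        [/\ (t <= c * (size (enc_instance N I)).+1 ^ k)%N,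
            run t (@init M (enc_instance N I)) = Some cf,
            tm_output cf = enc_solution sol,
            all entry_ok sol &
            (feasible N I (map (@entry_place R) sol) /\
            forall S : seq (placement R), feasible N I S ->
              (profit I S)%:R <= (1 + eps) * (profit I (map (@entry_place R) sol))%:R)].
Proof.
move=> eps0; have [eps_skew [Ps [s0 vPs apx]]] := Algorithm.approximation eps0.
have [M [c [k h]]] := Machine.machine_for (Machine.pt_snd (Implementation.pt_best Ps)).
exists eps_skew; split=> //; exists M, c, k => N I N0 sk.
have [t [cf [tb rt ot]]] := h N I; have [eok fea pE] := Algorithm.best_level_ok R I N0 vPs.
exists t, cf, (Algorithm.best_level Ps N I).2; split=> //; split=> // S fS.
by rewrite pE; apply: apx.
Qed.
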